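(* Let $V$ be a grading-restricted vertex superalgebra and $W$ a grading-restricted $V$-supermodule. Then for any $m\in\mathbb{Z}_+$, the first cohomology $H^1_m(V,W)$ is linearly isomorphic to the space $\mathrm{Der}(V,W)$ of derivations from $V$ to $W$. In particular, the spaces $H^1_m(V,W)$ for $m\in\mathbb{Z}_+$ are all isomorphic.
   Context: Everything is over $\mathbb{C}$; $\mathbb{N}=\{0,1,\dots\}$, $\mathbb{Z}_+=\{1,2,\dots\}$, $\mathbb{Z}_2=\mathbb{Z}/2\mathbb{Z}$, $\tfrac12\mathbb{Z}$ = integers and half-integers. VERTEX SUPERALGEBRA. A grading-restricted vertex superalgebra is a $\tfrac12\mathbb{Z}\times\mathbb{Z}_2$-graded space $V=\coprod_{n,\alpha}V^\alpha_{(n)}$, $V_{(n)}=V^0_{(n)}\oplus V^1_{(n)}$, $V^\alpha=\coprod_nV^\alpha_{(n)}$, with a linear map $Y:V\to\mathrm{Hom}(V,V((x)))$, $Y(u,x)=\sum_{n\in\mathbb{Z}}u_nx^{-n-1}$, and $\mathbf 1\in V^0_{(0)}$ such that: (1) $\dim V_{(n)}<\infty$, $V_{(n)}=0$ for $n$ sufficiently negative, and $[\mathbf d_V,Y(v,x)]=x\frac{d}{dx}Y(v,x)+Y(\mathbf d_Vv,x)$ where $\mathbf d_Vv=nv$ for $v\in V_{(n)}$; (2) $Y(u,x)v\in V^{i+j}[[x,x^{-1}]]$ for $u\in V^i,v\in V^j$ (write $|u|=i$ for the parity); (3) $Y(\mathbf 1,x)v=v$ and $Y(v,x)\mathbf 1\in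 v+xV[[x]]$; (4) with $\mathcal D_Vv=v_{-2}\mathbf 1$, $\frac{d}{dx}Y(u,x)=Y(\mathcal D_Vu,x)=[\mathcal D_V,Y(u,x)]$; (5) duality: for $\mathbb{Z}_2$-homogeneous $u_1,u_2$, all $v\in V$, $v'\in V'=\coprod_nV_{(n)}^*$, the series $\langle v',Y(u_1,z_1)Y(u_2,z_2)v\rangle$, $(-1)^{|u_1||u_2|}\langle v',Y(u_2,z_2)Y(u_1,z_1)v\rangle$, $\langle v',Y(Y(u_1,z_1-z_2)u_2,z_2)v\rangle$ converge absolutely in $|z_1|>|z_2|>0$, $|z_2|>|z_1|>0$, $|z_2|>|z_1-z_2|>0$ respectively to a common rational function with only possible poles at $z_1=0,z_2=0,z_1=z_2$. SUPERMODULE. A grading-restricted $V$-supermodule is a $\mathbb{C}\times\mathbb{Z}_2$-graded space $W=\coprod_{n,\alpha}W^\alpha_{(n)}$ ($W_{(n)}=W^0_{(n)}\oplus W^1_{(n)}$, $W^\alpha=\coprod_nW^\alpha_{(n)}$) with $Y_W:V\to\mathrm{Hom}(W,W((x)))$ and operators $\mathbf d_W,\mathcal D_W$ on $W$ such that: $\dim W_{(n)}<\infty$, $W_{(n)}=0$ if $\mathrm{Re}\,n$ is sufficiently negative, $\mathbf d_Ww=nw$ on $W_{(n)}$, $[\mathbf d_W,Y_W(v,x)]=x\frac{d}{dx}Y_W(v,x)+Y_W(\mathbf d_Vv,x)$; $Y_W(v,x)w\in W^{i+j}[[x,x^{-1}]]$ for $v\in V^i,w\in W^j$; $Y_W(\mathbf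 1,x)w=w$; $\frac{d}{dx}Y_W(u,x)=Y_W(\mathcal D_Vu,x)=[\mathcal D_W,Y_W(u,x)]$; duality as in (5), with $v,v'$ replaced by $w\in W$, $w'\in W'=\coprod_nW_{(n)}^*$, and series $\langle w',Y_W(u_1,z_1)Y_W(u_2,z_2)w\rangle$, $(-1)^{|u_1||u_2|}\langle w',Y_W(u_2,z_2)Y_W(u_1,z_1)w\rangle$, $\langle w',Y_W(Y(u_1,z_1-z_2)u_2,z_2)w\rangle$. As usual $\mathcal D_W$ is parity-preserving with $[\mathbf d_W,\mathcal D_W]=\mathcal D_W$, so it and $e^{z\mathcal D_W}$ extend to $\overline W$ below. DERIVATIONS. $\mathrm{Der}(V,W)$ is the space of linear maps $f:V\to W$ preserving the $\tfrac12\mathbb{Z}$-grading (i.e. $f(V_{(n)})\subseteq W_{(n)}$) and the $\mathbb{Z}_2$-grading such that for all $\mathbb{Z}_2$-homogeneous $u,v\in V$, $f(Y(u,x)v)=(-1)^{|u||v|}e^{x\mathcal D_W}Y_W(v,-x)f(u)+Y_W(u,x)f(v)$. RATIONAL FUNCTIONS. $\overline W=\prod_nW_{(n)}=(W')^*$; $P_r:\overline W\to W_{(r)}$ is the projection (likewise for $V$). $F_n\mathbb{C}=\{(z_1,\dots,z_n)\in\mathbb{C}^n:z_i\ne z_j,\ i\neq j\}$. $\widetilde W_{z_1,\dots,z_n}$ is the space of maps $f:F_n\mathbb{C}\to\overline W$ such that for every $w'\in W'$, $\langle w',f(z_1,\dots,z_n)\rangle$ is a rational function with only possible poles at $z_i=z_j$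 ($i\ne j$). For a series converging absolutely in some region, after pairing with each $w'\in W'$, to a rational function, $R(\langle w',\cdot\rangle)$ denotes that rational function and $E(\cdot)$ the corresponding $\overline W$-valued function, $\langle w',E(\cdot)\rangle=R(\langle w',\cdot\rangle)$. Set $E_V^{(l)}(v_1\otimes\cdots\otimes v_l;\mathbf 1;z_1,\dots,z_l)=E(Y(v_1,z_1)\cdots Y(v_l,z_l)\mathbf 1)\in\widetilde V_{z_1,\dots,z_l}$. COCHAINS. Linear maps $\Phi:V^{\otimes n}\to\widetilde W_{z_1,\dots,z_n}$ are written $\Phi(v_1\otimes\cdots\otimes v_n;z_1,\dots,z_n)$. $\mathcal D$-derivative property: for all $i,v_j,w'$, $\frac{\partial}{\partial z_i}\langle w',\Phi(v_1\otimes\cdots\otimes v_n;z_1,\dots,z_n)\rangle=\langle w',\Phi(v_1\otimes\cdots\otimes\mathcal D_Vv_i\otimes\cdots\otimes v_n;z_1,\dots,z_n)\rangle$, and $\left(\sum_i\frac{\partial}{\partial z_i}\right)\langle w',\Phi(\cdots)\rangle=\langle w',\mathcal D_W\Phi(\cdots)\rangle$. $\mathbf d$-conjugation property: $\langle w',z^{\mathbf d_W}\Phi(v_1\otimes\cdots\otimes v_n;z_1,\dots,z_n)\rangle=\langle w',\Phi(z^{\mathbf d_V}v_1\otimes\cdots\otimes z^{\mathbf d_V}v_n;zz_1,\dots,zz_n)\rangle$ for $z\in\mathbb{C}^\times$ (same branch of $\log z$ on both sides). Composable with $m\in\mathbb{N}$ vertex operators: for all $l_0\in\mathbb{N}$,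 $l_1,\dots,l_n\in\mathbb{Z}_+$ with $l_0+\cdots+l_n=m+n$, all $v_1,\dots,v_{m+n}\in V$, $w'\in W'$, put $s_i=l_0+\cdots+l_{i-1}$ and $\Psi_i=E_V^{(l_i)}(v_{s_i+1}\otimes\cdots\otimes v_{s_i+l_i};\mathbf 1;z_{s_i+1}-\zeta_i,\dots,z_{s_i+l_i}-\zeta_i)$; there exist positive integers $N(v_i,v_j)$ depending only on $v_i,v_j$ such that $$\sum_{r_0\in\mathbb{C},\ r_1,\dots,r_n\in\frac12\mathbb{Z}}\langle w',E(Y_W(v_1,z_1)\cdots Y_W(v_{l_0},z_{l_0})P_{r_0}\Phi(P_{r_1}\Psi_1\otimes\cdots\otimes P_{r_n}\Psi_n;\zeta_1,\dots,\zeta_n))\rangle$$ converges absolutely when $z_i\ne z_j$ ($i\neq j$), $|z_i|>|\zeta_j|,|z_k|$ for $1\le i\le l_0$, $1\le j\le n$, $l_0<k\le m+n$, and $|z_{s_i+p}-\zeta_i|+|z_{s_j+q}-\zeta_j|<|\zeta_i-\zeta_j|$ for $1\le i\ne j\le n$, $1\le p\le l_i$, $1\le q\le l_j$; and its sum extends analytically to a rational function in $z_1,\dots,z_{m+n}$, independent of the $\zeta$'s, with only possible poles at $z_i=z_j$, of order at most $N(v_i,v_j)$. For $n\ge1$, $\widehat C^n_0(V,W)$ is the space of $\Phi$ with the $\mathcal D$-derivative and $\mathbf d$-conjugation properties, and $\widehat C^n_m(V,W)$ its subspace of maps composable with $m$ vertex operators. $\Phi$ is parity-preserving if $P_r\Phi(v_1\otimes\cdots\otimes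 v_n;z_1,\dots,z_n)\in W^{|v_1|+\cdots+|v_n|}_{(r)}$ for all $r$ and homogeneous $v_i$. Here only $n\le 2$ is needed: $C^0_m(V,W)=W$; $C^1_m(V,W)$ is the space of parity-preserving $\Phi\in\widehat C^1_m(V,W)$; $C^2_m(V,W)$ is the space of parity-preserving $\Phi\in\widehat C^2_m(V,W)$ with $\Phi(v_1\otimes v_2;z_1,z_2)=(-1)^{|v_1||v_2|}\Phi(v_2\otimes v_1;z_2,z_1)$ for homogeneous $v_1,v_2$. COHOMOLOGY. For $m\in\mathbb{Z}_+$, $\delta^1_m:C^1_m(V,W)\to C^2_{m-1}(V,W)$ is given on homogeneous $v_1,v_2$ by $$(\delta^1_m\Phi)(v_1\otimes v_2;z_1,z_2)=E\Big(\sum_rY_W(v_1,z_1)P_r\Phi(v_2;z_2)\Big)-E\Big(\sum_r\Phi(P_rE_V^{(2)}(v_1\otimes v_2;\mathbf 1;z_1-\zeta,z_2-\zeta);\zeta)\Big)+(-1)^{|v_1||v_2|}E\Big(\sum_rY_W(v_2,z_2)P_r\Phi(v_1;z_1)\Big)$$ (the middle term is independent of $\zeta$), and $\delta^0_{m+1}:C^0_{m+1}(V,W)=W\to C^1_m(V,W)$ is the zero map. $H^1_m(V,W)=\ker\delta^1_m/\mathrm{im}\,\delta^0_{m+1}$.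
   Formalization: In ''composable with m vertex operators'' the sum is taken first over r_1,...,r_n, then over r_0, each absolutely convergent, instead of jointly over all indices; with joint absolute convergence on the stated domain the claim fails (e.g. affine sl_2, the derivation a_0). *)

(* Defs.v *)
From HB Require Import structures.
From mathcomp Require Import all_boot all_order all_algebra.
From mathcomp Require Import finmap complex ring_quotient generic_quotient.
From mathcomp Require Import all_classical all_reals all_analysis.
From mathcomp Require Import -(notations) mpoly.
From mathcomp.analysis.showcase Require Import summability.
From mathcomp Require Import ring zify.

Set Implicit Arguments.
Unset Strict Implicit.
Unset Printing Implicit Defensive.

Import Order.TTheory GRing.Theory Num.Theory.
Import numFieldNormedType.Exports.

Local Open Scope classical_set_scope.
Local Open Scope ring_scope.
Local Open Scope quotient_scope.

Section Subspaces.
Variables (K : pzRingType) (U : lmodType K).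

Record subspace := Subspace {
  sub_set : set U;
  sub_set0 : sub_set 0;
  sub_setD : forall a u v, sub_set u -> sub_set v -> sub_set (a *: u + v)
}.

Variable S : subspace.

Definition sub_pred : {pred U} := [pred u | `[< sub_set S u >]].

Lemma sub_pred_closed : submod_closed sub_pred.
Proof.
split; first by apply/asboolP/sub_set0.
by move=> a u v /asboolP Su /asboolP Sv; apply/asboolP/sub_setD.
Qed.

HB.instance Definition _ := GRing.isSubmodClosed.Build K U sub_pred sub_pred_closed.

Record sub_type := SubType { sub_val : U; _ : sub_val \in sub_pred }.

HB.instance Definition _ := [isSub for sub_val].
HB.instance Definition _ := [Choice of sub_type by <:].
HB.instance Definition _ := [SubChoice_isSubLmodule of sub_type by <:].

Lemma sub_val_lin a (x y : sub_type) :
  sub_val (a *: x + y) = a *: sub_val x + sub_val y.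
Proof. exact: (linearP (val : {linear sub_type -> U})). Qed.

Definition quot_type : Type := Quotient.quot sub_pred.

HB.instance Definition _ := GRing.Zmodule.on quot_type.

Definition quot_pi (u : U) : quot_type := \pi_(Quotient.quot sub_pred) u.

Definition quot_scale (a : K) (q : quot_type) : quot_type :=
  quot_pi (a *: repr (q : Quotient.quot sub_pred)).

Lemma quot_piP q : exists u, q = quot_pi u.
Proof.
by exists (repr (q : Quotient.quot sub_pred)); rewrite /quot_pi reprK.
Qed.

Lemma quot_pi_eq u v : (quot_pi u = quot_pi v) <-> sub_set S (u - v).
Proof.
by split=> [/eqP|Suv]; [|apply/eqP]; rewrite -Quotient.idealrBE;
   [move/asboolP|apply/asboolP].
Qed.

Lemma quot_piD u v : quot_pi (u + v) = quot_pi u + quot_pi v.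
Proof. exact: Quotient.pi_add. Qed.

Lemma quot_scale_pi a u : quot_scale a (quot_pi u) = quot_pi (a *: u).
Proof.
apply/eqP; rewrite /quot_scale -Quotient.idealrBE -scalerBr rpredZ //.
by rewrite Quotient.idealrBE reprK.
Qed.

Lemma quot_scaleA a b q : quot_scale a (quot_scale b q) = quot_scale (a * b) q.
Proof. by have [u ->] := quot_piP q; rewrite !quot_scale_pi scalerA. Qed.

Lemma quot_scale1 : left_id 1 quot_scale.
Proof. by move=> q; have [u ->] := quot_piP q; rewrite quot_scale_pi scale1r. Qed.

Lemma quot_scaleDr : right_distributive quot_scale +%R.
Proof.
move=> a p q; have [u ->] := quot_piP p; have [v ->] := quot_piP q.
by rewrite -quot_piD !quot_scale_pi -quot_piD scalerDr.
Qed.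

Lemma quot_scaleDl q : {morph quot_scale^~ q : a b / a + b}.
Proof.
move=> a b; have [u ->] := quot_piP q.
by rewrite !quot_scale_pi -quot_piD scalerDl.
Qed.

HB.instance Definition _ := GRing.Zmodule_isLmodule.Build K quot_type
  quot_scaleA quot_scale1 quot_scaleDr quot_scaleDl.

End Subspaces.

Definition linear_iso (K : pzRingType) (U U' : lmodType K) : Prop :=
  exists f : {linear U -> U'}, bijective f.

(* The complex numbers, declared as a numClosedFieldType because the normed
   topology of MathComp-Analysis is attached to that structure and not to the
   type R[i] itself. *)
Definition Cx (R : realType) : numClosedFieldType := R[i].

Definition cexp (R : realType) (z : Cx R) : Cx R :=
  (expR (complex.Re z) * cos (complex.Im z)
   +i* (expR (complex.Re z) * sin (complex.Im z)))%C.

(* The bound M is a complex number, necessarily real for the order of R[i]. *)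
Definition abs_cvg_to (R : realType) (I : choiceType) (F : I -> Cx R)
    (s : Cx R) : Prop :=
  (exists M : Cx R, forall A : {fset I}, partial_sum (fun i => `|F i|) A <= M)
  /\ partial_sum F @ totally --> s.

Section RationalFunctions.
Variables (R : realType) (n : nat).
Local Notation C := (Cx R).
Implicit Types (z : 'I_n -> C) (f : ('I_n -> C) -> C).

Definition conf : set ('I_n -> C) := [set z : 'I_n -> C | injective z].

Definition conf0 : set ('I_n -> C) := [set z : 'I_n -> C | injective z /\ forall i, z i != 0].

(* f is the rational function p/q on D, extended by 0 outside D; the extension
   makes f determined by its values on D. *)
Definition frac_on (D : set ('I_n -> C)) (q : ('I_n -> C) -> C) f : Prop :=
  (exists p : mpoly n C, forall z, D z -> f z = meval z p / q z)
  /\ forall z, ~ D z -> f z = 0.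

Definition diag_den (N : 'I_n -> 'I_n -> nat) z : C :=
  \prod_(i < n) \prod_(j < n | (i < j)%N) (z i - z j) ^+ N i j.

(* Only possible poles at z_i = z_j, of order at most N i j. *)
Definition diag_rat_ord N f : Prop := frac_on conf (diag_den N) f.

Definition diag_rat f : Prop := exists N, diag_rat_ord N f.

(* Only possible poles at z_i = 0 and z_i = z_j. *)
Definition diag0_rat f : Prop :=
  exists N M, frac_on conf0 (fun z => diag_den N z * (\prod_i z i) ^+ M) f.

End RationalFunctions.

(* A C x Z/2-graded space with finite-dimensional weight spaces and real parts
   of weights bounded below. The direct sum decomposition is given by the
   projections wpr r on the weight spaces W_(r) and ppr a on W^a, where bool
   stands for Z/2 (addb is the sum, andb the product). *)
Record gradedSpace (R : realType) := GradedSpace {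
  gs_sort :> lmodType (Cx R);
  wpr : Cx R -> gs_sort -> gs_sort;
  ppr : bool -> gs_sort -> gs_sort;
  wpr_linear : forall r, linear (wpr r);
  ppr_linear : forall a, linear (ppr a);
  wprM : forall r s w, wpr r (wpr s w) = if r == s then wpr r w else 0;
  pprM : forall a b w, ppr a (ppr b w) = if a == b then ppr a w else 0;
  wpr_ppr : forall r a w, wpr r (ppr a w) = ppr a (wpr r w);
  wpr_sum : forall w, exists2 s : seq (Cx R), uniq s & w = \sum_(r <- s) wpr r w;
  ppr_sum : forall w, w = ppr false w + ppr true w;
  wpr_fin : forall r, exists s : seq gs_sort, forall w,
    exists c : 'I_(size s) -> Cx R, wpr r w = \sum_i c i *: s`_i;
  wpr_low : exists N : R, forall r, complex.Re r < N -> forall w, wpr r w = 0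
}.

Section GradedSpaces.
Variables (R : realType) (W : gradedSpace R).
Local Notation C := (Cx R).

Definition wt (r : C) (w : W) : Prop := wpr r w = w.

Definition par (a : bool) (w : W) : Prop := ppr a w = w.

Definition dop (w : W) : W := \sum_(r \in [set: C]) r *: wpr r w.

(* z^d for the branch of the logarithm with log z = lam. *)
Definition zpow_d (lam : C) (w : W) : W :=
  \sum_(r \in [set: C]) cexp (lam * r) *: wpr r w.

(* The graded dual W', the direct sum of the duals of the weight spaces. *)
Definition gdual (w' : {scalar W}) : Prop :=
  finite_set [set r | exists w, w' (wpr r w) != 0].

(* The algebraic completion, the product of the weight spaces: the projection
   P_r is evaluation at r. *)
Definition wbar (f : C -> W) : Prop := forall r, wt r (f r).

(* For w' in W' and f in the completion, the sum has finite support. *)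
Definition pairing (w' : {scalar W}) (f : C -> W) : C :=
  \sum_(r \in [set: C]) w' (f r).

(* g = E(S) : the scalar series S w' converges absolutely on D to the rational
   function <w', g>, which belongs to the class cls. Since W' separates the
   points of the completion, there is at most one such g when D is a non-empty
   open set. *)
Definition is_E n (cls : set (('I_n -> C) -> C)) (I : choiceType)
    (D : set ('I_n -> C)) (S : {scalar W} -> ('I_n -> C) -> I -> C)
    (g : ('I_n -> C) -> C -> W) : Prop :=
  (forall z, wbar (g z)) /\
  forall w', gdual w' ->
    cls (fun z => pairing w' (g z)) /\
    forall z, D z -> abs_cvg_to (S w' z) (pairing w' (g z)).

End GradedSpaces.

(* A vertex operator map is given by its modes: YW u k is the operator u_k,
   the coefficient of x^(-k-1) in Y_W(u,x). *)
Definition modes (R : realType) (V W : gradedSpace R) := V -> int -> W -> W.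

Section VertexOperators.
Variables (R : realType) (V W : gradedSpace R).
Variables (Y : modes V V) (YW : modes V W).
Local Notation C := (Cx R).

(* YW is a linear map from V to Hom(W, W((x))). *)
Definition field_map : Prop :=
  [/\ forall u k, linear (YW u k),
      forall k w, linear (fun u => YW u k w) &
      forall u w, exists K : int, forall k, K <= k -> YW u k w = 0].

Definition d_bracket : Prop := forall v k w,
  dop (YW v k w) - YW v k (dop w)
  = (- k - 1)%:~R *: YW v k w + YW (dop v) k w.

Definition parity_compatible : Prop := forall a b v k w,
  par a v -> par b w -> par (a (+) b) (YW v k w).

(* d/dx Y_W(u,x) = Y_W(D_V u,x) = [D_W, Y_W(u,x)]; the coefficient of x^(-k-1)
   in d/dx Y_W(u,x) is - k u_(k-1). *)
Definition D_derivative (DV : V -> V) (DW : W -> W) : Prop := forall u k w,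
  (- k)%:~R *: YW u (k - 1) w = YW (DV u) k w /\
  YW (DV u) k w = DW (YW u k w) - YW u k (DW w).

Definition duality : Prop :=
  forall a b u1 u2, par a u1 -> par b u2 ->
  forall (w : W) (w' : {scalar W}), gdual w' ->
  exists2 f : ('I_2 -> C) -> C, diag0_rat f & forall z : 'I_2 -> C,
  let z1 := z 0 in let z2 := z 1 in
  [/\ 0 < `|z2| < `|z1| ->
        abs_cvg_to (fun k : int * int => w' (YW u1 k.1 (YW u2 k.2 w))
                      * z1 ^ (- k.1 - 1) * z2 ^ (- k.2 - 1)) (f z),
      0 < `|z1| < `|z2| ->
        abs_cvg_to (fun k : int * int => (-1) ^+ (a && b)
                      * w' (YW u2 k.1 (YW u1 k.2 w))
                      * z2 ^ (- k.1 - 1) * z1 ^ (- k.2 - 1)) (f z) &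
      0 < `|z1 - z2| < `|z2| ->
        abs_cvg_to (fun k : int * int => w' (YW (Y u1 k.1 u2) k.2 w)
                      * (z1 - z2) ^ (- k.1 - 1) * z2 ^ (- k.2 - 1)) (f z)].

(* (v_1)_(k_1) ... (v_l)_(k_l) w *)
Definition modes_prod l (v : 'I_l -> V) (k : 'I_l -> int) (w : W) : W :=
  foldr (fun i x => YW (v i) (k i) x) w (enum 'I_l).

(* The series <w', Y_W(v_1,z_1) ... Y_W(v_l,z_l) w>, indexed by modes. *)
Definition prod_series l (v : 'I_l -> V) (w : W) (w' : {scalar W})
    (z : 'I_l -> C) (k : {ffun 'I_l -> int}) : C :=
  w' (modes_prod v k w) * \prod_i z i ^ (- k i - 1).

(* |z_1| > ... > |z_l| > 0 *)
Definition radial l : set ('I_l -> C) :=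
  [set z : 'I_l -> C | (forall i j : 'I_l, (i < j)%N -> `|z j| < `|z i|)
           /\ forall i, z i != 0].

(* g = E(Y_W(v_1,z_1) ... Y_W(v_l,z_l) w) *)
Definition is_Eprod l (v : 'I_l -> V) (w : W) (g : ('I_l -> C) -> C -> W) :=
  is_E (@diag0_rat R l) (@radial l) (prod_series v w) g.

(* <w', Y_W(v,z) w>, a sum with finite support. *)
Definition mat_el (w' : {scalar W}) (v : V) (z : C) (w : W) : C :=
  \sum_(k \in [set: int]) w' (YW v k w) * z ^ (- k - 1).

End VertexOperators.

(* The (1/2)Z-grading is a C-grading supported on (1/2)Z. *)
Record vertexSuperalgebra (R : realType) := VertexSuperalgebra {
  vsa_space :> gradedSpace R;
  vY : modes vsa_space vsa_space;
  vac : vsa_space;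
  vsa_half : forall r, ~ (exists k : int, r = k%:~R / 2) ->
    forall v : vsa_space, wpr r v = 0;
  vac_wt : wt 0 vac;
  vac_par : par false vac;
  vY_field : field_map vY;
  vY_d : d_bracket vY;
  vY_par : parity_compatible vY;
  vY_vac : forall k v, vY vac k v = if k == -1 then v else 0;
  vY_creation : forall v, vY v (-1) vac = v /\ forall k, 0 <= k -> vY v k vac = 0;
  vY_D : D_derivative vY (fun v => vY v (-2) vac) (fun v => vY v (-2) vac);
  vY_duality : duality vY vY
}.

Definition DV (R : realType) (V : vertexSuperalgebra R) (v : V) : V :=
  vY v (-2) (vac V).

Record supermodule (R : realType) (V : vertexSuperalgebra R) := Supermodule {
  sm_space :> gradedSpace R;
  YW : modes V sm_space;
  DW : sm_space -> sm_space;
  DW_linear : linear DW;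
  DW_par : forall a w, par a w -> par a (DW w);
  DW_d : forall w, dop (DW w) - DW (dop w) = DW w;
  YW_field : field_map YW;
  YW_d : d_bracket YW;
  YW_par : parity_compatible YW;
  YW_vac : forall k w, YW (vac V) k w = if k == -1 then w else 0;
  YW_D : D_derivative YW (@DV R V) DW;
  YW_duality : duality (@vY R V) YW
}.

Section Cochains.
Variables (R : realType) (V : vertexSuperalgebra R) (W : supermodule V).
Local Notation C := (Cx R).

(* E_V^(l)(v_1, ..., v_l; 1; z_1, ..., z_l) *)
Definition EV l (v : 'I_l -> V) : ('I_l -> C) -> C -> V :=
  xget 0 [set g | is_E (@diag_rat R l) (@radial R l)
                    (prod_series (@vY R V) v (vac V)) g].

(* D_W raises weights by 1. *)
Definition DWbar (f : C -> W) : C -> W := fun r => DW (f (r - 1)).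

(* Maps from the n-fold tensor power of V to functions of z_1, ..., z_n with
   values in the completion of W, before any condition is imposed. A linear map
   on the tensor power is a multilinear map, and a function on F_n C is a
   function on C^n vanishing outside F_n C. *)
Definition cochain (n : nat) : lmodType C :=
  ('I_n -> V) -> ('I_n -> C) -> C -> W.

Section Conditions.
Variables (n : nat) (Phi : cochain n).

Definition multilinear : Prop := forall (i : 'I_n) (v : 'I_n -> V) z c x y,
  Phi [eta v with i |-> c *: x + y] z
  = c *: Phi [eta v with i |-> x] z + Phi [eta v with i |-> y] z.

Definition rational_valued : Prop := forall v,
  (forall z, wbar (Phi v z)) /\
  (forall z, ~ conf z -> Phi v z = 0) /\
  forall w', gdual w' -> diag_rat (fun z => pairing w' (Phi v z)).

Definition D_derivative_property : Prop :=
  forall v (w' : {scalar W}) z, gdual w' -> conf z ->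
  (forall i : 'I_n,
     is_derive (z i) 1 (fun t : C => pairing w' (Phi v [eta z with i |-> t]))
       (pairing w' (Phi [eta v with i |-> DV (v i)] z))) /\
  \sum_i 'D_1 (fun t : C => pairing w' (Phi v [eta z with i |-> t]) : C) (z i)
  = pairing w' (DWbar (Phi v z)).

Definition d_conjugation_property : Prop :=
  forall (lam : C) v (w' : {scalar W}) z, gdual w' -> conf z ->
  pairing w' (fun r => cexp (lam * r) *: Phi v z r)
  = pairing w' (Phi (fun i => zpow_d lam (v i)) (fun i => cexp lam * z i)).

Definition parity_preserving : Prop :=
  forall (a : 'I_n -> bool) v, (forall i, par (a i) (v i)) ->
  forall z r, par (\big[addb/false]_i a i) (Phi v z r).

End Conditions.

(* The components s, ..., s + l - 1 of a k-tuple, always used with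
   s + l <= k, so that the default value 0 plays no role. *)
Definition block (T : nmodType) k (x : 'I_k -> T) (s : nat) {l : nat} (p : 'I_l) : T :=
  oapp x 0 (insub (s + p)%N).

Definition offset n (l0 : nat) (l : 'I_n -> nat) (i : 'I_n) : nat :=
  (l0 + \sum_(j < n | (j < i)%N) l j)%N.

Definition composition_domain n k (l0 : nat) (l : 'I_n -> nat)
    (z : 'I_k -> C) (zeta : 'I_n -> C) : Prop :=
  [/\ conf z,
      forall i : 'I_k, (i < l0)%N ->
        (forall j, `|zeta j| < `|z i|) /\
        (forall j : 'I_k, (l0 <= j)%N -> `|z j| < `|z i|) &
      forall i j : 'I_n, i != j -> forall (p : 'I_(l i)) (q : 'I_(l j)),
        `|block z (offset l0 l i) p - zeta i|
        + `|block z (offset l0 l j) q - zeta j| < `|zeta i - zeta j|].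

(* The sum over (r_0, r_1, ..., r_n) is taken first over r_1, ..., r_n, which
   composes Phi with the products E_V, and then over r_0, each sum being
   absolutely convergent. Unconditional summability over all (r_0, ..., r_n)
   jointly is not meant: already for n = 1 and Phi(v; z) = e^(z D_W) f(v) with
   f a derivation, l_0 = l_1 = 1, it holds in general only for
   |zeta_1| + |z_2 - zeta_1| < |z_1|, and not on the whole domain. *)
Definition composable n (m : nat) (Phi : cochain n) : Prop :=
  exists2 N : V -> V -> nat, (forall u v, (0 < N u v)%N) &
  forall (l0 : nat) (l : 'I_n -> nat), (forall i, (0 < l i)%N) ->
  (l0 + \sum_i l i = m + n)%N ->
  forall (v : 'I_(m + n) -> V) (w' : {scalar W}), gdual w' ->
  exists2 f : ('I_(m + n) -> C) -> C,
    diag_rat_ord (fun i j => N (v i) (v j)) f &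
    forall (z : 'I_(m + n) -> C) zeta, composition_domain l0 l z zeta ->
    let Psi i := EV (block v (offset l0 l i) : 'I_(l i) -> V)
                   (fun p => block z (offset l0 l i) p - zeta i) in
    exists2 g : C -> {ffun 'I_n -> int} -> ('I_l0 -> C) -> C -> W,
      (forall r0 (r : {ffun 'I_n -> int}), is_Eprod (@YW R V W) (block v 0)
         (Phi (fun i => Psi i ((r i)%:~R / 2)) zeta r0) (g r0 r)) &
      exists2 a : C -> C,
        (forall r0, abs_cvg_to (fun r => pairing w' (g r0 r (fun p => block z 0 p))) (a r0)) &
        abs_cvg_to a (f z).

(* Chat^n_0 carries no composability condition. *)
Definition Chat n (m : nat) (Phi : cochain n) : Prop :=
  [/\ multilinear Phi, rational_valued Phi, D_derivative_property Phi,
      d_conjugation_property Phi & (0 < m)%N -> composable m Phi].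

Definition C1 (m : nat) (Phi : cochain 1) : Prop :=
  Chat m Phi /\ parity_preserving Phi.

Definition pair2 (T : Type) (x y : T) : 'I_2 -> T :=
  fun i => if i == 0 then x else y.

Definition C2 (m : nat) (Phi : cochain 2) : Prop :=
  [/\ Chat m Phi, parity_preserving Phi &
      forall a b v1 v2, par a v1 -> par b v2 -> forall z1 z2 : C,
      Phi (pair2 v1 v2) (pair2 z1 z2)
      = (-1) ^+ (a && b) *: Phi (pair2 v2 v1) (pair2 z2 z1)].

(* delta1 m Phi Chi : Phi is in C^1_m, Chi is in C^2_(m-1) and
   delta^1_m Phi = Chi. The map delta^1_m is given by its graph because E is
   only defined on convergent series. *)
Definition delta1 (m : nat) (Phi : cochain 1) (Chi : cochain 2) : Prop :=
  [/\ C1 m Phi, C2 m.-1 Chi &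
  forall a b v1 v2, par a v1 -> par b v2 ->
  exists g1 g2 g3 : ('I_2 -> C) -> C -> W,
  [/\ is_E (@diag_rat R 2) [set z : 'I_2 -> C | `|z 1| < `|z 0|]
        (fun w' z r => mat_el (@YW R V W) w' v1 (z 0)
                         (Phi (fun=> v2) (fun=> z 1) r)) g1,
      forall zeta : C, is_E (@diag_rat R 2) (@conf R 2)
        (fun w' z (r : int) => pairing w'
           (Phi (fun=> EV (pair2 v1 v2) (fun i => z i - zeta) (r%:~R / 2))
                (fun=> zeta))) g2,
      is_E (@diag_rat R 2) [set z : 'I_2 -> C | `|z 0| < `|z 1|]
        (fun w' z r => mat_el (@YW R V W) w' v2 (z 1)
                         (Phi (fun=> v1) (fun=> z 0) r)) g3 &
      forall z, conf z ->
        Chi (pair2 v1 v2) z = g1 z - g2 z + (-1) ^+ (a && b) *: g3 z]].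

Definition delta0 (w : W) : cochain 1 := 0.

Definition derivation (f : V -> W) : Prop :=
  [/\ linear f, forall r v, wt r v -> wt r (f v),
      forall a v, par a v -> par a (f v) &
  (* The coefficient of x^(-k-1) in
     f(Y(u,x)v) = (-1)^(|u||v|) e^(x D_W) Y_W(v,-x) f(u) + Y_W(u,x) f(v). *)
  forall a b u v, par a u -> par b v -> forall k : int,
    f (vY u k v)
    = (-1) ^+ (a && b) *:
        \sum_(j \in [set: nat])
           ((-1) ^ (- (k + j%:Z) - 1) / j`!%:R)
             *: iter j (@DW R V W) (YW v (k + j%:Z) (f u))
      + YW u k (f v)].

End Cochains.

Lemma cvg_lin (K : numClosedFieldType) T (F : set_system T) {FF : Filter F}
    (f g : T -> K) (a b c : K) :
  f @ F --> a -> g @ F --> b -> (fun x => c * f x + g x) @ F --> c * a + b.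
Proof.
move=> fa gb.
exact: (@cvgD K K _ F _ (fun x => c * f x) g (c * a) b (cvgMl_tmp fa) gb).
Qed.

Lemma is_derive_lin (K : numClosedFieldType) (f g : K -> K) (x a df dg : K) :
  is_derive x 1 f df -> is_derive x 1 g dg ->
  is_derive x 1 (fun t => a * f t + g t) (a * df + dg).
Proof.
move=> hf hg; exact: (@is_deriveD K K K (a \*: f) g x 1 _ _ (is_deriveZ a hf) hg).
Qed.

Lemma is_derive_val (K : numClosedFieldType) (f : K -> K) (x df : K) :
  is_derive x 1 f df -> 'D_1 f x = df.
Proof. by move=> hf; exact: derive_val. Qed.

Lemma is_derive_cst0 (K : numClosedFieldType) (x : K) :
  is_derive x 1 (fun _ : K => 0 : K) 0.
Proof. exact: (@is_derive_cst K K K 0 x 1). Qed.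

#[local] Existing Instance totally_filter.

Section Closure.
Variable R : realType.
Local Notation C := (Cx R).

Lemma abs_cvg_to_lin (I : choiceType) (F G : I -> C) (s t a : C) :
  abs_cvg_to F s -> abs_cvg_to G t ->
  abs_cvg_to (fun i => a * F i + G i) (a * s + t).
Proof.
move=> [[M hM] Fs] [[N hN] Gt]; split.
  exists (`|a| * M + N) => A.
  apply: (@le_trans _ _ (\sum_(i : A) (`|a| * `|F (val i)| + `|G (val i)|))).
    by apply: ler_sum => i _; rewrite -normrM ler_normD.
  rewrite big_split /= -mulr_sumr lerD ?hN //.
  by rewrite ler_wpM2l // hM.
rewrite (_ : partial_sum _ = fun A => a * partial_sum F A + partial_sum G A).
  exact: (@cvg_lin C _ totally _ (partial_sum F) (partial_sum G) s t a Fs Gt).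
by apply/funext => A; rewrite /partial_sum big_split /= -mulr_sumr.
Qed.

Lemma frac_on_lin n (D : set ('I_n -> C)) (P Q : mpoly n C) q1 q2 q3 f g (a : C) :
  (forall z, meval z P = q1 z) -> (forall z, meval z Q = q2 z) ->
  (forall z, D z -> q1 z != 0 /\ q2 z != 0 /\ q1 z * q2 z = q3 z) ->
  frac_on D q1 f -> frac_on D q2 g ->
  frac_on D q3 (fun z => a * f z + g z).
Proof.
move=> Pq Qq nz [[p1 hf] f0] [[p2 hg] g0]; split; last first.
  by move=> z nDz; rewrite f0 // g0 // mulr0 addr0.
exists (mpolyC n a * p1 * Q + p2 * P) => z Dz.
have [z1 [z2 <-]] := nz z Dz.
rewrite hf // hg // mevalD !mevalM mevalC Pq Qq.
by rewrite mulrA addf_div.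
Qed.

Definition diag_denP n (N : 'I_n -> 'I_n -> nat) : mpoly n C :=
  \prod_(i < n) \prod_(j < n | (i < j)%N)
     (mpolyX C (mnm1 i) - mpolyX C (mnm1 j)) ^+ N i j.

Lemma diag_denPE n (N : 'I_n -> 'I_n -> nat) z :
  meval z (diag_denP N) = diag_den N z.
Proof.
rewrite rmorph_prod; apply: eq_bigr => i _; rewrite rmorph_prod.
by apply: eq_bigr => j _; rewrite rmorphXn /= mevalB !mevalXU.
Qed.

Lemma diag_den_neq0 n (N : 'I_n -> 'I_n -> nat) (z : 'I_n -> C) :
  conf z -> diag_den N z != 0.
Proof.
move=> injz; apply/prodf_neq0 => i _; apply/prodf_neq0 => j ij.
rewrite expf_neq0 // subr_eq0; apply/eqP => /injz ije.
by rewrite ije ltnn in ij.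
Qed.

Lemma diag_denD n (N M : 'I_n -> 'I_n -> nat) (z : 'I_n -> C) :
  diag_den N z * diag_den M z = diag_den (fun i j => (N i j + M i j)%N) z.
Proof.
rewrite /diag_den -big_split; apply: eq_bigr => i _ /=.
by rewrite -big_split; apply: eq_bigr => j _ /=; rewrite exprD.
Qed.

Lemma diag_rat_ord_lin n (N M : 'I_n -> 'I_n -> nat) f g (a : C) :
  diag_rat_ord N f -> diag_rat_ord M g ->
  diag_rat_ord (fun i j => (N i j + M i j)%N) (fun z => a * f z + g z).
Proof.
apply: frac_on_lin (diag_denPE N) (diag_denPE M) _ => z zc.
by rewrite !diag_den_neq0 // diag_denD.
Qed.

Lemma diag_rat_lin n (f g : ('I_n -> C) -> C) (a : C) :
  diag_rat f -> diag_rat g -> diag_rat (fun z => a * f z + g z).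
Proof. by move=> [N fN] [M gM]; eexists; apply: diag_rat_ord_lin fN gM. Qed.

Lemma diag0_rat_lin n (f g : ('I_n -> C) -> C) (a : C) :
  diag0_rat f -> diag0_rat g -> diag0_rat (fun z => a * f z + g z).
Proof.
move=> [N [k fN]] [M [l gM]].
exists (fun i j => (N i j + M i j)%N), (k + l)%N.
have E (N' : 'I_n -> 'I_n -> nat) k' z :
    meval z (diag_denP N' * (\prod_i mpolyX C (mnm1 i)) ^+ k')
    = diag_den N' z * (\prod_i z i) ^+ k'.
  rewrite mevalM diag_denPE rmorphXn /= rmorph_prod.
  by congr (_ * _ ^+ _); apply: eq_bigr => i _ /=; rewrite mevalXU.
apply: frac_on_lin (E N k) (E M l) _ fN gM => z [injz z0].
have p0 : \prod_i z i != 0 by apply/prodf_neq0.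
rewrite !mulf_neq0 ?expf_neq0 ?diag_den_neq0 //; split=> //; split=> //.
by rewrite mulrACA diag_denD exprD.
Qed.

Lemma diag_rat0 n : diag_rat (fun _ : 'I_n -> C => 0).
Proof.
exists (fun _ _ => 0%N); split=> //; exists 0 => z _.
by rewrite meval0 mul0r.
Qed.

Lemma diag_rat_ord0 n (N : 'I_n -> 'I_n -> nat) :
  diag_rat_ord N (fun _ : 'I_n -> C => 0).
Proof. by split=> //; exists 0 => z _; rewrite meval0 mul0r. Qed.

Lemma diag0_rat0 n : diag0_rat (fun _ : 'I_n -> C => 0).
Proof.
exists (fun _ _ => 0%N), 0%N; split=> //; exists 0 => z _.
by rewrite meval0 mul0r.
Qed.

Lemma abs_cvg_to0 (I : choiceType) : abs_cvg_to (fun _ : I => 0 : C) 0.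
Proof.
split.
  by exists 0 => A; rewrite /partial_sum big1 // => i _; rewrite normr0.
rewrite (_ : partial_sum _ = fun=> 0); first exact: cvg_cst.
by apply/funext => A; rewrite /partial_sum big1.
Qed.


Lemma lin0 (U U' : lmodType C) (f : U -> U') : linear f -> f 0 = 0.
Proof. by move=> lf; have := lf (-1) 0 0; rewrite scaler0 addr0 scaleN1r addNr. Qed.

Lemma linZ (U U' : lmodType C) (f : U -> U') a x :
  linear f -> f (a *: x) = a *: f x.
Proof. by move=> lf; have := lf a x 0; rewrite (lin0 lf) !addr0. Qed.

Lemma linD (U U' : lmodType C) (f : U -> U') x y :
  linear f -> f (x + y) = f x + f y.
Proof. by move=> lf; have := lf 1 x y; rewrite !scale1r. Qed.

Lemma lin_sum (U U' : lmodType C) (f : U -> U') (I : Type) (s : seq I) (F : I -> U) :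
  linear f -> f (\sum_(i <- s) F i) = \sum_(i <- s) f (F i).
Proof.
move=> lf; elim: s => [|i s IH]; first by rewrite !big_nil (lin0 lf).
by rewrite !big_cons linD // IH.
Qed.

Lemma wpr_supp (W : gradedSpace R) (w : W) :
  exists A : {fset C}, forall r, r \notin A -> wpr r w = 0.
Proof.
have [s us ws] := wpr_sum w.
exists [fset x | x in s]%fset => r; rewrite in_fset /= => rs.
rewrite ws lin_sum; last exact: wpr_linear.
rewrite big_seq big1 // => t ts; rewrite wprM.
by case: eqP => // rt; rewrite rt ts in rs.
Qed.

Lemma wpr_dop (W : gradedSpace R) (w : W) t : wpr t (dop w) = t *: wpr t w.
Proof.
have [A A0] := wpr_supp w.
rewrite /dop (@fsbigTE _ _ _ _ A); last by move=> r /A0 ->; rewrite scaler0.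
rewrite lin_sum; last exact: wpr_linear.
rewrite (eq_bigr (fun r => if r == t then t *: wpr t w else 0)); last first.
  move=> r _; rewrite linZ; last exact: wpr_linear.
  by rewrite wprM eq_sym; case: eqP => [->//|_]; rewrite scaler0.
rewrite -big_mkcond /=.
have [tA|/A0 ->] := boolP (t \in A); last by rewrite scaler0 big1.
rewrite -big_filter filter_pred1_uniq ?big_seq1 //; exact: fset_uniq.
Qed.

Lemma wpr_total (W : gradedSpace R) (w : W) : (forall t, wpr t w = 0) -> w = 0.
Proof. by move=> w0; have [s _ ->] := wpr_sum w; rewrite big1. Qed.

Lemma dop_eq_wt (W : gradedSpace R) (w : W) t : dop w = t *: w -> wt t w.
Proof.
move=> dw; apply/eqP; rewrite -subr_eq0; apply/eqP/wpr_total => r.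
have lr := @wpr_linear _ W r.
rewrite linD // -scaleN1r linZ // scaleN1r wprM.
case: eqP => [->|/eqP rt]; first by rewrite subrr.
have /eqP := wpr_dop w r; rewrite dw linZ // eq_sym -subr_eq0 -scalerBl.
by rewrite scaler_eq0 subr_eq0 (negPf rt) => /eqP ->; rewrite subr0.
Qed.

Lemma dop_wt (W : gradedSpace R) (w : W) t : wt t w -> dop w = t *: w.
Proof.
move=> tw; apply/eqP; rewrite -subr_eq0; apply/eqP/wpr_total => r.
have lr := @wpr_linear _ W r.
rewrite (linD _ _ lr) -scaleN1r !(linZ _ _ lr) scaleN1r wpr_dop.
rewrite -[w in wpr r w]tw wprM.
by case: eqP => [->|_]; rewrite ?subrr // !scaler0 subr0.
Qed.

Lemma modes_wt (V W : gradedSpace R) (YW : modes V W) (s r : C) v k w :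
  field_map YW -> d_bracket YW -> wt s v -> wt r w ->
  wt (s + r - k%:~R - 1) (YW v k w).
Proof.
move=> [lY lY' _] dY sv rw; apply: dop_eq_wt.
have /eqP := dY v k w; rewrite (dop_wt sv) (dop_wt rw).
rewrite (linZ _ _ (lY v k)) (linZ _ _ (lY' k w)) subr_eq => /eqP ->.
by rewrite -!scalerDl rmorphB rmorphN /=; congr (_ *: _); ring.
Qed.

Lemma gdual_modes (V W : gradedSpace R) (YW : modes V W) (w' : {scalar W}) v w :
  field_map YW -> d_bracket YW -> gdual w' ->
  exists A : {fset int}, forall k, k \notin A -> w' (YW v k w) = 0.
Proof.
move=> fY dY fw'.
have hom s r : exists A : {fset int}, forall k, k \notin A ->
    w' (YW (wpr s v) k (wpr r w)) = 0.
  pose B := [set k : int | w' (YW (wpr s v) k (wpr r w)) != 0].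
  suff fB : finite_set B.
    exists (fset_set B) => k; rewrite in_fset_set // notin_setE /= => /negP.
    by rewrite negbK => /eqP.
  pose h (k : int) : C := s + r - k%:~R - 1.
  apply: (@sub_finite_set _ _ (h @^-1` [set r | exists w, w' (wpr r w) != 0])).
    move=> k /= nz; exists (YW (wpr s v) k (wpr r w)).
    have -> // : wpr (h k) (YW (wpr s v) k (wpr r w)) = YW (wpr s v) k (wpr r w).
    by apply: modes_wt; rewrite // /wt wprM eqxx.
  apply: finite_preimage fw' => k l _ _ /addIr /addrI /oppr_inj.
  exact: intr_inj.
have [sv _ ev] := wpr_sum v; have [sw _ ew] := wpr_sum w.
rewrite ev ew.
have [lY lY' _] := fY.
have hom1 r : exists A : {fset int}, forall k, k \notin A ->
    w' (YW (\sum_(s <- sv) wpr s v) k (wpr r w)) = 0.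
  elim: (sv) => [|s l [A hA]].
    exists fset0 => k _; rewrite big_nil (lin0 (lY' _ _)); exact: raddf0.
  have [B hB] := hom s r; exists (A `|` B)%fset => k.
  rewrite in_fsetU negb_or => /andP[kA kB].
  by rewrite big_cons (linD _ _ (lY' _ _)) raddfD /= hA // hB // addr0.
elim: (sw) => [|r l [A hA]].
  exists fset0 => k _; rewrite big_nil (lin0 (lY _ _)); exact: raddf0.
have [B hB] := hom1 r; exists (A `|` B)%fset => k.
rewrite in_fsetU negb_or => /andP[kA kB].
by rewrite big_cons (linD _ _ (lY _ _)) raddfD /= hA // hB // addr0.
Qed.

Lemma mat_el_lin (V W : gradedSpace R) (YW : modes V W) (w' : {scalar W}) v z a x y :
  field_map YW -> d_bracket YW -> gdual w' ->
  mat_el YW w' v z (a *: x + y) = a * mat_el YW w' v z x + mat_el YW w' v z y.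
Proof.
move=> fY dY gw; have [lY _ _] := fY.
have [A hA] := gdual_modes v x fY dY gw; have [B hB] := gdual_modes v y fY dY gw.
have E (w : W) : (forall k, k \notin (A `|` B)%fset -> w' (YW v k w) = 0) ->
    mat_el YW w' v z w = \sum_(k <- (A `|` B)%fset) w' (YW v k w) * z ^ (- k - 1).
  by move=> h; apply: fsbigTE => k /h ->; rewrite mul0r.
have hx k : k \notin (A `|` B)%fset -> w' (YW v k x) = 0.
  by rewrite in_fsetU negb_or => /andP[/hA].
have hy k : k \notin (A `|` B)%fset -> w' (YW v k y) = 0.
  by rewrite in_fsetU negb_or => /andP[_ /hB].
rewrite !E //; last by move=> k kAB; rewrite lY linearP /= hx // hy // mulr0 addr0.
rewrite mulr_sumr -big_split; apply: eq_bigr => k _ /=.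
by rewrite lY linearP /= mulrDl mulrA.
Qed.

Lemma pairing_supp (W : gradedSpace R) (w' : {scalar W}) : gdual w' ->
  exists A : {fset C}, forall f, wbar f -> pairing w' f = \sum_(r <- A) w' (f r).
Proof.
move=> fw'; exists (fset_set [set r | exists w, w' (wpr r w) != 0]) => f wf.
apply: fsbigTE => r; rewrite in_fset_set // notin_setE /= => nr.
apply/eqP; case: eqP => // /eqP nz; case: nr.
by exists (f r); rewrite wf.
Qed.

Lemma wbar_lin (W : gradedSpace R) (a : C) (f g : C -> W) :
  wbar f -> wbar g -> wbar (a *: f + g).
Proof.
by move=> wf wg r; rewrite /wt /= [LHS]wpr_linear wf wg.
Qed.

Lemma pairing_lin (W : gradedSpace R) (w' : {scalar W}) (a : C) (f g : C -> W) :
  gdual w' -> wbar f -> wbar g ->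
  pairing w' (a *: f + g) = a * pairing w' f + pairing w' g.
Proof.
move=> gw wf wg; have [A hA] := pairing_supp gw.
rewrite !hA //; last exact: wbar_lin.
by rewrite mulr_sumr -big_split; apply: eq_bigr => r _ /=; exact: linearP.
Qed.

Lemma is_E_lin (W : gradedSpace R) n (cls : set (('I_n -> C) -> C))
    (I : choiceType) (D : set ('I_n -> C)) (S T : {scalar W} -> ('I_n -> C) -> I -> C)
    (U : {scalar W} -> ('I_n -> C) -> I -> C) g h (a : C) :
  (forall f1 f2, cls f1 -> cls f2 -> cls (fun z => a * f1 z + f2 z)) ->
  (forall w' z i, gdual w' -> U w' z i = a * S w' z i + T w' z i) ->
  is_E cls D S g -> is_E cls D T h -> is_E cls D U (fun z => a *: g z + h z).
Proof.
move=> hcls hU [wg Eg] [wh Eh]; split=> [z|w' gw]; first exact: wbar_lin.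
have [cg sg] := Eg w' gw; have [ch sh] := Eh w' gw; split.
  rewrite (_ : (fun z => _) = fun z => a * pairing w' (g z) + pairing w' (h z)).
    exact: hcls.
  by apply/funext => z; apply: pairing_lin.
move=> z Dz; rewrite pairing_lin //.
rewrite (_ : U w' z = fun i => a * S w' z i + T w' z i).
  exact: abs_cvg_to_lin (sg z Dz) (sh z Dz).
by apply/funext => i; apply: hU.
Qed.

Lemma is_E0 (W : gradedSpace R) n (cls : set (('I_n -> C) -> C))
    (I : choiceType) (D : set ('I_n -> C)) (S : {scalar W} -> ('I_n -> C) -> I -> C) :
  cls (fun=> 0) -> (forall w' z i, S w' z i = 0) ->
  is_E cls D S (fun _ _ => 0).
Proof.
move=> c0 S0; split=> [z r|w' gw].
  by rewrite /wt (lin0 (@wpr_linear _ W r)).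
have p0 : pairing w' (fun=> 0) = 0 by apply: fsbig1 => r _; exact: raddf0.
rewrite p0; split=> // z Dz.
rewrite (_ : S w' z = fun=> 0); last by apply/funext => i.
exact: abs_cvg_to0.
Qed.

Section CochainClosure.
Variables (V : vertexSuperalgebra R) (W : supermodule V).

Lemma pairing0 (w' : {scalar W}) : pairing w' (0 : C -> W) = 0.
Proof. by apply: fsbig1 => r _; exact: raddf0. Qed.

Lemma wbar0 : wbar (0 : C -> W).
Proof. by move=> r; rewrite /wt (lin0 (@wpr_linear _ W r)). Qed.

Lemma DWbar_wbar (f : C -> W) : wbar f -> wbar (DWbar f).
Proof.
move=> wf r; rewrite /DWbar; have /eqP := @DW_d _ _ W (f (r - 1)).
rewrite (dop_wt (wf (r - 1))) (linZ _ _ (@DW_linear _ _ W)) subr_eq => /eqP dD.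
by apply: dop_eq_wt; rewrite dD -[X in X + _]scale1r -scalerDl addrC subrK.
Qed.

Lemma DWbar_lin a (f g : C -> W) : DWbar (a *: f + g) = a *: DWbar f + DWbar g.
Proof. by apply/funext => r; exact: (@DW_linear _ _ W). Qed.

Section Conditions.
Variable n : nat.
Implicit Types Phi Psi : cochain W n.

Lemma rational_wbar Phi v z : rational_valued Phi -> wbar (Phi v z).
Proof. by move=> /(_ v)[]. Qed.

Lemma pairing_cochain a Phi Psi w' v z :
  gdual w' -> rational_valued Phi -> rational_valued Psi ->
  pairing w' ((a *: Phi + Psi) v z)
  = a * pairing w' (Phi v z) + pairing w' (Psi v z).
Proof. by move=> gw rP rQ; apply: pairing_lin => //; exact: rational_wbar. Qed.

Lemma multilinear_lin a Phi Psi :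
  multilinear Phi -> multilinear Psi -> multilinear (a *: Phi + Psi).
Proof.
move=> mP mQ i v z c x y.
rewrite -![(a *: Phi + Psi) _ _]/(a *: Phi _ _ + Psi _ _) mP mQ.
by rewrite !scalerDr addrACA !scalerA mulrC.
Qed.

Lemma rational_lin a Phi Psi :
  rational_valued Phi -> rational_valued Psi -> rational_valued (a *: Phi + Psi).
Proof.
move=> rP rQ v; split; [|split].
- by move=> z; apply: wbar_lin; exact: rational_wbar.
- move=> z nz; rewrite -[LHS]/(a *: Phi _ _ + Psi _ _).
  by rewrite (rP v).2.1 // (rQ v).2.1 // scaler0 addr0.
move=> w' gw.
rewrite (_ : (fun z => _)
   = fun z => a * pairing w' (Phi v z) + pairing w' (Psi v z)).
  by apply: diag_rat_lin; [apply: (rP v).2.2|apply: (rQ v).2.2].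
by apply/funext => z; exact: pairing_cochain.
Qed.

Lemma D_derivative_lin a Phi Psi :
  rational_valued Phi -> rational_valued Psi ->
  D_derivative_property Phi -> D_derivative_property Psi ->
  D_derivative_property (a *: Phi + Psi).
Proof.
move=> rP rQ dP dQ v w' z gw cz.
have [dP1 dP2] := dP v w' z gw cz; have [dQ1 dQ2] := dQ v w' z gw cz.
have d1 (i : 'I_n) : is_derive (z i) 1
    (fun t : C => pairing w' ((a *: Phi + Psi) v [eta z with i |-> t]))
    (pairing w' ((a *: Phi + Psi) [eta v with i |-> DV (v i)] z)).
  rewrite pairing_cochain //.
  rewrite (_ : (fun t : C => _) = fun t : C =>
      a * pairing w' (Phi v [eta z with i |-> t])
      + pairing w' (Psi v [eta z with i |-> t])).
    exact: is_derive_lin (dP1 i) (dQ1 i).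
  by apply/funext => t; exact: pairing_cochain.
split=> //; rewrite -[(a *: Phi + Psi) v z]/(a *: Phi v z + Psi v z) DWbar_lin.
rewrite pairing_lin //; try by apply: DWbar_wbar; exact: rational_wbar.
rewrite -dP2 -dQ2 mulr_sumr -big_split; apply: eq_bigr => i _ /=.
rewrite (is_derive_val (d1 i)) (is_derive_val (dP1 i)) (is_derive_val (dQ1 i)).
exact: pairing_cochain.
Qed.

Lemma wbar_scale (c : C -> C) (f : C -> W) : wbar f -> wbar (fun r => c r *: f r).
Proof. by move=> wf r; rewrite /wt (linZ _ _ (@wpr_linear _ W r)) wf. Qed.

Lemma d_conjugation_lin a Phi Psi :
  rational_valued Phi -> rational_valued Psi ->
  d_conjugation_property Phi -> d_conjugation_property Psi ->
  d_conjugation_property (a *: Phi + Psi).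
Proof.
move=> rP rQ dP dQ lam v w' z gw cz; rewrite pairing_cochain // -dP // -dQ //.
rewrite -pairing_lin //; try by apply: wbar_scale; exact: rational_wbar.
congr pairing; apply/funext => r.
rewrite -[LHS]/(cexp (lam * r) *: (a *: Phi v z r + Psi v z r)).
rewrite -[RHS]/(a *: (cexp (lam * r) *: Phi v z r) + cexp (lam * r) *: Psi v z r).
by rewrite scalerDr !scalerA mulrC.
Qed.

Lemma parity_lin a Phi Psi : parity_preserving Phi -> parity_preserving Psi ->
  parity_preserving (a *: Phi + Psi).
Proof.
move=> pP pQ b v hv z r; rewrite /par.
rewrite -[(a *: Phi + Psi) v z r]/(a *: Phi v z r + Psi v z r).
by rewrite (@ppr_linear _ W) (pP b) // (pQ b).
Qed.

Lemma modes_prod_lin l (v : 'I_l -> V) k a (x y : W) :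
  modes_prod (@YW _ _ W) v k (a *: x + y)
  = a *: modes_prod (@YW _ _ W) v k x + modes_prod (@YW _ _ W) v k y.
Proof.
have [lY _ _] := @YW_field _ _ W.
by rewrite /modes_prod; elim: (enum _) => //= i s ->; rewrite lY.
Qed.

Lemma is_Eprod_lin l (v : 'I_l -> V) a (x y : W) g h :
  is_Eprod (@YW _ _ W) v x g -> is_Eprod (@YW _ _ W) v y h ->
  is_Eprod (@YW _ _ W) v (a *: x + y) (fun z => a *: g z + h z).
Proof.
apply: is_E_lin => [f1 f2|w' z k gw]; first exact: diag0_rat_lin.
by rewrite /prod_series modes_prod_lin linearP /= mulrDl mulrA.
Qed.

Lemma composable_lin m a Phi Psi :
  composable m Phi -> composable m Psi -> composable m (a *: Phi + Psi).
Proof.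
move=> [N N0 cP] [M M0 cQ].
exists (fun u v => (N u v + M u v)%N) => [u v|l0 l hl el v w' gw].
  by rewrite addn_gt0 N0.
have [f1 rf1 h1] := cP l0 l hl el v w' gw.
have [f2 rf2 h2] := cQ l0 l hl el v w' gw.
exists (fun z => a * f1 z + f2 z); first exact: diag_rat_ord_lin.
move=> z zeta dz Ps.
have [g1 E1 [a1 s1 t1]] := h1 z zeta dz; have [g2 E2 [a2 s2 t2]] := h2 z zeta dz.
exists (fun r0 r z' => a *: g1 r0 r z' + g2 r0 r z').
  by move=> r0 r; exact: is_Eprod_lin (E1 r0 r) (E2 r0 r).
exists (fun r0 => a * a1 r0 + a2 r0); last exact: abs_cvg_to_lin t1 t2.
move=> r0; rewrite (_ : (fun r => _) = fun r : {ffun 'I_n -> int} =>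
    a * pairing w' (g1 r0 r (block z 0)) + pairing w' (g2 r0 r (block z 0))).
  exact: abs_cvg_to_lin (s1 r0) (s2 r0).
apply/funext => r; apply: pairing_lin => //.
  exact: (E1 r0 r).1.
exact: (E2 r0 r).1.
Qed.

Lemma Chat_lin m a Phi Psi : Chat m Phi -> Chat m Psi -> Chat m (a *: Phi + Psi).
Proof.
move=> [mP rP DP dP cP] [mQ rQ DQ dQ cQ]; split.
- exact: multilinear_lin.
- exact: rational_lin.
- exact: D_derivative_lin.
- exact: d_conjugation_lin.
by move=> m0; apply: composable_lin; [exact: cP|exact: cQ].
Qed.

Lemma Chat0 m : Chat m (0 : cochain W n).
Proof.
split.
- by move=> i v z c x y; rewrite -![(0 : cochain W n) _ _]/0 scaler0 addr0.
- move=> v; split; [|split] => // [z|w' gw]; first exact: wbar0.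
  rewrite (_ : (fun z => _) = fun=> 0); first exact: diag_rat0.
  by apply/funext => z; exact: pairing0.
- move=> v w' z gw cz.
  have d0 (i : 'I_n) : is_derive (z i) 1
      (fun t : C => pairing w' ((0 : cochain W n) v [eta z with i |-> t]))
      (pairing w' ((0 : cochain W n) [eta v with i |-> DV (v i)] z)).
    have -> : (fun t : C => pairing w' ((0 : cochain W n) v [eta z with i |-> t]))
        = fun=> 0 by apply/funext => t; exact: pairing0.
    rewrite pairing0; exact: is_derive_cst0.
  split=> //; rewrite (_ : DWbar _ = 0); last first.
    by apply/funext => r; exact: (lin0 (@DW_linear _ _ W)).
  rewrite [RHS]pairing0; apply: big1 => i _.
  by rewrite (is_derive_val (d0 i)); exact: pairing0.
- move=> lam v w' z gw cz; rewrite [RHS]pairing0.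
  rewrite (_ : (fun r => _) = 0) ?pairing0 //.
  by apply/funext => r; exact: scaler0.
move=> m0; exists (fun _ _ => 1%N) => // l0 l hl el v w' gw.
exists (fun=> 0); first exact: diag_rat_ord0.
move=> z zeta dz Ps; exists (fun _ _ _ => 0).
  move=> r0 r; apply: is_E0; first exact: diag0_rat0.
  move=> u x k; rewrite /prod_series (_ : modes_prod _ _ _ _ = 0).
    by rewrite raddf0 mul0r.
  have [lY _ _] := @YW_field _ _ W.
  by rewrite /modes_prod; elim: (enum _) => //= i s ->; rewrite (lin0 (lY _ _)).
exists (fun=> 0); last exact: abs_cvg_to0.
move=> r0; rewrite (_ : (fun r => _) = fun=> 0); first exact: abs_cvg_to0.
by apply/funext => r; exact: pairing0.
Qed.

Lemma parity0 : parity_preserving (0 : cochain W n).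
Proof. by move=> b v hv z r; rewrite /par; exact: (lin0 (@ppr_linear _ W _)). Qed.

End Conditions.

Lemma C1_lin m a (Phi Psi : cochain W 1) :
  C1 m Phi -> C1 m Psi -> C1 m (a *: Phi + Psi).
Proof.
by move=> [cP pP] [cQ pQ]; split; [exact: Chat_lin|exact: parity_lin].
Qed.

Lemma C1_0 m : C1 m (0 : cochain W 1).
Proof. by split; [exact: Chat0|exact: parity0]. Qed.

Lemma C2_0 m : C2 m (0 : cochain W 2).
Proof.
split; [exact: Chat0|exact: parity0|].
by move=> b c v1 v2 _ _ z1 z2; rewrite -![(0 : cochain W 2) _ _]/0 scaler0.
Qed.

Lemma cocycle0 m : delta1 m (0 : cochain W 1) 0.
Proof.
split; [exact: C1_0|exact: C2_0|] => a b v1 v2 _ _.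
have [lY _ _] := @YW_field _ _ W.
have m0 w' (v : V) z : mat_el (@YW _ _ W) w' v z 0 = 0.
  by apply: fsbig1 => k _; rewrite (lin0 (lY _ _)) raddf0 mul0r.
exists (fun _ _ => 0), (fun _ _ => 0), (fun _ _ => 0); split.
- by apply: is_E0 => [|w' z r]; [exact: diag_rat0|exact: m0].
- by move=> zeta; apply: is_E0 => [|w' z r]; [exact: diag_rat0|exact: pairing0].
- by apply: is_E0 => [|w' z r]; [exact: diag_rat0|exact: m0].
by move=> z _; rewrite scaler0 addr0 subrr.
Qed.

Lemma cocycle_lin m a (Phi Psi : cochain W 1) :
  delta1 m Phi 0 -> delta1 m Psi 0 -> delta1 m (a *: Phi + Psi) 0.
Proof.
move=> [cP c0 dP] [cQ _ dQ]; split=> //; first exact: C1_lin.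
have [[_ rP _ _ _] _] := cP; have [[_ rQ _ _ _] _] := cQ.
move=> b c v1 v2 p1 p2.
have [g1 [g2 [g3 [E1 E2 E3 E]]]] := dP b c v1 v2 p1 p2.
have [h1 [h2 [h3 [F1 F2 F3 F]]]] := dQ b c v1 v2 p1 p2.
have fY := @YW_field _ _ W; have dY := @YW_d _ _ W.
exists (fun z => a *: g1 z + h1 z), (fun z => a *: g2 z + h2 z),
       (fun z => a *: g3 z + h3 z); split.
- apply: is_E_lin E1 F1; first by move=> *; exact: diag_rat_lin.
  by move=> w' z r gw; exact: mat_el_lin.
- move=> zeta; apply: is_E_lin (E2 zeta) (F2 zeta).
    by move=> *; exact: diag_rat_lin.
  by move=> w' z r gw; exact: pairing_cochain.
- apply: is_E_lin E3 F3; first by move=> *; exact: diag_rat_lin.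
  by move=> w' z r gw; exact: mat_el_lin.
move=> z cz; have := E z cz; have := F z cz.
rewrite -![(0 : cochain W 2) _ _]/0 => F0 E0.
have -> : a *: g1 z + h1 z - (a *: g2 z + h2 z)
          + (-1) ^+ (b && c) *: (a *: g3 z + h3 z)
  = a *: (g1 z - g2 z + (-1) ^+ (b && c) *: g3 z)
    + (h1 z - h2 z + (-1) ^+ (b && c) *: h3 z).
  rewrite !scalerDr scalerN !scalerA [a * _]mulrC opprD.
  by rewrite [a *: _ + h1 z + _]addrACA [RHS]addrACA.
by rewrite -F0 -E0 scaler0 addr0.
Qed.

Lemma derivation0 : derivation (0 : V -> W).
Proof.
have [lY _ _] := @YW_field _ _ W.
split=> //.
- by move=> a x y; rewrite -![(0 : V -> W) _]/0 scaler0 addr0.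
- by move=> r v _; exact: (lin0 (@wpr_linear _ W r)).
- by move=> r v _; exact: (lin0 (@ppr_linear _ W r)).
move=> a b u v _ _ k; rewrite -![(0 : V -> W) _]/0 (lin0 (lY _ _)) addr0.
rewrite fsbig1 ?scaler0 // => j _; rewrite (lin0 (lY _ _)).
have -> : iter j (@DW _ _ W) 0 = 0.
  by elim: j => //= j ->; exact: (lin0 (@DW_linear _ _ W)).
exact: scaler0.
Qed.

Lemma derivation_lin a (f g : V -> W) :
  derivation f -> derivation g -> derivation (a *: f + g).
Proof.
move=> [lf wf pf df] [lg wg pg dg].
have E x : (a *: f + g) x = a *: f x + g x by [].
have [lY _ tY] := @YW_field _ _ W.
split.
- move=> c x y; rewrite !E lf lg !scalerDr addrACA.
  by congr (_ + _ + _); rewrite !scalerA mulrC.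
- by move=> r v rv; rewrite E /wt (@wpr_linear _ W) wf // wg.
- by move=> r v rv; rewrite E /par (@ppr_linear _ W) pf // pg.
move=> b c u v bu cv k; rewrite !E (df b c) // (dg b c) // lY.
have itl j x y : iter j (@DW _ _ W) (a *: x + y)
    = a *: iter j (@DW _ _ W) x + iter j (@DW _ _ W) y.
  by elim: j => //= j ->; exact: (@DW_linear _ _ W).
have it0 j : iter j (@DW _ _ W) 0 = 0.
  by elim: j => //= j ->; exact: (lin0 (@DW_linear _ _ W)).
have [K1 hK1] := tY v (f u); have [K2 hK2] := tY v (g u).
pose K := (`|K1 - k| + `|K2 - k|)%N.
have hfin (x : W) (F : nat -> C) :
    (forall i : nat, (K <= i)%N -> YW v (k + i%:Z) x = 0) ->
    \sum_(j \in [set: nat]) F j *: iter j (@DW _ _ W) (YW v (k + j%:Z) x)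
    = \sum_(j <- [fset j | j in iota 0 K]%fset)
        F j *: iter j (@DW _ _ W) (YW v (k + j%:Z) x).
  move=> hx; apply: fsbigTE => j; rewrite in_fset /= mem_iota add0n /=.
  by rewrite -leqNgt => /hx ->; rewrite it0 scaler0.
have h1 (i : nat) : (K <= i)%N -> YW v (k + i%:Z) (f u) = 0.
  by move=> Ki; apply: hK1; move: Ki; rewrite /K; lia.
have h2 (i : nat) : (K <= i)%N -> YW v (k + i%:Z) (g u) = 0.
  by move=> Ki; apply: hK2; move: Ki; rewrite /K; lia.
rewrite !hfin //; last by move=> i Ki; rewrite lY h1 // h2 // scaler0 addr0.
rewrite scalerDr addrACA; congr (_ + _).
rewrite [a *: (_ *: _)]scalerA mulrC -scalerA -scalerDr; congr (_ *: _).
rewrite scaler_sumr -big_split; apply: eq_bigr => j _ /=.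
by rewrite lY itl scalerDr !scalerA mulrC.
Qed.

End CochainClosure.

End Closure.

Section Cohomology.
Variables (R : realType) (V : vertexSuperalgebra R) (W : supermodule V).

Definition cocycles1 (m : nat) : subspace (cochain W 1) :=
  Subspace (sub_set := [set Phi | delta1 m Phi 0]) (cocycle0 W m)
    (@cocycle_lin R V W m).

Lemma coboundary0 m :
  [set Phi : sub_type (cocycles1 m) | exists w : W, sub_val Phi = delta0 w] 0.
Proof. by exists 0. Qed.

Lemma coboundary_lin m a (Phi Psi : sub_type (cocycles1 m)) :
  (exists w : W, sub_val Phi = delta0 w) ->
  (exists w : W, sub_val Psi = delta0 w) ->
  exists w : W, sub_val (a *: Phi + Psi) = delta0 w.
Proof.
move=> [w Pw] [x Px]; exists w.
have -> : sub_val (a *: Phi + Psi) = a *: sub_val Phi + sub_val Psi.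
  exact: sub_val_lin.
by rewrite Pw Px scaler0 addr0.
Qed.

Definition coboundaries1 (m : nat) : subspace (sub_type (cocycles1 m)) :=
  Subspace (coboundary0 m) (@coboundary_lin m).

Definition H1 (m : nat) : lmodType (Cx R) := quot_type (coboundaries1 m).

Definition Der : lmodType (Cx R) :=
  sub_type (Subspace (sub_set := @derivation R V W) (derivation0 W)
              (@derivation_lin R V W)).

End Cohomology.

(* Main.v *)
From HB Require Import structures.
Require Import Defs.
From mathcomp Require Import all_boot all_order all_algebra.
From mathcomp Require Import finmap complex.
From mathcomp Require Import all_classical all_reals all_analysis.
From mathcomp Require Import -(notations) mpoly.
From mathcomp.analysis.showcase Require Import summability.
From mathcomp Require Import ring lra zify.

Set Implicit Arguments.
Unset Strict Implicit.
Unset Printing Implicit Defensive.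

Import Order.TTheory GRing.Theory Num.Theory.
Import numFieldNormedType.Exports.

Local Open Scope classical_set_scope.
Local Open Scope ring_scope.

#[local] Existing Instance totally_filter.


Section Sums.
Variable R : realType.
Local Notation C := (Cx R).

Definition abs_bounded (I : choiceType) (F : I -> C) : Prop :=
  exists M : C, forall A : {fset I}, \sum_(i <- A) `|F i| <= M.

Definition has_sum (I : choiceType) (F : I -> C) (s : C) : Prop :=
  forall e : C, 0 < e -> exists A0 : {fset I}, forall A : {fset I},
    (A0 `<=` A)%fset -> `|\sum_(i <- A) F i - s| < e.

Lemma abs_cvg_toE (I : choiceType) (F : I -> C) s :
  abs_cvg_to F s <-> abs_bounded F /\ has_sum F s.
Proof.
have pE (G : I -> C) (A : {fset I}) : partial_sum G A = \sum_(i <- A) G i.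
  by rewrite /partial_sum big_seq_fsetE.
split=> -[[M hM] h]; split.
- by exists M => A; rewrite -(pE (fun i => `|F i|)).
- move=> e e0; move/cvgrPdist_lt: h => /(_ e e0) [A0 _ hA0].
  by exists A0 => A AA; rewrite -pE distrC; exact: hA0.
- by exists M => A; rewrite pE.
apply/cvgrPdist_lt => e e0; have [A0 hA0] := h e e0.
by exists A0 => // A AA /=; rewrite pE distrC; exact: hA0.
Qed.

Lemma fsum_le (I : choiceType) (G : I -> C) (A B : {fset I}) :
  (forall i, 0 <= G i) -> (A `<=` B)%fset -> \sum_(i <- A) G i <= \sum_(i <- B) G i.
Proof.
move=> G0 AB; rewrite (big_fsetID _ (mem A) B) /=.
have -> : [fset x in B | x \in A]%fset = A.
  apply/fsetP => x; rewrite !inE /=; apply/andP/idP => [[]//|xA].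
  by split=> //; exact: (fsubsetP AB).
by rewrite lerDl sumr_ge0.
Qed.

Lemma has_sum_nneg_real (I : choiceType) (G : I -> R) (M : R) :
  (forall i, 0 <= G i) -> (forall A : {fset I}, \sum_(i <- A) G i <= M) ->
  exists s : R, forall e, 0 < e -> exists A0 : {fset I}, forall A : {fset I},
    (A0 `<=` A)%fset -> `|\sum_(i <- A) G i - s| < e.
Proof.
move=> G0 hM; pose E := [set x | exists A : {fset I}, x = \sum_(i <- A) G i].
have Eub : has_sup E.
  split; first by exists (\sum_(i <- fset0) G i); exists fset0.
  by exists M => _ [A ->].
exists (sup E) => e e0; have [_ [A0 ->] hA0] := sup_adherent e0 Eub.
exists A0 => A AA.
have h1 : \sum_(i <- A) G i <= sup E by apply: sup_upper_bound => //; exists A.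
have h2 : \sum_(i <- A0) G i <= \sum_(i <- A) G i.
  rewrite (big_fsetID _ (mem A0) A) /=.
  have -> : [fset x in A | x \in A0]%fset = A0.
    apply/fsetP => x; rewrite !inE /=; apply/andP/idP => [[]//|xA].
    by split=> //; exact: (fsubsetP AA).
  by rewrite lerDl sumr_ge0.
rewrite ltr_norml; apply/andP; split; lra.
Qed.

Lemma cabs_lt (x : C) (e : R) :
  `|complex.Re x| < e / 2 -> `|complex.Im x| < e / 2 -> `|x| < e%:C%C.
Proof.
move=> h1 h2; have -> : x = (complex.Re x)%:C%C + 'i%C * (complex.Im x)%:C%C.
  exact: complexE.
apply: (le_lt_trans (ler_normD _ _)); rewrite normrM.
have -> : `|'i%C : C| = 1 by rewrite normc_def /= expr0n /= add0r expr1n sqrtr1.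
rewrite mul1r !normc_def /= !expr0n !addr0 !sqrtr_sqr (splitr e).
by rewrite rmorphD /= ltrD // ltcR.
Qed.

Lemma has_sumB_real (I : choiceType) (G : I -> R) (M : R) :
  (forall A : {fset I}, \sum_(i <- A) `|G i| <= M) ->
  exists s : R, forall e, 0 < e -> exists A0 : {fset I}, forall A : {fset I},
    (A0 `<=` A)%fset -> `|\sum_(i <- A) G i - s| < e.
Proof.
move=> hM.
have [||s1 h1] := @has_sum_nneg_real I (fun i => `|G i|) M => //.
have [||s2 h2] := @has_sum_nneg_real I (fun i => `|G i| - G i) (M + M).
- by move=> i; rewrite subr_ge0 ler_norm.
- move=> A; apply: (@le_trans _ _ (\sum_(i <- A) (`|G i| + `|G i|))).
    by apply: ler_sum => i _; rewrite lerD2l -normrN ler_norm.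
  by rewrite big_split lerD.
exists (s1 - s2) => e e0.
have e2 : 0 < e / 2 by rewrite divr_gt0.
have [A1 k1] := h1 _ e2; have [A2 k2] := h2 _ e2.
exists (A1 `|` A2)%fset => A; rewrite fsubUset => /andP[/k1 a1 /k2 a2].
have -> : \sum_(i <- A) G i - (s1 - s2) =
  (\sum_(i <- A) `|G i| - s1) - (\sum_(i <- A) (`|G i| - G i) - s2).
  by rewrite sumrB; ring.
by apply: (le_lt_trans (ler_normB _ _)); rewrite (splitr e) ltrD.
Qed.

Lemma abs_bounded_has_sum (I : choiceType) (F : I -> C) :
  abs_bounded F -> exists s, has_sum F s.
Proof.
move=> [M hM].
have hb (g : C -> R) : (forall x, `|g x|%:C%C <= `|x|) ->
    forall A : {fset I}, \sum_(i <- A) `|g (F i)| <= complex.Re M.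
  move=> hg A; have : \sum_(i <- A) (`|g (F i)|%:C%C : C) <= M.
    by apply: le_trans (hM A); apply: ler_sum => i _; exact: hg.
  rewrite -(raddf_sum (real_complex R)) /=.
  by rewrite lecE /= => /andP[].
have [s1 h1] := has_sumB_real (hb (@complex.Re R) (@normc_ge_Re R)).
have hIm (x : C) : `|complex.Im x|%:C%C <= `|x|.
  rewrite normc_def lecR -sqrtr_sqr ler_wsqrtr // lerDr sqr_ge0 //.
have [s2 h2] := has_sumB_real (hb (@complex.Im R) hIm).
exists (s1 +i* s2)%C => e e0.
have [er e0'] : e = (complex.Re e)%:C%C /\ 0 < complex.Re e.
  move: e0; rewrite ltcE /= => /andP[/eqP ei er]; split=> //.
  by case: (e) ei => a b /= ->.
have e2 : 0 < complex.Re e / 2 by rewrite divr_gt0.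
have [A1 k1] := h1 _ e2; have [A2 k2] := h2 _ e2.
exists (A1 `|` A2)%fset => A; rewrite fsubUset => /andP[/k1 a1 /k2 a2].
rewrite er; apply: cabs_lt.
  by rewrite raddfB /= raddf_sum.
by rewrite raddfB /= raddf_sum.
Qed.
End Sums.

Section SumRules.
Variable R : realType.
Local Notation C := (Cx R).

Lemma has_sum_uniq (I : choiceType) (F : I -> C) s t :
  has_sum F s -> has_sum F t -> s = t.
Proof.
move=> hs ht; apply/eqP; rewrite -subr_eq0 -normr_eq0; apply/eqP.
apply/eqP; apply: contraT => nz.
have e0 : 0 < `|s - t| / 2 by rewrite divr_gt0 // lt_def nz normr_ge0.
have [A h1] := hs _ e0; have [B h2] := ht _ e0.
have := h1 _ (fsubsetUl A B); have := h2 _ (fsubsetUr A B).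
set x := \sum_(i <- _) _ => k1 k2; suff : `|s - t| < `|s - t| by rewrite ltxx.
have -> : s - t = (x - t) - (x - s) by ring.
apply: (le_lt_trans (ler_normB _ _)).
have -> : x - t - (x - s) = s - t by ring.
by rewrite [X in _ < X]splitr ltrD.
Qed.

Lemma abs_cvg_to_uniq (I : choiceType) (F : I -> C) s t :
  abs_cvg_to F s -> abs_cvg_to F t -> s = t.
Proof. by move=> /abs_cvg_toE[_ hs] /abs_cvg_toE[_ ht]; exact: has_sum_uniq hs ht. Qed.

Lemma abs_bounded_cvg (I : choiceType) (F : I -> C) :
  abs_bounded F -> exists s, abs_cvg_to F s.
Proof.
move=> bF; have [s hs] := abs_bounded_has_sum bF.
by exists s; apply/abs_cvg_toE.
Qed.

Lemma abs_cvg_to_bounded (I : choiceType) (F : I -> C) s :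
  abs_cvg_to F s -> abs_bounded F.
Proof. by move=> /abs_cvg_toE[]. Qed.

Lemma abs_cvg_to_ext (I : choiceType) (F G : I -> C) s :
  F =1 G -> abs_cvg_to F s -> abs_cvg_to G s.
Proof. by move=> /funext ->. Qed.

Lemma abs_cvg_toZ (I : choiceType) (F : I -> C) s a :
  abs_cvg_to F s -> abs_cvg_to (fun i => a * F i) (a * s).
Proof.
move=> Fs; rewrite -[a * s]addr0.
apply: abs_cvg_to_ext (abs_cvg_to_lin a Fs (abs_cvg_to0 R I)) => i /=.
by rewrite addr0.
Qed.

Lemma abs_cvg_toD (I : choiceType) (F G : I -> C) s t :
  abs_cvg_to F s -> abs_cvg_to G t -> abs_cvg_to (fun i => F i + G i) (s + t).
Proof.
move=> Fs Gt; rewrite -[s]mul1r.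
by apply: abs_cvg_to_ext (abs_cvg_to_lin 1 Fs Gt) => i /=; rewrite mul1r.
Qed.

Lemma abs_cvg_toB (I : choiceType) (F G : I -> C) s t :
  abs_cvg_to F s -> abs_cvg_to G t -> abs_cvg_to (fun i => F i - G i) (s - t).
Proof.
move=> Fs Gt; rewrite addrC -mulN1r.
by apply: abs_cvg_to_ext (abs_cvg_to_lin (-1) Gt Fs) => i /=; rewrite mulN1r addrC.
Qed.

Lemma abs_cvg_to_sum (J : Type) (r : seq J) (I : choiceType) (F : J -> I -> C) s :
  (forall j, abs_cvg_to (F j) (s j)) ->
  abs_cvg_to (fun i => \sum_(j <- r) F j i) (\sum_(j <- r) s j).
Proof.
move=> h; elim: r => [|j r IH].
  rewrite big_nil; apply: abs_cvg_to_ext (abs_cvg_to0 R I) => i.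
  by rewrite big_nil.
rewrite big_cons; apply: abs_cvg_to_ext (abs_cvg_toD (h j) IH) => i.
by rewrite big_cons.
Qed.

Lemma abs_bounded_le (I : choiceType) (F G : I -> C) :
  (forall i, `|F i| <= `|G i|) -> abs_bounded G -> abs_bounded F.
Proof.
move=> FG [M hM]; exists M => A; apply: le_trans (hM A).
by apply: ler_sum => i _.
Qed.

Lemma abs_bounded_sum (J : Type) (r : seq J) (I : choiceType) (F : J -> I -> C) :
  (forall j, abs_bounded (F j)) -> abs_bounded (fun i => \sum_(j <- r) F j i).
Proof.
move=> h.
have {}h j : exists s, abs_cvg_to (F j) s by exact: abs_bounded_cvg.
exact: abs_cvg_to_bounded (abs_cvg_to_sum r (fun j => xgetPex 0 (h j))).
Qed.

Lemma has_sum_le (I : choiceType) (F : I -> C) s (M : C) (A0 : {fset I}) :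
  (forall A : {fset I}, (A0 `<=` A)%fset -> `|\sum_(i <- A) F i| <= M) ->
  has_sum F s -> `|s| <= M.
Proof.
move=> hM hs.
have M0 : M \is Num.real by apply: ger0_real; exact: le_trans (hM A0 (fsubset_refl _)).
rewrite real_leNgt ?normr_real //; apply/negP => lt.
have e0 : 0 < `|s| - M by rewrite subr_gt0.
have [A h1] := hs _ e0; have := h1 _ (fsubsetUr A0 A).
have := hM _ (fsubsetUl A0 A).
set x := \sum_(i <- _) _ => k1 k2.
suff : `|s| < `|s| by rewrite ltxx.
have {1}-> : s = x - (x - s) by ring.
apply: (le_lt_trans (ler_normB _ _)).
have -> : `|s| = M + (`|s| - M) by ring.
exact: ler_ltD.
Qed.

Lemma big_imfset_inj (I J : choiceType) (h : J -> I) (F : I -> C) (B : {fset J}) :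
  injective h -> \sum_(i <- [fset h j | j in B]%fset) F i = \sum_(j <- B) F (h j).
Proof. by move=> ih; rewrite big_imfset //; exact: in2W. Qed.

Lemma big_preimage (I J : choiceType) (h : J -> I) (F : I -> C) (A : {fset I}) :
  injective h -> (forall i, (forall j, i <> h j) -> F i = 0) ->
  exists B : {fset J}, (forall j, (j \in B) = (h j \in A)) /\
    \sum_(i <- A) F i = \sum_(j <- B) F (h j).
Proof.
move=> ih F0.
have fA : finite_set (h @^-1` [set` A]).
  by apply: finite_preimage (finite_fset A) => x y _ _; exact: ih.
pose B := fset_set (h @^-1` [set` A]).
have mB j : (j \in B) = (h j \in A).
  by rewrite in_fset_set //; apply/idP/idP; rewrite inE.
exists B; split=> //.
rewrite -(big_imfset_inj F B ih); apply/esym/big_fset_incl.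
  by apply/fsubsetP => i /imfsetP[j /= jB ->]; rewrite -mB.
move=> i iA nB; apply: F0 => j ij; case/negP: nB; apply/imfsetP.
by exists j => //=; rewrite mB -ij.
Qed.

Lemma abs_cvg_to_reindex (I J : choiceType) (h : J -> I) (F : I -> C) s :
  injective h -> (forall i, (forall j, i <> h j) -> F i = 0) ->
  abs_cvg_to (fun j => F (h j)) s <-> abs_cvg_to F s.
Proof.
move=> ih F0.
have F0' i : (forall j, i <> h j) -> `|F i| = 0 by move/F0 ->; rewrite normr0.
have fwd t : abs_cvg_to (fun j => F (h j)) t -> abs_cvg_to F t.
  move=> /abs_cvg_toE[[M hM] ht]; apply/abs_cvg_toE; split.
    by exists M => A; have [B [_ ->]] := big_preimage A ih F0'; exact: hM.
  move=> e e0; have [A0 hA0] := ht e e0; exists [fset h j | j in A0]%fset => A AA.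
  have [B [mB ->]] := big_preimage A ih F0; apply: hA0.
  apply/fsubsetP => j jA; rewrite mB (fsubsetP AA) //.
  by apply/imfsetP; exists j.
split=> [|Fs]; first exact: fwd.
have : abs_bounded (fun j => F (h j)).
  have [M hM] := abs_cvg_to_bounded Fs; exists M => B.
  apply: le_trans (hM [fset h j | j in B]%fset).
  by rewrite (big_imfset_inj (fun i => `|F i|) B ih).
move=> /abs_bounded_cvg[t ht].
by rewrite (abs_cvg_to_uniq Fs (fwd _ ht)).
Qed.

Lemma abs_bounded_inj (I J : choiceType) (h : J -> I) (F : I -> C) :
  injective h -> abs_bounded F -> abs_bounded (fun j => F (h j)).
Proof.
move=> ih [M hM]; exists M => B; apply: le_trans (hM [fset h j | j in B]%fset).
by rewrite (big_imfset_inj (fun i => `|F i|) B ih).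
Qed.

Lemma abs_cvg_to_finite (I : choiceType) (F : I -> C) (A : {fset I}) :
  (forall i, i \notin A -> F i = 0) -> abs_cvg_to F (\sum_(i <- A) F i).
Proof.
move=> F0; apply/abs_cvg_toE; split.
  exists (\sum_(i <- A) `|F i|) => B.
  apply: le_trans (fsum_le _ (fsubsetUr A B)) _ => //.
  rewrite -(big_fset_incl _ (fsubsetUl A B)) // => i _ /F0 ->.
  by rewrite normr0.
move=> e e0; exists A => B AB.
by rewrite -(big_fset_incl _ AB) ?subrr ?normr0 // => i _ /F0.
Qed.

Lemma big_fsetX (V : nmodType) (I J : choiceType) (F : I * J -> V) (A : {fset I}) (B : {fset J}) :
  \sum_(p <- (A `*` B)%fset) F p = \sum_(i <- A) \sum_(j <- B) F (i, j).
Proof.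
rewrite -big_allpairs; apply: perm_big; apply: uniq_perm => //.
  by apply: allpairs_uniq => // -[? ?] [? ?].
move=> [i j]; rewrite in_fsetM /=; apply/andP/allpairsP => [[iA jB]|[[a b] [/= aA bB [-> ->]]]].
  by exists (i, j).
by [].
Qed.

Lemma abs_cvg_to_fubini (I J : choiceType) (F : I * J -> C) (a : I -> C) s :
  abs_cvg_to F s -> (forall i, abs_cvg_to (fun j => F (i, j)) (a i)) ->
  abs_cvg_to a s.
Proof.
move=> /abs_cvg_toE[[M hM] hs] ha.
have approx (A : {fset I}) (B0 : {fset J}) e : 0 < e ->
    exists B : {fset J}, (B0 `<=` B)%fset /\
      \sum_(i <- A) `|\sum_(j <- B) F (i, j) - a i| < e.
  move=> e0; pose d := e / (#|` A|.+1)%:R.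
  have d0 : 0 < d by rewrite divr_gt0 // ltr0Sn.
  have h i := (abs_cvg_toE _ _).1 (ha i).
  have {}h i : exists B : {fset J}, forall B' : {fset J}, (B `<=` B')%fset ->
      `|\sum_(j <- B') F (i, j) - a i| < d by exact: (h i).2 _ d0.
  have [Bf hB] := choice h.
  pose B := (B0 `|` \bigcup_(i <- A) Bf i)%fset.
  exists B; split; first exact: fsubsetUl.
  apply: (@le_lt_trans _ _ (\sum_(i <- A) d)).
    rewrite big_seq [leRHS]big_seq; apply: ler_sum => i iA.
    apply/ltW/hB; apply: fsubset_trans (fsubsetUr _ _).
    exact: (bigfcup_sup (P := xpredT) Bf iA).
  rewrite big_const_seq count_predT iter_addr_0 -mulr_natr /d mulrAC.
  rewrite ltr_pdivrMr ?ltr0Sn // ltr_pM2l // ltr_nat.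
  by rewrite ltnS.
apply/abs_cvg_toE; split.
  exists (M + 1) => A; have [B [_ hB]] := approx A fset0 1 ltr01.
  apply: (@le_trans _ _ (\sum_(i <- A) (\sum_(j <- B) `|F (i, j)| +
           `|\sum_(j <- B) F (i, j) - a i|))).
    apply: ler_sum => i _.
    have {1}-> : a i = \sum_(j <- B) F (i, j) - (\sum_(j <- B) F (i, j) - a i) by ring.
    by apply: (le_trans (ler_normB _ _)); rewrite lerD2r ler_norm_sum.
  rewrite big_split /= lerD //; last exact: ltW.
  by rewrite -(big_fsetX (fun p => `|F p|)).
move=> e e0; have e2 : 0 < e / 2 by rewrite divr_gt0.
have [A0 hA0] := hs _ e2.
exists [fset p.1 | p in A0]%fset => A AA.
have [B [BB hB]] := approx A [fset p.2 | p in A0]%fset _ e2.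
have sub : (A0 `<=` A `*` B)%fset.
  apply/fsubsetP => p pA; rewrite in_fsetM (fsubsetP AA) ?(fsubsetP BB) //.
    by apply/imfsetP; exists p.
  by apply/imfsetP; exists p.
have := hA0 _ sub; rewrite big_fsetX => h.
have -> : \sum_(i <- A) a i - s = (\sum_(i <- A) \sum_(j <- B) F (i, j) - s)
   - \sum_(i <- A) (\sum_(j <- B) F (i, j) - a i) by rewrite sumrB; ring.
apply: (le_lt_trans (ler_normB _ _)); rewrite (splitr e) ltrD //.
exact: le_lt_trans (ler_norm_sum _ _ _) hB.
Qed.

End SumRules.

Section Division.
Variable R : realType.
Local Notation C := (Cx R).

Lemma geom_bound (x y : C) n : 0 <= y -> y < x ->
  \sum_(m < n) y ^+ m / x ^+ m.+1 <= (x - y)^-1.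
Proof.
move=> y0 yx; have x0 : 0 < x by exact: le_lt_trans yx.
have xy : 0 < x - y by rewrite subr_gt0.
suff -> : \sum_(m < n) y ^+ m / x ^+ m.+1 = (1 - (y / x) ^+ n) / (x - y).
  rewrite ler_pdivrMr // mulVf ?gt_eqF // gerBl exprn_ge0 //.
  by rewrite divr_ge0 // ltW.
have xn0 : x != 0 by rewrite gt_eqF.
have xyn0 : x - y != 0 by rewrite gt_eqF.
elim: n => [|n IH]; first by rewrite big_ord0 expr0 subrr mul0r.
rewrite big_ord_recr /= IH !expr_div_n !exprS.
by field; rewrite xyn0 xn0 expf_neq0.
Qed.

Lemma division_bounded (I : zmodType) (c b mon : I -> C) (p q : I) (x y : C) :
  (forall k, c (k + p) - c (k + q) = b k) ->
  (forall k, exists m0, forall m, (m0 <= m)%N -> c (k + (q - p) *+ m) = 0) ->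
  `|y| < `|x| ->
  (forall k m, b (k - p + (q - p) *+ m) != 0 ->
     mon k = mon (k - p + (q - p) *+ m) * (y ^+ m / x ^+ m.+1)) ->
  abs_bounded (fun k => b k * mon k) -> abs_bounded (fun k => c k * mon k).
Proof.
move=> hb T yx hm [M hM].
have unfold_c k n : c k = \sum_(m < n) b (k - p + (q - p) *+ m) + c (k + (q - p) *+ n).
  elim: n => [|n IH]; first by rewrite big_ord0 add0r mulr0n addr0.
  rewrite big_ord_recr /= IH -addrA; congr (_ + _).
  set X := (q - p) *+ n.
  have e1 : k - p + X + p = k + X by rewrite addrAC subrK.
  have e2 : k - p + X + q = k + (q - p) *+ n.+1.
    by rewrite mulrSr -/X addrAC [X + _]addrC addrA [q - p]addrC addrA.
  by rewrite -hb e1 e2 subrK.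
have [m0 hm0] := choice T.
have M0 : 0 <= M by have := hM fset0; rewrite big_nil.
exists (M * (`|x| - `|y|)^-1) => A.
pose n := \max_(k <- A) m0 k.
have cE k : k \in A -> c k = \sum_(m < n) b (k - p + (q - p) *+ m).
  move=> kA; rewrite (unfold_c k n) hm0 ?addr0 //.
  by rewrite /n (big_rem k) //= leq_maxl.
apply: (@le_trans _ _ (\sum_(k <- A) \sum_(m < n)
   `|b (k - p + (q - p) *+ m) * mon (k - p + (q - p) *+ m)|
     * (`|y| ^+ m / `|x| ^+ m.+1))).
  rewrite big_seq [leRHS]big_seq; apply: ler_sum => k kA.
  rewrite cE // mulr_suml; apply: le_trans (ler_norm_sum _ _ _) _.
  apply: ler_sum => m _; have [->|/hm ->] := eqVneq (b (k - p + (q - p) *+ m)) 0.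
    by rewrite !mul0r normr0 mul0r.
  by rewrite !normrM normfV !normrX !mulrA.
rewrite exchange_big /=.
apply: (@le_trans _ _ (\sum_(m < n) M * (`|y| ^+ m / `|x| ^+ m.+1))); last first.
  by rewrite -mulr_sumr ler_wpM2l // geom_bound.
apply: ler_sum => m _; rewrite -mulr_suml; apply: ler_wpM2r; first by rewrite divr_ge0 // exprn_ge0.
pose h k := k - p + (q - p) *+ m.
have ih : injective h by move=> k l /addIr /addIr.
by rewrite -(big_imfset_inj (fun k => `|b k * mon k|) A ih).
Qed.
End Division.

Section OneVariable.
Variable R : realType.
Local Notation C := (Cx R).
Implicit Types (a b : int -> C) (t s : C) (q : {poly C}).

Definition lsum a t s : Prop := abs_cvg_to (fun k => a k * t ^ (- k - 1)) s.

Lemma lsum_ext a b t s : a =1 b -> lsum a t s -> lsum b t s.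
Proof. by move=> /funext ->. Qed.

Lemma lsum_shift a t s (n : int) : t != 0 -> lsum a t s ->
  lsum (fun k => a (k + n)) t (t ^ n * s).
Proof.
move=> t0 h; apply: (abs_cvg_to_ext
  (F := fun k => t ^ n * (a (k + n) * t ^ (- (k + n) - 1)))).
  move=> k; rewrite mulrCA -expfzDr //; congr (_ * _ ^ _); lia.
apply: abs_cvg_toZ.
have ih : injective (fun k : int => k + n) by exact: addIr.
apply/(abs_cvg_to_reindex (F := fun k => a k * t ^ (- k - 1)) s ih) => // i hi.
by case: (hi (i - n)); rewrite subrK.
Qed.

Lemma lsum_lin a b t s1 s2 c : lsum a t s1 -> lsum b t s2 ->
  lsum (fun k => c * a k + b k) t (c * s1 + s2).
Proof.
move=> h1 h2; apply: abs_cvg_to_ext (abs_cvg_to_lin c h1 h2) => k.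
by rewrite mulrDl mulrA.
Qed.

(* multiplication by t - c *)
Definition mulXB (c : C) a : int -> C := fun k => a (k + 1) - c * a k.

Lemma lsum_mulXB a t s c n : t != 0 -> lsum a t s ->
  lsum (iter n (mulXB c) a) t ((t - c) ^+ n * s).
Proof.
move=> t0 h; elim: n => [|n IH]; first by rewrite expr0 mul1r.
rewrite iterS exprS -mulrA mulrBl addrC -mulNr.
have := lsum_lin (- c) IH (lsum_shift 1 t0 IH); rewrite expr1z.
by apply: lsum_ext => k; rewrite /mulXB mulNr [- _ + _]addrC.
Qed.

Definition poly_coef q (k : int) : C := if k is Negz i then q`_i else 0.

Lemma lsum_poly q t : lsum (poly_coef q) t q.[t].
Proof.
have ih : injective Negz by move=> i j [].
apply/(abs_cvg_to_reindex (F := fun k => poly_coef q k * t ^ (- k - 1)) _ ih).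
  by case=> [n|n] h /=; [rewrite mul0r|case: (h n)].
have -> : q.[t] = \sum_(i <- [fset i | i in iota 0 (size q)]%fset) q`_i * t ^+ i.
  rewrite horner_coef -(big_mkord xpredT (fun i => q`_i * t ^+ i)).
  by apply: perm_big; apply: uniq_perm; rewrite ?iota_uniq ?fset_uniq // => x;
     rewrite in_fset /= /index_iota subn0.
have E (j : nat) : poly_coef q (Negz j) * t ^ (- Negz j - 1) = q`_j * t ^+ j.
  by rewrite /= NegzE opprK -addn1 PoszD addrK.
apply: (abs_cvg_to_ext (F := fun j : nat => q`_j * t ^+ j)) => [j|].
  by rewrite -E.
apply: (@abs_cvg_to_finite _ _ (fun j => q`_j * t ^+ j)) => i.
rewrite in_fset /= mem_iota add0n -leqNgt => sq.
by rewrite nth_default ?mul0r.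
Qed.

Lemma lt_exists_succ (j k : int) : j < k -> exists m : nat, k - j = m.+1%:Z.
Proof. by move=> jk; exists (absz (k - j - 1)%R); lia. Qed.

Lemma lsum_uniq0 a (K : int) : (forall k : int, K <= k -> a k = 0) ->
  (forall t, 0 < `|t| < 1 -> lsum a t 0) -> forall k, a k = 0.
Proof.
move=> aK h.
suff H n : forall k : int, K - n%:Z <= k -> a k = 0 by move=> k; apply: (H `|K - k|%N); lia.
elim: n => [|n IH] k; first by rewrite subr0; exact: aK.
rewrite le_eqVlt => /predU1P[kE|lt]; last by apply: IH; lia.
have {}IH (j : int) : k < j -> a j = 0 by move=> kj; apply: IH; lia.
clear kE; apply/eqP; apply: contraT => nz.
have hp1 : 0 < (2^-1 : C) by rewrite invr_gt0 ltr0n.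
have hp2 : (2^-1 : C) < 1 by rewrite invf_lt1 ?ltr0n // ltr1n.
have two : 0 < (2^-1 : C) < 1 by rewrite hp1 hp2.
have two0 : (2^-1 : C) != 0 by rewrite invr_eq0 pnatr_eq0.
pose G t (j : int) : C := if j < k then a j * t ^ (k - j) else 0.
have sG t : 0 < `|t| < 1 -> abs_cvg_to (G t) (- a k).
  move=> t1; have t0 : t != 0 by rewrite -normr_gt0; case/andP: t1.
  have := abs_cvg_toZ (t ^ (k + 1)) (h t t1); rewrite mulr0 => h1.
  have h2 : abs_cvg_to (fun j => if j == k then a k else 0) (a k).
    have := @abs_cvg_to_finite _ _ (fun j => if j == k then a k else 0) [fset k]%fset.
    rewrite big_seq_fset1 eqxx; apply => j; rewrite in_fset1.
    by move/negPf => ->.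
  have := abs_cvg_toB h1 h2; rewrite sub0r; apply: abs_cvg_to_ext => j.
  rewrite /G; case: (ltgtP j k) => [jk|kj|->].
  - rewrite subr0 mulrCA -expfzDr //; congr (_ * _ ^ _); lia.
  - by rewrite IH // mul0r mulr0 subr0.
  by rewrite mulrCA -expfzDr // (_ : k + 1 + _ = 0) ?expr0z ?mulr1 ?subrr //; lia.
have n2 : `|2^-1 : C| = 2^-1 by rewrite ger0_norm // ltW //; case/andP: two.
have := sG 2^-1; rewrite n2 => /(_ two) /abs_cvg_to_bounded[M hM].
have M0 : 0 <= M by have := hM fset0; rewrite big_nil.
have bnd s : 0 < s < 1 -> `|a k| <= s * M.
  move=> /andP[s0 s1].
  have st : 0 < `|s * 2^-1| < 1.
    by rewrite normrM n2 (gtr0_norm s0) mulr_gt0 //= mulr_ilt1 // ltW.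
  have /abs_cvg_toE[_ hs] := sG _ st.
  rewrite -normrN; apply: has_sum_le fset0 _ hs => A _.
  apply: (le_trans (ler_norm_sum _ _ _)).
  apply: (@le_trans _ _ (\sum_(j <- A) s * `|G 2^-1 j|)); last first.
    by rewrite -mulr_sumr ler_wpM2l ?hM // ltW.
  apply: ler_sum => j _.
  rewrite /G.
  case jk : (j < k).
  2: {
    by rewrite normr0 mulr0. }
  have [m km] := lt_exists_succ jk.
  rewrite km -!exprnP exprMn mulrCA normrM; apply: ler_wpM2r => //.
  rewrite normrX (gtr0_norm s0) exprS ger_pMr //.
  by rewrite exprn_ile1 // ltW.
have ak : 0 < `|a k| by rewrite normr_gt0.
have Ma : 0 < M + `|a k| by rewrite ltr_wpDl.
pose s := `|a k| / (2 * (M + `|a k|)).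
have s0 : 0 < s by rewrite divr_gt0 // mulr_gt0 // ltr0n.
have s1 : s < 1.
  rewrite /s ltr_pdivrMr ?mulr_gt0 ?ltr0n // mul1r mulr_natl mulr2n.
  by apply: (@le_lt_trans _ _ (M + `|a k|)); rewrite ?lerDr ?ltrDl.
have := bnd s; rewrite s0 s1 => /(_ isT).
rewrite /s mulrAC ler_pdivlMr ?mulr_gt0 ?ltr0n // ler_pM2l // => H.
have : 2 * (M + `|a k|) <= M + `|a k| by rewrite (le_trans H) // lerDl ltW.
by rewrite mulr_natl mulr2n gerDl => /(lt_le_trans Ma); rewrite ltxx.
Qed.

Lemma lsum_eq0 a b (K : int) (f : C -> C) :
  (forall k : int, K <= k -> a k = 0) -> (forall k : int, K <= k -> b k = 0) ->
  (forall t, 0 < `|t| < 1 -> lsum a t (f t)) ->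
  (forall t, 0 < `|t| < 1 -> lsum b t (f t)) -> a =1 b.
Proof.
move=> aK bK ha hb k; apply/eqP; rewrite -subr_eq0; apply/eqP.
apply: (@lsum_uniq0 (fun k => a k - b k) K) => [j Kj|t t1].
  by rewrite aK // bK // subrr.
rewrite -(subrr (f t)).
apply: abs_cvg_to_ext (abs_cvg_toB (ha t t1) (hb t t1)) => j.
by rewrite mulrBl.
Qed.

Lemma lsum_eq_oo a b (K : int) (f : C -> C) :
  (forall k : int, k < K -> a k = 0) -> (forall k : int, k < K -> b k = 0) ->
  (forall t, 1 < `|t| -> lsum a t (f t)) ->
  (forall t, 1 < `|t| -> lsum b t (f t)) -> a =1 b.
Proof.
move=> aK bK ha hb k.
have ih : injective (fun k : int => - k - 2) by move=> x y; lia.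
have refl c t s : t != 0 -> lsum c t^-1 s -> lsum (fun k => c (- k - 2)) t s.
  move=> t0 h; apply: (abs_cvg_to_ext
    (F := fun k => c (- k - 2) * t^-1 ^ (- (- k - 2) - 1))).
    move=> j; congr (_ * _); rewrite exprz_inv; congr (_ ^ _); lia.
  apply/(abs_cvg_to_reindex (F := fun k => c k * t^-1 ^ (- k - 1)) s ih) => // i hi.
  by case: (hi (- i - 2)); lia.
have inv t : 0 < `|t| < 1 -> t != 0 /\ 1 < `|t^-1|.
  move=> /andP[t0 t1]; split; first by rewrite -normr_gt0.
  by rewrite normfV invf_gt1.
have := @lsum_eq0 (fun k => a (- k - 2)) (fun k => b (- k - 2)) (- K - 1) (fun t => f t^-1).
move=> /(_ _ _ _ _ (- k - 2)); rewrite (_ : - (- k - 2) - 2 = k); last lia.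
apply.
- by move=> j Kj; apply: aK; lia.
- by move=> j Kj; apply: bK; lia.
- by move=> t /inv[t0 t1]; apply: refl => //; exact: ha.
by move=> t /inv[t0 t1]; apply: refl => //; exact: hb.
Qed.

Lemma poly_coef_ge0 q (k : int) : 0 <= k -> poly_coef q k = 0.
Proof. by case: k. Qed.

Lemma poly_coef_lt q (k : int) : k < - (size q)%:Z -> poly_coef q k = 0.
Proof. by case: k => // n; rewrite NegzE /= => h; rewrite nth_default //; lia. Qed.

(* A pole of order at most N at 0 is of order at most K if the Laurent
   expansion at 0 starts at t^(-K). *)
Lemma reduce_pole q (N M K : nat) (c : C) d : `|c| = 1 ->
  (forall k : int, K%:Z <= k -> d k = 0) ->
  (forall t, 0 < `|t| < 1 -> lsum d t (q.[t] / (t ^+ N * (t + c) ^+ M))) ->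
  exists q2, forall t, t != 0 -> t + c != 0 ->
    q.[t] / (t ^+ N * (t + c) ^+ M) = q2.[t] / (t ^+ K * (t + c) ^+ M).
Proof.
move=> c1 dK hd.
have tc0 t : `|t| < 1 -> t + c != 0.
  move=> t1; apply/eqP => /eqP; rewrite addr_eq0 => /eqP E.
  by move: t1; rewrite E normrN c1 ltxx.
pose d1 k := d (k + N%:Z); pose d2 := iter M (mulXB (- c)) d1.
have d2K (k : int) : K%:Z - N%:Z <= k -> d2 k = 0.
  rewrite /d2; elim: (M) k => [|m IH] k hk /=; first by apply: dK; lia.
  by rewrite /mulXB !IH ?mulr0 ?subr0 //; lia.
have E : d2 =1 poly_coef q.
  apply: (@lsum_eq0 _ _ (maxn K 0)%:Z (horner q)).
  - by move=> k hk; apply: d2K; lia.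
  - by move=> k hk; apply: poly_coef_ge0; lia.
  - move=> t /andP[t0 t1]; have t0' : t != 0 by rewrite -normr_gt0.
    have := hd t; rewrite t0 t1 => /(_ isT) /(lsum_shift N%:Z t0').
    move=> /(lsum_mulXB (- c) M t0').
    rewrite opprK -exprnP; set X := (X in lsum _ _ X); suff -> : X = q.[t] by [].
    have tc := tc0 t t1.
    by rewrite /X; field; rewrite !expf_neq0.
  by move=> t _; exact: lsum_poly.
have qlow i : (i < N - K)%N -> q`_i = 0.
  move=> iN; have := E (Negz i) => /= <-; apply: d2K; rewrite NegzE; lia.
pose n := (N - K)%N.
have q0 : q = drop_poly n q * 'X^n.
  rewrite -{1}[q](poly_take_drop n) (_ : take_poly n q = 0) ?add0r //.
  by apply/polyP => i; rewrite coef_take_poly coef0; case: ifP => // /qlow.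
exists (drop_poly n q * 'X^(K - N)) => t t0 tc.
rewrite {1}q0 !hornerM !hornerXn.
apply/eqP; rewrite eqr_div ?mulf_neq0 ?expf_neq0 //; apply/eqP.
have e : t ^+ n * t ^+ K = t ^+ (K - N) * t ^+ N.
  by rewrite -!exprD /n; congr (_ ^+ _); lia.
by rewrite !mulrA -!mulrA [t ^+ n * (_ * _)]mulrA e; ring.
Qed.

End OneVariable.

Section Binomials.
Variable R : realType.
Local Notation C := (Cx R).
Implicit Types (a b : int -> C) (t : C).

Definition gbin (j : int) (s : nat) : C :=
  (\prod_(i < s) (j%:~R - i%:R)) / s`!%:R.

Lemma fact_neq0 (s : nat) : s`!%:R != 0 :> C.
Proof. by rewrite pnatr_eq0 -lt0n fact_gt0. Qed.

Lemma gbin0 j : gbin j 0 = 1.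
Proof. by rewrite /gbin big_ord0 fact0 divr1. Qed.

Lemma gbin_0 s : gbin 0 s.+1 = 0.
Proof. by rewrite /gbin big_ord_recl subrr !mul0r. Qed.

Lemma gbinS j s : (s.+1)%:R * gbin j s.+1 = gbin j s * (j%:~R - s%:R).
Proof.
rewrite /gbin big_ord_recr /= factS natrM.
have h1 := fact_neq0 s; have h2 : s.+1%:R != 0 :> C by rewrite pnatr_eq0.
by field; rewrite nat1r h1 h2.
Qed.

Lemma gbin_pascal j s : gbin (j + 1) s.+1 = gbin j s.+1 + gbin j s.
Proof.
have E : \prod_(i < s.+1) ((j + 1)%:~R - i%:R) =
   (j%:~R + 1) * \prod_(i < s) (j%:~R - i%:R) :> C.
  rewrite big_ord_recl subr0 intrD; congr (_ * _); apply: eq_bigr => i _.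
  by rewrite lift0 -natr1; ring.
have n1 : s.+1%:R != 0 :> C by rewrite pnatr_eq0.
apply: (mulfI n1); rewrite mulrDr [X in _ = X + _]gbinS /gbin E factS natrM.
have h := fact_neq0 s; rewrite -!natr1.
by field; rewrite ?natr1 ?nat1r h n1.
Qed.

(* the coefficient of (t - 1)^(-j-1) in the re-expansion of a series in 1/t *)
Definition reexp (S : nat) (j : int) a : C :=
  \sum_(s < S) (-1) ^+ s * gbin j s * a (j - s%:Z).

Lemma reexp_stable S S' j a (K : int) : (forall k : int, k < K -> a k = 0) ->
  j - S%:Z < K -> (S <= S')%N -> reexp S' j a = reexp S j a.
Proof.
move=> aK jS SS; rewrite /reexp -(subnKC SS) big_split_ord /= [X in _ + X]big1 ?addr0 //.
by move=> i _; rewrite aK ?mulr0 //; lia.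
Qed.

Lemma reexp_succ S j a (K : int) : (forall k : int, k < K -> a k = 0) ->
  j + 1 - S%:Z < K -> (0 < S)%N -> reexp S (j + 1) a = reexp S j (mulXB 1 a).
Proof.
case: S => // S aK jS _; rewrite /reexp big_ord_recl /= gbin0 subr0.
rewrite [RHS](eq_bigr (fun s : 'I_S.+1 => (-1) ^+ s * gbin j s * a (j + 1 - s%:Z)
   - (-1) ^+ s * gbin j s * a (j - s%:Z))); last first.
  by move=> s _; rewrite /mulXB mul1r -mulrBr addrAC.
rewrite sumrB [X in _ = X - _]big_ord_recl /= gbin0 subr0.
rewrite [X in _ = _ - X]big_ord_recr /= [X in _ = _ - (_ + X)](_ : _ = 0) ?addr0; last first.
  by rewrite aK ?mulr0 //; lia.
rewrite -addrA -sumrB; congr (_ + _); apply: eq_bigr => s _.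
rewrite /bump /= add1n gbin_pascal exprS.
have -> : j + 1 - s.+1%:Z = j - s%:Z by lia.
ring.
Qed.

(* the expansion of (t - 1)^(-m-1) at infinity *)
Definition expand_oo (m k : int) : C :=
  match m with
  | Posz m => if k is Posz k then 'C(k, m)%:R else 0
  | Negz p => poly_coef (('X - 1%:P) ^+ p) k
  end.

Lemma Negz_succ k : Negz k.+1 + 1 = Negz k.
Proof. by rewrite !NegzE; lia. Qed.

Lemma mulXB_poly (q : {poly C}) c : mulXB c (poly_coef q) =1 poly_coef (('X - c%:P) * q).
Proof.
move=> k; rewrite /mulXB; case: k => [k|[|k]]; first by rewrite /= mulr0 subrr.
  by rewrite /= mulrBl coefB coefXM coefCM.
by rewrite Negz_succ /= mulrBl coefB coefXM coefCM.
Qed.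

Lemma expand_oo_step m : mulXB 1 (expand_oo m) =1 expand_oo (m - 1).
Proof.
move=> k; case: m => [[|m]|p].
- rewrite (_ : Posz 0 - 1 = Negz 0) //= /mulXB mul1r.
  case: k => [k|[|k]]; rewrite ?Negz_succ /= ?addn1 ?bin0 ?subrr ?expr0 ?subr0 ?coef1 //.
- rewrite (_ : Posz m.+1 - 1 = Posz m); last lia.
  rewrite /mulXB mul1r; case: k => [k|[|k]]; rewrite ?Negz_succ /= ?addn1 ?subrr //.
  by rewrite binS natrD addrAC subrr add0r.
rewrite (_ : Negz p - 1 = Negz p.+1); last lia.
by rewrite /= mulXB_poly exprS.
Qed.

Lemma expand_oo0 m : expand_oo m 0 = (m == 0)%:R.
Proof. by case: m => [[|m]|p] //=; rewrite bin0n. Qed.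

Lemma expand_oo_low m (k : int) : k < - `|m| -> expand_oo m k = 0.
Proof.
case: m => [m|p] /=; first by case: k => // n; lia.
move=> h; apply: poly_coef_lt; rewrite size_exp_XsubC; lia.
Qed.

End Binomials.

Section ThreePunctures.
Variable R : realType.
Local Notation C := (Cx R).
Implicit Types (t : C).

Lemma lsum_expand_oo m t : 1 < `|t| -> lsum (@expand_oo R m) t ((t - 1) ^ (- m - 1)).
Proof.
move=> t1.
have t0 : t != 0 by rewrite -normr_gt0 (lt_trans ltr01).
have tn1 : t - 1 != 0.
  by rewrite subr_eq0; apply/eqP => E; rewrite E normr1 ltxx in t1.
have neg p : lsum (@expand_oo R (Negz p)) t ((t - 1) ^ (- Negz p - 1)).
  have -> : - Negz p - 1 = p%:Z by rewrite NegzE; lia.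
  rewrite -exprnP /expand_oo; have := lsum_poly (('X - 1%:P) ^+ p) t.
  by rewrite horner_exp hornerXsubC.
have step (n : int) : lsum (@expand_oo R (n - 1)) t ((t - 1) ^ (- (n - 1) - 1)) ->
    lsum (@expand_oo R n) t ((t - 1) ^ (- n - 1)).
  move=> h; have stepE := @expand_oo_step R n.
  have bd : abs_bounded (fun k => @expand_oo R n k * t ^ (- k - 1)).
    apply: (@division_bounded R _ _ (@expand_oo R (n - 1)) _ 1 0 t 1).
    - by move=> k; rewrite -stepE /mulXB mul1r addr0.
    - move=> k; exists (absz (k + `|n| + 1)%R) => p hp; apply: expand_oo_low.
      rewrite sub0r mulNrn; lia.
    - by rewrite normr1.
    - move=> k p _; rewrite expr1n div1r -[_ ^- _]/((t ^ p.+1%:Z)^-1) invr_expz.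
      by rewrite -expfzDr //; congr (_ ^ _); rewrite sub0r mulNrn; lia.
    exact: abs_cvg_to_bounded h.
  have [s hs] := abs_bounded_cvg bd.
  have h2 := lsum_mulXB 1 1 t0 hs; rewrite expr1 in h2.
  have E : (t - 1) * s = (t - 1) ^ (- (n - 1) - 1).
    exact: abs_cvg_to_uniq (lsum_ext stepE h2) h.
  have E2 : (t - 1) ^ (- (n - 1) - 1) = (t - 1) * (t - 1) ^ (- n - 1).
    have -> : - (n - 1) - 1 = 1 + (- n - 1) by lia.
    by rewrite expfzDr // expr1z.
  rewrite E2 in E.
  have sE : s = (t - 1) ^ (- n - 1) by apply: (mulfI tn1).
  rewrite -sE; exact: hs.
case: m => [m|//]; elim: m => [|m IH]; first by apply: step; rewrite (_ : 0%:Z - 1 = Negz 0).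
by apply: step; rewrite (_ : m.+1%:Z - 1 = m); last lia.
Qed.

Lemma reexp_expand_oo (j m : int) S : j - S%:Z < - `|m| - 1 ->
  reexp S j (@expand_oo R m) = (m == j)%:R.
Proof.
have low (n : int) : forall k : int, k < - `|n| -> @expand_oo R n k = 0.
  by move=> k; exact: expand_oo_low.
pose P (i : int) := forall (m : int) S, i - S%:Z < - `|m| - 1 ->
  reexp S i (@expand_oo R m) = (m == i)%:R.
have up i : P i -> 0 <= i -> P (i + 1).
  move=> IH i0 n T h; rewrite (reexp_succ (low n)); [|lia|lia].
  rewrite (_ : mulXB 1 _ = expand_oo R (n - 1)); last by apply/funext/expand_oo_step.
  by rewrite IH ?subr_eq //; lia.
have down i : P (i + 1) -> P i.
  move=> IH n T h; rewrite -(@reexp_stable _ T (T + absz i + 5) _ _ _ (low n)); [|lia|lia].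
  have := reexp_succ (S := T + absz i + 5) (low (n + 1)) (j := i).
  rewrite (_ : mulXB 1 _ = expand_oo R n); last first.
    by apply/funext => k; rewrite expand_oo_step addrK.
  move=> <-; [|lia|lia].
  rewrite IH ?(inj_eq (addIr _)) //; lia.
have zero : P 0.
  move=> n [|T] h; first by lia.
  rewrite /reexp big_ord_recl /= gbin0 subr0 !mul1r expand_oo0 big1 ?addr0 //.
  by move=> i _; rewrite /bump /= add1n gbin_0 mulr0 mul0r.
suff Pj : P j by exact: Pj.
case: j => p.
  elim: p => [|p IH]; first exact: zero.
  by rewrite (_ : p.+1%:Z = p%:Z + 1); [apply: up|lia].
by elim: p => [|p IH]; apply: down; rewrite ?Negz_succ.
Qed.

Variables (F : C -> C) (q : {poly C}) (N M : nat).
Variables (al be de : int -> C) (Ka Kb Kd : int).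
Hypothesis FE : forall t, t != 0 -> t - 1 != 0 -> F t = q.[t] / ((t - 1) ^+ N * t ^+ M).
Hypothesis al0 : forall k : int, k < Ka -> al k = 0.
Hypothesis be0 : forall k : int, Kb <= k -> be k = 0.
Hypothesis de0 : forall k : int, Kd <= k -> de k = 0.
Hypothesis hal : forall t, 1 < `|t| -> lsum al t (F t).
Hypothesis hbe : forall t, 0 < `|t| < 1 -> lsum be t (F t).
Hypothesis hde : forall t, 0 < `|t| < 1 -> lsum de t (F (t + 1)).

Let norm_lt1_neq t : `|t| < 1 -> t + 1 != 0.
Proof.
move=> t1; apply/eqP => /eqP; rewrite addr_eq0 => /eqP E.
by move: t1; rewrite E normrN normr1 ltxx.
Qed.

Let gt1_neq t : 1 < `|t| -> t != 0 /\ t - 1 != 0.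
Proof.
move=> t1; split; first by rewrite -normr_gt0 (lt_trans ltr01).
by rewrite subr_eq0; apply/eqP => E; rewrite E normr1 ltxx in t1.
Qed.

Let lt1_neq t : 0 < `|t| < 1 -> t != 0 /\ t - 1 != 0.
Proof.
move=> /andP[t0 t1]; split; first by rewrite -normr_gt0.
by rewrite subr_eq0; apply/eqP => E; rewrite E normr1 ltxx in t1.
Qed.

Let iter_low (c : C) n (a : int -> C) (K : int) : (forall k : int, k < K -> a k = 0) ->
  forall k : int, k < K - n%:Z -> iter n (mulXB c) a k = 0.
Proof.
move=> aK; elim: n => [|n IH] k h /=; first by apply: aK; lia.
by rewrite /mulXB !IH ?mulr0 ?subr0 //; lia.
Qed.

Let iter_high (c : C) n (a : int -> C) (K : int) : (forall k : int, K <= k -> a k = 0) ->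
  forall k : int, K <= k -> iter n (mulXB c) a k = 0.
Proof.
move=> aK; elim: n => [|n IH] k h /=; first by apply: aK; lia.
by rewrite /mulXB !IH ?mulr0 ?subr0 //; lia.
Qed.

Lemma expansions_commute (K : nat) : Kd = K%:Z ->
  iter K (mulXB 1) al =1 iter K (mulXB 1) be.
Proof.
move=> KdE.
have [q2 Fq2] : exists q2 : {poly C}, forall t, t != 0 -> t - 1 != 0 ->
    F t = q2.[t] / ((t - 1) ^+ K * t ^+ M).
  have := @reduce_pole R (q \Po ('X + 1%:P)) N M K 1 de (normr1 _).
  case=> [k|t t1|q2 hq2]; first by rewrite -KdE; exact: de0.
    rewrite horner_comp hornerD hornerX hornerC.
    have [t0 _] := lt1_neq t1; have t2 : t + 1 != 0.
      by apply: norm_lt1_neq; case/andP: t1.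
    by have := hde t1; rewrite FE ?addrK.
  exists (q2 \Po ('X - 1%:P)) => t t0 t1; rewrite FE //.
  have := hq2 (t - 1) t1; rewrite subrK => /(_ t0).
  by rewrite !horner_comp !hornerE subrK => ->.
have FM t : t != 0 -> t - 1 != 0 -> t ^ M%:Z * ((t - 1) ^+ K * F t) = q2.[t].
  by move=> t0 t1; rewrite Fq2 // -exprnP; field; rewrite !expf_neq0.
have hA k : iter K (mulXB 1) al (k + M%:Z) = poly_coef q2 k.
  apply: (@lsum_eq_oo R (fun k => iter K (mulXB 1) al (k + M%:Z)) _
    (- `|Ka| - K%:Z - M%:Z - (size q2)%:Z) (horner q2)).
  - by move=> j h; apply: iter_low al0 _ _; lia.
  - by move=> j h; apply: poly_coef_lt; lia.
  - move=> t t1; have [t0 tn1] := gt1_neq t1; rewrite -FM //.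
    by apply: lsum_shift => //; apply: lsum_mulXB => //; exact: hal.
  by move=> t _; exact: lsum_poly.
have hB k : iter K (mulXB 1) be (k + M%:Z) = poly_coef q2 k.
  apply: (@lsum_eq0 R (fun k => iter K (mulXB 1) be (k + M%:Z)) _ `|Kb| (horner q2)).
  - by move=> j h; apply: iter_high be0 _ _; lia.
  - by move=> j h; apply: poly_coef_ge0; lia.
  - move=> t t1; have [t0 tn1] := lt1_neq t1; rewrite -FM //.
    by apply: lsum_shift => //; apply: lsum_mulXB => //; exact: hbe.
  by move=> t _; exact: lsum_poly.
by move=> k; rewrite -[k](subrK M%:Z) hA hB.
Qed.

Lemma expansions_reexp (K : nat) : Kb = K%:Z -> forall (j : int) S,
  j + K%:Z - S%:Z < Ka ->
  reexp S j (fun k => al (k + K%:Z)) = iter K (mulXB (-1)) de j.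
Proof.
move=> KbE.
have [q2 Fq2] : exists q2 : {poly C}, forall t, t != 0 -> t - 1 != 0 ->
    F t = q2.[t] / ((t - 1) ^+ N * t ^+ K).
  have c1 : `|-1 : C| = 1 by rewrite normrN normr1.
  have [||q2 hq2] := @reduce_pole R q M N K (-1) be c1.
  - by move=> k; rewrite -KbE; exact: be0.
  - move=> t t1; have [t0 tn1] := lt1_neq t1.
    by rewrite [t ^+ M * _]mulrC -FE //; exact: hbe.
  by exists q2 => t t0 t1; rewrite FE // [_ * t ^+ M]mulrC hq2 // [t ^+ K * _]mulrC.
pose r := q2 \Po ('X + 1%:P).
have rE t : r.[t] = q2.[t + 1] by rewrite horner_comp hornerD hornerX hornerC.
pose e k := poly_coef r (k - N%:Z).
have dE : iter K (mulXB (-1)) de =1 e.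
  apply: (@lsum_eq0 R _ _ (`|Kd| + N%:Z) (fun t => r.[t] / t ^+ N)).
  - by move=> j h; apply: iter_high de0 _ _; lia.
  - by move=> j h; apply: poly_coef_ge0; lia.
  - move=> t t1; have [t0 _] := lt1_neq t1; have t2 : t + 1 != 0.
      by apply: norm_lt1_neq; case/andP: t1.
    have t3 : t + 1 - 1 != 0 by rewrite addrK.
    have h := lsum_mulXB (-1) K t0 (hde t1); rewrite opprK (Fq2 _ t2 t3) addrK in h.
    have E : (t + 1) ^+ K * (q2.[t + 1] / (t ^+ N * (t + 1) ^+ K)) = r.[t] / t ^+ N.
      by rewrite rE; field; rewrite !expf_neq0.
    by rewrite E in h; exact: h.
  move=> t t1; have [t0 _] := lt1_neq t1.
  have h := lsum_shift (- N%:Z) t0 (lsum_poly r t).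
  by rewrite mulrC -exprnN in h; exact: h.
pose X k := \sum_(i < size r) r`_i * @expand_oo R (N%:Z - i%:Z - 1) k.
pose K0 : int := - `|Ka| - K%:Z - N%:Z - (size r)%:Z - 1.
have Xlow (k : int) : k < K0 -> X k = 0.
  rewrite /K0 => h; rewrite /X big1 // => i _; rewrite expand_oo_low ?mulr0 //.
  have := ltn_ord i; lia.
have allow (k : int) : k < Ka - K%:Z -> al (k + K%:Z) = 0 by move=> h; apply: al0; lia.
have alE : (fun k => al (k + K%:Z)) =1 X.
  apply: (@lsum_eq_oo R _ _ K0 (fun t => r.[t - 1] / (t - 1) ^+ N)).
  - by move=> k; rewrite /K0 => h; apply: allow; lia.
  - exact: Xlow.
  - move=> t t1; have [t0 tn1] := gt1_neq t1.
    have h := lsum_shift K%:Z t0 (hal t1); rewrite (Fq2 _ t0 tn1) in h.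
    have E : t ^ K%:Z * (q2.[t] / ((t - 1) ^+ N * t ^+ K)) = r.[t - 1] / (t - 1) ^+ N.
      by rewrite rE subrK -exprnP; field; rewrite !expf_neq0.
    by rewrite E in h; exact: h.
  move=> t t1; have [t0 tn1] := gt1_neq t1.
  have -> : r.[t - 1] / (t - 1) ^+ N =
      \sum_(i < size r) r`_i * (t - 1) ^ (- (N%:Z - i%:Z - 1) - 1).
    rewrite horner_coef mulr_suml; apply: eq_bigr => i _.
    rewrite -mulrA; congr (_ * _); rewrite exprnP exprnN -expfzDr //.
    congr (_ ^ _); lia.
  apply: (abs_cvg_to_ext (F := fun k => \sum_(i < size r)
     r`_i * (@expand_oo R (N%:Z - i%:Z - 1) k * t ^ (- k - 1)))).
    by move=> k; rewrite /X mulr_suml; apply: eq_bigr => i _; rewrite mulrA.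
  apply: abs_cvg_to_sum => i; apply: abs_cvg_toZ; exact: lsum_expand_oo.
move=> j S hS; rewrite dE.
pose S' := (S + absz j + absz K0 + 1)%N.
rewrite -(@reexp_stable R S S' j _ _ allow); [|lia|rewrite /S'; lia].
have -> : reexp S' j (fun k => al (k + K%:Z)) =
    \sum_(i < size r) r`_i * reexp S' j (@expand_oo R (N%:Z - i%:Z - 1)).
  rewrite /reexp; under eq_bigr do rewrite alE /X mulr_sumr.
  rewrite exchange_big /=; apply: eq_bigr => i _; rewrite mulr_sumr.
  by apply: eq_bigr => s _; rewrite mulrCA.
rewrite (eq_bigr (fun i : 'I_(size r) => r`_i * (N%:Z - i%:Z - 1 == j)%:R)); last first.
  move=> i _; rewrite reexp_expand_oo //.
  have := ltn_ord i; rewrite /S' /K0; lia.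
have ne (x y : int) : x <> y -> (x == y)%:R = 0 :> C by move=> /eqP/negbTE ->.
rewrite /e; case E : (j - N%:Z) => [p|p].
  by rewrite /= big1 // => i _; rewrite ne ?mulr0 //; move: (nat_of_ord i) => i'; clear -E; lia.
move: E; rewrite NegzE => E.
have [ps|ps] := ltnP p (size r).
  rewrite (bigD1 (Ordinal ps)) //= big1 ?addr0.
    by rewrite (_ : _ == j) ?mulr1 //; apply/eqP; lia.
  by move=> i; rewrite -val_eqE /= => /eqP; move: (nat_of_ord i) => i' ip; rewrite ne ?mulr0 //; clear -E ip; lia.
rewrite /= nth_default // big1 // => i _.
have hi : (i < p)%N := leq_trans (ltn_ord i) ps.
by rewrite ne ?mulr0 //; move: (nat_of_ord i) hi => i' hi; clear -E hi; lia.
Qed.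

End ThreePunctures.

Section Functionals.
Variable R : realType.
Local Notation C := (Cx R).

Section Pack.
Variables (U : lmodType C) (f : U -> C) (lf : forall a x y, f (a *: x + y) = a * f x + f y).

Definition scalar_fun (_ : forall a x y, f (a *: x + y) = a * f x + f y) : U -> C := f.

Let scalar_fun_linear : scalar (scalar_fun lf).
Proof. exact: lf. Qed.

HB.instance Definition _ := GRing.isLinear.Build C U C *%R (scalar_fun lf) scalar_fun_linear.

Definition mk_scalar : {scalar U} := scalar_fun lf.
End Pack.

Lemma comp_scalarP (U U' : lmodType C) (w' : {scalar U'}) (f : U -> U') :
  linear f -> forall a x y, w' (f (a *: x + y)) = a * w' (f x) + w' (f y).
Proof. by move=> lf a x y; rewrite lf linearP. Qed.

Definition comp_scalar (U U' : lmodType C) (w' : {scalar U'}) (f : U -> U')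
  (lf : linear f) : {scalar U} := mk_scalar (comp_scalarP w' lf).

Lemma exists_dual_basis (W : gradedSpace R) (r : C) :
  exists (n : nat) (e : 'I_n -> W) (phi : 'I_n -> {scalar W}),
    forall w, wpr r w = \sum_i phi i w *: e i.
Proof.
pose P n := `[< exists e : 'I_n -> W, forall w, exists c, wpr r w = \sum_i c i *: e i >].
have exP : exists n, P n.
  have [s hs] := wpr_fin W r; exists (size s); apply/asboolP.
  by exists (fun i => s`_i).
case: (ex_minnP exP) => n /asboolP[e he] hmin.
have free c : \sum_i c i *: e i = 0 -> forall i, c i = 0.
  move=> c0 i; apply/eqP; apply: contraT => ci.
  case: n e he hmin c i c0 ci => [|n] e he hmin c i c0 ci; first by case: i c0 ci.
  have : P n.
    apply/asboolP; exists (fun j => e (lift i j)) => w.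
    have [d ->] := he w; exists (fun j => d (lift i j) - d i / c i * c (lift i j)).
    rewrite (bigD1_ord i) //=.
    under [RHS]eq_bigr do rewrite scalerBl.
    rewrite sumrB [LHS]addrC; congr (_ + _).
    move: c0; rewrite (bigD1_ord i) //= => /eqP; rewrite addr_eq0 => /eqP c0.
    under eq_bigr do rewrite -scalerA.
    by rewrite -scaler_sumr -scalerN -c0 scalerA divfK.
  by move=> /hmin; rewrite ltnn.
have uniq c d : \sum_i c i *: e i = \sum_i d i *: e i -> forall i, c i = d i.
  move=> /eqP; rewrite -subr_eq0 -sumrB => /eqP h i; apply/eqP; rewrite -subr_eq0.
  apply/eqP/(free (fun i => c i - d i)).
  by under eq_bigr do rewrite scalerBl.
have [phi hphi] := choice he.
have lphi i a x y : phi (a *: x + y) i = a * phi x i + phi y i.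
  move: i; apply: uniq; rewrite -hphi wpr_linear !hphi scaler_sumr -big_split.
  by apply: eq_bigr => i _; rewrite /= scalerDl scalerA.
by exists n, e, (fun i => mk_scalar (lphi i)).
Qed.

Lemma gdual_wpr (W : gradedSpace R) (w' : {scalar W}) r :
  gdual (comp_scalar w' (@wpr_linear _ W r)).
Proof.
apply: sub_finite_set (finite_set1 r) => s /= [w]; rewrite /scalar_fun wprM.
by case: (r =P s) => [->//|_]; rewrite raddf0 eqxx.
Qed.

Lemma gdual_separates (W : gradedSpace R) (w : W) :
  (forall w' : {scalar W}, gdual w' -> w' w = 0) -> w = 0.
Proof.
move=> h; apply: wpr_total => r; have [n [e [phi hphi]]] := exists_dual_basis W r.
have -> : wpr r w = wpr r (wpr r w) by rewrite wprM eqxx.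
rewrite hphi big1 // => i _.
have -> : phi i (wpr r w) = 0 by exact: (h _ (gdual_wpr (phi i) r)).
by rewrite scale0r.
Qed.

Lemma gdual_separates_eq (W : gradedSpace R) (x y : W) :
  (forall w' : {scalar W}, gdual w' -> w' x = w' y) -> x = y.
Proof.
move=> h; apply/eqP; rewrite -subr_eq0; apply/eqP/gdual_separates => w' gw.
by rewrite raddfB /= h // subrr.
Qed.

Lemma wpr_sum_over (W : gradedSpace R) (w : W) (A : {fset C}) :
  (forall r, r \notin A -> wpr r w = 0) -> w = \sum_(r <- A) wpr r w.
Proof.
move=> hA; apply/eqP; rewrite -subr_eq0; apply/eqP/wpr_total => t.
have lt := @wpr_linear _ W t.
rewrite (linD _ _ lt) -scaleN1r (linZ _ _ lt) scaleN1r lin_sum //.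
apply/eqP; rewrite subr_eq0; apply/eqP.
rewrite (eq_bigr (fun r => if r == t then wpr t w else 0)); last first.
  by move=> r _; rewrite wprM [r == t]eq_sym.
rewrite -big_mkcond /=; have [tA|/hA ->] := boolP (t \in A); last by rewrite big1.
by rewrite -big_filter filter_pred1_uniq ?big_seq1 //; exact: fset_uniq.
Qed.

Lemma wpr_decomp (W : gradedSpace R) (w : W) :
  exists A : {fset C}, w = \sum_(r <- A) wpr r w.
Proof. by have [A hA] := wpr_supp w; exists A; exact: wpr_sum_over. Qed.

Lemma gdual_supp (W : gradedSpace R) (w' : {scalar W}) : gdual w' ->
  exists A : {fset C}, (forall w, w' w = \sum_(r <- A) w' (wpr r w)) /\
    forall r, r \notin A -> forall w, w' (wpr r w) = 0.
Proof.
move=> fw'; pose A := fset_set [set r | exists w, w' (wpr r w) != 0].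
have A0 r : r \notin A -> forall w, w' (wpr r w) = 0.
  rewrite in_fset_set // notin_setE /= => nr w; apply/eqP; apply: contraT => nz.
  by case: nr; exists w.
exists A; split=> // w; have [B hB] := wpr_supp w.
have hAB : forall r, r \notin (A `|` B)%fset -> wpr r w = 0.
  by move=> r; rewrite in_fsetU negb_or => /andP[_ /hB].
rewrite {1}(wpr_sum_over hAB) raddf_sum /=; apply/esym/big_fset_incl.
  exact: fsubsetUl.
by move=> r _ /A0.
Qed.

Lemma wt_wpr (W : gradedSpace R) (r : C) (w : W) : wt r (wpr r w).
Proof. by rewrite /wt wprM eqxx. Qed.

Lemma wt_neq (W : gradedSpace R) (r s : C) (w : W) : wt r w -> s != r -> wpr s w = 0.
Proof. by move=> <- sr; rewrite wprM (negPf sr). Qed.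

Lemma par_ppr (W : gradedSpace R) a (w : W) : par a (ppr a w).
Proof. by rewrite /par pprM eqxx. Qed.

Lemma wt_ppr (W : gradedSpace R) r a (w : W) : wt r w -> wt r (ppr a w).
Proof. by rewrite /wt wpr_ppr => ->. Qed.

Lemma par_wpr (W : gradedSpace R) r a (w : W) : par a w -> par a (wpr r w).
Proof. by rewrite /par -wpr_ppr => ->. Qed.

End Functionals.

Section PolyLine.
Variable R : realType.
Local Notation C := (Cx R).

Lemma meval_line n (p : mpoly n C) (u v : 'I_n -> C) :
  exists q : {poly C}, forall t, q.[t] = meval (fun i => u i + t * v i) p.
Proof.
exists (mmap (@polyC C) (fun i => (u i)%:P + v i *: 'X) p) => t.
rewrite /meval /mmap horner_sum; apply: eq_bigr => m _.
rewrite hornerM hornerC /=; congr (_ * _).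
rewrite /mmap1 horner_prod; apply: eq_bigr => i _.
by rewrite horner_exp hornerD hornerC hornerZ hornerX mulrC.
Qed.

Lemma diag_den2 (N : 'I_2 -> 'I_2 -> nat) (z : 'I_2 -> C) :
  diag_den N z = (z 0 - z 1) ^+ N 0 1.
Proof.
rewrite /diag_den !big_ord_recl !big_ord0 !big_mkcond /= !big_ord_recl !big_ord0 /=.
rewrite !mul1r !mulr1 [X in _ * X]big1 => [|j]; last by case: j => [[|[|]]].
rewrite mulr1; have -> : lift ord0 ord0 = 1 :> 'I_2 by apply/val_inj.
by rewrite (_ : ord0 = 0).
Qed.

Lemma prod_pair2 (x y : C) : \prod_i pair2 x y i = x * y.
Proof. by rewrite big_ord_recl big_ord1. Qed.

Lemma pair2_conf (x y : C) : x != y -> conf (pair2 x y).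
Proof.
move=> xy i j; rewrite /pair2.
case: (unliftP 0 i) => [i'|] ->; case: (unliftP 0 j) => [j'|] -> //=.
- by rewrite !ord1.
- by move=> E; rewrite E eqxx in xy.
by move=> E; rewrite E eqxx in xy.
Qed.

Lemma pair2_conf0 (x y : C) : x != y -> x != 0 -> y != 0 -> conf0 (pair2 x y).
Proof.
by move=> xy x0 y0; split; [exact: pair2_conf|move=> i; rewrite /pair2; case: ifP].
Qed.

End PolyLine.

Section DualityModes.
Variable R : realType.
Local Notation C := (Cx R).

Definition shift_diff (U : zmodType) (h : int -> int -> U) (j k : int) : U :=
  h (j + 1) k - h j (k + 1).

Definition shift_sum (U : zmodType) (h : int -> int -> U) (j k : int) : U :=
  h (j + 1) k + h j (k + 1).

Lemma iter_shift_diff (U : lmodType C) (phi : {scalar U}) (h : int -> int -> U) (E : int) n :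
  (forall j k : int, j + k != E -> phi (h j k) = 0) ->
  forall j k, phi (iter n (@shift_diff U) h j k) =
    if j + k == E - n%:Z then iter n (mulXB 1) (fun j => phi (h j (E - j))) j else 0.
Proof.
move=> h0; elim: n => [|n IH] j k.
  rewrite subr0 /=; case: eqP => [<-|/eqP/h0 //]; congr (phi (h _ _)); lia.
rewrite iterS [in RHS]iterS /shift_diff raddfB /= !IH /mulXB mul1r.
have -> : (j + 1 + k == E - n%:Z) = (j + k == E - n.+1%:Z) by apply/eqP/eqP; lia.
have -> : (j + (k + 1) == E - n%:Z) = (j + k == E - n.+1%:Z) by apply/eqP/eqP; lia.
by case: ifP => _ //; rewrite subrr.
Qed.

Lemma iter_shift_sum (U : lmodType C) (phi : {scalar U}) (h : int -> int -> U) (E : int) n :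
  (forall j k : int, j + k != E -> phi (h j k) = 0) ->
  forall j k, phi (iter n (@shift_sum U) h j k) =
    if j + k == E - n%:Z then iter n (mulXB (-1)) (fun j => phi (h j (E - j))) j else 0.
Proof.
move=> h0; elim: n => [|n IH] j k.
  rewrite subr0 /=; case: eqP => [<-|/eqP/h0 //]; congr (phi (h _ _)); lia.
rewrite iterS [in RHS]iterS /shift_sum raddfD /= !IH /mulXB mulN1r opprK.
have -> : (j + 1 + k == E - n%:Z) = (j + k == E - n.+1%:Z) by apply/eqP/eqP; lia.
have -> : (j + (k + 1) == E - n%:Z) = (j + k == E - n.+1%:Z) by apply/eqP/eqP; lia.
by case: ifP => _ //; rewrite addr0.
Qed.

Lemma iter_shift_diff0 (U : lmodType C) n (h : int -> int -> U) :
  (forall j k, h j k = 0) -> forall j k, iter n (@shift_diff U) h j k = 0.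
Proof.
move=> h0; elim: n => [|n IH] j k //=; by rewrite /shift_diff !IH subrr.
Qed.

Section Setup.
Variables (V W : gradedSpace R) (Y : modes V V) (YW : modes V W).
Hypotheses (fY : field_map Y) (dY : d_bracket Y) (fW : field_map YW) (dW : d_bracket YW).
Hypothesis dual : duality Y YW.

Variables (a b : bool) (u1 u2 : V) (s1 s2 r t : C) (w : W) (w' : {scalar W}).
Hypotheses (p1 : par a u1) (p2 : par b u2) (w1 : wt s1 u1) (w2 : wt s2 u2) (wr : wt r w).

Let phi := comp_scalar w' (@wpr_linear _ W t).

Let phi_wt s x : wt s x -> s != t -> phi x = 0.
Proof. by move=> sx st; rewrite /phi /= /scalar_fun (wt_neq sx) ?raddf0 // eq_sym. Qed.

Lemma weight_constraint (j k : int) :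
  ~ (s1 + s2 + r - 2 - t = (j + k)%:~R) ->
  [/\ phi (YW u1 j (YW u2 k w)) = 0, phi (YW u2 k (YW u1 j w)) = 0 &
      phi (YW (Y u1 j u2) k w) = 0].
Proof.
move=> h; split; apply: phi_wt.
- exact: modes_wt fW dW w1 (modes_wt k fW dW w2 wr).
- apply/eqP => E; apply: h; rewrite -E rmorphD /=; ring.
- exact: modes_wt fW dW w2 (modes_wt j fW dW w1 wr).
- apply/eqP => E; apply: h; rewrite -E rmorphD /=; ring.
- exact: modes_wt fW dW (modes_wt j fY dY w1 w2) wr.
apply/eqP => E; apply: h; rewrite -E rmorphD /=; ring.
Qed.

Variable E : int.
Hypothesis hE : s1 + s2 + r - 2 - t = E%:~R.

Let cons (j k : int) : j + k != E ->
  [/\ phi (YW u1 j (YW u2 k w)) = 0, phi (YW u2 k (YW u1 j w)) = 0 &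
      phi (YW (Y u1 j u2) k w) = 0].
Proof.
by move=> jk; apply: weight_constraint => E'; case/eqP: jk;
  rewrite hE in E'; exact: (intr_inj (esym E')).
Qed.

Lemma duality_one_variable : exists (F : C -> C) (q : {poly C}) (N M : nat),
  [/\ forall x, x != 0 -> x - 1 != 0 -> F x = q.[x] / ((x - 1) ^+ N * x ^+ M),
      forall x, 1 < `|x| ->
        lsum (fun j => phi (YW u1 j (YW u2 (E - j) w))) x (F x),
      forall x, 0 < `|x| < 1 ->
        lsum (fun j => (-1) ^+ (a && b) * phi (YW u2 (E - j) (YW u1 j w))) x (F x) &
      forall x, 0 < `|x| < 1 ->
        lsum (fun j => phi (YW (Y u1 j u2) (E - j) w)) x (F (x + 1))].
Proof.
have [f [N [M [[p fp] _]]] fE] := dual p1 p2 w (gdual_wpr w' t).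
have [q hq] := meval_line p (pair2 0 1) (pair2 1 0).
exists (fun x => f (pair2 x 1)), q, (N 0 1), M.
have inj1 : injective (fun j : int => (j, E - j)) by move=> i j [].
have inj2 : injective (fun j : int => (E - j, j)) by move=> i j [_].
split.
- move=> x x0 x1; have xn1 : x != 1 by rewrite -subr_eq0.
  rewrite fp; last exact: pair2_conf0 _ _ (oner_neq0 _).
  rewrite diag_den2 prod_pair2 mulr1 hq /pair2 /=; congr (meval _ _ / _).
  apply/funext => i; rewrite /pair2; case: ifP => _; first by rewrite add0r mulr1.
  by rewrite mulr0 addr0.
- move=> x x1; have [h _ _] := fE (pair2 x 1).
  have {}h := h; rewrite /= /pair2 /= normr1 ltr01 x1 in h; have {}h := h isT.
  have := (abs_cvg_to_reindex _ inj1 _).2 h; move=> H.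
  apply: abs_cvg_to_ext (H _) => [j|]; first by rewrite /= exp1rz mulr1.
  move=> [j k] nj /=; rewrite (_ : scalar_fun _ _ = 0) ?mul0r //.
  have /cons[] // : j + k != E.
  by apply/eqP => jk; case: (nj j); congr pair; lia.
- move=> x x1; have [_ h _] := fE (pair2 x 1).
  rewrite /= /pair2 /= normr1 x1 in h; have {}h := h isT.
  have := (abs_cvg_to_reindex _ inj2 _).2 h; move=> H.
  apply: abs_cvg_to_ext (H _) => [j|]; first by rewrite /= exp1rz mulr1.
  move=> [k j] nj /=; rewrite (_ : scalar_fun _ _ = 0) ?mulr0 ?mul0r //.
  have /cons[] // : j + k != E.
  by apply/eqP => jk; case: (nj j); congr pair; lia.
move=> x x1; have [_ _ h] := fE (pair2 (x + 1) 1).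
rewrite /= /pair2 /= normr1 addrK x1 in h; have {}h := h isT.
have := (abs_cvg_to_reindex _ inj1 _).2 h; move=> H.
apply: abs_cvg_to_ext (H _) => [j|]; first by rewrite /= exp1rz mulr1.
move=> [j k] nj /=; rewrite (_ : scalar_fun _ _ = 0) ?mul0r //.
have /cons[] // : j + k != E.
by apply/eqP => jk; case: (nj j); congr pair; lia.
Qed.
End Setup.
End DualityModes.

Section Locality.
Variable R : realType.
Local Notation C := (Cx R).

Lemma iter_shift_diff_sum (U : lmodType C) (I : Type) (r : seq I) n
    (h : I -> int -> int -> U) j k :
  iter n (@shift_diff U) (fun j k => \sum_(i <- r) h i j k) j k =
  \sum_(i <- r) iter n (@shift_diff U) (h i) j k.
Proof.
elim: n j k => [|n IH] j k //=; rewrite /shift_diff !IH -sumrB.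
by apply: eq_bigr.
Qed.

Lemma iter_shift_sum_sum (U : lmodType C) (I : Type) (r : seq I) n
    (h : I -> int -> int -> U) j k :
  iter n (@shift_sum U) (fun j k => \sum_(i <- r) h i j k) j k =
  \sum_(i <- r) iter n (@shift_sum U) (h i) j k.
Proof.
elim: n j k => [|n IH] j k //=; rewrite /shift_sum !IH -big_split.
by apply: eq_bigr.
Qed.

Lemma iter_shift_diff_ext (U : lmodType C) n (h h' : int -> int -> U) j k :
  (forall j' k' : int, j <= j' <= j + n%:Z -> k <= k' <= k + n%:Z -> h j' k' = h' j' k') ->
  iter n (@shift_diff U) h j k = iter n (@shift_diff U) h' j k.
Proof.
elim: n j k => [|n IH] j k hh /=; first by apply: hh; lia.
by rewrite /shift_diff; congr (_ - _); apply: IH => j' k' ? ?; apply: hh; lia.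
Qed.

Lemma iter_shift_sum_ext (U : lmodType C) n (h h' : int -> int -> U) j k :
  (forall j' k' : int, j <= j' <= j + n%:Z -> k <= k' <= k + n%:Z -> h j' k' = h' j' k') ->
  iter n (@shift_sum U) h j k = iter n (@shift_sum U) h' j k.
Proof.
elim: n j k => [|n IH] j k hh /=; first by apply: hh; lia.
by rewrite /shift_sum; congr (_ + _); apply: IH => j' k' ? ?; apply: hh; lia.
Qed.

Section Truncation.
Variables (V W : gradedSpace R) (YW : modes V W).

Definition trunc (u : V) (w : W) (K : int) : Prop :=
  forall s r p q (k : int), K <= k -> YW (wpr s (ppr p u)) k (wpr r (ppr q w)) = 0.

Hypothesis fW : field_map YW.

Lemma modes0l k w : YW 0 k w = 0.
Proof. by have [_ l _] := fW; rewrite (lin0 (l k w)). Qed.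

Lemma modes0r u k : YW u k 0 = 0.
Proof. by have [l _ _] := fW; rewrite (lin0 (l u k)). Qed.

Lemma modes_suml (I : Type) (r : seq I) (F : I -> V) k w :
  YW (\sum_(i <- r) F i) k w = \sum_(i <- r) YW (F i) k w.
Proof. by have [_ l _] := fW; rewrite (lin_sum _ _ (l k w)). Qed.

Lemma modes_sumr (I : Type) (r : seq I) (F : I -> W) u k :
  YW u k (\sum_(i <- r) F i) = \sum_(i <- r) YW u k (F i).
Proof. by have [l _ _] := fW; rewrite (lin_sum _ _ (l u k)). Qed.

Lemma trunc_exists u w : exists K : nat, trunc u w K%:Z.
Proof.
have [_ _ tW] := fW.
have t1 (x : V) (y : W) : exists K : nat, forall k : int, K%:Z <= k -> YW x k y = 0.
  by have [K hK] := tW x y; exists (absz K) => k h; apply: hK; lia.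
have t2 (A B : {fset C}) p q : exists K : nat, forall s r (k : int),
    s \in A -> r \in B -> K%:Z <= k -> YW (wpr s (ppr p u)) k (wpr r (ppr q w)) = 0.
  have [f hf] := choice (fun sr : C * C => t1 (wpr sr.1 (ppr p u)) (wpr sr.2 (ppr q w))).
  exists (\max_(s <- A) \max_(r <- B) f (s, r)) => s r k sA rB h.
  apply: (hf (s, r)) => /=; apply: le_trans h; rewrite lez_nat.
  apply: (@leq_trans (\max_(r <- B) f (s, r))); first by rewrite (big_rem r) //= leq_maxl.
  by rewrite [X in (_ <= X)%N](big_rem s) //= leq_maxl.
have t3 p q : exists K : nat, forall s r (k : int),
    K%:Z <= k -> YW (wpr s (ppr p u)) k (wpr r (ppr q w)) = 0.
  have [A hA] := wpr_supp (ppr p u); have [B hB] := wpr_supp (ppr q w).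
  have [K hK] := t2 A B p q; exists K => s r k h.
  have [sA|/hA ->] := boolP (s \in A); last by rewrite modes0l.
  have [rB|/hB ->] := boolP (r \in B); last by rewrite modes0r.
  exact: hK.
have [f hf] := choice (fun pq : bool * bool => t3 pq.1 pq.2).
exists (\max_(pq : bool * bool) f pq) => s r p q k h.
apply: (hf (p, q)) => /=; apply: le_trans h; rewrite lez_nat.
exact: (leq_bigmax (p, q)).
Qed.

Lemma trunc_le u w (K K' : int) : K <= K' -> trunc u w K -> trunc u w K'.
Proof. by move=> KK h s r p q k K'k; apply: h; exact: le_trans K'k. Qed.

Lemma trunc_modes u w K (k : int) p q : trunc u w K -> K <= k -> YW (ppr p u) k (ppr q w) = 0.
Proof.
move=> h Kk; have [A ->] := wpr_decomp (ppr p u); have [B ->] := wpr_decomp (ppr q w).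
rewrite modes_suml big1 // => s _; rewrite modes_sumr big1 // => r _.
exact: h.
Qed.

Lemma modesDl x y k w : YW (x + y) k w = YW x k w + YW y k w.
Proof. by have [_ l _] := fW; rewrite (linD _ _ (l k w)). Qed.

Lemma modesDr u k x y : YW u k (x + y) = YW u k x + YW u k y.
Proof. by have [l _ _] := fW; rewrite (linD _ _ (l u k)). Qed.

Lemma trunc_full u w K (k : int) : trunc u w K -> K <= k -> YW u k w = 0.
Proof.
move=> h Kk; rewrite (ppr_sum u) (ppr_sum w) modesDl !modesDr.
by rewrite !(trunc_modes _ _ h Kk) !addr0.
Qed.

Lemma trunc_comp u w K s p r q : trunc u w K -> trunc (wpr s (ppr p u)) (wpr r (ppr q w)) K.
Proof.
move=> h s' r' p' q' k Kk; rewrite -!wpr_ppr !wprM !pprM.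
have z a : ppr a (0 : V) = 0 by rewrite (lin0 (@ppr_linear _ V _)).
have z' a : ppr a (0 : W) = 0 by rewrite (lin0 (@ppr_linear _ W _)).
have y a : wpr a (0 : V) = 0 by rewrite (lin0 (@wpr_linear _ V _)).
have y' a : wpr a (0 : W) = 0 by rewrite (lin0 (@wpr_linear _ W _)).
case: eqP => _; last by rewrite modes0l.
case: (r' == r); last by rewrite modes0r.
case: eqP => _; last by rewrite y modes0l.
case: (q' == q); last by rewrite y' modes0r.
exact: h.
Qed.

End Truncation.
End Locality.

Section LocalityFromDuality.
Variable R : realType.
Local Notation C := (Cx R).
Variables (V W : gradedSpace R) (Y : modes V V) (YW : modes V W).
Hypotheses (fY : field_map Y) (dY : d_bracket Y) (fW : field_map YW) (dW : d_bracket YW).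
Hypothesis dual : duality Y YW.

Let phi (w' : {scalar W}) t := comp_scalar w' (@wpr_linear _ W t).

Lemma separate_wpr (x y : W) :
  (forall (w' : {scalar W}) t, phi w' t x = phi w' t y) -> x = y.
Proof.
move=> h; apply: gdual_separates_eq => w' gw; have [A [hA _]] := gdual_supp gw.
by rewrite !hA; apply: eq_bigr => r _; exact: h.
Qed.

Lemma locality_homogeneous a b u1 u2 s1 s2 r w (K : nat) :
  par a u1 -> par b u2 -> wt s1 u1 -> wt s2 u2 -> wt r w ->
  (forall k : int, K%:Z <= k -> Y u1 k u2 = 0) ->
  forall j k, iter K (@shift_diff W) (fun j k =>
    YW u1 j (YW u2 k w) - (-1) ^+ (a && b) *: YW u2 k (YW u1 j w)) j k = 0.
Proof.
move=> p1 p2 w1 w2 wr uK j k; have [_ _ tW] := fW.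
apply: separate_wpr => w' t; rewrite raddf0.
have wc := weight_constraint fY dY fW dW w' w1 w2 wr (t := t).
have hl x y : phi w' t (x - (-1) ^+ (a && b) *: y)
    = phi w' t x - (-1) ^+ (a && b) * phi w' t y.
  by rewrite raddfB /= linearZ.
case: (pselect (exists E : int, s1 + s2 + r - 2 - t = E%:~R)) => [[E hE]|nE]; last first.
  rewrite (iter_shift_diff (E := j + k + K%:Z + 1)); last first.
    move=> j' k' _; rewrite hl; have [|-> -> _] := wc j' k'; last by rewrite mulr0 subrr.
    by move=> h; case: nE; exists (j' + k').
  by rewrite (_ : _ == _ = false) //; apply/negbTE/eqP; lia.
have cons (j' k' : int) : j' + k' != E -> phi w' t (YW u1 j' (YW u2 k' w)) = 0 /\
    phi w' t (YW u2 k' (YW u1 j' w)) = 0.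
  move=> jk; have [|-> -> _] := wc j' k' => //.
  by rewrite hE => /intr_inj E'; rewrite E' eqxx in jk.
rewrite (iter_shift_diff (E := E)); last first.
  by move=> j' k' /cons[e1 e2]; rewrite hl e1 e2 mulr0 subrr.
case: ifP => // _.
have [F [q [N [M [FE hal hbe hde]]]]] :=
  duality_one_variable fY dY fW dW dual w' p1 p2 w1 w2 wr hE.
have [K2 hK2] := tW u2 w; have [K1 hK1] := tW u1 w.
have := @expansions_commute R F q N M _ _ _ (E - K2 + 1) K1 K%:Z FE _ _ _ hal hbe hde K erefl j.
move=> ec.
have E1 n i : iter n (mulXB 1) (fun j => phi w' t
     (YW u1 j (YW u2 (E - j) w) - (-1) ^+ (a && b) *: YW u2 (E - j) (YW u1 j w))) i =
   iter n (mulXB 1) (fun j => phi w' t (YW u1 j (YW u2 (E - j) w))) i -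
   iter n (mulXB 1) (fun j => (-1) ^+ (a && b) * phi w' t (YW u2 (E - j) (YW u1 j w))) i.
  elim: n i => [|n IH] i /=; first exact: hl.
  by rewrite /mulXB !IH !mul1r opprD opprK addrACA [X in _ = X + _]addrC [X in _ = _ + X]opprD opprK; ring.
rewrite E1 ec ?subrr //.
- by move=> i h; rewrite hK2 ?(modes0r fW) ?raddf0 //; lia.
- by move=> i h; rewrite hK1 ?(modes0r fW) ?raddf0 ?mulr0 //.
by move=> i h; rewrite uK ?(modes0l fW) ?raddf0.
Qed.

Lemma weak_assoc_homogeneous a b u y s1 s2 r w (K : nat) (S0 : int) :
  par a u -> par b y -> wt s1 u -> wt s2 y -> wt r w ->
  (forall k : int, K%:Z <= k -> YW u k w = 0) ->
  (forall k : int, S0 <= k -> YW y k w = 0) ->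
  forall (j k : int) S, S0 <= k + S%:Z ->
  iter K (@shift_sum W) (fun j k => YW (Y u j y) k w) j k =
  \sum_(s < S) ((-1) ^+ s * gbin R j s) *: YW u (j + K%:Z - s%:Z) (YW y (k + s%:Z) w).
Proof.
move=> p1 p2 w1 w2 wr uK yS j k S hS; have [_ _ tY] := fY.
apply: separate_wpr => w' t; rewrite raddf_sum /=.
have wc := weight_constraint fY dY fW dW w' w1 w2 wr (t := t).
under eq_bigr do rewrite linearZ /=.
case: (pselect (exists E : int, s1 + s2 + r - 2 - t = E%:~R)) => [[E hE]|nE]; last first.
  rewrite (iter_shift_sum (E := j + k + K%:Z + 1)); last first.
    move=> j' k' _; have [|_ _ ->] := wc j' k' => //.
    by move=> h; case: nE; exists (j' + k').
  rewrite (_ : _ == _ = false); last by apply/negbTE/eqP; lia.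
  rewrite big1 // => s _; have [|-> _ _] := wc (j + K%:Z - s%:Z) (k + s%:Z); rewrite ?mulr0 //.
  by move=> h; case: nE; exists (j + K%:Z - s%:Z + (k + s%:Z)).
have cons (j' k' : int) : j' + k' != E -> phi w' t (YW u j' (YW y k' w)) = 0 /\
    phi w' t (YW (Y u j' y) k' w) = 0.
  move=> jk; have [|-> _ ->] := wc j' k' => //.
  by rewrite hE => /intr_inj E'; rewrite E' eqxx in jk.
rewrite (iter_shift_sum (E := E)); last by move=> j' k' /cons[_ ->].
case: eqP => [jk|/eqP jk]; last first.
  rewrite big1 // => s _.
  have [|e _] := cons (j + K%:Z - s%:Z) (k + s%:Z); first by apply/eqP => h; case/eqP: jk; lia.
  by rewrite [X in _ * X]e mulr0.
have [F [q [N [M [FE hal hbe hde]]]]] :=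
  duality_one_variable fY dY fW dW dual w' p1 p2 w1 w2 wr hE.
have [K2 hK2] := tY u y.
have := @expansions_reexp R F q N M _ _ _ (E - S0 + 1) K%:Z K2 FE _ _ _ hal hbe hde K erefl j S.
move=> <-.
- rewrite /reexp; apply: eq_bigr => s _; congr (_ * phi w' t (YW u _ (YW y _ w))); lia.
- by move=> i h; rewrite yS ?(modes0r fW) ?raddf0 //; lia.
- by move=> i h; rewrite uK ?(modes0r fW) ?raddf0 ?mulr0 //.
- by move=> i h; rewrite hK2 ?(modes0l fW) ?raddf0.
lia.
Qed.

Lemma locality u v (K : nat) : trunc Y u v K%:Z -> forall a b w j k,
  iter K (@shift_diff W) (fun j k =>
    YW (ppr a u) j (YW (ppr b v) k w)
    - (-1) ^+ (a && b) *: YW (ppr b v) k (YW (ppr a u) j w)) j k = 0.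
Proof.
move=> tr a b w j k.
have [A uE] := wpr_decomp (ppr a u); have [B vE] := wpr_decomp (ppr b v).
have [D wE] := wpr_decomp w.
pose h s t r j k := YW (wpr s (ppr a u)) j (YW (wpr t (ppr b v)) k (wpr r w))
  - (-1) ^+ (a && b) *: YW (wpr t (ppr b v)) k (YW (wpr s (ppr a u)) j (wpr r w)).
rewrite (_ : (fun j k => _) = fun j k =>
   \sum_(s <- A) \sum_(t <- B) \sum_(r <- D) h s t r j k); last first.
  apply/funext => i; apply/funext => l; rewrite {1 2}uE {1 2}vE {1 2}wE /h.
  under [RHS]eq_bigr do under eq_bigr do rewrite sumrB -scaler_sumr.
  under [RHS]eq_bigr do rewrite sumrB -scaler_sumr.
  rewrite [RHS]sumrB -scaler_sumr; congr (_ - _ *: _).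
    rewrite (modes_suml fW); apply: eq_bigr => s _.
    rewrite (modes_suml fW) (modes_sumr fW); apply: eq_bigr => t _.
    by rewrite (modes_sumr fW) (modes_sumr fW).
  rewrite exchange_big /= (modes_suml fW); apply: eq_bigr => t _.
  rewrite (modes_suml fW) (modes_sumr fW); apply: eq_bigr => s _.
  by rewrite (modes_sumr fW) (modes_sumr fW).
rewrite iter_shift_diff_sum big1 // => s _.
rewrite iter_shift_diff_sum big1 // => t _.
rewrite iter_shift_diff_sum big1 // => r _.
apply: (@locality_homogeneous a b _ _ s t r).
- by apply: par_wpr; exact: par_ppr.
- by apply: par_wpr; exact: par_ppr.
- exact: wt_wpr.
- exact: wt_wpr.
- exact: wt_wpr.
by move=> i Ki; exact: tr.
Qed.

Lemma weak_assoc u y w (K : nat) (S0 j k : int) (S : nat) :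
  trunc YW u w K%:Z -> trunc YW y w S0 -> S0 <= k + S%:Z ->
  iter K (@shift_sum W) (fun j k => YW (Y u j y) k w) j k =
  \sum_(s < S) ((-1) ^+ s * gbin R j s) *: YW u (j + K%:Z - s%:Z) (YW y (k + s%:Z) w).
Proof.
move=> tu ty hS.
have dec (U : gradedSpace R) (x : U) : exists A : {fset C * bool},
    x = \sum_(i <- A) wpr i.1 (ppr i.2 x).
  have [A hA] := wpr_supp x; have [A0 h0] := wpr_supp (ppr false x).
  have [A1 h1] := wpr_supp (ppr true x).
  exists ((A0 `|` A1) `*` [fset false; true])%fset.
  rewrite big_fsetX exchange_big /= big_fsetU1 ?in_fset1 //= big_seq_fset1.
  rewrite -!wpr_sum_over -?ppr_sum //.
    by move=> r; rewrite in_fsetU negb_or => /andP[_ /h1].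
  by move=> r; rewrite in_fsetU negb_or => /andP[/h0].
have [A uE] := dec _ u; have [B yE] := dec _ y; have [D wE] := dec _ w.
pose h (a b d : C * bool) j k :=
  YW (Y (wpr a.1 (ppr a.2 u)) j (wpr b.1 (ppr b.2 y))) k (wpr d.1 (ppr d.2 w)).
rewrite (_ : (fun j k => _) = fun j k =>
   \sum_(a <- A) \sum_(b <- B) \sum_(d <- D) h a b d j k); last first.
  apply/funext => i; apply/funext => l; rewrite {1}uE {1}yE {1}wE.
  rewrite (modes_suml fY) (modes_suml fW); apply: eq_bigr => a _.
  rewrite (modes_sumr fY) (modes_suml fW); apply: eq_bigr => b _.
  by rewrite (modes_sumr fW).
rewrite iter_shift_sum_sum.
under eq_bigr do rewrite iter_shift_sum_sum.
under eq_bigr do under eq_bigr do rewrite iter_shift_sum_sum.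
rewrite [RHS](eq_bigr (fun s : 'I_S => \sum_(a <- A) \sum_(b <- B) \sum_(d <- D)
   ((-1) ^+ s * gbin R j s) *: YW (wpr a.1 (ppr a.2 u)) (j + K%:Z - s%:Z)
      (YW (wpr b.1 (ppr b.2 y)) (k + s%:Z) (wpr d.1 (ppr d.2 w))))); last first.
  move=> s _; rewrite {1}uE {1}yE {1}wE.
  rewrite (modes_suml fW) scaler_sumr; apply: eq_bigr => a _.
  rewrite (modes_suml fW) (modes_sumr fW) scaler_sumr; apply: eq_bigr => b _.
  by rewrite (modes_sumr fW) (modes_sumr fW) scaler_sumr.
rewrite [RHS]exchange_big /=; apply: eq_bigr => a _.
rewrite [RHS]exchange_big /=; apply: eq_bigr => b _.
rewrite [RHS]exchange_big /=; apply: eq_bigr => d _.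
apply: (@weak_assoc_homogeneous a.2 b.2 _ _ a.1 b.1 d.1 _ K S0) => //.
- by apply: par_wpr; exact: par_ppr.
- by apply: par_wpr; exact: par_ppr.
- exact: wt_wpr.
- exact: wt_wpr.
- exact: wt_wpr.
- by move=> i Ki; exact: tu.
by move=> i Ki; exact: ty.
Qed.
End LocalityFromDuality.

Section SkewOperator.
Variable R : realType.
Local Notation C := (Cx R).
Variables (V : vertexSuperalgebra R) (W : supermodule V).
Local Notation YW := (@YW R V W).
Local Notation Y := (@vY R V).
Local Notation DW := (@DW R V W).

Let fW := @YW_field R V W.
Let lD := @DW_linear R V W.

Definition divD (i : nat) (x : W) : W := i`!%:R^-1 *: iter i DW x.

Lemma iterD_linear i : linear (iter i DW).
Proof. by elim: i => [|i IH] a x y //=; rewrite IH lD. Qed.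

Lemma divD_linear i : linear (divD i).
Proof.
move=> a x y; rewrite /divD iterD_linear scalerDr; congr (_ + _).
by rewrite [LHS]scalerA [RHS]scalerA mulrC.
Qed.

Lemma divD0 x : divD 0 x = x.
Proof. by rewrite /divD fact0 invr1 scale1r. Qed.

Lemma D_divD i x : DW (divD i x) = i.+1%:R *: divD i.+1 x.
Proof.
rewrite /divD (linZ _ _ lD) iterS scalerA; congr (_ *: _).
by rewrite factS natrM invfM mulrA divff ?mul1r.
Qed.

Lemma divD_D i x : divD i (DW x) = i.+1%:R *: divD i.+1 x.
Proof. by rewrite -D_divD /divD (linZ _ _ lD) -iterSr. Qed.

Lemma divD_modes0 i : divD i 0 = 0.
Proof. exact: lin0 (divD_linear i). Qed.

Lemma modes_D u j x : YW u j (DW x) = DW (YW u j x) + j%:~R *: YW u (j - 1) x.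
Proof.
have [e1 e2] := @YW_D R V W u j x.
rewrite -e1 in e2; rewrite rmorphN /= scaleNr in e2.
have -> : j%:~R *: YW u (j - 1) x = - (DW (YW u j x) - YW u j (DW x)).
  by rewrite -e2 opprK.
by rewrite opprB addrC subrK.
Qed.

Lemma modes_divD u j i x :
  YW u j (divD i x) = \sum_(s < i.+1) gbin R j s *: divD (i - s) (YW u (j - s%:Z) x).
Proof.
have [lY _ _] := fW.
elim: i x => [|i IH] x.
  by rewrite big_ord1 gbin0 scale1r !divD0 subr0.
have n0 : i.+1%:R != 0 :> C by rewrite pnatr_eq0.
apply: (scalerI n0); rewrite -(linZ _ _ (lY _ _)) -divD_D IH.
pose G (s : nat) := gbin R j s *: divD (i.+1 - s) (YW u (j - s%:Z) x).
have E1 (s : 'I_i.+1) :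
  gbin R j s *: divD (i - s) (YW u (j - s%:Z) (DW x)) =
  (i.+1 - s)%:R *: G s + s.+1%:R *: G s.+1.
  have si : (s <= i)%N by rewrite -ltnS.
  rewrite modes_D (linD _ _ (divD_linear _)) divD_D (linZ _ _ (divD_linear _)).
  rewrite scalerDr /G -(subSn si) subSS; congr (_ + _).
    by rewrite [LHS]scalerA [RHS]scalerA mulrC.
  rewrite [LHS]scalerA [RHS]scalerA gbinS rmorphB /=; congr (_ *: divD _ (YW u _ x)); lia.
rewrite (eq_bigr _ (fun s _ => E1 s)) big_split /=.
have -> : \sum_(s < i.+1) (i.+1 - s)%:R *: G s = \sum_(s < i.+2) (i.+1 - s)%:R *: G s.
  by rewrite [RHS]big_ord_recr /= subnn scale0r addr0.
have -> : \sum_(s < i.+1) s.+1%:R *: G s.+1 = \sum_(s < i.+2) s%:R *: G s.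
  by rewrite [RHS]big_ord_recl /= scale0r add0r.
rewrite -big_split /= scaler_sumr; apply: eq_bigr => s _.
by rewrite -scalerDl -natrD subnK // -ltnS.
Qed.

(* the coefficient of x^(-k-1) in e^(x D) Y_W(y, -x) w *)
Definition skew_op (w : W) (k : int) (y : V) : W :=
  \sum_(i \in [set: nat]) ((-1) ^ (- (k + i%:Z) - 1) / i`!%:R) *: iter i DW (YW y (k + i%:Z) w).

Lemma skew_opE w k y (S0 : int) n : trunc YW y w S0 -> S0 <= k + n%:Z ->
  skew_op w k y = \sum_(i < n) (-1) ^ (- (k + i%:Z) - 1) *: divD i (YW y (k + i%:Z) w).
Proof.
move=> ty hn; rewrite /skew_op (@fsbigTE _ _ _ _ [fset i | i in iota 0 n]%fset); last first.
  move=> i; rewrite in_fset /= mem_iota add0n -leqNgt => ni.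
  by rewrite (trunc_full fW ty) ?(lin0 (iterD_linear i)) ?scaler0 //; lia.
rewrite -(big_mkord xpredT (fun i => (-1) ^ (- (k + i%:Z) - 1) *: divD i (YW y (k + i%:Z) w))).
rewrite (perm_big (index_iota 0 n)) /=; last first.
  apply: uniq_perm; rewrite ?iota_uniq ?fset_uniq // => x.
  by rewrite in_fset /= /index_iota subn0.
by apply: eq_bigr => i _; rewrite /divD scalerA.
Qed.

Lemma skew_op_linear_r w k : linear (skew_op w k).
Proof.
move=> a x y; have [K1 h1] := trunc_exists fW x w; have [K2 h2] := trunc_exists fW y w.
have [K3 h3] := trunc_exists fW (a *: x + y) w.
have [_ lY _] := fW.
pose K := (K1 + K2 + K3 + absz k)%N.
rewrite (skew_opE (n := K) h1) ?(skew_opE (n := K) h2) ?(skew_opE (n := K) h3); try by rewrite /K; lia.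
rewrite scaler_sumr -big_split; apply: eq_bigr => i _ /=.
rewrite lY divD_linear scalerDr; congr (_ + _).
by rewrite [LHS]scalerA [RHS]scalerA mulrC.
Qed.

Lemma skew_op_linear_l k y : linear (fun w => skew_op w k y).
Proof.
move=> a w x; have [K1 h1] := trunc_exists fW y w; have [K2 h2] := trunc_exists fW y x.
have [K3 h3] := trunc_exists fW y (a *: w + x).
have [lY _ _] := fW.
pose K := (K1 + K2 + K3 + absz k)%N.
rewrite (skew_opE (n := K) h1) ?(skew_opE (n := K) h2) ?(skew_opE (n := K) h3); try by rewrite /K; lia.
rewrite scaler_sumr -big_split; apply: eq_bigr => i _ /=.
rewrite lY divD_linear scalerDr; congr (_ + _).
by rewrite [LHS]scalerA [RHS]scalerA mulrC.
Qed.

Lemma skew_op_trunc w k y (K : int) : trunc YW y w K -> K <= k -> skew_op w k y = 0.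
Proof. by move=> h Kk; rewrite (skew_opE (n := 0) h) ?big_ord0 // addr0. Qed.

Lemma skew_op_local u w (K : nat) : trunc YW u w K%:Z -> forall x j k,
  iter K (@shift_diff W) (fun j k => YW u j (skew_op w k x) - skew_op w k (Y u j x)) j k = 0.
Proof.
move=> tu x j k; have [S0 tx] := trunc_exists fW x w.
have [T hT] := choice (fun j => trunc_exists fW (Y u j x) w).
pose n := (S0 + absz k + \max_(i < K.+1) T (j + i%:Z)%R + K)%N.
have [lY _ _] := fW.
pose It m j k := \sum_(s < n) ((-1) ^+ s * gbin R j s) *: YW u (j + m%:Z - s%:Z) (YW x (k + s%:Z) w).
pose g j k := It 0%N j k - YW (Y u j x) k w.
have ItS m (j' k' : int) : k <= k' -> It m (j' + 1) k' + It m j' (k' + 1) = It m.+1 j' k'.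
  move=> kk; rewrite /It.
  have n0 : (0 < n)%N \/ n = 0%N by case: (n); [right|left].
  case: n0 => [|n0]; last first.
    rewrite n0 !big_ord0 addr0 //.
  case En : n => [//|n'] _.
  rewrite [X in X + _]big_ord_recl [in RHS]big_ord_recl /= !gbin0 expr0 mulr1 !scale1r.
  rewrite [X in _ + X]big_ord_recr /=.
  rewrite [X in _ + (_ + X)](_ : _ = 0); last first.
    rewrite (trunc_full fW tx) ?(modes0r fW) ?scaler0 //.
    move: En; rewrite /n; lia.
  rewrite [X in _ + X = _]addr0 -addrA -big_split /=; congr (_ + _).
    congr (YW u _ _); lia.
  apply: eq_bigr => s _; rewrite /bump /= add1n gbin_pascal exprS.
  have -> : j' + 1 + m%:Z - s.+1%:Z = j' + m%:Z - s%:Z by lia.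
  have -> : j' + m.+1%:Z - s.+1%:Z = j' + m%:Z - s%:Z by lia.
  have -> : k' + 1 + s%:Z = k' + s.+1%:Z by lia.
  by rewrite -scalerDl; congr (_ *: _); ring.
have ItK m (j' k' : int) : k <= k' -> iter m (@shift_sum W) (It 0%N) j' k' = It m j' k'.
  elim: m j' k' => [//|m IH] j' k' kk /=.
  by rewrite /shift_sum !IH ?ItS //; lia.
have gK (k' : int) : k <= k' -> iter K (@shift_sum W) g j k' = 0.
  move=> kk.
  have -> : iter K (@shift_sum W) g j k' = iter K (@shift_sum W) (It 0%N) j k'
      - iter K (@shift_sum W) (fun j k => YW (Y u j x) k w) j k'.
    elim: (K) (j) (k') => [//|m IH] j1 k1 /=.
    by rewrite /shift_sum !IH opprD addrACA.
  rewrite ItK // (weak_assoc (@vY_field _ V) (@vY_d _ V) fW (@YW_d _ _ W) (@YW_duality _ _ W)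
    (S := n) j tu tx) ?subrr //.
  rewrite /n; lia.
have hE (j' k' : int) : j <= j' <= j + K%:Z -> k <= k' <= k + K%:Z ->
   YW u j' (skew_op w k' x) - skew_op w k' (Y u j' x) =
   \sum_(i < n) (-1) ^ (- (k' + i%:Z) - 1) *: divD i (g j' (k' + i%:Z)).
  move=> hj hk; rewrite (skew_opE (n := n) tx); last by rewrite /n; lia.
  rewrite (skew_opE (n := n) (hT j')); last first.
    have hi : (absz (j' - j)%R < K.+1)%N by lia.
    have hm : (T j' <= \max_(i < K.+1) T (j + i%:Z)%R)%N.
      have {1}-> : j' = j + (Ordinal hi)%:Z by rewrite /=; lia.
      exact: (leq_bigmax (F := fun i : 'I_K.+1 => T (j + i%:Z)%R)).
    move: hm hk; rewrite /n; set X := \max_(i < K.+1) _; lia.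
  rewrite (modes_sumr fW).
  have E1 (i : 'I_n) : YW u j' ((-1) ^ (- (k' + i%:Z) - 1) *: divD i (YW x (k' + i%:Z) w)) =
     \sum_(s < n | (s <= i)%N) (-1) ^ (- (k' + i%:Z) - 1) *:
        (gbin R j' s *: divD (i - s) (YW u (j' - s%:Z) (YW x (k' + i%:Z) w))).
    rewrite (linZ _ _ (lY _ _)) modes_divD scaler_sumr.
    rewrite (big_ord_widen n (fun s => (-1) ^ (- (k' + i%:Z) - 1) *:
        (gbin R j' s *: divD (i - s) (YW u (j' - s%:Z) (YW x (k' + i%:Z) w))))) //.
  rewrite (eq_bigr _ (fun i _ => E1 i)) (exchange_big_dep xpredT) //=.
  have E2 (s : 'I_n) : \sum_(i < n | (s <= i)%N) (-1) ^ (- (k' + i%:Z) - 1) *: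
        (gbin R j' s *: divD (i - s) (YW u (j' - s%:Z) (YW x (k' + i%:Z) w))) =
     \sum_(i < n) (-1) ^ (- (k' + i%:Z) - 1) *: (((-1) ^+ s * gbin R j' s) *:
        divD i (YW u (j' - s%:Z) (YW x (k' + i%:Z + s%:Z) w))).
    pose A (i : nat) := (-1) ^ (- (k' + i%:Z) - 1) *:
        (gbin R j' s *: divD (i - s) (YW u (j' - s%:Z) (YW x (k' + i%:Z) w))).
    pose B (i : nat) := (-1) ^ (- (k' + i%:Z) - 1) *: (((-1) ^+ s * gbin R j' s) *:
        divD i (YW u (j' - s%:Z) (YW x (k' + i%:Z + s%:Z) w))).
    have AB i : A (i + s)%N = B i.
      rewrite /A /B addnK PoszD addrA [LHS]scalerA [RHS]scalerA; congr (_ *: _).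
      rewrite [RHS]mulrA; congr (_ * gbin R j' s).
      have -> : - (k' + i%:Z + s%:Z) - 1 = - (k' + i%:Z) - 1 + - s%:Z :> int by lia.
      rewrite expfzDr ?oppr_eq0 ?oner_eq0 //; congr (_ * _).
      by rewrite -exprz_inv invrN1.
    have sn : (s <= n)%N by exact: ltnW.
    transitivity (\sum_(s <= i < n) A i).
      rewrite -(big_mkord (fun i => (s <= i)%N) A).
      rewrite (big_cat_nat (n := s)) //= big_nat_cond big1 ?add0r.
        by rewrite big_nat_cond [RHS]big_nat_cond; apply: eq_bigl => i; case: (s <= i)%N.
      by move=> i /andP[/andP[_ h1] h2]; lia.
    rewrite -{1}[s : nat]add0n big_addn -(big_mkord xpredT B).
    rewrite [RHS](big_cat_nat (n := (n - s)%N)) //= ?leq_subr // [X in _ = _ + X]big_nat_cond.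
    rewrite [X in _ = _ + X]big1 ?addr0; first by apply: eq_bigr.
    move=> i; rewrite andbT => /andP[h1 h2].
    rewrite /B (trunc_full fW tx) ?(modes0r fW) ?divD_modes0 ?scaler0 //.
    move: h1; rewrite /n; lia.
  rewrite (eq_bigr _ (fun s _ => E2 s)) exchange_big /= -sumrB.
  apply: eq_bigr => i _; rewrite -scaler_sumr -scalerBr; congr (_ *: _).
  have dB y1 y2 : divD i (y1 - y2) = divD i y1 - divD i y2.
    by rewrite (linD _ _ (divD_linear i)) -scaleN1r (linZ _ _ (divD_linear i)) scaleN1r.
  rewrite /g dB; congr (_ - _); rewrite /It (lin_sum _ _ (divD_linear i)).
  by apply: eq_bigr => s _; rewrite (linZ _ _ (divD_linear i)) addr0.
rewrite (iter_shift_diff_ext hE).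
have signE m (j1 k1 : int) : iter m (@shift_diff W) (fun j k =>
     \sum_(i < n) (-1) ^ (- (k + i%:Z) - 1) *: divD i (g j (k + i%:Z))) j1 k1 =
   \sum_(i < n) (-1) ^ (- (k1 + i%:Z) - 1) *: divD i (iter m (@shift_sum W) g j1 (k1 + i%:Z)).
  elim: m j1 k1 => [//|m IH] j1 k1 /=; rewrite /shift_diff !IH -sumrB.
  apply: eq_bigr => i _; rewrite /shift_sum (linD _ _ (divD_linear i)) scalerDr.
  congr (_ + _); rewrite -scaleNr.
  have -> : k1 + 1 + i%:Z = k1 + i%:Z + 1 by lia.
  have -> : - (k1 + i%:Z + 1) - 1 = -1 + (- (k1 + i%:Z) - 1) :> int by lia.
  by rewrite expfzDr ?oppr_eq0 ?oner_eq0 // exprN1 invrN1 mulN1r opprK.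
rewrite signE big1 // => i _; rewrite gK ?divD_modes0 ?scaler0 //; lia.
Qed.

End SkewOperator.

Section Arrays.
Variable R : realType.
Local Notation C := (Cx R).
Variable n : nat.
Local Notation idx := {ffun 'I_n -> int}.

Definition un (i : 'I_n) : idx := [ffun j => (j == i)%:Z].

Lemma unE i j : un i j = (j == i)%:Z.
Proof. by rewrite ffunE. Qed.

Lemma idxD (k l : idx) i : (k + l) i = k i + l i.
Proof. by rewrite ffunE. Qed.

Lemma idxN (k : idx) i : (- k) i = - k i.
Proof. by rewrite ffunE. Qed.

Lemma un_add_ge (k : idx) i j : k i <= (k + un j) i.
Proof. by rewrite idxD unE lerDl; case: eqP. Qed.

Lemma sum_un (k : idx) i : \sum_j (k + un i) j = \sum_j k j + 1.
Proof.
rewrite (eq_bigr (fun j => k j + (un i) j)) => [|j _]; last by rewrite idxD.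
rewrite big_split /= [X in _ + X](bigD1 i) //= unE eqxx.
by congr (_ + _); rewrite big1 ?addr0 // => j ji; rewrite unE (negPf ji).
Qed.

Section Diff.
Variable U : zmodType.
Implicit Types (c : idx -> U) (p : 'I_n * 'I_n) (s t : seq ('I_n * 'I_n)).

(* multiplication by x_i - x_j *)
Definition dmul p c : idx -> U := fun k => c (k + un p.1) - c (k + un p.2).

Definition dmuls s c : idx -> U := foldr dmul c s.

Lemma dmulC p q c : dmul p (dmul q c) = dmul q (dmul p c).
Proof.
apply/funext => k; rewrite /dmul.
rewrite (addrAC k (un q.1) (un p.1)) (addrAC k (un q.1) (un p.2)).
rewrite (addrAC k (un q.2) (un p.1)) (addrAC k (un q.2) (un p.2)).
by rewrite !opprD !opprK addrACA.
Qed.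

Lemma dmuls_cat s t c : dmuls (s ++ t) c = dmuls s (dmuls t c).
Proof. by rewrite /dmuls foldr_cat. Qed.

Lemma dmul_dmuls p s c : dmul p (dmuls s c) = dmuls s (dmul p c).
Proof. by elim: s => //= q s IH; rewrite dmulC IH. Qed.

Lemma dmulsC s t c : dmuls s (dmuls t c) = dmuls t (dmuls s c).
Proof. by elim: s => //= q s ->; rewrite dmul_dmuls. Qed.

Lemma dmuls_perm s t c : perm_eq s t -> dmuls s c = dmuls t c.
Proof.
elim: s t => [|p s IH] t; first by rewrite perm_sym => /perm_nilP ->.
move=> pst; have pt : p \in t by rewrite -(perm_mem pst) mem_head.
case/splitPr: pt pst => t1 t2 pst.
have /IH st : perm_eq s (t1 ++ t2).
  rewrite -(perm_cons p); apply: perm_trans pst _.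
  by rewrite -cat1s perm_catCA.
by rewrite /= st !dmuls_cat dmul_dmuls.
Qed.

Lemma dmuls_ext s c c' : c =1 c' -> dmuls s c =1 dmuls s c'.
Proof. by move=> /funext ->. Qed.

Lemma dmuls0 s k : dmuls s (fun=> 0) k = 0.
Proof. by elim: s k => //= p s IH k; rewrite /dmul !IH subrr. Qed.

Lemma dmuls_sum s (J : Type) (r : seq J) (c : J -> idx -> U) k :
  dmuls s (fun k => \sum_(j <- r) c j k) k = \sum_(j <- r) dmuls s (c j) k.
Proof.
elim: s k => //= p s IH k; rewrite /dmul !IH -sumrB.
by apply: eq_bigr.
Qed.

(* a support bounded above in the i-th mode stays so *)
Lemma dmuls_vanish_above s c i (K : int) :
  (forall k : idx, K <= k i -> c k = 0) ->
  forall k : idx, K <= k i -> dmuls s c k = 0.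
Proof.
move=> h; elim: s => //= p s IH k Kk; rewrite /dmul !IH ?subrr //.
  exact: le_trans Kk (un_add_ge _ _ _).
exact: le_trans Kk (un_add_ge _ _ _).
Qed.

Lemma dmuls_vanish_below s c (B : int) :
  (forall k : idx, \sum_i k i < B -> c k = 0) ->
  forall k : idx, \sum_i k i < B - (size s)%:Z -> dmuls s c k = 0.
Proof.
move=> h; elim: s => [|p s IH] k /=; first by rewrite subr0; exact: h.
move=> kB; have kB' : \sum_i k i + 1 < B - (size s)%:Z.
  by move: kB; move: (\sum_i k i) => x; lia.
by rewrite /dmul !IH ?subrr // sum_un.
Qed.

Lemma dmuls_nseq2 N i j c (H : int -> int -> U) (k : idx) : i != j ->
  (forall a b : nat, c (k + un i *+ a + un j *+ b) = H (k i + a%:Z) (k j + b%:Z)) ->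
  dmuls (nseq N (i, j)) c k = iter N (@shift_diff U) H (k i) (k j).
Proof.
move=> ij; elim: N k => [|N IH] k h.
  by have := h 0%N 0%N; rewrite !mulr0n !addr0.
rewrite /= /dmul /= /shift_diff !IH.
- by rewrite !idxD !unE !eqxx (negPf ij) eq_sym (negPf ij) !addr0.
- move=> a b; have -> : k + un j + un i *+ a + un j *+ b = k + un i *+ a + un j *+ b.+1.
    by rewrite mulrS addrA (addrAC k (un j)).
  rewrite h !idxD !unE eqxx (negPf ij) addr0; congr H; lia.
move=> a b; have -> : k + un i + un i *+ a + un j *+ b = k + un i *+ a.+1 + un j *+ b.
  by rewrite mulrS addrA.
rewrite h !idxD !unE eqxx eq_sym (negPf ij) addr0; congr H; lia.
Qed.

End Diff.

Lemma dmul_lin (U : lmodType C) p a (c c' : idx -> U) k : dmul p (fun k => a *: c k + c' k) k = a *: dmul p c k + dmul p c' k.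
Proof. by rewrite /dmul scalerBr opprD addrACA. Qed.

Lemma dmuls_lin (U : lmodType C) s a (c c' : idx -> U) k : dmuls s (fun k => a *: c k + c' k) k = a *: dmuls s c k + dmuls s c' k.
Proof.
elim: s k => //= p s IH k; rewrite -dmul_lin; congr dmul.
by apply/funext => l; exact: IH.
Qed.


(* an operation not depending on the shifted modes commutes with dmuls *)
Lemma dmuls_apply (U U' : zmodType) s (G : idx -> U -> U') (h : idx -> U) :
  (forall k x y, G k (x - y) = G k x - G k y) ->
  (forall k p, p \in s -> G (k + un p.1) = G k /\ G (k + un p.2) = G k) ->
  forall k, dmuls s (fun k => G k (h k)) k = G k (dmuls s h k).
Proof.
move=> GB Gs; elim: s Gs => [//|p s IH] Gs k /=.
have {}IH : dmuls s (fun k => G k (h k)) = fun k => G k (dmuls s h k).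
  apply/funext => l; apply: IH => k' q qs; apply: Gs; by rewrite in_cons qs orbT.
rewrite IH /dmul GB; have [-> ->] := Gs k p (mem_head _ _); by [].
Qed.

Lemma dmuls_additive (U U' : zmodType) s (G : U -> U') (h : idx -> U) k :
  (forall x y, G (x - y) = G x - G y) ->
  dmuls s (fun k => G (h k)) k = G (dmuls s h k).
Proof. by move=> GB; apply: (dmuls_apply (G := fun=> G)). Qed.

(* The linear factors of prod_(i<j) (x_i - x_j)^(N i j), for i and j in s. *)
Definition row_factors (N : 'I_n -> 'I_n -> nat) i (js : seq 'I_n) :=
  flatten [seq nseq (N i j) (i, j) | j <- js].

Fixpoint factors (N : 'I_n -> 'I_n -> nat) (s : seq 'I_n) :=
  if s is i :: s' then row_factors N i s' ++ factors N s' else [::].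

Definition dens N := factors N (enum 'I_n).

Lemma factors_split N s1 i s2 : exists r, perm_eq (factors N (s1 ++ i :: s2)) (row_factors N i s2 ++ r).
Proof.
elim: s1 => [|j s1 [r IH]] /=; first by exists (factors N s2).
exists (row_factors N j (s1 ++ i :: s2) ++ r).
by rewrite perm_sym perm_catCA perm_cat2l perm_sym.
Qed.

Lemma mem_row_factors N i js p : p \in row_factors N i js -> p.1 = i /\ p.2 \in js.
Proof.
move=> /flatten_mapP[j jj]; rewrite mem_nseq => /andP[_ /eqP ->]; by [].
Qed.

Lemma mem_factors N s p : sorted (fun i j : 'I_n => (i < j)%N) s ->
  p \in factors N s -> (p.1 < p.2)%N /\ p.1 \in s /\ p.2 \in s.
Proof.
have tr : transitive (fun i j : 'I_n => (i < j)%N) by move=> ? ? ?; exact: ltn_trans.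
elim: s => //= i s IH; rewrite path_sortedE // => /andP[/allP is_ ss].
rewrite mem_cat => /orP[/mem_row_factors[-> p2]|/(IH ss)[p12 [p1 p2]]].
  by rewrite is_ // !in_cons eqxx p2 orbT.
by rewrite !in_cons p1 p2 !orbT.
Qed.

Lemma enum_ord_sorted : sorted (fun i j : 'I_n => (i < j)%N) (enum 'I_n).
Proof. by have := iota_ltn_sorted 0 n; rewrite -val_enum_ord sorted_map. Qed.

Lemma mem_dens N p : p \in dens N -> (p.1 < p.2)%N.
Proof. by case/(mem_factors enum_ord_sorted). Qed.

Lemma prod_factors N s (F : 'I_n * 'I_n -> C) : sorted (fun i j : 'I_n => (i < j)%N) s ->
  \prod_(p <- factors N s) F p =
  \prod_(i <- s) \prod_(j <- s | (i < j)%N) F (i, j) ^+ N i j.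
Proof.
have tr : transitive (fun i j : 'I_n => (i < j)%N) by move=> ? ? ?; exact: ltn_trans.
elim: s => [|i s IH]; first by rewrite !big_nil.
rewrite /= path_sortedE // => /andP[/allP is_ ss].
rewrite big_cat /= IH // big_cons big_cons ltnn; congr (_ * _).
  rewrite /row_factors big_flatten big_map [RHS]big_seq_cond [LHS]big_seq.
  rewrite [RHS](eq_bigl (fun j => j \in s)) => [|j]; last first.
    by apply/andb_idr => js; exact: is_.
  by apply: eq_bigr => j _; rewrite big_nseq; elim: (N i j) => //= m ->; rewrite exprS.
rewrite big_seq [RHS]big_seq; apply: eq_bigr => j js; rewrite big_cons.
by rewrite ltnNge ltnW // is_.
Qed.

Lemma prod_dens N (z : 'I_n -> C) : \prod_(p <- dens N) (z p.1 - z p.2) = diag_den N z.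
Proof.
rewrite (prod_factors _ (fun p => z p.1 - z p.2) enum_ord_sorted) /diag_den.
by rewrite big_enum; apply: eq_bigr => i _; rewrite big_enum_cond.
Qed.

End Arrays.

Section LocalProducts.
Variable R : realType.
Local Notation C := (Cx R).

Lemma linB (U1 U2 : lmodType C) (f : U1 -> U2) : linear f -> forall x y, f (x - y) = f x - f y.
Proof. by move=> lf x y; rewrite (linD _ _ lf) -scaleN1r (linZ _ _ lf) scaleN1r. Qed.

Variables (n : nat) (U : lmodType C).
Local Notation idx := {ffun 'I_n -> int}.
Variables (a : 'I_n -> bool -> int -> U -> U) (N : 'I_n -> 'I_n -> nat).

Definition field_at i k x := a i false k x + a i true k x.

Definition field_prod (s : seq 'I_n) (k : idx) (w : U) : U :=
  foldr (fun i x => field_at i (k i) x) w s.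

Definition local_at i j : Prop := forall p q w l m,
  iter (N i j) (@shift_diff U) (fun l m =>
    a i p l (a j q m w) - (-1) ^+ (p && q) *: a j q m (a i p l w)) l m = 0.

Lemma field_prod_cons i s k w : field_prod (i :: s) k w = field_at i (k i) (field_prod s k w).
Proof. by []. Qed.

Lemma field_prod_cat s t k w : field_prod (s ++ t) k w = field_prod s k (field_prod t k w).
Proof. by rewrite /field_prod foldr_cat. Qed.

Lemma un_mulE (i j : 'I_n) (b : nat) : (un i *+ b) j = (if j == i then b else 0)%:Z.
Proof.
elim: b => [|b IH]; first by rewrite mulr0n ffunE; case: ifP.
by rewrite mulrSr idxD IH unE; case: ifP => _; lia.
Qed.

Lemma field_prod_shift s k j w : j \notin s -> field_prod s (k + un j) w = field_prod s k w.
Proof.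
elim: s => [//|i s IH]; rewrite in_cons negb_or => /andP[ji js].
by rewrite !field_prod_cons IH // idxD unE eq_sym (negPf ji) addr0.
Qed.

Lemma field_prod_shift_mul s k j (m : nat) w : j \notin s ->
  field_prod s (k + un j *+ m) w = field_prod s k w.
Proof.
move=> js; elim: m => [|m IH]; first by rewrite mulr0n addr0.
by rewrite mulrSr addrA field_prod_shift.
Qed.

Hypothesis a_lin : forall i p k, linear (a i p k).

Lemma field_at_linear i k : linear (field_at i k).
Proof. by move=> c x y; rewrite /field_at !a_lin addrACA scalerDr. Qed.

Lemma field_prod_linear s k : linear (field_prod s k).
Proof.
elim: s => [//|i s IH] c x y.
by rewrite !field_prod_cons IH field_at_linear.
Qed.

Hypothesis a_local : forall i j : 'I_n, (i < j)%N -> local_at i j.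

Lemma dmulsD s (c c' : idx -> U) k : dmuls s (fun k => c k + c' k) k = dmuls s c k + dmuls s c' k.
Proof.
rewrite -[dmuls s c k]scale1r -dmuls_lin; apply: dmuls_ext => l.
by rewrite scale1r.
Qed.

Lemma dmulsZ s x (c : idx -> U) k : dmuls s (fun k => x *: c k) k = x *: dmuls s c k.
Proof.
rewrite -[RHS]addr0 -(dmuls0 U s k) -dmuls_lin; apply: dmuls_ext => l.
by rewrite addr0.
Qed.

Lemma swap_fields (i j : 'I_n) p q (x : idx -> U) :
  (i < j)%N -> (forall k, x (k + un i) = x k) -> (forall k, x (k + un j) = x k) ->
  dmuls (nseq (N i j) (i, j)) (fun k => a i p (k i) (a j q (k j) (x k))) =
  fun k => (-1) ^+ (p && q) *:
    dmuls (nseq (N i j) (i, j)) (fun k => a j q (k j) (a i p (k i) (x k))) k.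
Proof.
move=> ij xi xj; apply/funext => l; apply/eqP; rewrite -subr_eq0 -dmulsZ; apply/eqP.
have nij : i != j by apply/eqP => E; rewrite E ltnn in ij.
have := @dmulsD (nseq (N i j) (i, j)) (fun k => a i p (k i) (a j q (k j) (x k)))
  (fun k => - 1 *: ((-1) ^+ (p && q) *: a j q (k j) (a i p (k i) (x k)))) l.
rewrite [in X in _ + X]dmulsZ scaleN1r => <-.
rewrite (@dmuls_nseq2 _ _ _ _ _ _ (fun l' m' =>
     a i p l' (a j q m' (x l)) - (-1) ^+ (p && q) *: a j q m' (a i p l' (x l)))) //.
  exact: a_local.
have xi' k b : x (k + un i *+ b) = x k.
  by elim: b => [|b IH]; rewrite ?mulr0n ?addr0 // mulrSr addrA xi.
have xj' k b : x (k + un j *+ b) = x k.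
  by elim: b => [|b IH]; rewrite ?mulr0n ?addr0 // mulrSr addrA xj.
move=> b c; rewrite scaleN1r xj' xi' !idxD !un_mulE !eqxx (negPf nij) eq_sym (negPf nij).
by rewrite !addr0.
Qed.

Section OneField.
Variables (w0 : U) (i : 'I_n) (K : int).
Hypothesis a_trunc : forall p (k : int), K <= k -> a i p k w0 = 0.

Lemma row_factors_vanish p js : uniq js -> (forall j : 'I_n, j \in js -> (i < j)%N) ->
  forall k : idx, K <= k i ->
  dmuls (row_factors N i js) (fun k => a i p (k i) (field_prod js k w0)) k = 0.
Proof.
elim: js => [|j js IH] ujs ltjs k Kk; first by rewrite /= a_trunc.
have {ujs} [jjs ujs] : j \notin js /\ uniq js by move: ujs => /= /andP.
have ij : (i < j)%N by apply: ltjs; rewrite mem_head.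
have ijs : i \notin js.
  by apply/negP => h; have := ltjs i; rewrite in_cons h orbT ltnn => /(_ isT).
have {}IH (k' : idx) (Kk' : K <= k' i) : dmuls (row_factors N i js)
    (fun k => a i p (k i) (field_prod js k w0)) k' = 0.
  by apply: IH => // l ljs; apply: ltjs; rewrite in_cons ljs orbT.
have E q : dmuls (row_factors N i js) (dmuls (nseq (N i j) (i, j))
    (fun k => a i p (k i) (a j q (k j) (field_prod js k w0)))) k = 0.
  rewrite swap_fields //; try by move=> k'; exact: field_prod_shift.
  rewrite dmulsZ dmulsC (@dmuls_vanish_above _ _ _ _ i K) ?scaler0 //.
  move=> k' Kk'.
  rewrite (@dmuls_apply _ _ _ _ (fun k => a j q (k j))
    (fun k => a i p (k i) (field_prod js k w0))) ?IH ?(lin0 (a_lin _ _ _)) //.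
    by move=> l x y; exact: linB.
  move=> l pp /mem_row_factors[-> p2].
  rewrite !idxD !unE; have -> : (j == i) = false by apply/eqP => E; rewrite E ltnn in ij.
  have -> : (j == pp.2) = false by apply/eqP => E; rewrite E p2 in jjs.
  by rewrite !addr0.
rewrite [row_factors N i (j :: js)]/(nseq (N i j) (i, j) ++ row_factors N i js).
rewrite dmuls_cat dmulsC.
have -> : dmuls (nseq (N i j) (i, j)) (fun k => a i p (k i) (field_prod (j :: js) k w0)) =
   fun k => dmuls (nseq (N i j) (i, j))
              (fun k => a i p (k i) (a j false (k j) (field_prod js k w0))) k +
            dmuls (nseq (N i j) (i, j))
              (fun k => a i p (k i) (a j true (k j) (field_prod js k w0))) k.
  apply/funext => l; rewrite -dmulsD; apply: dmuls_ext => l'.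
  by rewrite field_prod_cons /field_at (linD _ _ (a_lin _ _ _)).
by rewrite dmulsD !E addr0.
Qed.

(* prod_(i<j) (x_i - x_j)^(N i j) a_1(x_1) ... a_n(x_n) w0 has x_i-powers
   bounded below by those of a_i(x_i) w0. *)
Lemma local_product_vanish (k : idx) : K <= k i ->
  dmuls (dens N) (fun k => field_prod (enum 'I_n) k w0) k = 0.
Proof.
move=> Kk; have := mem_enum 'I_n i; have := enum_uniq 'I_n; have := enum_ord_sorted n.
rewrite /dens => srt ue; rewrite inE => ie; move: srt ue.
case/splitPr: ie => s1 s2 srt ue.
have tr : transitive (fun i j : 'I_n => (i < j)%N) by move=> ? ? ?; exact: ltn_trans.
have [r pr] := factors_split N s1 i s2; rewrite (dmuls_perm _ pr).
move: ue; rewrite cat_uniq => /and3P[u1 u2 /andP[is2 us2]].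
have lt2 (j : 'I_n) : j \in s2 -> (i < j)%N.
  have := subseq_sorted tr (suffix_subseq s1 (i :: s2)) srt.
  by rewrite /= path_sortedE // => /andP[/allP h _]; exact: h.
rewrite dmuls_cat dmulsC; apply: (@dmuls_vanish_above _ _ _ _ i K) Kk.
move=> k' Kk'.
have ns1 (j : 'I_n) : j \in i :: s2 -> j \notin s1.
  by move=> js; apply/negP => js1; case/negP: u2; apply/hasP; exists j.
have E : (fun k => field_prod (s1 ++ i :: s2) k w0) =
    (fun k => field_prod s1 k (field_prod (i :: s2) k w0)).
  by apply/funext => l; rewrite field_prod_cat.
rewrite E (dmuls_apply (G := fun k => field_prod s1 k)).
- have -> : dmuls (row_factors N i s2) (fun k => field_prod (i :: s2) k w0) k' = 0.
    have -> : (fun k : idx => field_prod (i :: s2) k w0) = fun k =>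
       a i false (k i) (field_prod s2 k w0) + a i true (k i) (field_prod s2 k w0) by [].
    by rewrite dmulsD !row_factors_vanish ?addr0.
  exact: lin0 (field_prod_linear _ _).
- by move=> l x y; apply: linB; exact: field_prod_linear.
move=> l p /mem_row_factors[-> p2]; split; apply/funext => x; apply: field_prod_shift; apply: ns1.
  exact: mem_head.
by rewrite in_cons p2 orbT.
Qed.

End OneField.
End LocalProducts.

Section Evaluation.
Variable R : realType.
Local Notation C := (Cx R).
Variable n : nat.
Local Notation idx := {ffun 'I_n -> int}.
Implicit Types (z : 'I_n -> C) (k : idx).

Definition mon z k : C := \prod_i z i ^ (- k i - 1).

Definition finsupp (U : nmodType) (P : idx -> U) : Prop :=
  exists A : {fset idx}, forall k, k \notin A -> P k = 0.

Definition evalA (U : lmodType C) (P : idx -> U) z : U :=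
  \sum_(k \in [set: idx]) mon z k *: P k.

Lemma evalAE (U : lmodType C) (P : idx -> U) z (A : {fset idx}) :
  (forall k, k \notin A -> P k = 0) -> evalA P z = \sum_(k <- A) mon z k *: P k.
Proof. by move=> hA; apply: fsbigTE => k /hA ->; rewrite scaler0. Qed.

Lemma finsupp_lin (U : lmodType C) a (P Q : idx -> U) :
  finsupp P -> finsupp Q -> finsupp (fun k => a *: P k + Q k).
Proof.
move=> [A hA] [B hB]; exists (A `|` B)%fset => k.
by rewrite in_fsetU negb_or => /andP[/hA -> /hB ->]; rewrite scaler0 addr0.
Qed.

Lemma evalA_lin (U : lmodType C) a (P Q : idx -> U) z : finsupp P -> finsupp Q ->
  evalA (fun k => a *: P k + Q k) z = a *: evalA P z + evalA Q z.
Proof.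
move=> [A hA] [B hB].
have hA' k : k \notin (A `|` B)%fset -> P k = 0.
  by rewrite in_fsetU negb_or => /andP[/hA].
have hB' k : k \notin (A `|` B)%fset -> Q k = 0.
  by rewrite in_fsetU negb_or => /andP[_ /hB].
rewrite (evalAE _ hA') (evalAE _ hB') (@evalAE _ _ _ (A `|` B)%fset); last first.
  by move=> k h; rewrite hA' // hB' // scaler0 addr0.
rewrite scaler_sumr -big_split; apply: eq_bigr => k _ /=.
by rewrite scalerDr; congr (_ + _); rewrite !scalerA mulrC.
Qed.

Lemma evalA_linear (U U' : lmodType C) (f : U -> U') (P : idx -> U) z : linear f -> finsupp P ->
  evalA (fun k => f (P k)) z = f (evalA P z).
Proof.
move=> lf [A hA]; rewrite (evalAE _ hA) (@evalAE _ _ _ A); last first.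
  by move=> k /hA ->; rewrite (lin0 lf).
by rewrite (lin_sum _ _ lf); apply: eq_bigr => k _; rewrite (linZ _ _ lf).
Qed.

Lemma finsupp_comp (U U' : nmodType) (f : U -> U') (P : idx -> U) :
  f 0 = 0 -> finsupp P -> finsupp (fun k => f (P k)).
Proof. by move=> f0 [A hA]; exists A => k /hA ->. Qed.

Lemma finsupp_box (U : nmodType) (P : idx -> U) (K : 'I_n -> int) (B : int) :
  (forall k i, K i <= k i -> P k = 0) ->
  (forall k, \sum_i k i < B -> P k = 0) -> finsupp P.
Proof.
move=> hK hB.
pose T : nat := (\sum_i absz (K i) + absz B)%N.
have hT k : P k != 0 -> forall i, - T%:Z <= k i < T%:Z.
  move=> nz i.
  have k1 j : k j < K j by rewrite ltNge; apply/negP => /hK h; rewrite h eqxx in nz.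
  have k2 : B <= \sum_i k i by rewrite leNgt; apply/negP => /hB h; rewrite h eqxx in nz.
  have k3 : \sum_(j | j != i) k j <= (\sum_(j | j != i) absz (K j))%N%:Z.
    rewrite (big_morph Posz PoszD (erefl _)); apply: ler_sum => j _.
    by have := k1 j; lia.
  have := k1 i; move: k2 k3; rewrite /T (bigD1 i) //= [in X in _ -> _ -> X](bigD1 i) //=.
  move: (\sum_(j | j != i) k j) (\sum_(j | j != i) absz (K j))%N => x y; lia.
clearbody T.
pose f (g : {ffun 'I_n -> 'I_(T + T).+1}) : idx := [ffun i => (g i)%:Z - T%:Z].
exists [fset f g | g in {: {ffun 'I_n -> 'I_(T + T).+1}}]%fset => k kA.
apply/eqP; apply: contraT => /hT hk; case/negP: kA; apply/imfsetP.
exists [ffun i => inord (absz (k i + T%:Z))] => //=.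
by apply/ffunP => i; rewrite !ffunE inordK; have /andP[] := hk i; move: (k i) => x; lia.
Qed.

Lemma abs_cvg_evalA (P : idx -> C) z : finsupp P ->
  abs_cvg_to (fun k => P k * mon z k) (evalA (U := C^o) P z).
Proof.
move=> [A hA]; rewrite (evalAE _ hA).
under eq_bigr do rewrite /GRing.scale /= mulrC.
by apply: abs_cvg_to_finite => k /hA ->; rewrite mul0r.
Qed.

Lemma evalA_poly (P : idx -> C) : finsupp P -> (forall k i, 0 <= k i -> P k = 0) ->
  exists p : mpoly n C, forall z, evalA (U := C^o) P z = meval z p.
Proof.
move=> [A hA] neg.
exists (\sum_(k <- A) mpolyC n (P k) * mpolyX C (Multinom [tuple absz (- k i - 1)%R | i < n])) => z.
rewrite (evalAE _ hA) raddf_sum; apply: eq_bigr => k _ /=.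
rewrite mevalM mevalC /GRing.scale /= mulrC.
have [->|nz] := eqVneq (P k) 0; first by rewrite !mul0r.
congr (_ * _); rewrite mevalX; apply: eq_bigr => i _; rewrite mnmE exprnP.
congr (_ ^ _); have : k i < 0 by rewrite ltNge; apply/negP => /neg h; rewrite h eqxx in nz.
by move: (k i) => x; lia.
Qed.

Lemma evalA_poly0 (P : idx -> C) (M : nat) : finsupp P -> (forall k i, M%:Z <= k i -> P k = 0) ->
  exists p : mpoly n C, forall z, (forall i, z i != 0) ->
    evalA (U := C^o) P z = meval z p / (\prod_i z i) ^+ M.
Proof.
move=> [A hA] hM.
pose P' k := P (k + [ffun=> M%:Z]).
have fP' : finsupp P'.
  exists [fset k - [ffun=> M%:Z] | k in A]%fset => k kA; apply: hA.
  apply: contra kA => kA; apply/imfsetP; exists (k + [ffun=> M%:Z]) => //=.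
  by rewrite addrK.
have [k i ki|p hp] := evalA_poly fP'.
  by apply: (hM _ i); rewrite !ffunE; move: (k i) ki => x; lia.
exists p => z z0; rewrite -hp.
have hPP : evalA (U := C^o) P z * (\prod_i z i) ^+ M = evalA (U := C^o) P' z.
  have h1 := abs_cvg_toZ ((\prod_i z i) ^+ M) (abs_cvg_evalA z (ex_intro _ A hA)).
  have h2 := abs_cvg_evalA z fP'.
  have ih : injective (fun k : idx => k + [ffun=> M%:Z]) by exact: addIr.
  rewrite mulrC; apply: abs_cvg_to_uniq h2.
  have {}h1 := (abs_cvg_to_reindex (F := fun k => (\prod_i z i) ^+ M * (P k * mon z k)) _ ih _).2 h1.
  have off (k : idx) : (forall j, k <> j + [ffun=> M%:Z]) ->
      (\prod_i z i) ^+ M * (P k * mon z k) = 0.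
    by move=> h; case: (h (k - [ffun=> M%:Z])); rewrite subrK.
  apply: abs_cvg_to_ext (h1 off) => k; rewrite mulrCA /P'; congr (_ * _).
    rewrite /mon -prodrXl -big_split; apply: eq_bigr => i _ /=.
    by rewrite exprnP -expfzDr // !ffunE; congr (_ ^ _); move: (k i) => x; lia.
by rewrite -hPP mulfK // expf_neq0 //; apply/prodf_neq0.
Qed.

(* the arrays for which evaluation at a point with some zero coordinates makes sense *)
Definition good z (c : idx -> C) := forall k i, z i = 0 -> 0 <= k i -> c k = 0.

Lemma good_dmuls z s c : good z c -> good z (dmuls s c).
Proof.
move=> g k i zi k0; apply: (@dmuls_vanish_above _ _ s c i 0) k0 => k' h.
exact: g zi h.
Qed.

Lemma good_neq0 z c : (forall i, z i != 0) -> good z c.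
Proof. by move=> h k i z0; have := h i; rewrite z0 eqxx. Qed.

Lemma mon_un z k i : z i != 0 -> mon z k = z i * mon z (k + un i).
Proof.
move=> zi; rewrite /mon (bigD1 i) // [in RHS](bigD1 i) //= mulrA idxD unE eqxx.
have -> : - (k i + true%:Z) - 1 = - 1 + (- k i - 1) by move: (k i) => x; lia.
rewrite [in RHS]expfzDr // exprN1 mulrA mulfV // mul1r; congr (_ * _).
apply: eq_bigr => j ji; rewrite idxD unE; congr (_ ^ _).
by rewrite (negPf ji); move: (k j) => x; lia.
Qed.

Lemma abs_cvg_un z c i s : good z c -> abs_cvg_to (fun k => c k * mon z k) s ->
  abs_cvg_to (fun k => c (k + un i) * mon z k) (z i * s).
Proof.
move=> g h; have [z0|z0] := eqVneq (z i) 0.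
  rewrite z0 mul0r; apply: abs_cvg_to_ext (abs_cvg_to0 R _) => k.
  have [ki|ki] := leP 0 ((k + un i) i); first by rewrite (g _ i) ?mul0r.
  rewrite /mon (bigD1 i) //= z0 exp0rz.
  by move: ki; rewrite idxD unE eqxx; move: (k i) => x; case: eqP => [|_ _]; [lia|rewrite mul0r mulr0].
have ih : injective (fun k : idx => k + un i) by exact: addIr.
have h1 := abs_cvg_toZ (z i) h.
have {}h1 := (abs_cvg_to_reindex (F := fun k => z i * (c k * mon z k)) _ ih _).2 h1.
have off (k : idx) : (forall j, k <> j + un i) -> z i * (c k * mon z k) = 0.
  by move=> hk; case: (hk (k - un i)); rewrite subrK.
by apply: abs_cvg_to_ext (h1 off) => k; rewrite mulrCA -mon_un.
Qed.

Lemma abs_cvg_dmuls z c s x : good z c -> abs_cvg_to (fun k => c k * mon z k) x ->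
  abs_cvg_to (fun k => dmuls s c k * mon z k) (\prod_(p <- s) (z p.1 - z p.2) * x).
Proof.
move=> g h; elim: s => [|p s IH]; first by rewrite big_nil mul1r.
rewrite big_cons -mulrA mulrBl; have gd := good_dmuls s g.
apply: abs_cvg_to_ext (abs_cvg_toB (abs_cvg_un p.1 gd IH) (abs_cvg_un p.2 gd IH)) => k.
by rewrite /= /dmul mulrBl.
Qed.

Definition trunc_dir (c : idx -> C) (p : 'I_n * 'I_n) : Prop :=
  forall k, exists m0, forall m, (m0 <= m)%N -> c (k + (un p.2 - un p.1) *+ m) = 0.

Lemma trunc_dir_dmuls s c p : trunc_dir c p -> trunc_dir (dmuls s c) p.
Proof.
move=> h; elim: s => //= q s IH k.
have [m1 h1] := IH (k + un q.1); have [m2 h2] := IH (k + un q.2).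
exists (maxn m1 m2) => m; rewrite geq_max => /andP[mm1 mm2].
by rewrite /dmul (addrAC k _ (un q.1)) (addrAC k _ (un q.2)) h1 // h2 // subrr.
Qed.

Lemma expz_split (t : C) (e : int) (m : nat) : t != 0 \/ m%:Z <= e -> t ^ e = t ^ (e - m%:Z) * t ^+ m.
Proof.
case=> [t0|me]; first by rewrite exprnP -expfzDr // subrK.
have [a ea] : exists a : nat, e - m%:Z = a%:Z by exists (absz (e - m%:Z)%R); lia.
have -> : e = (a + m)%N%:Z by lia.
by rewrite PoszD addrK -PoszD -!exprnP exprD.
Qed.

Lemma dmuls_bounded z s c : (forall p, p \in s -> `|z p.2| < `|z p.1|) ->
  (forall p, p \in s -> trunc_dir c p) -> good z c ->
  abs_bounded (fun k => dmuls s c k * mon z k) -> abs_bounded (fun k => c k * mon z k).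
Proof.
elim: s => //= p s IH hz T g bd; apply: IH => //.
- by move=> q qs; apply: hz; rewrite in_cons qs orbT.
- by move=> q qs; apply: T; rewrite in_cons qs orbT.
have pz := hz p (mem_head _ _); have Tp := T p (mem_head _ _).
have z1 : z p.1 != 0 by rewrite -normr_gt0; exact: le_lt_trans (normr_ge0 _) pz.
have p12 : p.1 != p.2 by apply/eqP => E; rewrite E ltxx in pz.
apply: (@division_bounded R _ (dmuls s c) (dmul p (dmuls s c)) (mon z)
    (un p.1) (un p.2) (z p.1) (z p.2)) bd => //.
  exact: trunc_dir_dmuls.
move=> k m; set k' := k - un p.1 + _ => nz.
have k'E i : k' i = k i - (un p.1 i) + (un p.2 i - un p.1 i) * m%:Z.
  rewrite /k' idxD idxD idxN.
  congr (_ + _); elim: (m) => [|m' IH]; first by rewrite mulr0n mulr0 ffunE.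
  rewrite mulrSr idxD IH idxD idxN.
  lia.
have p21 : (p.2 == p.1) = false by rewrite eq_sym (negPf p12).
have k'1 : k' p.1 = k p.1 - 1 - m%:Z by rewrite k'E !unE eqxx (negPf p12); move: (k p.1) => x; lia.
have k'2 : k' p.2 = k p.2 + m%:Z by rewrite k'E !unE eqxx p21; move: (k p.2) => x; lia.
have split_mon l : mon z l = z p.1 ^ (- l p.1 - 1) * (z p.2 ^ (- l p.2 - 1) *
    \prod_(i | (i != p.1) && (i != p.2)) z i ^ (- l i - 1)).
  by rewrite /mon (bigD1 p.1) //= (bigD1 p.2) // p21.
have rest : \prod_(i | (i != p.1) && (i != p.2)) z i ^ (- k i - 1) =
   \prod_(i | (i != p.1) && (i != p.2)) z i ^ (- k' i - 1).
  apply: eq_bigr => i /andP[i1 i2]; rewrite k'E !unE (negPf i1) (negPf i2).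
  by congr (_ ^ _); move: (k i) => x; lia.
rewrite !split_mon rest k'1 k'2.
have -> : z p.2 ^ (- k p.2 - 1) = z p.2 ^ (- (k p.2 + m%:Z) - 1) * z p.2 ^+ m.
  rewrite (@expz_split _ _ m); last first.
    have [z20|] := eqVneq (z p.2) 0; last by left.
    right; have gb := good_dmuls (p :: s) g; have : ~ (0 <= k' p.2).
      by move=> /(gb k' p.2 z20) E; move: nz; rewrite /= in E; rewrite E eqxx.
    by rewrite k'2; move: (k p.2) => x; lia.
  by congr (_ ^ _ * _); move: (k p.2) => x; lia.
have -> : z p.1 ^ (- k p.1 - 1) = z p.1 ^ (- (k p.1 - 1 - m%:Z) - 1) / z p.1 ^+ m.+1.
  by rewrite exprnN -expfzDr //; congr (_ ^ _); move: (k p.1) => x; lia.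
set A := _ ^ _; set B := _ ^ _; set D := \prod_(i | _) _.
by field; rewrite expf_neq0.
Qed.

Lemma dmuls_cvg z s c : (forall p, p \in s -> `|z p.2| < `|z p.1|) ->
  (forall p, p \in s -> trunc_dir c p) -> good z c -> finsupp (dmuls s c) ->
  abs_cvg_to (fun k => c k * mon z k)
    (evalA (U := C^o) (dmuls s c) z / \prod_(p <- s) (z p.1 - z p.2)).
Proof.
move=> hz T g fs; have h := abs_cvg_evalA z fs.
have [x hx] := abs_bounded_cvg (dmuls_bounded hz T g (abs_cvg_to_bounded h)).
have := abs_cvg_to_uniq h (abs_cvg_dmuls s g hx) => ->.
rewrite mulrAC mulfV ?mul1r // prodf_seq_neq0; apply/allP => p ps /=.
by rewrite subr_eq0; apply/eqP => E; have := hz p ps; rewrite E ltxx.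
Qed.

End Evaluation.

Section RegularArrays.
Variable R : realType.
Local Notation C := (Cx R).
Variables (n : nat) (W : gradedSpace R).
Local Notation idx := {ffun 'I_n -> int}.
Implicit Types (N : 'I_n -> 'I_n -> nat) (c : idx -> W) (z : 'I_n -> C).

(* c is the expansion in |x_1| > ... > |x_n| of a rational function whose poles
   at x_i = x_j have order at most N i j and whose poles at x_i = 0 have order
   at most M *)
Definition regular N (M : nat) c : Prop :=
  [/\ forall r, finsupp (fun k => wpr r (dmuls (dens N) c k)),
      forall (k : idx) i, M%:Z <= k i -> dmuls (dens N) c k = 0 &
      forall i j : 'I_n, (i < j)%N -> forall k, exists m0, forall m,
        (m0 <= m)%N -> c (k + (un j - un i) *+ m) = 0].

Definition rat_fun N (D : set ('I_n -> C)) c z (r : C) : W :=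
  if `[< D z >] then (diag_den N z)^-1 *: evalA (fun k => wpr r (dmuls (dens N) c k)) z
  else 0.

Lemma rat_fun_wbar N D c z : (forall r, finsupp (fun k => wpr r (dmuls (dens N) c k))) ->
  wbar (rat_fun N D c z).
Proof.
move=> fs r; rewrite /wt /rat_fun; case: ifP => _; last first.
  exact: lin0 (@wpr_linear _ W r).
rewrite (linZ _ _ (@wpr_linear _ W r)) -evalA_linear; [|exact: wpr_linear|exact: fs].
have -> : (fun k => wpr r (wpr r (dmuls (dens N) c k))) = (fun k => wpr r (dmuls (dens N) c k)).
  by apply/funext => k; rewrite wprM eqxx.
by [].
Qed.

Lemma pairing_gdual (w' : {scalar W}) (A : {fset C}) (f : C -> W) :
  (forall r, r \notin A -> forall w, w' (wpr r w) = 0) -> wbar f ->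
  pairing w' f = \sum_(r <- A) w' (f r).
Proof. by move=> hA wf; apply: fsbigTE => r /hA h; rewrite -(wf r). Qed.

Lemma finsupp_gdual N c (w' : {scalar W}) : gdual w' ->
  (forall r, finsupp (fun k => wpr r (dmuls (dens N) c k))) ->
  finsupp (dmuls (dens N) (fun k => w' (c k))).
Proof.
move=> gw fs; have [A [wA _]] := gdual_supp gw.
have [B hB] := choice fs.
exists (\bigcup_(r <- A) B r)%fset => k kB.
rewrite (@dmuls_additive _ _ _ _ w'); last by move=> x y; rewrite raddfB.
rewrite wA big_seq big1 // => r rA; rewrite hB ?raddf0 //.
apply: contra kB => kB; apply/bigfcupP; exists r => //; by rewrite rA.
Qed.

Lemma pairing_rat_fun N (D : set ('I_n -> C)) c z (w' : {scalar W}) : gdual w' ->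
  (forall r, finsupp (fun k => wpr r (dmuls (dens N) c k))) -> D z ->
  pairing w' (rat_fun N D c z) =
  evalA (U := C^o) (dmuls (dens N) (fun k => w' (c k))) z / diag_den N z.
Proof.
move=> gw fs Dz; have [A [wA wA0]] := gdual_supp gw.
rewrite (pairing_gdual wA0 (rat_fun_wbar _ _ fs)) /rat_fun asboolT //.
under eq_bigr do rewrite linearZ /=.
rewrite -mulr_sumr mulrC; congr (_ / _).
have [B hB] := choice fs.
have E : dmuls (dens N) (fun k => w' (c k)) = fun k => \sum_(r <- A) w' (wpr r (dmuls (dens N) c k)).
  by apply/funext => k; rewrite (@dmuls_additive _ _ _ _ w') ?wA // => x y; rewrite raddfB.
rewrite E (@evalAE _ _ (C^o) _ _ (\bigcup_(r <- A) B r)%fset); last first.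
  move=> k kB; rewrite big_seq big1 // => r rA; rewrite hB ?raddf0 //.
  by apply: contra kB => kB; apply/bigfcupP; exists r => //; rewrite rA.
under [RHS]eq_bigr do rewrite scaler_sumr.
rewrite [RHS]exchange_big /= big_seq [RHS]big_seq; apply: eq_bigr => r rA.
rewrite (@evalAE _ _ _ _ _ (\bigcup_(r <- A) B r)%fset); last first.
  move=> k kB; rewrite hB //.
  by apply: contra kB => kB; apply/bigfcupP; exists r => //; rewrite rA.
by rewrite raddf_sum; apply: eq_bigr => k _ /=; rewrite linearZ.
Qed.

Lemma dmuls_scalar_vanish N M c (w' : {scalar W}) :
  (forall (k : idx) i, M%:Z <= k i -> dmuls (dens N) c k = 0) ->
  forall (k : idx) i, M%:Z <= k i -> dmuls (dens N) (fun k => w' (c k)) k = 0.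
Proof.
move=> h k i ki; rewrite (@dmuls_additive _ _ _ _ w') ?(h k i) ?raddf0 //.
by move=> x y; rewrite raddfB.
Qed.

Lemma rat_fun_diag_rat N c (w' : {scalar W}) : gdual w' -> regular N 0 c ->
  diag_rat_ord N (fun z => pairing w' (rat_fun N (@conf R n) c z)).
Proof.
move=> gw [fs h0 _]; split; last first.
  move=> z nz; have -> : rat_fun N (@conf R n) c z = fun=> 0.
    by apply/funext => r; rewrite /rat_fun asboolF.
  by apply: fsbig1 => r _; exact: raddf0.
have [p hp] := evalA_poly (finsupp_gdual gw fs) (dmuls_scalar_vanish w' h0).
by exists p => z cz; rewrite pairing_rat_fun // hp.
Qed.

Lemma rat_fun_diag0_rat N M c (w' : {scalar W}) : gdual w' -> regular N M c ->
  diag0_rat (fun z => pairing w' (rat_fun N (@conf0 R n) c z)).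
Proof.
move=> gw [fs h0 _]; exists N, M; split; last first.
  move=> z nz; have -> : rat_fun N (@conf0 R n) c z = fun=> 0.
    by apply/funext => r; rewrite /rat_fun asboolF.
  by apply: fsbig1 => r _; exact: raddf0.
have [p hp] := evalA_poly0 (finsupp_gdual gw fs) (dmuls_scalar_vanish w' h0).
exists p => z cz; rewrite pairing_rat_fun // hp; last by case: cz.
by rewrite -mulrA -invfM [_ ^+ M * _]mulrC.
Qed.

Lemma radial_conf z : radial z -> conf z /\ conf0 z.
Proof.
move=> [h z0]; suff iz : injective z by [].
move=> i j E; apply/val_inj/eqP; rewrite eqn_leq.
by apply/andP; split; rewrite leqNgt; apply/negP => /h; rewrite E ltxx.
Qed.

Lemma rat_fun_radial N M D c (w' : {scalar W}) z : gdual w' -> regular N M c ->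
  radial z -> D z ->
  abs_cvg_to (fun k => w' (c k) * mon z k) (pairing w' (rat_fun N D c z)).
Proof.
move=> gw [fs h0 T] rz Dz; rewrite pairing_rat_fun // -prod_dens.
apply: dmuls_cvg.
- by move=> p /mem_dens p12; case: rz => h _; exact: h.
- move=> p /mem_dens p12 k; have [m0 hm] := T _ _ p12 k.
  by exists m0 => m mm; rewrite hm ?raddf0.
- by apply: good_neq0; case: rz.
exact: finsupp_gdual.
Qed.

Lemma regular_is_E N c : regular N 0 c ->
  is_E (@diag_rat R n) (@radial R n) (fun w' z k => w' (c k) * mon z k)
    (rat_fun N (@conf R n) c).
Proof.
move=> rc; have [fs _ _] := rc; split=> [z|w' gw]; first exact: rat_fun_wbar.
split; first by exists N; exact: rat_fun_diag_rat.
move=> z rz; exact: (rat_fun_radial gw rc rz (radial_conf rz).1).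
Qed.

Lemma regular_is_E0 N M c : regular N M c ->
  is_E (@diag0_rat R n) (@radial R n) (fun w' z k => w' (c k) * mon z k)
    (rat_fun N (@conf0 R n) c).
Proof.
move=> rc; have [fs _ _] := rc; split=> [z|w' gw]; first exact: rat_fun_wbar.
split; first exact: rat_fun_diag0_rat gw rc.
move=> z rz; exact: (rat_fun_radial gw rc rz (radial_conf rz).2).
Qed.

(* A rational function is determined by its values in the radial region: a
   line through z leaves it only at finitely many points. *)
Lemma radial_line z : exists b : 'I_n -> C, exists T : R, 0 < T /\
  forall t : R, T < t -> radial (fun i => z i + t%:C%C * b i).
Proof.
have [M hM] : exists M : R, forall i, `|z i| <= M%:C%C.
  exists (\sum_i complex.Re `|z i|) => i.
  have e j : `|z j| = (complex.Re `|z j|)%:C%C by rewrite normc_def.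
  rewrite e rmorph_sum /= (bigD1 i) //= -!e lerDl sumr_ge0 // => j _.
  by rewrite -e.
exists (fun i : 'I_n => (n - i)%:R), (`|M| + `|M| + 1); split.
  by rewrite ltr_wpDl // addr_ge0.
move=> t Tt; have t0 : 0 <= t by apply: ltW; apply: lt_trans Tt; rewrite ltr_wpDl // addr_ge0.
have hM' i : `|z i| <= `|M|%:C%C by apply: le_trans (hM i) _; rewrite lecR ler_norm.
have nt (m : nat) : `|t%:C%C * m%:R : C| = (t * m%:R)%:C%C.
  rewrite normrM normr_nat rmorphM rmorph_nat; congr (_ * _).
  by rewrite ger0_norm // ler0c.
have up (i : 'I_n) : `|z i + t%:C%C * (n - i)%:R| <= (`|M| + t * (n - i)%:R)%:C%C.
  by apply: le_trans (ler_normD _ _) _; rewrite nt rmorphD lerD.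
have low (i : 'I_n) : (t * (n - i)%:R - `|M|)%:C%C <= `|z i + t%:C%C * (n - i)%:R|.
  rewrite [X in _ <= `|X|]addrC; apply: le_trans (lerB_normD _ _).
  by rewrite nt rmorphB lerB.
split.
  move=> i j ij; apply: le_lt_trans (up j) _; apply: lt_le_trans (low i).
  rewrite ltcR; have : ((n - j)%:R + 1 <= (n - i)%:R :> R).
    rewrite -[1]/(1%:R) -natrD ler_nat; have := ltn_ord j; lia.
  by move=> h; have := ler_wpM2l t0 h; rewrite mulrDr mulr1; lra.
move=> i; rewrite -normr_gt0; apply: lt_le_trans (low i); rewrite ltcR.
have h : (1 <= (n - i)%:R :> R) by rewrite ler1n subn_gt0.
by have := ler_wpM2l t0 h; rewrite mulr1; have := normr_ge0 M; lra.
Qed.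

Lemma poly_infinite_roots (q : {poly C}) (T : R) :
  (forall t : R, T < t -> q.[t%:C%C] = 0) -> q = 0.
Proof.
move=> h; apply: (@roots_geq_poly_eq0 _ _ [seq (T + i.+1%:R)%:C%C | i <- iota 0 (size q)]).
- apply/allP => _ /mapP[i _ ->]; rewrite /root h //.
  by rewrite ltrDl ltr0Sn.
- rewrite map_inj_uniq ?iota_uniq // => i j [] /addrI /eqP.
  by rewrite eqr_nat => /eqP [].
by rewrite size_map size_iota.
Qed.

Lemma meval_eq_radial (p q : mpoly n C) : (forall z, radial z -> meval z p = meval z q) ->
  forall z, meval z p = meval z q.
Proof.
move=> h z; have [b [T [T0 hT]]] := radial_line z.
have [p1 hp] := meval_line p z b; have [q1 hq] := meval_line q z b.
have : p1 - q1 = 0.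
  apply: (@poly_infinite_roots _ T) => t Tt.
  by rewrite hornerD hornerN hp hq h ?subrr //; exact: hT.
move=> /eqP; rewrite subr_eq0 => /eqP E.
have z0 : z = fun i => z i + 0 * b i by apply/funext => i; rewrite mul0r addr0.
by rewrite z0 -hp -hq E.
Qed.

Lemma diag_rat_eq_radial (f g : ('I_n -> C) -> C) : diag_rat f -> diag_rat g ->
  (forall z, radial z -> f z = g z) -> forall z, f z = g z.
Proof.
move=> [N [[p hp] f0]] [M [[q hq] g0]] h z.
have [cz|nz] := pselect (conf z); last by rewrite f0 // g0.
rewrite hp // hq //.
have E : meval z (p * diag_denP R M) = meval z (q * diag_denP R N).
  apply: meval_eq_radial => x rx; have [cx _] := radial_conf rx.
  have h1 := h x rx; rewrite (hp _ cx) (hq _ cx) in h1.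
  rewrite !mevalM !diag_denPE; apply/eqP.
  by rewrite -eqr_div ?diag_den_neq0 //; apply/eqP.
move: E; rewrite !mevalM !diag_denPE => E.
by apply/eqP; rewrite eqr_div ?diag_den_neq0 // E.
Qed.

Lemma is_E_uniq (I : choiceType) (S : {scalar W} -> ('I_n -> C) -> I -> C) g h :
  is_E (@diag_rat R n) (@radial R n) S g -> is_E (@diag_rat R n) (@radial R n) S h -> g = h.
Proof.
move=> [wg Eg] [wh Eh]; apply/funext => z; apply/funext => r.
apply: gdual_separates_eq => w' gw.
pose v' := comp_scalar w' (@wpr_linear _ W r).
have gv : gdual v' by exact: gdual_wpr.
have [cg sg] := Eg v' gv; have [ch sh] := Eh v' gv.
have := diag_rat_eq_radial cg ch _ z.
have pE (f : C -> W) : wbar f -> pairing v' f = w' (f r).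
  move=> wf; rewrite (@pairing_gdual v' [fset r]%fset f) ?big_seq_fset1 //.
    by rewrite /v' /= /scalar_fun wf.
  move=> s; rewrite in_fset1 => sr w; rewrite /v' /= /scalar_fun wprM eq_sym (negPf sr).
  exact: raddf0.
rewrite !pE //; apply => x rx.
exact: abs_cvg_to_uniq (sg x rx) (sh x rx).
Qed.

End RegularArrays.

Section MixedFields.
Variable R : realType.
Local Notation C := (Cx R).

Lemma iter_shift_diff_additive (U U' : zmodType) (f : U -> U') n (h : int -> int -> U) j k :
  (forall x y, f (x - y) = f x - f y) ->
  f (iter n (@shift_diff U) h j k) = iter n (@shift_diff U') (fun j k => f (h j k)) j k.
Proof. by move=> fB; elim: n j k => [//|n IH] j k /=; rewrite /shift_diff fB !IH. Qed.

Definition local2 (U : lmodType C) (a b : bool -> int -> U -> U) (N : nat) : Prop :=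
  forall p q w l m, iter N (@shift_diff U) (fun l m =>
    a p l (b q m w) - (-1) ^+ (p && q) *: b q m (a p l w)) l m = 0.

Lemma local2_le (U : lmodType C) (a b : bool -> int -> U -> U) (N N' : nat) :
  (N <= N')%N -> local2 a b N -> local2 a b N'.
Proof.
move=> NN h p q w l m; rewrite -(subnK NN) iterD.
by apply: iter_shift_diff0 => j k; exact: h.
Qed.

Lemma local2_sym (U : lmodType C) (a b : bool -> int -> U -> U) (N : nat) :
  local2 a b N -> local2 b a N.
Proof.
move=> h p q w l0 m0.
have E n (g : int -> int -> U) (l m : int) :
    iter n (@shift_diff U) (fun l m => - (-1) ^+ (p && q) *: g m l) l m =
    (- (-1) ^+ (p && q) * (-1) ^+ n) *: iter n (@shift_diff U) g m l.
  elim: n l m => [|n IH] l' m' /=; first by rewrite mulr1.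
  rewrite /shift_diff !IH exprS -scalerBr mulN1r mulrN scaleNr -scalerN.
  by rewrite opprB.
have := E N (fun l m => a q l (b p m w) - (-1) ^+ (q && p) *: b p m (a q l w)) l0 m0.
rewrite h scaler0 => <-; apply: iter_shift_diff_ext => j k _ _.
rewrite scaleNr scalerBr scalerA andbC -expr2 sqrr_sign scale1r.
by rewrite opprB andbC.
Qed.

Variables (V : vertexSuperalgebra R) (W : supermodule V).
Local Notation YW := (@YW R V W).
Local Notation Y := (@vY R V).
Let fY := @vY_field R V.
Let fW := @YW_field R V W.

Lemma ppr_modes a c u k (y : V) : par a u -> ppr c (Y u k y) = Y u k (ppr (c (+) a) y).
Proof.
move=> au.
have h b : ppr c (Y u k (ppr b y)) = if c == a (+) b then Y u k (ppr b y) else 0.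
  have e : ppr (a (+) b) (Y u k (ppr b y)) = Y u k (ppr b y) := vY_par k au (par_ppr b y).
  by rewrite -{1}e pprM; case: eqP => [->|].
rewrite {1}(ppr_sum y) (modesDr fY) (linD _ _ (@ppr_linear _ V c)) !h.
by case: a c {au h} => -[] /=; rewrite ?addr0 ?add0r.
Qed.

(* The operator Y(w, x)y = (-1)^(|w||y|) e^(x D) Y_W(y, -x) w for the component
   of w of parity p. *)
Definition skew_super p (w : W) k (y : V) : W :=
  \sum_(q : bool) (-1) ^+ (p && q) *: skew_op (ppr p w) k (ppr q y).

Definition fld (g : V + W) (p : bool) (k : int) (x : V * W) : V * W :=
  match g with
  | inl v => (Y (ppr p v) k x.1, YW (ppr p v) k x.2)
  | inr w => (0, skew_super p w k x.1)
  end.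

Definition compat (g h : V + W) (N : nat) : Prop :=
  match g, h with
  | inl u, inl v => trunc Y u v N%:Z
  | inl u, inr w => trunc YW u w N%:Z
  | inr w, inl u => trunc YW u w N%:Z
  | inr _, inr _ => True
  end.

Lemma skew_super_linear p w k : linear (skew_super p w k).
Proof.
move=> a x y; rewrite /skew_super !big_bool /= !(@ppr_linear _ V) !skew_op_linear_r.
by rewrite !scalerDr !scalerA ![_ * a]mulrC addrACA.
Qed.

Lemma fld_linear g p k : linear (fld g p k).
Proof.
have [lY _ _] := fY; have [lW _ _] := fW.
case: g => [v|w] a [x1 x2] [y1 y2] /=.
  by rewrite lY lW.
by rewrite skew_super_linear; congr pair; rewrite /= scaler0 addr0.
Qed.

Lemma trunc_ppr (U1 U2 : gradedSpace R) (Y1 : modes U1 U2) u w K p q : field_map Y1 ->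
  trunc Y1 u w K -> trunc Y1 (ppr p u) (ppr q w) K.
Proof.
move=> f1 h s r p' q' k Kk; rewrite !pprM.
case: eqP => _; last by rewrite (lin0 (@wpr_linear _ U1 s)) (modes0l f1).
case: eqP => _; last by rewrite (lin0 (@wpr_linear _ U2 r)) (modes0r f1).
exact: h.
Qed.

Lemma skew_super_modes p q u w j k x :
  YW (ppr p u) j (skew_super q w k x)
  - (-1) ^+ (p && q) *: skew_super q w k (Y (ppr p u) j x) =
  \sum_(b : bool) (-1) ^+ (q && b) *:
     (YW (ppr p u) j (skew_op (ppr q w) k (ppr b x)) -
      skew_op (ppr q w) k (Y (ppr p u) j (ppr b x))).
Proof.
have [lW _ _] := fW.
rewrite /skew_super !big_bool /= !(modesDr fW) !(linZ _ _ (lW _ _)).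
rewrite !(ppr_modes _ _ _ (par_ppr p u)) !scalerBr.
have E (A B A' B' : W) : A + B - (A' + B') = (A - A') + (B - B').
  by rewrite opprD addrACA.
rewrite -E; case: p; case: q => /=; rewrite ?expr0 ?expr1 ?scale1r ?scaleN1r ?opprK.
- by rewrite opprD opprK [X in _ + _ + X]addrC.
- by rewrite [X in _ + _ - X]addrC.
- by [].
by [].
Qed.

Lemma fld_local g h N : compat g h N -> local2 (fld g) (fld h) N.
Proof.
have core u w : trunc YW u w N%:Z -> local2 (fld (inl u)) (fld (inr w)) N.
  move=> tr p q [x1 x2] l m.
  have E1 : (iter N (@shift_diff _) (fun l m => fld (inl u) p l (fld (inr w) q m (x1, x2)) -
     (-1) ^+ (p && q) *: fld (inr w) q m (fld (inl u) p l (x1, x2))) l m).1 = 0.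
    rewrite (iter_shift_diff_additive (f := fst)) //.
    apply: iter_shift_diff0 => j k /=.
    by rewrite (modes0r fY) scaler0 subr0.
  have E2 : (iter N (@shift_diff _) (fun l m => fld (inl u) p l (fld (inr w) q m (x1, x2)) -
     (-1) ^+ (p && q) *: fld (inr w) q m (fld (inl u) p l (x1, x2))) l m).2 = 0.
    rewrite (iter_shift_diff_additive (f := snd)) //=.
    pose d b j k := YW (ppr p u) j (skew_op (ppr q w) k (ppr b x1)) -
      skew_op (ppr q w) k (Y (ppr p u) j (ppr b x1)).
    transitivity (iter N (@shift_diff W)
      (fun j k => \sum_(b : bool) (-1) ^+ (q && b) *: d b j k) l m).
      by apply: iter_shift_diff_ext => j k _ _; exact: skew_super_modes.
    rewrite iter_shift_diff_sum big1 // => b _.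
    have := iter_shift_diff_additive (f := *:%R ((-1) ^+ (q && b))) N (d b) l m.
    move=> <-; last by move=> x y; rewrite scalerBr.
    rewrite skew_op_local ?scaler0 //; exact: trunc_ppr fW tr.
  by rewrite [LHS]surjective_pairing E1 E2.
case: g h => [u|w] [v|w2] //= tr.
- move=> p q [x1 x2] l m.
  have l1 := locality fY (@vY_d _ V) fY (@vY_d _ V) (@vY_duality _ V) tr.
  have l2 := locality fY (@vY_d _ V) fW (@YW_d _ _ W) (@YW_duality _ _ W) tr.
  rewrite [LHS]surjective_pairing (iter_shift_diff_additive (f := fst)) //.
  rewrite (iter_shift_diff_additive (f := snd)) //=.
  by rewrite l1 l2.
- exact: core.
- by apply: local2_sym; exact: core.
move=> p q x l m; apply: iter_shift_diff0 => j k /=.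
have z r w' i : skew_super r w' i 0 = 0 by exact: lin0 (skew_super_linear _ _ _).
by rewrite !z; congr pair; rewrite /= ?scaler0 subr0.
Qed.

End MixedFields.

Section WeightBounds.
Variable R : realType.
Local Notation C := (Cx R).

Definition wt_ge (W : gradedSpace R) (b : R) (x : W) : Prop :=
  forall r, complex.Re r < b -> wpr r x = 0.

Lemma wt_ge0 (W : gradedSpace R) b : wt_ge b (0 : W).
Proof. by move=> r _; rewrite (lin0 (@wpr_linear _ W r)). Qed.

Lemma wt_geD (W : gradedSpace R) b (x y : W) : wt_ge b x -> wt_ge b y -> wt_ge b (x + y).
Proof. by move=> hx hy r rb; rewrite (linD _ _ (@wpr_linear _ W r)) hx // hy // addr0. Qed.

Lemma wt_geZ (W : gradedSpace R) b c (x : W) : wt_ge b x -> wt_ge b (c *: x).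
Proof. by move=> hx r rb; rewrite (linZ _ _ (@wpr_linear _ W r)) hx // scaler0. Qed.

Lemma wt_ge_sum (W : gradedSpace R) b (I : Type) (s : seq I) (F : I -> W) :
  (forall i, wt_ge b (F i)) -> wt_ge b (\sum_(i <- s) F i).
Proof.
move=> h; elim: s => [|i s IH]; first by rewrite big_nil; exact: wt_ge0.
by rewrite big_cons; apply: wt_geD.
Qed.

Lemma wt_ge_ppr (W : gradedSpace R) b a (x : W) : wt_ge b x -> wt_ge b (ppr a x).
Proof. by move=> h r rb; rewrite wpr_ppr h // (lin0 (@ppr_linear _ W a)). Qed.

Lemma wt_ge_wt (W : gradedSpace R) (t : C) b (x : W) : wt t x -> b <= complex.Re t -> wt_ge b x.
Proof.
move=> tx bt r rb; apply: (wt_neq tx); apply/eqP => E.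
by move: rb; rewrite E ltNge bt.
Qed.

Lemma wt_ge_modes (V W : gradedSpace R) (Y1 : modes V W) s b u k w :
  field_map Y1 -> d_bracket Y1 -> wt_ge s u -> wt_ge b w ->
  wt_ge (s + b - k%:~R - 1) (Y1 u k w).
Proof.
move=> f1 d1 su bw; have [A ->] := wpr_decomp u; have [B ->] := wpr_decomp w.
rewrite (modes_suml f1); apply: wt_ge_sum => r; rewrite (modes_sumr f1); apply: wt_ge_sum => t.
have [/su ->|sr] := ltP (complex.Re r) s; first by rewrite (modes0l f1); exact: wt_ge0.
have [/bw ->|bt] := ltP (complex.Re t) b; first by rewrite (modes0r f1); exact: wt_ge0.
apply: wt_ge_wt (modes_wt k f1 d1 (wt_wpr r u) (wt_wpr t w)) _.
have -> : complex.Re (r + t - k%:~R - 1 : C) = complex.Re r + complex.Re t - k%:~R - 1.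
  rewrite !raddfB !raddfD /= -[k%:~R in LHS](rmorph_int (real_complex R)) /=; ring.
lra.
Qed.

Variables (V : vertexSuperalgebra R) (W : supermodule V).
Let fY := @vY_field R V.
Let fW := @YW_field R V W.

Lemma DW_wt r (w : W) : wt r w -> wt (r + 1) (@DW R V W w).
Proof.
move=> rw; apply: dop_eq_wt; have /eqP := @DW_d _ _ W w.
rewrite (dop_wt rw) (linZ _ _ (@DW_linear _ _ W)) subr_eq => /eqP ->.
by rewrite scalerDl scale1r addrC.
Qed.

Lemma wt_ge_DW b (w : W) : wt_ge b w -> wt_ge (b + 1) (@DW R V W w).
Proof.
move=> h; have [A ->] := wpr_decomp w.
rewrite (lin_sum _ _ (@DW_linear _ _ W)); apply: wt_ge_sum => r.
have [/h ->|br] := ltP (complex.Re r) b.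
  by rewrite (lin0 (@DW_linear _ _ W)); exact: wt_ge0.
by apply: wt_ge_wt (DW_wt (wt_wpr r w)) _; rewrite raddfD /= lerD2r.
Qed.

Lemma wt_ge_iterDW b (w : W) i : wt_ge b w -> wt_ge (b + i%:R) (iter i (@DW R V W) w).
Proof.
move=> h; elim: i => [|i IH] /=; first by rewrite addr0.
by rewrite -natr1 addrA; apply: wt_ge_DW.
Qed.

Lemma wt_ge_skew_op s b (w : W) k (y : V) : wt_ge s y -> wt_ge b w ->
  wt_ge (s + b - k%:~R - 1) (skew_op w k y).
Proof.
move=> sy bw; have [S0 tr] := trunc_exists fW y w.
rewrite (skew_opE (n := (S0 + absz k)%N) tr); last by lia.
apply: wt_ge_sum => i; apply: wt_geZ; apply: wt_geZ.
have := @wt_ge_iterDW _ _ i (wt_ge_modes (k := k + i%:Z) fW (@YW_d _ _ W) sy bw).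
rewrite intrD; set b1 := _ + _; set b2 := _ - 1; suff -> : b1 = b2 by [].
rewrite /b1 /b2 pmulrn; ring.
Qed.

Definition wt_ge2 (b : R) (x : V * W) : Prop := wt_ge b x.1 /\ wt_ge b x.2.

Lemma weights_bounded : exists b : R, (forall v : V, wt_ge b v) /\ (forall w : W, wt_ge b w).
Proof.
have [b1 h1] := wpr_low V; have [b2 h2] := wpr_low W.
exists (Num.min b1 b2); split=> x r; rewrite lt_min => /andP[r1 r2].
  exact: h1.
exact: h2.
Qed.

Lemma wt_ge2_fld (b0 b : R) g p k (x : V * W) :
  (forall v : V, wt_ge b0 v) -> (forall w : W, wt_ge b0 w) ->
  wt_ge2 b x -> wt_ge2 (b0 + b - k%:~R - 1) (fld g p k x).
Proof.
move=> hV hW [x1 x2]; case: g => [v|w] /=; split=> /=.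
- exact: wt_ge_modes fY (@vY_d _ V) (hV _) x1.
- exact: wt_ge_modes fW (@YW_d _ _ W) (hV _) x2.
- exact: wt_ge0.
rewrite /skew_super; apply: wt_ge_sum => q; apply: wt_geZ.
rewrite [b0 + b]addrC; apply: wt_ge_skew_op; [exact: wt_ge_ppr|exact: hW].
Qed.

End WeightBounds.

Section ProductsRegular.
Variable R : realType.
Local Notation C := (Cx R).
Variables (V : vertexSuperalgebra R) (W : supermodule V) (n : nat).
Local Notation idx := {ffun 'I_n -> int}.
Let fY := @vY_field R V.
Let fW := @YW_field R V W.

Definition fprod (g : 'I_n -> V + W) (k : idx) (x : V * W) : V * W :=
  field_prod (fun i => fld (g i)) (enum 'I_n) k x.

Lemma wt_ge2_prod (g : 'I_n -> V + W) (s : seq 'I_n) (x : V * W) :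
  exists b : R, exists b0 : R, forall k : idx,
  wt_ge2 (b + \sum_(i <- s) (b0 - (k i)%:~R - 1)) (field_prod (fun i => fld (g i)) s k x).
Proof.
have [b0 [hV hW]] := weights_bounded W.
exists b0, b0 => k; elim: s => [|i s IH].
  by rewrite big_nil addr0; split; [exact: hV|exact: hW].
rewrite field_prod_cons big_cons.
have -> : b0 + (b0 - (k i)%:~R - 1 + \sum_(j <- s) (b0 - (k j)%:~R - 1)) =
  b0 + (b0 + \sum_(j <- s) (b0 - (k j)%:~R - 1)) - (k i)%:~R - 1 by ring.
have h p := wt_ge2_fld (g i) p (k i) hV hW IH.
by split; apply: wt_geD; [exact: (h false).1|exact: (h true).1|exact: (h false).2|exact: (h true).2].
Qed.

Lemma prod_weight_bound (g : 'I_n -> V + W) (x : V * W) (r : C) :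
  exists B : int, forall k : idx, \sum_i k i < B ->
    wpr r (fprod g k x).1 = 0 /\ wpr r (fprod g k x).2 = 0.
Proof.
have [b [b0 h]] := wt_ge2_prod g (enum 'I_n) x.
pose c := b + n%:R * (b0 - 1) - complex.Re r.
exists (Num.floor c) => k kB.
have kc : (\sum_i k i)%:~R < c.
  by apply: lt_le_trans (floor_le_tmp c); rewrite ltr_int.
have : complex.Re r < b + \sum_(i <- enum 'I_n) (b0 - (k i)%:~R - 1).
  rewrite big_enum /=.
  have -> : \sum_(i < n) (b0 - (k i)%:~R - 1) = n%:R * (b0 - 1) - (\sum_i k i)%:~R.
    have -> : n%:R * (b0 - 1) = \sum_(i < n) (b0 - 1) by rewrite sumr_const card_ord mulr_natl.
    by rewrite rmorph_sum /= -sumrB; apply: eq_bigr => i _; ring.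
  move: kc; rewrite /c; move: (\sum_i k i)%:~R => X; lra.
by case: (h k) => h1 h2 lt; split; [exact: h1|exact: h2].
Qed.

Lemma fld_trunc (g : V + W) (x : V * W) : exists K : nat, forall p (k : int),
  K%:Z <= k -> fld g p k x = 0.
Proof.
case: g => [v|w] /=.
  have [K1 h1] := trunc_exists fY v x.1; have [K2 h2] := trunc_exists fW v x.2.
  exists (K1 + K2)%N => p k Kk; congr pair.
    rewrite (ppr_sum x.1) (modesDr fY) !(trunc_modes fY _ _ h1) ?addr0 //; lia.
  rewrite (ppr_sum x.2) (modesDr fW) !(trunc_modes fW _ _ h2) ?addr0 //; lia.
have [K h] := trunc_exists fW x.1 w.
exists K => p k Kk; congr pair; rewrite /skew_super big1 // => q _.
by rewrite (skew_op_trunc (K := K) _ Kk) ?scaler0 //; exact: trunc_ppr.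
Qed.

Lemma fprod_trunc_dir (g : 'I_n -> V + W) (x : V * W) (i j : 'I_n) : (i < j)%N ->
  forall k : idx, exists m0, forall m, (m0 <= m)%N ->
    fprod g (k + (un j - un i) *+ m) x = 0.
Proof.
move=> ij k; have := mem_enum 'I_n j; have := enum_uniq 'I_n; have := enum_ord_sorted n.
rewrite /fprod => srt ue; rewrite inE => ie; move: srt ue.
case/splitPr: ie => s1 s2 srt ue.
have tr : transitive (fun i j : 'I_n => (i < j)%N) by move=> ? ? ?; exact: ltn_trans.
have ji : j != i by apply/eqP => E; rewrite E ltnn in ij.
have js2 : j \notin s2 by move: ue; rewrite cat_uniq => /and3P[_ _ /andP[]].
have is2 : i \notin s2.
  have := subseq_sorted tr (suffix_subseq s1 (j :: s2)) srt.
  rewrite /= path_sortedE // => /andP[/allP h _]; apply/negP => /h.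
  by rewrite ltnNge ltnW.
have [K hK] := fld_trunc (g j) (field_prod (fun i => fld (g i)) s2 k x).
exists (K + absz (k j))%N => m hm.
have kE l : (k + (un j - un i) *+ m) l = k l + (l == j)%:Z * m%:Z - (l == i)%:Z * m%:Z.
  rewrite idxD; elim: (m) => [|m' IH]; first by rewrite mulr0n ffunE !mulr0; lia.
  rewrite mulrSr idxD addrA IH idxD idxN !unE.
  by move: (k l) => y; lia.
have e2 : field_prod (fun i => fld (g i)) s2 (k + (un j - un i) *+ m) x =
    field_prod (fun i => fld (g i)) s2 k x.
  elim: s2 {srt ue hK} js2 is2 => [//|l s IH].
  rewrite !in_cons !negb_or => /andP[jl js] /andP[il is'].
  by rewrite !field_prod_cons IH // kE eq_sym (negPf jl) [l == i]eq_sym (negPf il) !mul0r addr0 subr0.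
rewrite field_prod_cat field_prod_cons e2 /field_at !hK; last 2 first.
- by rewrite kE eqxx (negPf ji); move: (k j) hm => y; lia.
- by rewrite kE eqxx (negPf ji); move: (k j) hm => y; lia.
rewrite addr0; apply: lin0; apply: field_prod_linear => l p l'; exact: fld_linear.
Qed.

Variables (g : 'I_n -> V + W) (N : 'I_n -> 'I_n -> nat) (M : nat) (x : V * W).
Hypothesis gN : forall i j : 'I_n, (i < j)%N -> compat (g i) (g j) (N i j).
Hypothesis gx : forall i p (k : int), M%:Z <= k -> fld (g i) p k x = 0.

Lemma fprod_vanish (k : idx) i : M%:Z <= k i -> dmuls (dens N) (fun k => fprod g k x) k = 0.
Proof.
apply: local_product_vanish => [l p m|l j lj|p m].
- exact: fld_linear.
- exact: fld_local (gN lj).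
exact: gx.
Qed.

Lemma fprod_regular1 : regular N M (fun k => (fprod g k x).1).
Proof.
have v (k : idx) i : M%:Z <= k i -> dmuls (dens N) (fun k => (fprod g k x).1) k = 0.
  move=> ki; rewrite (@dmuls_additive _ _ _ _ (fun y : V * W => y.1)) //.
  by rewrite (fprod_vanish ki).
split=> [r|//|i j ij k].
  have [B hB] := prod_weight_bound g x r.
  apply: (@finsupp_box _ _ _ (fun=> M%:Z) (B - (size (dens N))%:Z)).
    by move=> k i /v ->; rewrite (lin0 (@wpr_linear _ V r)).
  move=> k kB; rewrite -(@dmuls_additive _ _ _ _ (wpr r)); last by apply: linB; exact: wpr_linear.
  by apply: dmuls_vanish_below kB => k' /hB[].
have [m0 hm] := fprod_trunc_dir g x ij k.
by exists m0 => m /hm ->.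
Qed.

Lemma fprod_regular2 : regular N M (fun k => (fprod g k x).2).
Proof.
have v (k : idx) i : M%:Z <= k i -> dmuls (dens N) (fun k => (fprod g k x).2) k = 0.
  move=> ki; rewrite (@dmuls_additive _ _ _ _ (fun y : V * W => y.2)) //.
  by rewrite (fprod_vanish ki).
split=> [r|//|i j ij k].
  have [B hB] := prod_weight_bound g x r.
  apply: (@finsupp_box _ _ _ (fun=> M%:Z) (B - (size (dens N))%:Z)).
    by move=> k i /v ->; rewrite (lin0 (@wpr_linear _ W r)).
  move=> k kB; rewrite -(@dmuls_additive _ _ _ _ (wpr r)); last by apply: linB; exact: wpr_linear.
  by apply: dmuls_vanish_below kB => k' /hB[].
have [m0 hm] := fprod_trunc_dir g x ij k.
by exists m0 => m /hm ->.
Qed.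

End ProductsRegular.

Section Taylor.
Variable R : realType.
Local Notation C := (Cx R).
Variable n : nat.
Local Notation idx := {ffun 'I_n -> int}.

(* the generator of simultaneous translations, sum_i d/dx_i *)
Definition dtot (U : lmodType C) (c : idx -> U) (k : idx) : U :=
  \sum_i (- (k i))%:~R *: c (k - un i).

Definition mpow (y : 'I_n -> C) (k : idx) : {poly C} :=
  \prod_i ((y i)%:P + 'X) ^+ absz (- k i - 1)%R.

Lemma deriv_prod_seq (s : seq 'I_n) (F : 'I_n -> {poly C}) : uniq s ->
  (\prod_(i <- s) F i)^`() = \sum_(i <- s) (F i)^`() * \prod_(j <- s | j != i) F j.
Proof.
elim: s => [_|i s IH].
  by rewrite !big_nil; exact: derivC.
move=> /andP[is_ us]; rewrite !big_cons derivM (IH us) eqxx /=; congr (_ + _).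
  congr (_ * _); rewrite big_seq [RHS]big_seq_cond; apply: eq_bigl => j.
  case: (boolP (j \in s)) => js; last by [].
  by apply/esym/eqP => ji; rewrite -ji js in is_.
rewrite mulr_sumr big_seq [RHS]big_seq; apply: eq_bigr => j js.
rewrite big_cons ifT; first exact: mulrCA.
by apply/eqP => ij; rewrite ij js in is_.
Qed.

Lemma deriv_mpow y (k : idx) : (forall i, k i < 0) ->
  (mpow y k)^`() = \sum_i (- (k i + 1))%:~R *: mpow y (k + un i).
Proof.
move=> kn; rewrite /mpow deriv_prod_seq ?index_enum_uniq //; apply: eq_bigr => i _.
rewrite deriv_exp derivD derivC derivX add0r mul1r.
rewrite [in RHS](bigD1 i) //= idxD unE eqxx.
have -> : \prod_(j < n | j != i) ((y j)%:P + 'X) ^+ `|(- (k + un i) j - 1)%R| =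
   \prod_(j < n | j != i) ((y j)%:P + 'X) ^+ `|(- k j - 1)%R|.
  by apply: eq_bigr => j ji; rewrite idxD unE (negPf ji) addr0.
have [m [e1 e2 e3]] : exists m : nat, [/\ absz (- k i - 1)%R = m, (- (k i + 1))%:~R = m%:R :> C &
    (0 < m)%N -> absz (- (k i + true%:Z) - 1)%R = m.-1].
  exists (absz (- k i - 1)%R); move: (kn i); move: (k i) => x x0.
  split; [by []| |].
    by rewrite pmulrn; congr (_%:~R); move: x0; clear; lia.
  by rewrite -[true%:Z]/(1 : int); move: x0; clear; lia.
rewrite e1 e2; case: m {e1 e2} e3 => [|m] e3.
  by rewrite mulr0n mul0r scale0r.
by rewrite e3 // scaler_nat mulrnAl.
Qed.

Definition tpoly (P : idx -> C) (y : 'I_n -> C) : {poly C} :=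
  \sum_(k \in [set: idx]) P k *: mpow y k.

Lemma tpolyE P y (A : {fset idx}) : (forall k, k \notin A -> P k = 0) ->
  tpoly P y = \sum_(k <- A) P k *: mpow y k.
Proof. by move=> hA; apply: fsbigTE => k /hA ->; rewrite scale0r. Qed.

Definition negsupp (U : nmodType) (P : idx -> U) := forall (k : idx) (i : 'I_n), 0 <= k i -> P k = 0.

Lemma negsupp_neg (U : nmodType) (P : idx -> U) (k : idx) :
  negsupp P -> P k != 0 -> forall i : 'I_n, k i < 0.
Proof. by move=> h nz i; rewrite ltNge; apply/negP => /h e; rewrite e eqxx in nz. Qed.

Lemma tpoly_horner P y t : finsupp P -> negsupp P ->
  (tpoly P y).[t] = evalA (U := C^o) P (fun i => y i + t).
Proof.
move=> [A hA] neg; rewrite (tpolyE _ hA) (evalAE _ hA) horner_sum.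
apply: eq_bigr => k _; rewrite hornerZ /GRing.scale /= mulrC.
have [->|nz] := eqVneq (P k) 0; first by rewrite !mulr0.
congr (_ * _); rewrite /mpow /mon horner_prod; apply: eq_bigr => i _.
rewrite horner_exp hornerD hornerC hornerX exprnP; congr (_ ^ _).
by have := negsupp_neg neg nz i; move: (k i) => x; lia.
Qed.

Lemma finsupp_dtot (U : lmodType C) (P : idx -> U) : finsupp P -> finsupp (dtot P).
Proof.
move=> [A hA]; exists (\bigcup_(i <- enum 'I_n) [fset ((k : idx) + un i)%R | k in A])%fset => k kA.
rewrite /dtot big1 // => i _; rewrite hA ?scaler0 //; apply: contra kA => kA.
apply/bigfcupP; exists i; rewrite ?mem_enum //; apply/imfsetP.
by exists (k - un i) => //=; rewrite subrK.
Qed.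

Lemma negsupp_dtot (U : lmodType C) (P : idx -> U) : negsupp P -> negsupp (dtot P).
Proof.
move=> h k i ki; rewrite /dtot big1 // => j _.
have [ji|ji] := eqVneq i j.
  rewrite -ji; have [->|k0] := eqVneq (k i) 0; first by rewrite oppr0 scale0r.
  rewrite (h _ i) ?scaler0 // idxD idxN unE eqxx.
  by move/eqP: k0 ki; move: (k i) => x; lia.
by rewrite (h _ i) ?scaler0 // idxD idxN unE (negPf ji) subr0.
Qed.

Lemma deriv_tpoly P y : finsupp P -> negsupp P -> (tpoly P y)^`() = tpoly (dtot P) y.
Proof.
move=> [A hA] neg.
pose B := (A `|` \bigcup_(i <- enum 'I_n) [fset ((k : idx) + un i)%R | k in A])%fset.
have AB i : ([fset ((k : idx) + un i)%R | k in A] `<=` B)%fset.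
  by apply: fsubset_trans (fsubsetUr _ _); apply: (bigfcup_sup (P := xpredT)); rewrite ?mem_enum.
have hB k : k \notin B -> dtot P k = 0.
  move=> kB; rewrite /dtot big1 // => i _; rewrite hA ?scaler0 //; apply: contra kB => kA.
  by apply: (fsubsetP (AB i)); apply/imfsetP; exists (k - un i) => //=; rewrite subrK.
rewrite (tpolyE _ hA) (tpolyE _ hB) raddf_sum /=.
transitivity (\sum_(k <- A) \sum_i (P k * (- (k i + 1))%:~R) *: mpow y (k + un i)).
  apply: eq_bigr => k _; rewrite derivZ.
  have [->|nz] := eqVneq (P k) 0.
    by rewrite scale0r big1 // => i _; rewrite mul0r scale0r.
  rewrite deriv_mpow; last exact: negsupp_neg neg nz.
  by rewrite scaler_sumr; apply: eq_bigr => i _; rewrite scalerA.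
rewrite exchange_big /=.
under [RHS]eq_bigr do rewrite /dtot scaler_suml.
rewrite [RHS]exchange_big /=; apply: eq_bigr => i _.
have ii : injective (fun k : idx => k + un i) by exact: addIr.
rewrite -(big_fset_incl _ (AB i)); last first.
  move=> k _ kA; rewrite hA ?scaler0 ?scale0r //; apply: contra kA => kA.
  by apply/imfsetP; exists (k - un i) => //=; rewrite subrK.
rewrite big_imfset /=; last by move=> k l _ _; exact: ii.
apply: eq_bigr => k _; rewrite addrK idxD unE eqxx /GRing.scale /= mulrC.
by congr (_ *: _).
Qed.

Lemma taylor_evalA (P : idx -> C) (y : 'I_n -> C) t : finsupp P -> negsupp P ->
  exists m0, forall m, (m0 <= m)%N -> evalA (U := C^o) P (fun i => y i + t) =
    \sum_(i < m) t ^+ i / i`!%:R * evalA (U := C^o) (iter i (@dtot C^o) P) y.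
Proof.
move=> fP nP.
have fi i : finsupp (iter i (@dtot C^o) P).
  by elim: i => [//|i IH] /=; exact: finsupp_dtot.
have ni i : negsupp (iter i (@dtot C^o) P).
  by elim: i => [//|i IH] /=; exact: negsupp_dtot.
have di i : (tpoly P y)^`(i) = tpoly (iter i (@dtot C^o) P) y.
  elim: i => [//|i IH]; rewrite derivnS IH deriv_tpoly //.
have y0 : (fun j => y j + 0) = y by apply/funext => j; rewrite addr0.
exists (size (tpoly P y)) => m hm.
rewrite -tpoly_horner // -[t]add0r nderiv_taylor; last exact: mulrC.
have E i : (tpoly P y)^`N(i).[0] = (i`!%:R)^-1 * evalA (U := C^o) (iter i (@dtot C^o) P) y.
  have -> : evalA (U := C^o) (iter i (@dtot C^o) P) y = ((tpoly P y)^`(i)).[0].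
    rewrite di (tpoly_horner y 0 (fi i) (ni i)) y0; reflexivity.
  rewrite nderivn_def hornerMn -(mulr_natl (tpoly P y)^`N(i).[0]) mulrA mulVf ?mul1r ?pnatr_eq0 -?lt0n ?fact_gt0 //.
rewrite [0 + t]add0r -(subnKC hm) big_split_ord /= [X in _ = _ + X]big1 ?addr0.
  by apply: eq_bigr => i _; rewrite E mulrC mulrA.
move=> i _; have := E (size (tpoly P y) + i)%N.
have -> : (tpoly P y)^`N(size (tpoly P y) + i) = 0.
  apply/polyP => j; rewrite coef_nderivn coef0 nth_default ?mul0rn //.
  by rewrite -addnA leq_addr.
by rewrite horner0 => e; rewrite -mulrA -e mulr0.
Qed.
End Taylor.

Section ProductsOfVertexOperators.
Variable R : realType.
Local Notation C := (Cx R).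
Variables (V : vertexSuperalgebra R) (W : supermodule V).
Local Notation YW := (@YW R V W).
Local Notation Y := (@vY R V).
Let fY := @vY_field R V.
Let fW := @YW_field R V W.

Lemma field_at_inl n (v : 'I_n -> V) (i : 'I_n) (k : int) (x : V * W) :
  field_at (fun i => @fld R V W (inl (v i))) i k x = (Y (v i) k x.1, YW (v i) k x.2).
Proof.
rewrite /field_at /=; congr pair; rewrite /= -?(modesDl fY) -?(modesDl fW) -ppr_sum //.
Qed.

Lemma fprod_inl n (v : 'I_n -> V) (k : {ffun 'I_n -> int}) (x : V * W) :
  fprod (fun i => inl (v i)) k x = (modes_prod Y v k x.1, modes_prod YW v k x.2).
Proof.
rewrite /fprod /modes_prod; elim: (enum 'I_n) => [|i s IH] /=; first by case: x.
by rewrite IH field_at_inl.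
Qed.

Lemma trunc_vac (w : W) : trunc YW (vac V) w 0.
Proof.
move=> s r p q k k0.
have pv : ppr p (vac V) = if p then 0 else vac V.
  rewrite -{1}(@vac_par R V) pprM; case: p => //=; exact: vac_par.
have -> : wpr s (ppr p (vac V)) = if (s == 0) && ~~ p then vac V else 0.
  rewrite pv; case: p {pv} => /=; first by rewrite andbF (lin0 (@wpr_linear _ V s)).
  rewrite andbT -{1}(@vac_wt R V) wprM; case: eqP => [->|//]; exact: vac_wt.
case: ifP => _; last exact: (modes0l fW).
by rewrite YW_vac; case: eqP => // k1; move: k0; rewrite k1.
Qed.

Lemma fld_creation (g : V + W) p (k : int) : 0 <= k -> fld g p k (vac V, 0) = 0.
Proof.
move=> k0; case: g => [v|w] /=.
  by rewrite (vY_creation (ppr p v)).2 // (modes0r fW).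
congr pair; rewrite /skew_super big1 // => q _.
rewrite (@skew_op_trunc _ _ _ _ _ _ 0) ?scaler0 //.
by apply: trunc_ppr => //; exact: trunc_vac.
Qed.
End ProductsOfVertexOperators.

Section Adjoint.
Variables (R : realType) (V : vertexSuperalgebra R).
Local Notation DV := (@DV R V).

Lemma DV_linear : linear DV.
Proof. by have [_ l _] := @vY_field R V => a x y; exact: l. Qed.

Lemma DV_vac : DV (vac V) = 0.
Proof. by rewrite /Defs.DV vY_vac. Qed.

Lemma DV_par a v : par a v -> par a (DV v).
Proof. by move=> av; have := vY_par (-2) av (@vac_par R V); rewrite addbF. Qed.

Lemma DV_d v : dop (DV v) - DV (dop v) = DV v.
Proof.
have := @vY_d R V v (-2) (vac V); have [l _ _] := @vY_field R V.
rewrite (dop_wt (@vac_wt R V)) scale0r (lin0 (l _ _)) subr0 => ->.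
by rewrite opprK -[2 - 1]/(1 : int) scale1r addrK.
Qed.

Definition adjoint : supermodule V :=
  @Supermodule R V V (@vY R V) DV DV_linear DV_par DV_d (@vY_field R V) (@vY_d R V)
    (@vY_par R V) (@vY_vac R V) (@vY_D R V) (@vY_duality R V).
End Adjoint.

Section EVregular.
Variable R : realType.
Local Notation C := (Cx R).
Variables (V : vertexSuperalgebra R) (n : nat).
Local Notation idx := {ffun 'I_n -> int}.
Local Notation Y := (@vY R V).
Local Notation DV := (@DV R V).
Let fY := @vY_field R V.

Definition EVarr (v : 'I_n -> V) (k : idx) : V := modes_prod Y v k (vac V).

Variables (v : 'I_n -> V) (N : 'I_n -> 'I_n -> nat).
Hypothesis vN : forall i j : 'I_n, (i < j)%N -> trunc Y (v i) (v j) (N i j)%:Z.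

Lemma EVarr_regular : regular N 0 (EVarr v).
Proof.
have h (i j : 'I_n) : (i < j)%N -> compat (inl (v i) : V + adjoint V) (inl (v j)) (N i j) by exact: vN.
have := @fprod_regular1 R V (adjoint V) n (fun i => inl (v i)) N 0 (vac V, 0) h
   (fun i p k => @fld_creation R V (adjoint V) (inl (v i)) p k).
by congr regular; apply/funext => k; rewrite fprod_inl.
Qed.

Lemma EV_rat_fun : EV v = rat_fun N (@conf R n) (EVarr v).
Proof.
have E := regular_is_E EVarr_regular.
have ex : exists g, [set g | is_E (@diag_rat R n) (@radial R n)
                    (prod_series Y v (vac V)) g] g by exists (rat_fun N (@conf R n) (EVarr v)).
have E2 := xgetPex 0 ex.
exact: is_E_uniq E2 E.
Qed.

Lemma EV_wbar z : wbar (EV v z).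
Proof. by rewrite EV_rat_fun; apply: rat_fun_wbar; have [h _ _] := EVarr_regular. Qed.

Lemma EV_zero z r : ~ conf z -> EV v z r = 0.
Proof. by move=> nz; rewrite EV_rat_fun /rat_fun; case: asboolP. Qed.


Lemma modes_foldr_shift (v' : 'I_n -> V) (k : idx) (j : 'I_n) s w : j \notin s ->
  foldr (fun i x => Y (v' i) ((k - un j) i) x) w s = foldr (fun i x => Y (v' i) (k i) x) w s.
Proof.
elim: s => [//|i s IH]; rewrite in_cons negb_or => /andP[ji js] /=.
by rewrite IH // idxD idxN unE eq_sym (negPf ji) subr0.
Qed.

Lemma DV_EVarr k : DV (EVarr v k) = dtot (EVarr v) k.
Proof.
have Dm u j x : DV (Y u j x) = (- j)%:~R *: Y u (j - 1) x + Y u j (DV x).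
  have [e1 e2] := @vY_D R V u j x.
  by rewrite e1 e2 subrK.
rewrite /dtot /EVarr /modes_prod -big_enum /=.
have : uniq (enum 'I_n) by exact: enum_uniq.
elim: (enum 'I_n) => [_|i s IH] /=; first by rewrite big_nil DV_vac.
move=> /andP[is_ us]; rewrite Dm IH // big_cons; congr (_ + _).
  by rewrite idxD idxN unE eqxx modes_foldr_shift.
rewrite (modes_sumr fY) big_seq [RHS]big_seq; apply: eq_bigr => j js.
have ji : (i == j) = false by apply/eqP => E; rewrite E js in is_.
have [l _ _] := fY.
by rewrite (linZ _ _ (l _ _)) idxD idxN unE ji subr0.
Qed.

Lemma dtot_dmul (U : lmodType C) p (c : idx -> U) k : dtot (dmul p c) k = dmul p (dtot c) k.
Proof.
have e (q : 'I_n) (k' : idx) : \sum_i (- (k' + un q) i)%:~R *: c (k' + un q - un i) =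
    \sum_i (- k' i)%:~R *: c (k' - un i + un q) - c k'.
  have -> : c k' = \sum_i (i == q)%:R *: c (k' - un i + un q).
    rewrite (bigD1 q) //= eqxx scale1r subrK big1 ?addr0 // => i iq.
    by rewrite (negPf iq) scale0r.
  rewrite -sumrB; apply: eq_bigr => i _; rewrite -scalerBl (addrAC k'); congr (_ *: _).
  by rewrite idxD unE opprD intrD; case: (i == q) => /=; rewrite ?mulrNz ?oppr0.
rewrite /dmul /dtot !e opprB addrA subrK -sumrB.
by apply: eq_bigr => i _; rewrite scalerBr.
Qed.

Lemma dtot_ext (U : lmodType C) (c c' : idx -> U) : c =1 c' -> dtot c =1 dtot c'.
Proof. by move=> e k; apply: eq_bigr => i _; rewrite e. Qed.

Lemma dtot_dmuls (U : lmodType C) s (c : idx -> U) k : dtot (dmuls s c) k = dmuls s (dtot c) k.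
Proof.
elim: s k => [//|p s IH] k /=; rewrite dtot_dmul /dmul.
by rewrite !IH.
Qed.

End EVregular.

Section Translation.
Variable R : realType.
Local Notation C := (Cx R).

Lemma low_weights (W : gradedSpace R) (r : C) : exists J : nat, forall j : nat, (J <= j)%N ->
  forall w : W, wpr (r - j%:R) w = 0.
Proof.
have [N hN] := @wpr_low _ W.
exists (Num.truncn `|complex.Re r - N|).+1 => j Jj w; apply: hN.
have h1 : `|complex.Re r - N| < j%:R.
  by apply: lt_le_trans (truncnS_gt _) _; rewrite ler_nat.
have h2 : complex.Re r - N <= `|complex.Re r - N| by exact: ler_norm.
have -> : complex.Re (r - j%:R) = complex.Re r - j%:R.
  rewrite raddfB /=; congr (_ - _).
  by elim: j {Jj h1} => [|j IH] //; rewrite -!natr1 raddfD /= IH.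
by have := le_lt_trans h2 h1; lra.
Qed.

Variables (V : vertexSuperalgebra R).

Section Module.
Variable W : supermodule V.
Local Notation DW := (@DW R V W).

Lemma wpr_DW r (x : W) : wpr r (DW x) = DW (wpr (r - 1) x).
Proof.
have [A ->] := wpr_decomp x.
rewrite (lin_sum _ _ (@DW_linear _ _ W)) !(lin_sum _ _ (@wpr_linear _ W _)).
rewrite (lin_sum _ _ (@DW_linear _ _ W)); apply: eq_bigr => s _.
rewrite wprM; have h := DW_wt (wt_wpr s x).
rewrite -h wprM; have -> : (r == s + 1) = (r - 1 == s) by rewrite subr_eq.
case: eqP => [e|_]; last by rewrite (lin0 (@DW_linear _ _ W)).
by rewrite e -[in LHS](subrK 1 r) e h.
Qed.

Lemma wpr_divD r j (x : W) : wpr r (divD j x) = divD j (wpr (r - j%:R) x).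
Proof.
rewrite /divD (linZ _ _ (@wpr_linear _ W r)); congr (_ *: _).
elim: j r => [|j IH] r /=; first by rewrite subr0.
by rewrite wpr_DW IH -natr1 opprD addrAC addrA.
Qed.

(* e^(zD) on the completion *)
Definition expD (z : C) (x : C -> W) (r : C) : W :=
  \sum_(j \in [set: nat]) z ^+ j *: divD j (x (r - j%:R)).

Lemma expDE z x r J : (forall j : nat, (J <= j)%N -> x (r - j%:R) = 0) ->
  expD z x r = \sum_(j < J) z ^+ j *: divD j (x (r - j%:R)).
Proof.
move=> hJ; rewrite /expD (fsbigTE [fset j | j in iota 0 J]%fset).
  rewrite -(big_mkord xpredT (fun j => z ^+ j *: divD j (x (r - j%:R)))).
  apply: perm_big; apply: uniq_perm; rewrite ?iota_uniq ?fset_uniq // => y.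
  by rewrite in_fset /= /index_iota subn0.
move=> j; rewrite in_fset /= mem_iota add0n /= -leqNgt => /hJ ->.
by rewrite divD_modes0 scaler0.
Qed.

Lemma expD_wbarE (x : C -> W) r : wbar x ->
  exists J0, forall J, (J0 <= J)%N -> forall z, expD z x r = \sum_(j < J) z ^+ j *: divD j (x (r - j%:R)).
Proof.
move=> wx; have [J0 h] := low_weights W r.
exists J0 => J JJ z; apply: expDE => j Jj; rewrite -(wx _); apply: h.
exact: leq_trans Jj.
Qed.

Lemma expD_wbar z (x : C -> W) : wbar x -> wbar (expD z x).
Proof.
move=> wx r; have [J h] := expD_wbarE r wx; rewrite (h J) // /wt.
rewrite (lin_sum _ _ (@wpr_linear _ W r)); apply: eq_bigr => j _.
by rewrite (linZ _ _ (@wpr_linear _ W r)) wpr_divD wx.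
Qed.
End Module.

Variable n : nat.
Local Notation idx := {ffun 'I_n -> int}.
Local Notation Y := (@vY R V).
Variables (v : 'I_n -> V) (N : 'I_n -> 'I_n -> nat).
Hypothesis vN : forall i j : 'I_n, (i < j)%N -> trunc Y (v i) (v j) (N i j)%:Z.

Let P r (k : idx) : V := wpr r (dmuls (dens N) (EVarr v) k).

Lemma dtot_linear (U U' : lmodType C) (g : U -> U') (c : idx -> U) k : linear g ->
  dtot (fun k => g (c k)) k = g (dtot c k).
Proof.
by move=> lg; rewrite /dtot (lin_sum _ _ lg); apply: eq_bigr => i _; rewrite (linZ _ _ lg).
Qed.

Lemma dtot_EVarr_wpr r k : dtot (P r) k = @DV R V (P (r - 1) k).
Proof.
rewrite /P (dtot_linear _ _ (@wpr_linear _ V r)) dtot_dmuls.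
rewrite -(dmuls_ext _ (DV_EVarr v)) -[RHS](@wpr_DW (adjoint V)); congr wpr.
by apply: dmuls_additive => x y; exact: (linB (@DV_linear R V)).
Qed.

Lemma iter_dtot_EVarr j r k :
  iter j (@dtot R n V) (P r) k = iter j (@DV R V) (P (r - j%:R) k).
Proof.
elim: j r k => [|j IH] r k /=; first by rewrite subr0.
rewrite (dtot_ext (IH r)) (dtot_linear _ _ (@iterD_linear R V (adjoint V) j)).
rewrite dtot_EVarr_wpr -iterSr -natr1 opprD addrA.
reflexivity.
Qed.

(* E_V intertwines translations: E_V(v; z) = e^(zeta D) E_V(v; z - zeta). *)
Lemma EV_translation z (zeta : C) r :
  EV v z r = expD (W := adjoint V) zeta (EV v (fun i => z i - zeta)) r.
Proof.
have wb := EV_wbar vN (fun i => z i - zeta).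
have [J0 hJ] := @expD_wbarE (adjoint V) _ r wb.
have [cz|nz] := pselect (conf z); last first.
  have nz' : ~ conf (fun i => z i - zeta).
    by move=> c; apply: nz => i j e; apply: c; rewrite e.
  rewrite (EV_zero vN) // (hJ J0) // big1 // => j _.
  by rewrite (EV_zero vN) // divD_modes0 scaler0.
have cz' : conf (fun i => z i - zeta) by move=> i j /addIr /cz.
have [fP nP _] := EVarr_regular vN.
have nP' r' : negsupp (P r').
  by move=> k i ki; rewrite /P (nP k i) // (lin0 (@wpr_linear _ V r')).
apply: (@gdual_separates_eq R V) => w' gw.
have lw : linear (w' : V -> C^o) by move=> a x y; rewrite linearP.
have [m0 hm] := taylor_evalA (fun i => z i - zeta) zeta
   (finsupp_comp (raddf0 w') (fP r)) (fun k i ki => etrans (congr1 w' (nP' r k i ki)) (raddf0 w')).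
have {}hm := hm _ (leq_maxr J0 m0); rewrite (hJ _ (leq_maxl J0 m0)).
have zz : (fun i => z i - zeta + zeta) = z by apply/funext => i; rewrite subrK.
rewrite zz in hm.
rewrite (EV_rat_fun vN) /rat_fun !asboolT //.
have -> : diag_den N (fun i => z i - zeta) = diag_den N z.
  by apply: eq_bigr => i _; apply: eq_bigr => j _; rewrite opprB addrA subrK.
rewrite linearZ /= -(evalA_linear z lw (fP r)) hm raddf_sum /= mulr_sumr.
apply: eq_bigr => j _; rewrite linearZ /= (linZ _ _ (@divD_linear _ _ (adjoint V) j)) linearZ /=.
rewrite [RHS]mulrCA; congr (_ * _); rewrite -[LHS]mulrA; congr (_ * _).
rewrite /divD linearZ /=; congr (_ * _).
rewrite -(evalA_linear _ (@iterD_linear _ _ (adjoint V) j) (fP _)).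
rewrite -(evalA_linear _ lw); last first.
  by apply: finsupp_comp (fP _); exact: (lin0 (@iterD_linear _ _ (adjoint V) j)).
have e k : iter j (@dtot R n C^o) (fun k => w' (P r k)) k =
    w' (iter j (@DV R V) (P (r - j%:R) k)).
  rewrite -(iter_dtot_EVarr j r k).
  elim: (nat_of_ord j) k => [|i IH] k; first by [].
  by rewrite 2!iterS (dtot_ext IH) (dtot_linear _ _ lw).
exact: (congr1 (fun Q : idx -> C^o => evalA Q _) (funext e)).
Qed.
End Translation.

Lemma evalA_sum (R : realType) n (U : lmodType (Cx R)) (J : Type) (s : seq J)
    (P : J -> {ffun 'I_n -> int} -> U) z : (forall j, finsupp (P j)) ->
  evalA (fun k => \sum_(j <- s) P j k) z = \sum_(j <- s) evalA (P j) z.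
Proof.
move=> fP; have f0 : finsupp (fun _ : {ffun 'I_n -> int} => 0 : U) by exists fset0.
have fs s' : finsupp (fun k => \sum_(j <- s') P j k).
  elim: s' => [|j s' [A hA]]; first by exists fset0 => k _; rewrite big_nil.
  have [B hB] := fP j; exists (A `|` B)%fset => k; rewrite in_fsetU negb_or => /andP[kA kB].
  by rewrite big_cons hA // hB // addr0.
elim: s => [|j s IH].
  by rewrite big_nil (evalAE _ (A := fset0)) ?big_seq_fset0 // => k _; rewrite big_nil.
rewrite big_cons -IH -[evalA (P j) z]scale1r -evalA_lin //.
by congr evalA; apply/funext => k; rewrite big_cons scale1r.
Qed.

Section TranslationMaps.
Variable R : realType.
Local Notation C := (Cx R).
Variables (V : vertexSuperalgebra R) (W : supermodule V) (f : V -> W).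

Definition D_map := [/\ linear f, forall r v, wpr r (f v) = f (wpr r v) &
  forall v, f (@DV R V v) = @DW R V W (f v)].

Hypothesis fD : D_map.

Lemma D_map_divD j v : f (@divD R V (adjoint V) j v) = divD j (f v).
Proof.
have [lf _ fDV] := fD.
rewrite /divD (linZ _ _ lf); congr (_ *: _).
elim: j => [//|j IH] /=; rewrite -IH; exact: fDV.
Qed.

Lemma D_map_expD z (x : C -> V) r : wbar x ->
  f (expD (W := adjoint V) z x r) = expD z (fun s => f (x s)) r.
Proof.
have [lf fw _] := fD => wx.
have [J hJ] := @expD_wbarE R V (adjoint V) x r wx.
have wfx : wbar (fun s => f (x s)) by move=> s; rewrite /wt fw wx.
have [J' hJ'] := expD_wbarE r wfx.
rewrite (hJ _ (leq_maxl J J')) (hJ' _ (leq_maxr J J')) (lin_sum _ _ lf).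
by apply: eq_bigr => j _; rewrite (linZ _ _ lf) D_map_divD.
Qed.
End TranslationMaps.

Section DerivationFacts.
Variable R : realType.
Local Notation C := (Cx R).
Variables (V : vertexSuperalgebra R) (W : supermodule V).
Local Notation YW := (@YW R V W).
Local Notation Y := (@vY R V).
Local Notation DW := (@DW R V W).
Let fY := @vY_field R V.
Let fW := @YW_field R V W.

Lemma skew_op_vac (w : W) i : skew_op w (- i%:Z - 1) (vac V) = divD i w.
Proof.
rewrite (skew_opE (n := i.+1) (@trunc_vac R V W w)); last by lia.
rewrite big_ord_recr /= big1 ?add0r => [|j _].
  have -> : - i%:Z - 1 + i%:Z = -1 by lia.
  by rewrite YW_vac eqxx opprK subrr expr0z scale1r.
have ji := ltn_ord j; rewrite YW_vac; case: eqP => [e|_].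
  by exfalso; move: (nat_of_ord j) ji e => x; lia.
by rewrite divD_modes0 scaler0.
Qed.

Lemma skew_super_vac (w : W) i :
  skew_super false w (- i%:Z - 1) (vac V) + skew_super true w (- i%:Z - 1) (vac V) = divD i w.
Proof.
have tv : ppr true (vac V) = 0 by rewrite -{1}(@vac_par R V) pprM.
rewrite /skew_super !big_bool /= tv (@vac_par R V).
rewrite !(lin0 (@skew_op_linear_r R V W _ _)) !scaler0 !add0r !expr0 !scale1r !skew_op_vac.
rewrite [in RHS](ppr_sum w) -[ppr false w in RHS]scale1r.
by rewrite (@divD_linear R V W i) scale1r.
Qed.

Variables (f : V -> W) (df : derivation f).

Lemma der_linear : linear f. Proof. by case: df. Qed.

Lemma der_ppr p v : ppr p (f v) = f (ppr p v).
Proof.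
have [lf _ pf _] := df.
rewrite {1}(ppr_sum v) (linD _ _ lf) (linD _ _ (@ppr_linear _ W p)).
rewrite -(pf _ _ (par_ppr false v)) -(pf _ _ (par_ppr true v)) !pprM.
by case: p => /=; rewrite ?addr0 ?add0r; exact: pf (par_ppr _ _).
Qed.

Lemma der_wpr r v : wpr r (f v) = f (wpr r v).
Proof.
have [lf wf _ _] := df; have [A ->] := wpr_decomp v.
rewrite !(lin_sum _ _ lf) !(lin_sum _ _ (@wpr_linear _ _ r)) (lin_sum _ _ lf).
apply: eq_bigr => s _; rewrite wprM -(wf _ _ (wt_wpr s v)) wprM.
by case: eqP => [->|_]; [exact: wf (wt_wpr _ _)|rewrite (lin0 lf)].
Qed.

Lemma der_modes u k y :
  f (Y u k y) = skew_super false (f u) k y + skew_super true (f u) k y + YW u k (f y).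
Proof.
have [lf _ _ hf] := df.
have e p q : f (Y (ppr p u) k (ppr q y)) =
   (-1) ^+ (p && q) *: skew_op (ppr p (f u)) k (ppr q y) + YW (ppr p u) k (f (ppr q y)).
  by rewrite der_ppr (hf _ _ _ _ (par_ppr p u) (par_ppr q y)).
have eY p : f (Y (ppr p u) k y) = skew_super p (f u) k y + YW (ppr p u) k (f y).
  rewrite {1}(ppr_sum y) (modesDr fY) (linD _ _ lf) !e /skew_super big_bool /=.
  rewrite addrACA [X in X + _]addrC; congr (_ + _).
  by rewrite -(modesDr fW) -(linD _ _ lf) -ppr_sum.
rewrite {1}(ppr_sum u) (modesDl fY) (linD _ _ lf) !eY addrACA; congr (_ + _).
by rewrite -(modesDl fW) -ppr_sum.
Qed.

Lemma der_vac : f (vac V) = 0.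
Proof.
have := der_modes (vac V) (- 0%:Z - 1) (vac V).
rewrite skew_super_vac divD0 vY_vac YW_vac /= -{1}[f (vac V)]addr0 => /addrI.
by move=> <-.
Qed.

Lemma der_DV v : f (@DV R V v) = DW (f v).
Proof.
rewrite /DV -[- 2]/(- 1%:Z - 1) der_modes skew_super_vac der_vac (modes0r fW) addr0.
by rewrite /divD invr1 scale1r.
Qed.

Lemma der_D_map : D_map f.
Proof. by split; [exact: der_linear|exact: der_wpr|exact: der_DV]. Qed.

Variable n : nat.
Local Notation idx := {ffun 'I_n -> int}.

Definition der_at (v : 'I_n -> V) (i : 'I_n) : 'I_n -> V + W :=
  fun j => if j == i then inr (f (v j)) else inl (v j).

(* Leibniz rule *)
Lemma der_EVarr (v : 'I_n -> V) (k : idx) :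
  f (EVarr v k) = \sum_i (fprod (der_at v i) k (vac V, 0)).2.
Proof.
rewrite /EVarr /modes_prod /fprod -[in RHS]big_enum /=.
have : uniq (enum 'I_n) by exact: enum_uniq.
elim: (enum 'I_n) => [_|j s IH] /=; first by rewrite big_nil der_vac.
move=> /andP[js us]; rewrite big_cons der_modes IH // (modes_sumr fW); congr (_ + _).
  rewrite /field_at /der_at eqxx /=.
  have -> : (foldr (fun i x => field_at (fun j0 => fld (der_at v j j0)) i (k i) x) (vac V, 0) s).1 =
      foldr (fun i x => Y (v i) (k i) x) (vac V) s.
    elim: s js {IH us} => [//|i s IH]; rewrite in_cons negb_or => /andP[ji js] /=.
    rewrite -IH // /field_at /der_at eq_sym (negPf ji) /=.
    by rewrite -(modesDl fY) -ppr_sum.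
  by [].
rewrite big_seq [RHS]big_seq; apply: eq_bigr => i is_.
have ji : (j == i) = false by apply/eqP => e; rewrite e is_ in js.
by rewrite /field_at /der_at ji /= -(modesDl fW) -ppr_sum.
Qed.

Variables (v : 'I_n -> V) (N : 'I_n -> 'I_n -> nat).
Hypothesis vN : forall i j : 'I_n, (i < j)%N -> trunc Y (v i) (v j) (N i j)%:Z.
Hypothesis vwN : forall i j : 'I_n, (i < j)%N -> trunc YW (v i) (f (v j)) (N i j)%:Z.
Hypothesis wvN : forall i j : 'I_n, (i < j)%N -> trunc YW (v j) (f (v i)) (N i j)%:Z.

Lemma der_at_compat i0 (i j : 'I_n) : (i < j)%N -> compat (der_at v i0 i) (der_at v i0 j) (N i j).
Proof.
move=> ij; rewrite /der_at; case: eqP => [_|_]; case: eqP => [_|_] //=.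
- exact: wvN.
- exact: vwN.
exact: vN.
Qed.

Lemma der_at_regular i0 : regular N 0 (fun k => (fprod (der_at v i0) k (vac V, 0)).2).
Proof.
by apply: fprod_regular2; [exact: der_at_compat|move=> i p k; exact: fld_creation].
Qed.

Lemma der_EV z r :
  f (EV v z r) = \sum_i rat_fun N (@conf R n) (fun k => (fprod (der_at v i) k (vac V, 0)).2) z r.
Proof.
have lf := der_linear.
rewrite (EV_rat_fun vN) /rat_fun; case: asboolP => cz; last first.
  by rewrite (lin0 lf) big1.
have [fP _ _] := EVarr_regular vN.
rewrite (linZ _ _ lf) -(evalA_linear z lf (fP r)) -scaler_sumr; congr (_ *: _).
have ls := @evalA_sum _ _ _ _ (enum 'I_n) (fun i k => wpr r (dmuls (dens N)
     (fun k => (fprod (der_at v i) k (vac V, 0)).2) k)) z.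
rewrite -[RHS]big_enum -ls; last by move=> i; have [h _ _] := der_at_regular i.
congr evalA; apply/funext => k.
rewrite -(lin_sum _ _ (@wpr_linear _ W r)) -dmuls_sum -der_wpr; congr wpr.
rewrite -(@dmuls_additive _ _ _ _ f) => [|x y]; last exact: linB.
by apply: dmuls_ext => k'; rewrite der_EVarr big_enum.
Qed.
End DerivationFacts.

Section Splitting.
Variable R : realType.
Local Notation C := (Cx R).
Variables l0 l1 : nat.
Local Notation n := (l0 + l1)%N.
Local Notation idx m := {ffun 'I_m -> int}.

Definition kl (k : idx n) : idx l0 := [ffun a => k (lshift l1 a)].
Definition kr (k : idx n) : idx l1 := [ffun b => k (rshift l0 b)].
Definition kjoin (q : idx l1 * idx l0) : idx n :=
  [ffun i => match fintype.split i with inl a => q.2 a | inr b => q.1 b end].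

Lemma kl_join q : kl (kjoin q) = q.2.
Proof.
apply/ffunP => a; rewrite !ffunE; have := unsplitK (inl a : 'I_l0 + 'I_l1).
by rewrite /= => ->.
Qed.

Lemma kr_join q : kr (kjoin q) = q.1.
Proof.
apply/ffunP => a; rewrite !ffunE; have := unsplitK (inr a : 'I_l0 + 'I_l1).
by rewrite /= => ->.
Qed.

Lemma kjoinK k : kjoin (kr k, kl k) = k.
Proof.
apply/ffunP => i; rewrite ffunE; case: (fintype.splitP i) => [a|b] e /=; rewrite !ffunE; congr (k _);
  exact: val_inj.
Qed.

Lemma kjoin_inj : injective kjoin.
Proof.
move=> [p q] [p' q'] e; have := congr1 kr e; have := congr1 kl e.
by rewrite !kr_join !kl_join /= => -> ->.
Qed.

Lemma kl_unl k a : kl (k + un (lshift l1 a)) = kl k + un a.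
Proof. by apply/ffunP => b; rewrite idxD !ffunE (inj_eq (@lshift_inj _ _)). Qed.

Lemma kr_unl k a : kr (k + un (lshift l1 a)) = kr k.
Proof. by apply/ffunP => b; rewrite !ffunE eq_rlshift addr0. Qed.

Lemma kr_unr k b : kr (k + un (rshift l0 b)) = kr k + un b.
Proof. by apply/ffunP => a; rewrite idxD !ffunE (inj_eq (@rshift_inj _ _)). Qed.

Lemma kl_unr k b : kl (k + un (rshift l0 b)) = kl k.
Proof. by apply/ffunP => a; rewrite !ffunE eq_lrshift addr0. Qed.

Lemma enum_split : enum 'I_n = map (lshift l1) (enum 'I_l0) ++ map (@rshift l0 l1) (enum 'I_l1).
Proof.
apply: (inj_map val_inj); rewrite val_enum_ord map_cat -(map_comp val (lshift l1)) -(map_comp val (@rshift l0 l1)) iotaD add0n; congr (_ ++ _).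
  by rewrite -[LHS]val_enum_ord; apply: eq_map.
rewrite -[in LHS](addn0 l0) iotaDl -[iota 0 l1]val_enum_ord -(map_comp (addn l0) val).
by apply: eq_map.
Qed.

Definition lsh2 (p : 'I_l0 * 'I_l0) := (lshift l1 p.1, lshift l1 p.2).
Definition rsh2 (p : 'I_l1 * 'I_l1) := (rshift l0 p.1, rshift l0 p.2).

Lemma dmuls_lsh (U : zmodType) s (c : idx l0 -> idx l1 -> U) k :
  dmuls (map lsh2 s) (fun k => c (kl k) (kr k)) k = dmuls s (fun k' => c k' (kr k)) (kl k).
Proof.
elim: s k => [//|p s IH] k /=; rewrite /dmul !IH !kl_unl !kr_unl.
by [].
Qed.

Lemma dmuls_rsh (U : zmodType) s (c : idx l0 -> idx l1 -> U) k :
  dmuls (map rsh2 s) (fun k => c (kl k) (kr k)) k = dmuls s (fun k'' => c (kl k) k'') (kr k).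
Proof.
elim: s k => [//|p s IH] k /=; rewrite /dmul !IH !kl_unr !kr_unr.
by [].
Qed.

Lemma mon_split (z : 'I_n -> C) k :
  mon z k = mon (fun a => z (lshift l1 a)) (kl k) * mon (fun b => z (rshift l0 b)) (kr k).
Proof.
rewrite /mon big_split_ord /=.
by congr (_ * _); apply: eq_bigr => a _; rewrite ffunE.
Qed.

Variable N : 'I_n -> 'I_n -> nat.
Definition Nl (a b : 'I_l0) := N (lshift l1 a) (lshift l1 b).
Definition Nr (a b : 'I_l1) := N (rshift l0 a) (rshift l0 b).
Definition mixed : seq ('I_n * 'I_n) :=
  flatten [seq row_factors N (lshift l1 a) (map (@rshift l0 l1) (enum 'I_l1)) | a <- enum 'I_l0].

Lemma row_factors_cat i s t : row_factors N i (s ++ t) = row_factors N i s ++ row_factors N i t.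
Proof. by rewrite /row_factors map_cat flatten_cat. Qed.

Lemma factors_cat s t : perm_eq (factors N (s ++ t))
  (flatten [seq row_factors N i t | i <- s] ++ (factors N s ++ factors N t)).
Proof.
elim: s => [|i s IH] //=; rewrite row_factors_cat.
have /permP IH' := IH; apply/permP => P.
by rewrite !count_cat IH' !count_cat; move: (count _ _) => x; lia.
Qed.

Lemma factors_lsh s : factors N (map (lshift l1) s) = map lsh2 (factors Nl s).
Proof.
elim: s => [//|a s IH] /=; rewrite IH map_cat; congr (_ ++ _).
rewrite /row_factors -map_comp map_flatten -map_comp; congr flatten; apply: eq_map => b /=.
by rewrite map_nseq.
Qed.

Lemma factors_rsh s : factors N (map (@rshift l0 l1) s) = map rsh2 (factors Nr s).
Proof.
elim: s => [//|a s IH] /=; rewrite IH map_cat; congr (_ ++ _).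
rewrite /row_factors -map_comp map_flatten -map_comp; congr flatten; apply: eq_map => b /=.
by rewrite map_nseq.
Qed.

Lemma dens_split : perm_eq (dens N) (mixed ++ (map lsh2 (dens Nl) ++ map rsh2 (dens Nr))).
Proof.
rewrite /dens enum_split; apply: perm_trans (factors_cat _ _) _.
by rewrite factors_lsh factors_rsh -map_comp.
Qed.

Lemma mem_mixed p : p \in mixed -> exists a b, p = (lshift l1 a, rshift l0 b).
Proof.
move=> /flattenP[s /mapP[a _ ->]] /mem_row_factors[p1 /mapP[b _ p2]].
by exists a, b; rewrite [p]surjective_pairing p1 p2.
Qed.

Lemma diag_den_split (z : 'I_n -> C) : diag_den N z =
  \prod_(p <- mixed) (z p.1 - z p.2) *
  (diag_den Nl (fun a => z (lshift l1 a)) * diag_den Nr (fun b => z (rshift l0 b))).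
Proof.
rewrite -!prod_dens (perm_big _ dens_split) !big_cat /=; congr (_ * (_ * _)).
  by rewrite big_map.
by rewrite big_map.
Qed.
End Splitting.

Section Composition.
Variable R : realType.
Local Notation C := (Cx R).
Variables (V : vertexSuperalgebra R) (W : supermodule V).
Local Notation YW := (@YW R V W).
Local Notation Y := (@vY R V).
Let fY := @vY_field R V.
Let fW := @YW_field R V W.
Local Notation idx m := {ffun 'I_m -> int}.

Lemma trunc_wprl (U1 U2 : gradedSpace R) (Y1 : modes U1 U2) u w K s : field_map Y1 ->
  trunc Y1 u w K -> trunc Y1 (wpr s u) w K.
Proof.
move=> f1 h s' r' p' q' k Kk; rewrite [wpr s' _]wpr_ppr wprM; case: eqP => _.
  by rewrite -wpr_ppr; exact: h.
by rewrite (lin0 (@ppr_linear _ U1 _)) (modes0l f1).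
Qed.

Lemma trunc_wprr (U1 U2 : gradedSpace R) (Y1 : modes U1 U2) u w K s : field_map Y1 ->
  trunc Y1 u w K -> trunc Y1 u (wpr s w) K.
Proof.
move=> f1 h s' r' p' q' k Kk; rewrite [wpr r' _]wpr_ppr wprM; case: eqP => _.
  by rewrite -wpr_ppr; exact: h.
by rewrite (lin0 (@ppr_linear _ U2 _)) (modes0r f1).
Qed.

Lemma dmuls_supp n (U : zmodType) s (c : idx n -> U) (P : int -> Prop) :
  (forall k, c k <> 0 -> P (\sum_i k i)) ->
  forall k, dmuls s c k <> 0 -> P (\sum_i k i + (size s)%:Z).
Proof.
move=> h; elim: s => [|p s IH] k /=; first by rewrite addr0; exact: h.
have e i : \sum_j (k + un i) j + (size s)%:Z = \sum_j k j + (size s).+1%:Z.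
  by rewrite sum_un -addrA; congr (_ + _); rewrite -addn1 addrC PoszD.
rewrite /dmul => nz.
have [e1|/eqP/IH] := eqVneq (dmuls s c (k + un p.1)) 0; last by rewrite e.
have [e2|/eqP/IH] := eqVneq (dmuls s c (k + un p.2)) 0; last by rewrite e.
by case: nz; rewrite e1 e2 subr0.
Qed.

Lemma modes_prod_wt l (v : 'I_l -> V) (s : 'I_l -> C) (k : idx l) r w :
  (forall i, wt (s i) (v i)) -> wt r w ->
  wt (r + \sum_i s i - (\sum_i k i)%:~R - l%:R) (modes_prod YW v k w).
Proof.
move=> sv rw.
have -> : r + \sum_i s i - (\sum_i k i)%:~R - l%:R = r + \sum_i (s i - (k i)%:~R - 1).
  rewrite !sumrB rmorph_sum /= sumr_const card_ord !addrA.
  by congr (_ - _ - _).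
rewrite -big_enum /= /modes_prod; elim: (enum _) => [|i t IH] /=.
  by rewrite big_nil addr0.
have := modes_wt (k i) fW (@YW_d _ _ W) (sv i) IH.
by rewrite big_cons; congr wt; ring.
Qed.

Lemma modes_prod_linear l (v : 'I_l -> V) (k : 'I_l -> int) : linear (modes_prod YW v k).
Proof. by move=> a x y; exact: modes_prod_lin. Qed.

Lemma modes_prod_slot l (v : 'I_l -> V) (a : 'I_l) (A : seq C) (x : C -> V) k w :
  v a = \sum_(s <- A) x s ->
  modes_prod YW v k w = \sum_(s <- A) modes_prod YW [eta v with a |-> x s] k w.
Proof.
move=> va; rewrite /modes_prod.
have h s t : a \notin t ->
    foldr (fun i y => YW ([eta v with a |-> x s] i) (k i) y) w t
    = foldr (fun i y => YW (v i) (k i) y) w t.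
  elim: t => [//|i t IH]; rewrite in_cons negb_or => /andP[ai a_t].
  by rewrite [LHS]/= [RHS]/= IH //= eq_sym (negPf ai).
have : a \in enum 'I_l by rewrite mem_enum.
have : uniq (enum 'I_l) by exact: enum_uniq.
elim: (enum 'I_l) => [//|i t IH] /andP[it ut]; rewrite in_cons.
have [e _|ai /= a_t] := eqVneq a i.
  rewrite -e in it *.
  rewrite [LHS]/= va (modes_suml fW); apply: eq_bigr => s _.
  by rewrite [RHS]/= eqxx h.
rewrite IH // (modes_sumr fW); apply: eq_bigr => s _.
by rewrite eq_sym (negPf ai).
Qed.

Section Glued.
Variables l0 l1 : nat.
Local Notation n := (l0 + l1)%N.
Variable g : 'I_l1 -> V + W.

Definition glue (v : 'I_l0 -> V) (i : 'I_n) : V + W :=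
  match fintype.split i with inl a => inl (v a) | inr b => g b end.

Lemma glue_l v a : glue v (lshift l1 a) = inl (v a).
Proof. by rewrite /glue; have := unsplitK (inl a : 'I_l0 + 'I_l1); rewrite /= => ->. Qed.

Lemma glue_r v b : glue v (rshift l0 b) = g b.
Proof. by rewrite /glue; have := unsplitK (inr b : 'I_l0 + 'I_l1); rewrite /= => ->. Qed.

Definition right_arr (k : idx l1) : W := (fprod g k (vac V, 0)).2.
Definition glue_arr v (k : idx n) : W := (fprod (glue v) k (vac V, 0)).2.

Lemma glue_arrE v k : glue_arr v k = modes_prod YW v (kl k) (right_arr (kr k)).
Proof.
rewrite /glue_arr /right_arr; have -> : fprod (glue v) k (vac V, 0) =
    fprod (fun a => inl (v a)) (kl k) (fprod g (kr k) (vac V, 0)).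
  rewrite /fprod enum_split field_prod_cat.
  have -> : field_prod (fun i => fld (glue v i)) (map (@rshift l0 l1) (enum 'I_l1)) k (vac V, 0) =
     field_prod (fun i => fld (g i)) (enum 'I_l1) (kr k) (vac V, 0).
    elim: (enum 'I_l1) => [//|b t IH]; rewrite [map _ _]/= !field_prod_cons IH.
    by rewrite /field_at glue_r ffunE.
  move: (field_prod _ (enum 'I_l1) _ _) => x; elim: (enum 'I_l0) => [//|a t IH].
  by rewrite [map _ _]/= !field_prod_cons IH /field_at glue_l ffunE.
by rewrite fprod_inl.
Qed.

Variable N : 'I_n -> 'I_n -> nat.

Definition glue_compat v := forall i j : 'I_n, (i < j)%N -> compat (glue v i) (glue v j) (N i j).

Definition left_form v (w' : {scalar W}) (k : idx l0) (x : W) : C :=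
  dmuls (dens (Nl N)) (fun k => w' (modes_prod YW v k x) : C^o) k.

Definition right_num (k : idx l1) : W := dmuls (dens (Nr N)) right_arr k.

Lemma left_form_linear v w' k a x y :
  left_form v w' k (a *: x + y) = a * left_form v w' k x + left_form v w' k y.
Proof.
rewrite /left_form -[a * _]/(a *: (_ : C^o)) -dmuls_lin; apply: dmuls_ext => k'.
by rewrite modes_prod_linear linearP.
Qed.

Lemma left_form0 v w' k : left_form v w' k 0 = 0.
Proof.
have := left_form_linear v w' k 1 0 0.
by rewrite scaler0 addr0 mul1r -{1}[left_form _ _ _ 0]addr0 => /addrI <-.
Qed.

Lemma left_form_sum v w' k (A : seq C) (x : C -> W) :
  left_form v w' k (\sum_(r <- A) x r) = \sum_(r <- A) left_form v w' k (x r).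
Proof.
apply: (big_morph (left_form v w' k)); last exact: left_form0.
by move=> y y'; have := left_form_linear v w' k 1 y y'; rewrite scale1r mul1r.
Qed.

Lemma glue_dmuls v (w' : {scalar W}) k :
  dmuls (map (@lsh2 l0 l1) (dens (Nl N)) ++ map (@rsh2 l0 l1) (dens (Nr N)))
    (fun k => w' (glue_arr v k) : C^o) k = left_form v w' (kl k) (right_num (kr k)).
Proof.
rewrite dmuls_cat.
have e k1 : dmuls (map (@rsh2 l0 l1) (dens (Nr N))) (fun k => w' (glue_arr v k) : C^o) k1 =
    w' (modes_prod YW v (kl k1) (right_num (kr k1))).
  rewrite (dmuls_ext _ (fun k => congr1 w' (glue_arrE v k))).
  rewrite (dmuls_rsh _ (fun k' k'' => w' (modes_prod YW v k' (right_arr k'')) : C^o)).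
  rewrite /right_num; by apply: (@dmuls_additive _ _ _ _ (fun x => w' (modes_prod YW v (kl k1) x) : C^o)) => x y;
    rewrite (linB (@modes_prod_linear _ _ _)) raddfB.
rewrite (dmuls_ext _ e).
exact: (dmuls_lsh _ (fun k' k'' => w' (modes_prod YW v k' (right_num k'')) : C^o)).
Qed.

Variable z : 'I_n -> C.
Hypothesis cz : conf z.
Hypothesis l1_gt0 : (0 < l1)%N.
Hypothesis lr : forall a b, `|z (rshift l0 b)| < `|z (lshift l1 a)|.

Let zl a := z (lshift l1 a).
Let zr b := z (rshift l0 b).

Lemma glue_regular v : glue_compat v -> regular N 0 (glue_arr v).
Proof. by move=> cv; apply: fprod_regular2 => // i p k; exact: fld_creation. Qed.

Lemma right_regular v : glue_compat v -> regular (Nr N) 0 right_arr.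
Proof.
move=> cv; apply: fprod_regular2 => [i j ij|i p k]; last exact: fld_creation.
by have := cv (rshift l0 i) (rshift l0 j); rewrite !glue_r /= ltn_add2l; exact.
Qed.

Lemma glue_cvg v (w' : {scalar W}) : glue_compat v -> gdual w' ->
  abs_cvg_to (fun k => left_form v w' (kl k) (right_num (kr k)) * mon z k)
    (diag_den (Nl N) zl * diag_den (Nr N) zr *
     pairing w' (rat_fun N (@conf R n) (glue_arr v) z)).
Proof.
move=> cv gw; have rv := glue_regular cv; have [fP nP tP] := rv.
rewrite (pairing_rat_fun gw fP cz) (diag_den_split N z).
set F : idx n -> C := fun k => w' (glue_arr v k).
set s := map (@lsh2 l0 l1) (dens (Nl N)) ++ map (@rsh2 l0 l1) (dens (Nr N)).
have eF k : left_form v w' (kl k) (right_num (kr k)) = dmuls s (F : idx n -> C^o) k.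
  by rewrite -glue_dmuls.
apply: (@abs_cvg_to_ext _ _ (fun k => dmuls s (F : idx n -> C^o) k * mon z k)).
  by move=> k; rewrite eF.
have p0 : \prod_(p <- mixed N) (z p.1 - z p.2) != 0.
  rewrite prodf_seq_neq0; apply/allP => p /mem_mixed[a [b ->]] /=.
  rewrite subr_eq0; apply/eqP => e; have := lr a b; by rewrite e ltxx.
have d1 : diag_den (Nl N) zl != 0.
  by apply: diag_den_neq0 => a b /cz /lshift_inj.
have d2 : diag_den (Nr N) zr != 0.
  by apply: diag_den_neq0 => a b /cz /rshift_inj.
have -> : dmuls (dens N) (F : idx n -> C^o) = dmuls (mixed N) (dmuls s (F : idx n -> C^o)).
  by apply/funext => k; rewrite (dmuls_perm _ (dens_split N)) dmuls_cat.
have fin : finsupp (dmuls (mixed N) (dmuls s (F : idx n -> C^o))).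
  have [A hA] := finsupp_gdual gw fP; exists A => k /hA.
  by rewrite (dmuls_perm _ (dens_split N)) dmuls_cat.
have := @dmuls_cvg R n z (mixed N) (dmuls s (F : idx n -> C^o)).
set E := evalA _ _ => h.
have -> : diag_den (Nl N) zl * diag_den (Nr N) zr *
   (E / (\prod_(p <- mixed N) (z p.1 - z p.2) * (diag_den (Nl N) zl * diag_den (Nr N) zr)))
   = E / \prod_(p <- mixed N) (z p.1 - z p.2) by field; rewrite p0 d1 d2.
apply: h => //.
- by move=> p /mem_mixed[a [b ->]]; exact: lr.
- move=> p /mem_mixed[a [b ->]]; apply: trunc_dir_dmuls => k.
  have ab : (lshift l1 a < rshift l0 b)%N by rewrite /= (leq_trans (ltn_ord a)) ?leq_addr.
  have [m0 hm] := tP _ _ ab k.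
  by exists m0 => m /hm; rewrite /F => ->; rewrite raddf0.
move=> k i zi ki; rewrite -eF; case: (fintype.splitP i) => [a|b] e.
  have ei : i = lshift l1 a by exact: val_inj.
  have := lr a (Ordinal l1_gt0); rewrite -ei zi normr0 => h0.
  by have := lt_le_trans h0 (normr_ge0 (z (rshift l0 (Ordinal l1_gt0)))); rewrite ltxx.
have [_ nR _] := right_regular cv.
rewrite /right_num (nR _ b) ?left_form0 // ffunE.
by have -> : rshift l0 b = i by exact: val_inj.
Qed.
End Glued.
End Composition.

Section JointSummation.
Variable R : realType.
Local Notation C := (Cx R).
Variables (V : vertexSuperalgebra R) (W : supermodule V).
Local Notation YW := (@YW R V W).
Local Notation Y := (@vY R V).
Let fY := @vY_field R V.
Let fW := @YW_field R V W.
Local Notation idx m := {ffun 'I_m -> int}.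
Variables l0 l1 : nat.
Local Notation n := (l0 + l1)%N.
Variables (g : 'I_l1 -> V + W) (N : 'I_n -> 'I_n -> nat).
Variable z : 'I_n -> C.
Hypothesis cz : conf z.
Hypothesis l1_gt0 : (0 < l1)%N.
Hypothesis lr : forall a b, `|z (rshift l0 b)| < `|z (lshift l1 a)|.
Let zl a := z (lshift l1 a).
Let zr b := z (rshift l0 b).

Local Notation wproj w' t := (comp_scalar w' (@wpr_linear _ W t)).

Definition joint v (w' : {scalar W}) (q : C * idx n) : C :=
  left_form N v w' (kl q.2) (wpr q.1 (right_num g N (kr q.2))) * mon z q.2.

Lemma wpr_decomp0 (U : gradedSpace R) (x : U) :
  exists A : {fset C}, x = \sum_(r <- A) wpr r x /\ forall r, r \notin A -> wpr r x = 0.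
Proof.
have [A hA] := wpr_decomp x; exists A; split=> // r rA.
rewrite hA (lin_sum _ _ (@wpr_linear _ U r)) big_seq big1 // => s sA.
by rewrite wprM; case: eqP => // e; rewrite e sA in rA.
Qed.

Lemma left_form_hom v (s : 'I_l0 -> C) (w' : {scalar W}) t r0 k x : (forall a, wt (s a) (v a)) ->
  left_form N v (wproj w' t) k (wpr r0 x) <> 0 ->
  r0 = t - \sum_a s a + (\sum_a k a + (size (dens (Nl N)))%:Z)%:~R + l0%:R.
Proof.
move=> sv nz.
have h : forall k' : idx l0, wproj w' t (modes_prod YW v k' (wpr r0 x)) <> 0 ->
    t = r0 + \sum_a s a - (\sum_a k' a)%:~R - l0%:R.
  move=> k' nz'; apply/eqP; case: eqVneq => // ne; case: nz'.
  have wu := modes_prod_wt k' sv (wt_wpr r0 x).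
  by rewrite [LHS]/= /comp_scalar /= /scalar_fun (wt_neq wu ne) raddf0.
have := @dmuls_supp l0 C (dens (Nl N)) _ (fun e => t = r0 + \sum_a s a - e%:~R - l0%:R) h k nz.
by move=> ->; ring.
Qed.

Lemma joint_hom v (s : 'I_l0 -> C) (w' : {scalar W}) t :
  glue_compat g N v -> (forall a, wt (s a) (v a)) ->
  abs_bounded (joint v (wproj w' t)).
Proof.
move=> cv sv; pose rho (k : idx n) : C :=
  t - \sum_a s a + (\sum_a kl k a + (size (dens (Nl N)))%:Z)%:~R + l0%:R.
have supp r0 k x : r0 != rho k -> left_form N v (wproj w' t) (kl k) (wpr r0 x) = 0.
  move=> ne; apply/eqP; apply/negP => /negP/eqP /(left_form_hom sv) e.
  by rewrite e eqxx in ne.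
have tot k x : left_form N v (wproj w' t) (kl k) x =
    left_form N v (wproj w' t) (kl k) (wpr (rho k) x).
  have [A [hA zA]] := wpr_decomp0 x; rewrite {1}hA left_form_sum.
  have [rA|rA] := boolP (rho k \in A).
    rewrite (big_fsetD1 _ rA) /= big_seq big1 ?addr0 // => r.
    by rewrite in_fsetD1 => /andP[ne _]; exact: supp.
  rewrite zA // left_form0 big_seq big1 // => r rA'; apply: supp.
  by apply: contraNneq rA => <-.
have gw := @gdual_wpr R W w' t.
have cvg := glue_cvg cz l1_gt0 lr cv gw.
have hi : injective (fun k : idx n => (rho k, k)) by move=> k k' [].
have := abs_cvg_to_reindex (F := joint v (wproj w' t)) (diag_den (Nl N) zl * diag_den (Nr N) zr *
     pairing (wproj w' t) (rat_fun N (@conf R n) (glue_arr g v) z)) hi.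
case=> [[r0 k] h|h _].
  rewrite /joint /= supp ?mul0r //; apply/eqP => e; apply: (h k); by rewrite e.
apply: abs_cvg_to_bounded (h _).
by apply: abs_cvg_to_ext cvg => k; rewrite /joint /= -tot.
Qed.

Lemma abs_bounded_ext (I : choiceType) (F G : I -> C) : F =1 G -> abs_bounded F -> abs_bounded G.
Proof. by move=> e; apply: abs_bounded_le => i; rewrite e. Qed.

Lemma left_form_slot v (a : 'I_l0) (A : seq C) (x : C -> V) (w' : {scalar W}) k y :
  v a = \sum_(s <- A) x s ->
  left_form N v w' k y = \sum_(s <- A) left_form N [eta v with a |-> x s] w' k y.
Proof.
move=> va; rewrite /left_form -dmuls_sum; apply: dmuls_ext => k'.
by rewrite (modes_prod_slot _ _ va) raddf_sum.
Qed.

Lemma compat_wprl (v : V) (h : V + W) (m : nat) s : compat (inl v) h m -> compat (inl (wpr s v)) h m.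
Proof. by case: h => [u|w] /=; exact: trunc_wprl. Qed.

Lemma compat_wprr (v : V) (h : V + W) (m : nat) s : compat h (inl v) m -> compat h (inl (wpr s v)) m.
Proof. by case: h => [u|w] /=; [exact: trunc_wprr|exact: trunc_wprl]. Qed.

Lemma glue_compat_wpr v u : glue_compat g N v ->
  (forall a, u a = v a \/ exists s, u a = wpr s (v a)) -> glue_compat g N u.
Proof.
move=> cv uv i j ij.
have e i' : glue g u i' = glue g v i' \/
    exists2 y, glue g v i' = inl y & exists s, glue g u i' = inl (wpr s y).
  rewrite /glue; case: (fintype.split i') => [a|b]; last by left.
  by have [->|[s ->]] := uv a; [left|right; exists (v a) => //; exists s].
have := cv i j ij; have [->|[y -> [s ->]]] := e i.
  by have [->|[y -> [s ->]]] := e j; [|exact: compat_wprr].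
have [->|[y' -> [s' ->]]] := e j; first exact: compat_wprl.
by move=> h; apply: compat_wprl; exact: compat_wprr.
Qed.

Lemma joint_bounded v (w' : {scalar W}) : glue_compat g N v -> gdual w' -> abs_bounded (joint v w').
Proof.
move=> cv gw; have [A [hA _]] := gdual_supp gw.
apply: (@abs_bounded_ext _ (fun q => \sum_(t <- A) joint v (wproj w' t) q)).
  move=> [r k]; rewrite /joint /= -mulr_suml; congr (_ * _).
  by rewrite /left_form -dmuls_sum; apply: dmuls_ext => k'; rewrite [RHS]hA.
apply: abs_bounded_sum => t.
suff H (T : seq 'I_l0) : forall u, (forall a, u a = v a \/ exists s, u a = wpr s (v a)) ->
    (forall a, a \notin T -> exists s, wt s (u a)) -> abs_bounded (joint u (wproj w' t)).
  by apply: (H (enum 'I_l0)) => a; [left|rewrite mem_enum].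
elim: T => [|a T IH] u uv uT.
  have /choice[s hs] : forall a, exists s, wt s (u a) by move=> a; exact: uT.
  by apply: joint_hom hs; exact: glue_compat_wpr uv.
have [B [hB _]] := wpr_decomp0 (u a).
apply: (@abs_bounded_ext _ (fun q => \sum_(s <- B) joint [eta u with a |-> wpr s (u a)] (wproj w' t) q)).
  by move=> [r k]; rewrite /joint /= -mulr_suml -(left_form_slot _ _ _ hB).
apply: abs_bounded_sum => s; apply: IH => [b|b bT] /=.
  case: eqP => [->|_]; last exact: uv.
  right; have [->|[s' ->]] := uv a; first by exists s.
  rewrite wprM; case: eqP => [_|ne]; first by exists s.
  have [r hr] := low_weights V 0; exists (0 - r%:R); by rewrite hr.
case: eqP => [_|ba]; first by exists s; exact: wt_wpr.
by apply: uT; rewrite in_cons negb_or bT andbT; apply/eqP.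
Qed.
End JointSummation.

Section CompositionSum.
Variable R : realType.
Local Notation C := (Cx R).
Variables (V : vertexSuperalgebra R) (W : supermodule V).
Local Notation YW := (@YW R V W).
Let fW := @YW_field R V W.
Local Notation idx m := {ffun 'I_m -> int}.

(* <w', Y_W(v_1, z_1) ... Y_W(v_l, z_l) x> *)
Definition left_fun l (M : 'I_l -> 'I_l -> nat) (v : 'I_l -> V) (x : W) (z : 'I_l -> C) : C -> W :=
  rat_fun M (@conf0 R l) (fun k => modes_prod YW v k x) z.

Variables l0 l1 : nat.
Local Notation n := (l0 + l1)%N.
Variables (g : 'I_l1 -> V + W) (N : 'I_n -> 'I_n -> nat) (v : 'I_l0 -> V).
Hypothesis cv : glue_compat g N v.

Lemma left_regular x : exists M, regular (Nl N) M (fun k => modes_prod YW v k x).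
Proof.
have tr (a : 'I_l0) : exists K : nat, forall p (k : int), K%:Z <= k ->
  @fld R V W (inl (v a)) p k (0, x) = 0 by exact: fld_trunc.
have [K hK] := choice tr.
exists (\max_a K a)%N.
have -> : (fun k : idx l0 => modes_prod YW v k x) =
    (fun k => (fprod (fun a => inl (v a)) k (0, x)).2).
  by apply/funext => k; rewrite fprod_inl.
apply: fprod_regular2 => [i j ij|i p k Mk].
  by have := cv (i := lshift l1 i) (j := lshift l1 j); rewrite !glue_l; apply.
apply: hK; apply: le_trans Mk; rewrite lez_nat.
exact: (leq_bigmax i).
Qed.

Lemma left_is_Eprod x : is_Eprod YW v x (left_fun (Nl N) v x).
Proof. have [M rM] := left_regular x; exact: regular_is_E0 rM. Qed.

Variable z : 'I_n -> C.
Hypothesis cz : conf z.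
Hypothesis l1_gt0 : (0 < l1)%N.
Hypothesis lr : forall a b, `|z (rshift l0 b)| < `|z (lshift l1 a)|.
Let zl a := z (lshift l1 a).
Let zr b := z (rshift l0 b).
Variable w' : {scalar W}.
Hypothesis gw : gdual w'.

Lemma zl_conf0 : conf0 zl.
Proof.
split=> [a b /cz /lshift_inj //|a]; apply/eqP => e.
have := lr a (Ordinal l1_gt0); rewrite -/(zl a) e normr0 => h.
by have := lt_le_trans h (normr_ge0 (z (rshift l0 (Ordinal l1_gt0)))); rewrite ltxx.
Qed.

Lemma zr_conf : conf zr.
Proof. by move=> a b /cz /rshift_inj. Qed.

Lemma left_form_finsupp x : finsupp (fun k => left_form N v w' k x : C^o).
Proof. have [M [fP _ _]] := left_regular x; exact: finsupp_gdual gw fP. Qed.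

Definition left_eval (x : W) : C^o := evalA (U := C^o) (fun k => left_form N v w' k x) zl.

Lemma left_eval_linear : linear left_eval.
Proof.
move=> a x y; rewrite /left_eval -evalA_lin; try exact: left_form_finsupp.
apply: (congr1 (fun P : idx l0 -> C^o => evalA P zl)).
by apply/funext => k; rewrite left_form_linear.
Qed.

Lemma pairing_left_fun x : pairing w' (left_fun (Nl N) v x zl) =
  left_eval x / diag_den (Nl N) zl.
Proof.
have [M [fP _ _]] := left_regular x.
by rewrite /left_fun (pairing_rat_fun gw fP zl_conf0).
Qed.

Let dd := diag_den (Nl N) zl * diag_den (Nr N) zr.
Let a r0 := pairing w' (left_fun (Nl N) v (rat_fun (Nr N) (@conf R l1) (right_arr g) zr r0) zl).

Lemma dd_neq0 : dd != 0.
Proof.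
by rewrite mulf_neq0 // diag_den_neq0 //; [exact: zl_conf0.1|exact: zr_conf].
Qed.

Lemma joint_slice_weight r0 : abs_cvg_to (fun k => joint g N z v w' (r0, k)) (dd * a r0).
Proof.
have d1 := diag_den_neq0 (Nl N) zl_conf0.1; have d2 := diag_den_neq0 (Nr N) zr_conf.
have [fR _ _] := right_regular cv.
pose x (k : idx l1) := wpr r0 (right_num g N k).
have [A hA] : finsupp x by exact: fR.
pose L := left_eval.
have -> : dd * a r0 = \sum_(k <- A) mon zr k * L (x k).
  rewrite /dd /a pairing_left_fun /rat_fun asboolT; last exact: zr_conf.
  rewrite (linZ _ _ left_eval_linear) (evalAE _ hA).
  rewrite (lin_sum _ _ left_eval_linear) /GRing.scale /=.
  rewrite [X in _ * (_ * X / _)](_ : _ = \sum_(k <- A) mon zr k * L (x k)).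
    by field; rewrite d1 d2.
  by apply: eq_bigr => k _; rewrite (linZ _ _ left_eval_linear).
pose F (q : idx l1 * idx l0) := left_form N v w' q.2 (x q.1) * (mon zl q.2 * mon zr q.1).
have -> : (fun k => joint g N z v w' (r0, k)) = (fun k => F (kr k, kl k)).
  by apply/funext => k; rewrite /joint /F /= mon_split.
apply/(abs_cvg_to_reindex _ (@kjoin_inj l0 l1)) => [k h|].
  by case: (h (kr k, kl k)); rewrite kjoinK.
apply: (@abs_cvg_to_ext _ _ F); first by move=> q; rewrite kr_join kl_join -surjective_pairing.
have fB : forall k, exists B : {fset idx l0}, forall k', k' \notin B -> left_form N v w' k' (x k) = 0.
  by move=> k; exact: left_form_finsupp.
have [B hB] := choice fB.
pose B' := (\bigcup_(k <- A) B k)%fset.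
have BB' k k' : k' \notin B' -> left_form N v w' k' (x k) = 0.
  move=> kB; have [kA|kA] := boolP (k \in A); last by rewrite hA // left_form0.
  apply: hB; apply: contra kB => kB; apply/bigfcupP; exists k => //; by rewrite kA.
have -> : \sum_(k <- A) mon zr k * L (x k) = \sum_(q <- (A `*` B')%fset) F q.
  rewrite big_fsetX; apply: eq_bigr => k _; rewrite /L /left_eval (@evalAE _ _ _ _ _ B'); last exact: BB'.
  by rewrite mulr_sumr; apply: eq_bigr => k' _; rewrite /F /GRing.scale /=; ring.
apply: abs_cvg_to_finite => -[k k']; rewrite in_fsetM negb_and => /orP[kA|kB]; rewrite /F /=.
  by rewrite hA // left_form0 mul0r.
by rewrite BB' // mul0r.
Qed.

Lemma joint_slice_modes k : abs_cvg_to (fun r0 => joint g N z v w' (r0, k))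
  (left_form N v w' (kl k) (right_num g N (kr k)) * mon z k).
Proof.
have [A [hA zA]] := wpr_decomp0 (right_num g N (kr k)).
rewrite {1}hA left_form_sum mulr_suml.
by apply: abs_cvg_to_finite => r /zA; rewrite /joint /= => ->; rewrite left_form0 mul0r.
Qed.

(* Inserting the weight projections between the two blocks of operators does
   not change the sum. *)
Lemma composition_cvg : abs_cvg_to
  (fun r0 => pairing w' (left_fun (Nl N) v (rat_fun (Nr N) (@conf R l1) (right_arr g) zr r0) zl))
  (pairing w' (rat_fun N (@conf R n) (glue_arr g v) z)).
Proof.
have [S hS] := abs_bounded_cvg (joint_bounded cz l1_gt0 lr cv gw).
have h1 := abs_cvg_to_fubini hS joint_slice_weight.
have swap : abs_cvg_to (fun q : idx n * C => joint g N z v w' (q.2, q.1)) S.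
  apply/(abs_cvg_to_reindex (h := fun q : idx n * C => (q.2, q.1)) (F := joint g N z v w')) => //.
    by move=> [k r] [k' r'] /= [-> ->].
  by move=> [r k] h; case: (h (k, r)).
have h2 := abs_cvg_to_fubini swap joint_slice_modes.
have e := abs_cvg_to_uniq h2 (glue_cvg cz l1_gt0 lr cv gw).
have h3 := abs_cvg_toZ dd^-1 h1.
have e3 := mulKf dd_neq0 (pairing w' (rat_fun N (@conf R n) (glue_arr g v) z)).
rewrite e in h3; rewrite -e3.
exact: (abs_cvg_to_ext (fun r0 => mulKf dd_neq0 (a r0)) h3).
Qed.
End CompositionSum.

Section ExponentialCochain.
Variable R : realType.
Local Notation C := (Cx R).
Variables (V : vertexSuperalgebra R) (W : supermodule V).
Local Notation DW := (@DW R V W).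

Lemma cexpD (x y : C) : cexp (x + y) = cexp x * cexp y.
Proof.
case: x => a b; case: y => c d; rewrite /cexp /= expRD cosD sinD.
by apply/eqP; rewrite eq_complex /=; apply/andP; split; apply/eqP; ring.
Qed.

Lemma cexp0 : cexp 0 = 1 :> C.
Proof. by rewrite /cexp /= expR0 cos0 sin0 mul1r mulr0. Qed.

Lemma cexpMn (x : C) j : cexp (x * j%:R) = cexp x ^+ j.
Proof.
elim: j => [|j IH]; first by rewrite mulr0 cexp0 expr0.
by rewrite -natr1 mulrDr mulr1 cexpD IH exprSr.
Qed.

Lemma wpr_zpow (U : gradedSpace R) (lam r : C) (x : U) :
  wpr r (zpow_d lam x) = cexp (lam * r) *: wpr r x.
Proof.
have [A [hA zA]] := wpr_decomp0 x.
rewrite /zpow_d (@fsbigTE _ _ _ _ A); last by move=> s /zA ->; rewrite scaler0.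
rewrite (lin_sum _ _ (@wpr_linear _ U r)).
have e s : wpr r (cexp (lam * s) *: wpr s x) = if r == s then cexp (lam * r) *: wpr r x else 0.
  rewrite (linZ _ _ (@wpr_linear _ U r)) wprM; case: eqP => [->//|_]; exact: scaler0.
under eq_bigr do rewrite e.
have [rA|rA] := boolP (r \in A).
  rewrite (big_fsetD1 _ rA) /= eqxx big_seq big1 ?addr0 // => s.
  by rewrite in_fsetD1 eq_sym => /andP[/negPf ->].
by rewrite zA // scaler0 big1 // => s _; case: ifP.
Qed.

Lemma expD_lin z a (x y : C -> W) : wbar x -> wbar y ->
  expD z (fun s => a *: x s + y s) = fun r => a *: expD z x r + expD z y r.
Proof.
move=> wx wy; apply/funext => r.
have [J1 h1] := expD_wbarE r wx; have [J2 h2] := expD_wbarE r wy.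
have [J3 h3] := expD_wbarE r (wbar_lin a wx wy).
pose J := (J1 + J2 + J3)%N.
rewrite (h1 J) ?(h2 J) ?(h3 J) /J; try lia.
rewrite scaler_sumr -big_split; apply: eq_bigr => j _ /=.
rewrite (@divD_linear _ _ W) scalerDr; congr (_ + _).
by rewrite [LHS]scalerA [RHS]scalerA mulrC.
Qed.

Lemma DWbar_expD z (x : C -> W) : wbar x -> DWbar (expD z x) = expD z (DWbar x).
Proof.
move=> wx; apply/funext => r; rewrite {1}/DWbar.
have [J1 h1] := expD_wbarE (r - 1) wx; have [J2 h2] := expD_wbarE r (DWbar_wbar wx).
rewrite (h1 _ (leq_maxl J1 J2)) (h2 _ (leq_maxr J1 J2)) (lin_sum _ _ (@DW_linear _ _ W)).
apply: eq_bigr => j _; rewrite (linZ _ _ (@DW_linear _ _ W)) /DWbar divD_D D_divD.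
by congr (_ *: (_ *: divD _ (x _))); rewrite addrAC.
Qed.

Lemma low_weights_fset (U : gradedSpace R) (A : {fset C}) : exists J : nat,
  forall r, r \in A -> forall j : nat, (J <= j)%N -> forall x : U, wpr (r - j%:R) x = 0.
Proof.
have [J hJ] := choice (low_weights U).
exists (\max_(r <- A) J r)%N => r rA j Jj; apply: hJ; apply: leq_trans Jj.
by rewrite (big_fsetD1 _ rA) leq_maxl.
Qed.

Lemma pairing_expD (w' : {scalar W}) (x : C -> W) : gdual w' -> wbar x ->
  exists Q : {poly C}, forall z, pairing w' (expD z x) = Q.[z] /\
    pairing w' (DWbar (expD z x)) = Q^`().[z].
Proof.
move=> gw wx; have [A [_ zA]] := gdual_supp gw.
have [J hJ] := low_weights_fset W A.
have x0 r j : r \in A -> (J <= j)%N -> x (r - j%:R) = 0.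
  by move=> rA Jj; rewrite -(wx _); exact: hJ.
pose q j := \sum_(r <- A) w' (divD j (x (r - j%:R))).
have q0 j : (J <= j)%N -> q j = 0.
  by move=> Jj; rewrite /q big_seq big1 // => r rA; rewrite x0 // divD_modes0 raddf0.
pose Q := \poly_(j < J.+1) q j.
have Qq j : Q`_j = q j by rewrite coef_poly; case: ltnP => // /ltnW /q0 ->.
have hor (y : C -> W) (P : {poly C}) (K : nat) z : wbar y ->
    (forall r j, r \in A -> (K <= j)%N -> y (r - j%:R) = 0) ->
    (size P <= K)%N -> (forall j, P`_j = \sum_(r <- A) w' (divD j (y (r - j%:R)))) ->
    pairing w' (expD z y) = P.[z].
  move=> wy y0 sP Pj; rewrite (pairing_gdual zA (expD_wbar z wy)) (horner_coef_wide _ sP).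
  transitivity (\sum_(r <- A) \sum_(j < K) w' (z ^+ j *: divD j (y (r - j%:R)))).
    rewrite big_seq [RHS]big_seq; apply: eq_bigr => r rA.
    by rewrite (@expDE _ _ _ _ _ _ K) ?raddf_sum // => j; exact: y0.
  rewrite exchange_big /=; apply: eq_bigr => j _; rewrite Pj mulr_suml.
  by apply: eq_bigr => r _; rewrite linearZ mulrC.
exists Q => z; split.
  apply: (hor _ _ J.+1) => //; last exact: size_poly.
  by move=> r j rA /ltnW; exact: x0.
have e r j : r - 1 - j%:R = r - j.+1%:R :> C by rewrite -natr1 opprD addrAC addrA.
rewrite DWbar_expD //; apply: (hor _ _ J.+1); first exact: DWbar_wbar.
- by move=> r j rA Jj; rewrite /DWbar addrAC e x0 ?(lin0 (@DW_linear _ _ W)) // ltnW // ltnW.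
- have [->|nz] := eqVneq Q 0; first by rewrite linear0 size_poly0.
  by apply: leq_trans (ltnW (lt_size_deriv nz)) _; exact: size_poly.
move=> j; rewrite coef_deriv Qq /q -sumrMnl; apply: eq_bigr => r _.
by rewrite /DWbar addrAC e divD_D scaler_nat (raddfMn w').
Qed.

Lemma is_derive_horner (Q : {poly C}) (t : C) : is_derive t 1 (fun t : C => Q.[t]) Q^`().[t].
Proof.
elim/poly_ind: Q => [|Q c IH].
  rewrite (_ : (fun t : C => _) = fun=> 0); last by apply/funext => u; rewrite horner0.
  by rewrite linear0 horner0; exact: is_derive_cst0.
have h : is_derive t 1 (fun t : C => Q.[t] * t) (Q.[t] *: 1 + t *: Q^`().[t]).
  exact: (@is_deriveM C C (fun t : C => Q.[t]) id t 1 _ _ IH (is_derive_id _ _)).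
have := is_derive_lin 1 h (@is_derive_cst C C C c t 1).
rewrite (_ : (fun u : C => 1 * (Q.[u] * u) + _) = fun u => (Q * 'X + c%:P).[u]); last first.
  by apply/funext => u; rewrite hornerD hornerM hornerX hornerC mul1r.
congr (is_derive _ _ _ _).
rewrite derivD derivC [_ + 0]addr0 derivM derivX mulr1 [_ + 0]addr0 hornerD hornerMX.
by rewrite /GRing.scale /= mul1r mulr1 addrC mulrC.
Qed.

Lemma conf1 (z : 'I_1 -> C) : conf z.
Proof. by move=> i j _; rewrite !ord1. Qed.

Lemma poly_diag_rat1 (N : 'I_1 -> 'I_1 -> nat) (Q : {poly C}) (F : ('I_1 -> C) -> C) :
  (forall z, F z = Q.[z 0]) -> diag_rat_ord N F.
Proof.
move=> FQ; split; last by move=> z; case; exact: conf1.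
exists (\sum_(j < size Q) mpolyC 1 Q`_j * mpolyX C (mnm1 0) ^+ j) => z _.
have -> : diag_den N z = 1.
  by rewrite /diag_den big_ord1 big_pred0 // => j; rewrite (ord1 j).
rewrite divr1 FQ horner_coef raddf_sum /=; apply: eq_bigr => j _.
by rewrite mevalM mevalC rmorphXn /= mevalXU.
Qed.

Variables (f : V -> W) (df : derivation f).

Definition exp_cochain : cochain W 1 := fun v z => expD (z 0) (fun r => wpr r (f (v 0))).

Lemma wbar_wpr (x : W) : wbar (fun r => wpr r x).
Proof. by move=> r; exact: wt_wpr. Qed.

Lemma exp_cochain_multilinear : multilinear exp_cochain.
Proof.
move=> i v z c x y; rewrite /exp_cochain /= (ord1 i) eqxx.
have -> : (fun r => wpr r (f (c *: x + y))) = fun r => c *: wpr r (f x) + wpr r (f y).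
  by apply/funext => r; rewrite (der_linear df) (@wpr_linear _ W).
exact: expD_lin (@wbar_wpr _) (@wbar_wpr _).
Qed.

Lemma exp_cochain_rational : rational_valued exp_cochain.
Proof.
move=> v; split; first by move=> z; apply: expD_wbar; exact: wbar_wpr.
split=> [z|w' gw]; first by case; exact: conf1.
have [Q hQ] := pairing_expD gw (@wbar_wpr (f (v 0))).
by exists (fun _ _ => 0%N); apply: (poly_diag_rat1 _ (Q := Q)) => z; exact: (hQ (z 0)).1.
Qed.

Lemma exp_cochain_D : D_derivative_property exp_cochain.
Proof.
move=> v w' z gw _; have wx := @wbar_wpr (f (v 0)).
have [Q hQ] := pairing_expD gw wx.
have e (i : 'I_1) : (fun t : C => pairing w' (exp_cochain v [eta z with i |-> t])) = fun t => Q.[t].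
  apply/funext => t; rewrite /exp_cochain /= (ord1 i) eqxx; exact: (hQ t).1.
have h (i : 'I_1) : is_derive (z i) 1
    (fun t : C => pairing w' (exp_cochain v [eta z with i |-> t])) Q^`().[z 0].
  by rewrite e (ord1 i); exact: is_derive_horner.
have d : pairing w' (DWbar (exp_cochain v z)) = Q^`().[z 0] by exact: (hQ (z 0)).2.
split=> [i|]; last by rewrite big_ord1 (is_derive_val (h 0)) d.
suff -> : pairing w' (exp_cochain [eta v with i |-> DV (v i)] z) = Q^`().[z 0] by exact: h.
rewrite -d /exp_cochain DWbar_expD //= (ord1 i) eqxx; congr (pairing w' (expD _ _)).
by apply/funext => r; rewrite (der_DV df) wpr_DW.
Qed.

Lemma exp_cochain_d : d_conjugation_property exp_cochain.
Proof.
move=> lam v w' z gw _; congr (pairing w'); apply/funext => r; rewrite /exp_cochain.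
have wx := @wbar_wpr (f (v 0)); have wy := @wbar_wpr (f (zpow_d lam (v 0))).
have [J1 h1] := expD_wbarE r wx; have [J2 h2] := expD_wbarE r wy.
rewrite (h1 _ (leq_maxl J1 J2)) (h2 _ (leq_maxr J1 J2)) scaler_sumr; apply: eq_bigr => j _.
rewrite [in RHS](der_wpr df) wpr_zpow (linZ _ _ (der_linear df)) (linZ _ _ (@divD_linear _ _ W j)).
rewrite !scalerA -(der_wpr df); congr (_ *: _).
have -> : cexp (lam * r) = cexp lam ^+ j * cexp (lam * (r - j%:R)).
  by rewrite -cexpMn -cexpD -mulrDr; congr (cexp (_ * _)); rewrite addrC subrK.
by rewrite exprMn; ring.
Qed.

Lemma exp_cochain_parity : parity_preserving exp_cochain.
Proof.
move=> a v av z r; rewrite big_ord1.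
have [_ _ pf _] := df.
have [J h] := expD_wbarE r (@wbar_wpr (f (v 0))); rewrite /exp_cochain (h J) // /par.
rewrite (lin_sum _ _ (@ppr_linear _ W _)); apply: eq_bigr => j _.
rewrite (linZ _ _ (@ppr_linear _ W _)) /divD (linZ _ _ (@ppr_linear _ W _)).
have hx : par (a ord0) (wpr (r - j%:R) (f (v 0))) by apply: par_wpr; exact: pf.
congr (_ *: (_ *: _)); move: (wpr _ _) hx => x hx.
by elim: (nat_of_ord j) => [//|i IH] /=; exact: (@DW_par _ _ W _ _ IH).
Qed.
End ExponentialCochain.

Section Composability.
Variable R : realType.
Local Notation C := (Cx R).
Variables (V : vertexSuperalgebra R) (W : supermodule V).
Local Notation YW := (@YW R V W).
Local Notation Y := (@vY R V).
Let fY := @vY_field R V.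
Let fW := @YW_field R V W.
Local Notation idx m := {ffun 'I_m -> int}.

Lemma diag_rat_ord_sum n (N : 'I_n -> 'I_n -> nat) (J : Type) (s : seq J)
    (F : J -> ('I_n -> C) -> C) :
  (forall j, diag_rat_ord N (F j)) -> diag_rat_ord N (fun z => \sum_(j <- s) F j z).
Proof.
move=> h; elim: s => [|j s [[p hp] p0]].
  split=> [|z _]; last by rewrite big_nil.
  by exists 0 => z _; rewrite big_nil meval0 mul0r.
have [[q hq] q0] := h j; split=> [|z nz]; last by rewrite big_cons q0 // p0 // addr0.
by exists (q + p) => z cz; rewrite big_cons hq // hp // mevalD mulrDl.
Qed.

Lemma half_inj : injective (fun k : int => k%:~R / 2 : C).
Proof.
move=> k k' /(mulIf _) h; apply: (@intr_inj C); apply: h.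
by rewrite invr_neq0 // pnatr_eq0.
Qed.

(* Only finitely many weights of y contribute to each weight of e^(zeta D) f(y). *)
Lemma weight_sum (L : W -> C^o) (zeta : C) (y : C -> V) r0 (f : V -> W) : D_map f -> linear L -> wbar y ->
  abs_cvg_to (fun k : int => L (expD zeta (fun s => wpr s (f (y (k%:~R / 2)))) r0))
    (L (f (expD (W := adjoint V) zeta y r0))).
Proof.
move=> mf lL wy; have [lf fw _] := mf.
have wfy : wbar (fun s => f (y s)) by move=> s; rewrite /wt fw wy.
have [J hJ] := low_weights W r0.
have e0 (x : C -> W) : wbar x -> expD zeta x r0 = \sum_(j < J) zeta ^+ j *: divD j (x (r0 - j%:R)).
  by move=> wx; apply: expDE => j Jj; rewrite -(wx _); exact: hJ.
rewrite (D_map_expD mf) // (e0 _ wfy) (lin_sum _ _ lL).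
pose T (j : nat) (k : int) := L (zeta ^+ j *: divD j (wpr (r0 - j%:R) (f (y (k%:~R / 2))))).
apply: (@abs_cvg_to_ext _ _ (fun k => \sum_(j < J) T j k)).
  by move=> k; rewrite (e0 _ (wbar_wpr _)) (lin_sum _ _ lL).
apply: abs_cvg_to_sum => j.
have T0 k : r0 - j%:R != k%:~R / 2 -> T j k = 0.
  move=> ne; rewrite /T fw -(wy (k%:~R / 2)) wprM (negPf ne).
  by rewrite (lin0 lf) divD_modes0 scaler0 (lin0 lL).
have [[k0 hk]|nk] := pselect (exists k : int, r0 - j%:R = k%:~R / 2).
  have -> : L (zeta ^+ j *: divD j (f (y (r0 - j%:R)))) = \sum_(k <- [fset k0]%fset) T j k.
    by rewrite big_seq_fset1 /T -hk fw wy.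
  apply: abs_cvg_to_finite => k; rewrite in_fset1 => kk; apply: T0.
  by rewrite hk; apply: contra kk => /eqP /half_inj ->.
have y0 : y (r0 - j%:R) = 0 by rewrite -(wy _); exact: vsa_half.
have -> : L (zeta ^+ j *: divD j (f (y (r0 - j%:R)))) = \sum_(k <- fset0) T j k.
  by rewrite big_seq_fset0 y0 (lin0 lf) divD_modes0 scaler0 (lin0 lL).
apply: abs_cvg_to_finite => k _; apply: T0; apply/eqP => e; apply: nk; by exists k.
Qed.

Variables (f : V -> W) (df : derivation f).

Lemma block_l (T : nmodType) l0 l1 (x : 'I_(l0 + l1) -> T) :
  (block x 0 : 'I_l0 -> T) = fun a => x (lshift l1 a).
Proof.
apply/funext => a; rewrite /block add0n insubT /=.
  by rewrite (leq_trans (ltn_ord a)) ?leq_addr.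
by move=> h; congr x; exact: val_inj.
Qed.

Lemma block_r (T : nmodType) l0 l1 (x : 'I_(l0 + l1) -> T) :
  (block x l0 : 'I_l1 -> T) = fun b => x (rshift l0 b).
Proof.
apply/funext => b; rewrite /block insubT /=; first by rewrite ltn_add2l.
by move=> h; congr x; exact: val_inj.
Qed.

Variable N0 : V -> V -> nat.
Hypothesis N0Y : forall u v, trunc Y u v (N0 u v)%:Z.
Hypothesis N0l : forall u v, trunc YW u (f v) (N0 u v)%:Z.
Hypothesis N0r : forall u v, trunc YW v (f u) (N0 u v)%:Z.

Lemma composable_blocks K l0 l1 (v : 'I_K -> V) (w' : {scalar W}) :
  (l0 + l1)%N = K -> (0 < l1)%N -> gdual w' ->
  exists2 F : ('I_K -> C) -> C, diag_rat_ord (fun i j => N0 (v i) (v j)) F &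
  forall (z : 'I_K -> C) (zeta : C), conf z ->
  (forall i j : 'I_K, (i < l0)%N -> (l0 <= j)%N -> `|z j| < `|z i|) ->
  let y := EV (block v l0 : 'I_l1 -> V) (fun p => block z l0 p - zeta) in
  exists2 g : C -> int -> ('I_l0 -> C) -> C -> W,
    (forall r0 k, is_Eprod YW (block v 0)
      (expD zeta (fun s => wpr s (f (y (k%:~R / 2)))) r0) (g r0 k)) &
  exists2 a : C -> C,
    (forall r0, abs_cvg_to (fun k => pairing w' (g r0 k (block z 0))) (a r0)) &
    abs_cvg_to a (F z).
Proof.
move=> eK; case: K / eK v => v l1_gt0 gw.
pose N (i j : 'I_(l0 + l1)) := N0 (v i) (v j).
pose vl a := v (lshift l1 a); pose vr b := v (rshift l0 b).
have cv b : glue_compat (der_at f vr b) N vl.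
  have e i : glue (der_at f vr b) vl i = der_at f v (rshift l0 b) i.
    rewrite -(splitK i); case: (fintype.split i) => [a|b'] /=.
      by rewrite glue_l /der_at eq_lrshift.
    by rewrite glue_r /der_at (inj_eq (@rshift_inj _ _)).
  move=> i j ij; rewrite !e.
  exact: (@der_at_compat R V W f _ v N (fun i j _ => @N0Y _ _) (fun i j _ => @N0l _ _)
    (fun i j _ => @N0r _ _) (rshift l0 b) i j ij).
pose b0 := Ordinal l1_gt0.
exists (fun z => \sum_b pairing w' (rat_fun N (@conf R _) (glue_arr (der_at f vr b) vl) z)).
  apply: diag_rat_ord_sum => b; apply: rat_fun_diag_rat => //; exact: glue_regular (cv b).
move=> z zeta cz lr; rewrite (block_l v) (block_r v) (block_l z) (block_r z) => y.
have lr' a b : `|z (rshift l0 b)| < `|z (lshift l1 a)|.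
  by apply: lr; rewrite /= ?leq_addr.
pose zl a := z (lshift l1 a); pose zr b := z (rshift l0 b).
pose L x : C^o := pairing w' (left_fun (Nl N) vl x zl).
have LE x : L x = left_eval N vl z w' x / diag_den (Nl N) zl.
  by rewrite /L (pairing_left_fun (cv b0)).
have lL : linear L.
  move=> c x x'; rewrite !LE (left_eval_linear (cv b0)) //.
  by rewrite mulrDl /GRing.scale /= mulrA.
have vrN (i j : 'I_l1) : (i < j)%N -> trunc Y (vr i) (vr j) (Nr N i j)%:Z by move=> _; exact: N0Y.
have wy : wbar y by exact: (EV_wbar vrN).
exists (fun r0 k => left_fun (Nl N) vl (expD zeta (fun s => wpr s (f (y (k%:~R / 2)))) r0)).
  by move=> r0 k; exact: left_is_Eprod (cv b0) _.
exists (fun r0 => L (f (EV vr zr r0))) => [r0|].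
  rewrite (EV_translation vrN zr zeta r0); apply: weight_sum => //; exact: der_D_map.
have h b := composition_cvg (cv b) cz l1_gt0 lr' gw.
have h' := abs_cvg_to_sum (enum 'I_l1) h.
rewrite -[X in abs_cvg_to _ X]big_enum.
refine (abs_cvg_to_ext _ h') => r0.
have -> : f (EV vr zr r0) = \sum_(b <- enum 'I_l1)
    rat_fun (Nr N) (@conf R l1) (right_arr (der_at f vr b)) zr r0.
  rewrite big_enum; exact: (@der_EV R V W f df l1 vr (Nr N) vrN
    (fun i j _ => @N0l _ _) (fun i j _ => @N0r _ _) zr r0).
by rewrite (lin_sum _ _ lL).
Qed.
End Composability.

Section ExponentialIsCochain.
Variable R : realType.
Local Notation C := (Cx R).
Variables (V : vertexSuperalgebra R) (W : supermodule V).
Local Notation YW := (@YW R V W).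
Local Notation Y := (@vY R V).
Let fY := @vY_field R V.
Let fW := @YW_field R V W.

Lemma pole_orders (f : V -> W) : exists N : V -> V -> nat, forall u v,
  [/\ (0 < N u v)%N, trunc Y u v (N u v)%:Z, trunc YW u (f v) (N u v)%:Z &
      trunc YW v (f u) (N u v)%:Z].
Proof.
have h (q : V * V) : exists K : nat, [/\ (0 < K)%N, trunc Y q.1 q.2 K%:Z,
    trunc YW q.1 (f q.2) K%:Z & trunc YW q.2 (f q.1) K%:Z].
  have [K1 h1] := trunc_exists fY q.1 q.2; have [K2 h2] := trunc_exists fW q.1 (f q.2).
  have [K3 h3] := trunc_exists fW q.2 (f q.1).
  exists (K1 + K2 + K3).+1; split=> //.
  - apply: trunc_le h1; clear; lia.
  - apply: trunc_le h2; clear; lia.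
  apply: trunc_le h3; clear; lia.
have [N hN] := choice h; exists (fun u v => N (u, v)) => u v; exact: (hN (u, v)).
Qed.

Variables (f : V -> W) (df : derivation f).

Lemma exp_cochain_composable m : composable m (exp_cochain f).
Proof.
have [N hN] := pole_orders f.
exists N => [u v|l0 l hl el v w' gw]; first by have [] := hN u v.
have el' : (l0 + l 0%R)%N = (m + 1)%N by rewrite -el big_ord1.
have [|||F rF hF] := @composable_blocks R V W f df N _ _ _ (m + 1)%N l0 (l 0) v w' el' (hl 0) gw.
- by move=> u u'; have [] := hN u u'.
- by move=> u u'; have [] := hN u u'.
- by move=> u u'; have [] := hN u u'.
exists F => // z zeta [cz cd _].
have cd' (i j : 'I_(m + 1)) : (i < l0)%N -> (l0 <= j)%N -> `|z j| < `|z i|.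
  by move=> il jl; exact: (cd i il).2.
have [g hg [a ha sa]] := hF z (zeta 0) cz cd'.
have o : offset l0 l 0 = l0 by rewrite /offset big_pred0 ?addn0 // => j; rewrite (ord1 j).
move=> Psi; exists (fun r0 (r : {ffun 'I_1 -> int}) => g r0 (r 0)).
  by move=> r0 r; rewrite /exp_cochain /Psi o; exact: hg.
exists a; last exact: sa.
move=> r0.
have hi : injective (fun k : int => [ffun => k] : {ffun 'I_1 -> int}).
  by move=> k k' /ffunP /(_ 0); rewrite !ffunE.
pose F' (r : {ffun 'I_1 -> int}) := pairing w' (g r0 (r 0) (fun p => block z 0 p)).
have hr : forall r, (forall k : int, r <> [ffun => k]) -> F' r = 0.
  by move=> r h; case: (h (r 0)); apply/ffunP => i; rewrite ffunE (ord1 i).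
have := (abs_cvg_to_reindex (a r0) hi hr).1; rewrite /F'; apply.
have -> : (fun k : int => pairing w' (g r0 ([ffun => k] (0 : 'I_1)) (fun p => block z 0 p)))
   = fun k => pairing w' (g r0 k (fun p => block z 0 p)).
  by apply/funext => k; rewrite ffunE.
exact: ha.
Qed.

Lemma exp_cochain_C1 m : C1 m (exp_cochain f).
Proof.
split; last exact: exp_cochain_parity.
split; [exact: exp_cochain_multilinear|exact: exp_cochain_rational|exact: exp_cochain_D|
  exact: exp_cochain_d|].
by move=> _; exact: exp_cochain_composable.
Qed.
End ExponentialIsCochain.

Section TwoPoints.
Variable R : realType.
Local Notation C := (Cx R).
Variables (V : vertexSuperalgebra R) (W : supermodule V).
Local Notation YW := (@YW R V W).
Local Notation Y := (@vY R V).
Let fY := @vY_field R V.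
Let fW := @YW_field R V W.
Local Notation idx m := {ffun 'I_m -> int}.

Lemma enum_ord1 : enum 'I_1 = [:: 0].
Proof. by apply: (inj_map val_inj); rewrite val_enum_ord. Qed.

Lemma enum_ord2 : enum 'I_2 = [:: 0; 1].
Proof. by apply: (inj_map val_inj); rewrite val_enum_ord. Qed.

Lemma dens1 (N : 'I_1 -> 'I_1 -> nat) : dens N = [::].
Proof. by rewrite /dens enum_ord1. Qed.

Lemma diag_den1 (N : 'I_1 -> 'I_1 -> nat) (z : 'I_1 -> C) : diag_den N z = 1.
Proof. by rewrite -prod_dens dens1 big_nil. Qed.

(* the field Y(w, x) applied to y, for w of any parity *)
Definition skew_full (w : W) k (y : V) : W := skew_super false w k y + skew_super true w k y.

Lemma mon1 (z : 'I_1 -> C) k : mon z k = z 0 ^ (- k 0 - 1).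
Proof. by rewrite /mon big_ord1. Qed.

Lemma one_field_vac (w : W) (N : 'I_1 -> 'I_1 -> nat) z r :
  rat_fun N (@conf R 1) (right_arr (fun=> inr w)) z r = expD (z 0) (fun s => wpr s w) r.
Proof.
have arrE k : right_arr (fun _ : 'I_1 => inr w : V + W) k = skew_full w (k 0) (vac V).
  by rewrite /right_arr /fprod enum_ord1 /= /field_at.
rewrite /rat_fun asboolT; last exact: conf1.
rewrite diag_den1 invr1 scale1r dens1 /= /evalA.
pose h (j : nat) : idx 1 := [ffun=> - j%:Z - 1].
have hi : injective h.
  by move=> j j' /ffunP /(_ 0); rewrite !ffunE => e; move: e; clear; lia.
rewrite -(@fsbig_widen _ _ _ _ (range h) setT) //; last first.
  move=> k [_ nk] /=; suff -> : right_arr (fun=> inr w) k = 0.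
    by rewrite (lin0 (@wpr_linear _ W r)) scaler0.
  rewrite arrE /skew_full; have [k0|k0] := leP 0 (k 0); last first.
    exfalso; apply: nk; exists (absz (- k 0 - 1)%R) => //.
    by apply/ffunP => i; rewrite ffunE (ord1 i); move: (k 0) k0 => x; clear; lia.
  have h0 p : skew_super p w (k 0) (vac V) = 0.
    by have := @fld_creation R V W (inr w) p (k 0) k0; case.
  by rewrite !h0 addr0.
rewrite (@reindex_fsbig _ _ _ _ _ h setT); last first.
  by split=> [j _|j j' _ _ /hi|]; [exists j| |].
apply: eq_fsbigr => j _; rewrite mon1 arrE /skew_full ffunE skew_super_vac wpr_divD.
by rewrite opprB opprK [1 + _]addrC addrK.
Qed.

Variables (u : V) (w : W) (N : nat).
Hypothesis uw : trunc YW u w N%:Z.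

Definition two_arr : idx 2 -> W := @glue_arr R V W 1 1 (fun=> inr w) (fun=> u).

Lemma two_arrE k : two_arr k = YW u (k 0) (skew_full w (k 1) (vac V)).
Proof.
rewrite /two_arr glue_arrE /modes_prod /right_arr /fprod enum_ord1 /= /field_at !ffunE.
by congr (YW u (k _) (skew_full w (k _) _)); exact: val_inj.
Qed.

Lemma two_compat : @glue_compat R V W 1 1 (fun=> inr w) (fun _ _ => N) (fun=> u).
Proof.
move=> i j; rewrite /glue; case: (fintype.splitP i) => [a|a] ea; case: (fintype.splitP j) => [b|b] eb //=.
by rewrite ea eb !(ord1 a) !(ord1 b).
Qed.

Lemma two_regular : regular (fun _ _ => N) 0 two_arr.
Proof. exact: glue_regular two_compat. Qed.

Lemma two_point (w' : {scalar W}) (z : 'I_2 -> C) : gdual w' -> `|z 1| < `|z 0| ->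
  abs_cvg_to (fun r => mat_el YW w' u (z 0) (expD (z 1) (fun s => wpr s w) r))
    (pairing w' (rat_fun (fun _ _ => N) (@conf R 2) two_arr z)).
Proof.
move=> gw z10.
have cz : conf z.
  have ne : z 0 != z 1 by apply: contraTneq z10 => ->; rewrite ltxx.
  have o2 (i : 'I_2) : i = 0 \/ i = 1.
    by case: i => -[|[|//]] h; [left|right]; exact: val_inj.
  move=> i j; case: (o2 i) => ->; case: (o2 j) => -> // e; by rewrite e eqxx in ne.
have e0 (a : 'I_1) : lshift 1 a = 0 :> 'I_2 by apply: val_inj; rewrite (ord1 a).
have e1 (a : 'I_1) : rshift 1 a = 1 :> 'I_2 by apply: val_inj; rewrite (ord1 a).
have lr (a b : 'I_1) : `|z (rshift 1 b)| < `|z (lshift 1 a)| by rewrite e0 e1.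
have z0 : z 0 != 0.
  apply: contraTneq z10 => ->; rewrite normr0; apply/negP => h.
  by have := lt_le_trans h (normr_ge0 (z 1)); rewrite ltxx.
have cvg := composition_cvg two_compat cz (isT : (0 < 1)%N) lr gw.
apply: (abs_cvg_to_ext _ cvg) => r.
rewrite (pairing_left_fun two_compat cz (isT : (0 < 1)%N) lr gw) diag_den1 divr1.
rewrite one_field_vac e1 /left_eval /evalA /mat_el.
pose h (k : int) : idx 1 := [ffun=> k].
rewrite (@reindex_fsbig _ _ _ _ _ h setT); last first.
  split=> // [k k' _ _ /ffunP /(_ 0)|k _]; first by rewrite !ffunE.
  by exists (k 0) => //; apply/ffunP => i; rewrite ffunE (ord1 i).
apply: eq_fsbigr => k _; rewrite mon1 e0 ffunE /left_form dens1 /= /modes_prod enum_ord1 /= ffunE.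
by rewrite /GRing.scale /= mulrC.
Qed.
End TwoPoints.

Section TwoVariables.
Variable R : realType.
Local Notation C := (Cx R).
Local Notation idx m := {ffun 'I_m -> int}.

Definition idx2 (l m : int) : idx 2 := [ffun i => if i == 0 then l else m].
Definition swap2 (k : idx 2) : idx 2 := idx2 (k 1) (k 0).

Lemma ord2P (i : 'I_2) : i = 0 \/ i = 1.
Proof. by case: i => -[|[|//]] h; [left|right]; exact: val_inj. Qed.

Lemma idx2E (k : idx 2) : idx2 (k 0) (k 1) = k.
Proof. by apply/ffunP => i; rewrite ffunE; case: (ord2P i) => ->. Qed.

Lemma swap2K : involutive swap2.
Proof. by move=> k; rewrite /swap2 !ffunE /= idx2E. Qed.

Lemma mon2 (z : 'I_2 -> C) k : mon z k = z 0 ^ (- k 0 - 1) * z 1 ^ (- k 1 - 1).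
Proof.
rewrite /mon !big_ord_recl big_ord0 mulr1.
by have -> : lift ord0 ord0 = 1 :> 'I_2 by exact: val_inj.
Qed.

Lemma dens2 N : dens (fun _ _ : 'I_2 => N) = nseq N (0, 1).
Proof. by rewrite /dens enum_ord2 /= /row_factors /= !cats0. Qed.

Lemma conf_neq (z : 'I_2 -> C) : z 0 != z 1 -> conf z.
Proof.
move=> ne i j; case: (ord2P i) => ->; case: (ord2P j) => -> // e; by rewrite e eqxx in ne.
Qed.

Lemma conf_pair2 (z : 'I_2 -> C) : conf (pair2 (z 1) (z 0)) <-> conf z.
Proof.
split=> c; apply: conf_neq.
  by apply/eqP => e; have := c 0 1 (esym e).
by apply/eqP => /= /c.
Qed.

Variable W : gradedSpace R.

Lemma dmuls2 N (H : int -> int -> W) k :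
  dmuls (dens (fun _ _ : 'I_2 => N)) (fun k => H (k 0) (k 1)) k =
  iter N (@shift_diff W) H (k 0) (k 1).
Proof.
rewrite dens2; apply: dmuls_nseq2 => // a b.
by rewrite !idxD !un_mulE /= ?addr0.
Qed.

Lemma iter_shift_diff_swap N (H : int -> int -> W) l m :
  iter N (@shift_diff W) (fun l m => H m l) l m =
  (-1) ^+ N *: iter N (@shift_diff W) H m l.
Proof.
elim: N l m => [|N IH] l m; first by rewrite expr0 scale1r.
rewrite !iterS {1}/shift_diff !IH -scalerBr -opprB scalerN -scaleNr.
by rewrite exprS mulN1r.
Qed.

Lemma iter_shift_diff_lin N (H H' : int -> int -> W) (x : C) l m :
  iter N (@shift_diff W) (fun l m => H' l m - x *: H l m) l m =
  iter N (@shift_diff W) H' l m - x *: iter N (@shift_diff W) H l m.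
Proof.
elim: N l m => [//|N IH] l m; rewrite !iterS {1}/shift_diff !IH /shift_diff scalerBr.
by rewrite !opprD !opprK addrACA.
Qed.

(* Exchanging the two variables of a rational function *)
Lemma rat_fun_swap N (H H' : int -> int -> W) (e : C) z r :
  (forall l m, iter N (@shift_diff W) (fun l m => H' l m - e *: H m l) l m = 0) ->
  regular (fun _ _ => N) 0 (fun k : idx 2 => H (k 0) (k 1)) ->
  rat_fun (fun _ _ => N) (@conf R 2) (fun k => H' (k 0) (k 1)) (pair2 (z 1) (z 0)) r =
  e *: rat_fun (fun _ _ => N) (@conf R 2) (fun k => H (k 0) (k 1)) z r.
Proof.
move=> loc [fP _ _]; rewrite /rat_fun.
have [cz|nz] := pselect (conf z); last first.
  by rewrite !asboolF ?scaler0 // conf_pair2.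
rewrite !asboolT ?conf_pair2 // !diag_den2 /=.
pose P k := wpr r (dmuls (dens (fun _ _ : 'I_2 => N)) (fun k => H (k 0) (k 1)) k).
have sH l m : iter N (@shift_diff W) H' l m = (e * (-1) ^+ N) *: iter N (@shift_diff W) H m l.
  rewrite -scalerA -iter_shift_diff_swap; apply/eqP; rewrite -subr_eq0.
  by rewrite -(iter_shift_diff_lin _ (fun l m => H m l)) loc.
have E : evalA (fun k => wpr r (dmuls (dens (fun _ _ : 'I_2 => N)) (fun k => H' (k 0) (k 1)) k))
     (pair2 (z 1) (z 0)) = (e * (-1) ^+ N) *: evalA P z.
  have lin : linear (fun x : W => (e * (-1) ^+ N) *: x).
    by move=> a x y; rewrite scalerDr !scalerA mulrC.
  rewrite -(evalA_linear z lin (fP r)) /evalA.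
  rewrite (@reindex_fsbig _ _ _ _ _ swap2 setT); last first.
    split=> // [k k' _ _ /(inv_inj swap2K) //|k _]; by exists (swap2 k); rewrite ?swap2K.
  apply: eq_fsbigr => k _; rewrite !mon2 !ffunE /= mulrC dmuls2 !ffunE /= sH.
  by rewrite (linZ _ _ (@wpr_linear _ W r)) /P dmuls2.
rewrite E !scalerA; congr (_ *: _).
rewrite -[z 1 - z 0]opprB (exprNn (z 0 - z 1)) invfM invr_sign.
have s1 : (-1) ^+ N * (-1) ^+ N = 1 :> C by rewrite -expr2 sqrr_sign.
move: s1; move: ((-1) ^+ N) (((z 0 - z 1) ^+ N)^-1) => s x s1.
by transitivity (s * s * (e * x)); [ring|rewrite s1 mul1r].
Qed.

Lemma normC_pos (x y : C) : `|x| < `|y| -> y != 0.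
Proof.
move=> h; apply/eqP => y0; rewrite y0 normr0 in h.
by have := lt_le_trans h (normr_ge0 x); rewrite ltxx.
Qed.

(* At the points (t, 0) the expansion becomes a Laurent series in t. *)
Lemma eval_line N (c : idx 2 -> W) (w' : {scalar W}) t : gdual w' ->
  regular (fun _ _ => N) 0 c -> (forall k : idx 2, 0 <= k 1 -> c k = 0) -> t != 0 ->
  abs_cvg_to (fun l : int => w' (c (idx2 l (-1))) * t ^ (- l - 1))
    (pairing w' (rat_fun (fun _ _ => N) (@conf R 2) c (pair2 t 0))).
Proof.
move=> gw rc c0 t0; have [fP nP tP] := rc.
have cz : conf (pair2 t 0) by exact: conf_neq.
pose z := pair2 t (0 : C); pose F (k : idx 2) : C := w' (c k).
have hF : abs_cvg_to (fun k => F k * mon z k)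
    (pairing w' (rat_fun (fun _ _ => N) (@conf R 2) c z)).
  rewrite (pairing_rat_fun gw fP cz) -prod_dens; apply: dmuls_cvg.
  - by move=> p; rewrite dens2 => /nseqP[-> _]; rewrite /z /= normr0 normr_gt0.
  - move=> p; rewrite dens2 => /nseqP[-> _] k.
    have [m0 hm] := tP 0 1 isT k.
    by exists m0 => m /hm; rewrite /F => ->; rewrite raddf0.
  - move=> k i; case: (ord2P i) => ->; rewrite /z /=; first by move/eqP; rewrite (negPf t0).
    by move=> _ /c0; rewrite /F => ->; rewrite raddf0.
  exact: finsupp_gdual gw fP.
have hi : injective (fun l : int => idx2 l (-1)).
  by move=> l l' /ffunP /(_ 0); rewrite !ffunE.
have hr k : (forall l : int, k <> idx2 l (-1)) -> F k * mon z k = 0.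
  move=> h; have k1 : k 1 != -1.
    by apply/eqP => e; case: (h (k 0)); rewrite -e idx2E.
  rewrite mon2 /z /= exp0rz [- k 1 - 1 == 0](_ : _ = false) ?mulr0 //.
  by apply/eqP => e; move/eqP: k1; apply; move: e; move: (k 1) => x; clear; lia.
have := (abs_cvg_to_reindex _ hi hr).2 hF.
apply: abs_cvg_to_ext => l; rewrite /F mon2 !ffunE /z /=.
by rewrite [- -1 - 1](_ : _ = 0) // expr0z mulr1.
Qed.
End TwoVariables.

Section CocycleOfDerivation.
Variable R : realType.
Local Notation C := (Cx R).
Variables (V : vertexSuperalgebra R) (W : supermodule V).
Local Notation YW := (@YW R V W).
Local Notation Y := (@vY R V).
Let fY := @vY_field R V.
Let fW := @YW_field R V W.
Local Notation idx m := {ffun 'I_m -> int}.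

Section Exchange.
Variables (u : V) (w : W) (N : nat).
Hypothesis uw : trunc YW u w N%:Z.

Definition two_swapped (k : idx 2) : W := skew_full w (k 0) (Y u (k 1) (vac V)).

Lemma two_swapped_regular : regular (fun _ _ => N) 0 two_swapped.
Proof.
pose g (i : 'I_2) : V + W := if i == 0 then inr w else inl u.
have -> : two_swapped = fun k => (fprod g k (vac V, 0)).2.
  apply/funext => k; rewrite /fprod enum_ord2 /= /field_at /g /= -(modesDl fY) -ppr_sum.
  by [].
apply: fprod_regular2 => [i j|i p k]; last exact: fld_creation.
by case: (ord2P i) => ->; case: (ord2P j) => ->.
Qed.

Lemma skew_super_par p a y k : par a w -> p != a -> skew_super p w k y = 0.
Proof.
move=> wa pa; have w0 : ppr p w = 0 by rewrite -wa pprM (negPf pa).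
by rewrite /skew_super w0 big1 // => q _; rewrite (lin0 (@skew_op_linear_l R V W _ _)) scaler0.
Qed.

Lemma skew_full_par a y k : par a w -> skew_full w k y = skew_super a w k y.
Proof.
by move=> wa; rewrite /skew_full; case: a wa => wa;
   [rewrite (skew_super_par _ _ wa) ?add0r|rewrite (skew_super_par (p := true) _ _ wa) ?addr0].
Qed.

Variables (a b : bool).
Hypotheses (wa : par a w) (ub : par b u).

Lemma exchange_local l m : iter N (@shift_diff W) (fun l m =>
  YW u l (skew_full w m (vac V)) - (-1) ^+ (a && b) *: skew_full w m (Y u l (vac V))) l m = 0.
Proof.
have loc := @fld_local R V W (inl u) (inr w) N uw b a (vac V, 0) l m.
have := congr1 snd loc.
rewrite (@iter_shift_diff_additive _ W snd); last by move=> x y.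
rewrite /= ub andbC => e; rewrite -[RHS]e.
by congr (iter N _ _ _ _); apply/funext => l'; apply/funext => m'; rewrite !(skew_full_par _ _ wa).
Qed.

Lemma two_exchange z r : rat_fun (fun _ _ => N) (@conf R 2) (two_arr u w) (pair2 (z 1) (z 0)) r =
  (-1) ^+ (a && b) *: rat_fun (fun _ _ => N) (@conf R 2) two_swapped z r.
Proof.
have -> : two_arr u w = fun k : idx 2 => (fun l m => YW u l (skew_full w m (vac V))) (k 0) (k 1).
  by apply/funext => k; rewrite two_arrE.
exact: (@rat_fun_swap R W N (fun l m => skew_full w l (Y u m (vac V)))
  (fun l m => YW u l (skew_full w m (vac V))) _ z r exchange_local two_swapped_regular).
Qed.
End Exchange.

(* The sum over the weights of E_V in the middle term of the coboundary. *)
Lemma middle_sum (f : V -> W) (w' : {scalar W}) v1 v2 z zeta : D_map f -> gdual w' ->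
  abs_cvg_to (fun k : int => pairing w' (exp_cochain f
      (fun=> EV (pair2 v1 v2) (fun i => z i - zeta) (k%:~R / 2)) (fun=> zeta)))
    (pairing w' (fun r => f (EV (pair2 v1 v2) z r))).
Proof.
move=> mf gw; have [lf fw _] := mf.
have [N hN] := trunc_exists fY v1 v2.
have vN (i j : 'I_2) : (i < j)%N -> trunc Y (pair2 v1 v2 i) (pair2 v1 v2 j) ((fun _ _ => N) i j)%:Z.
  by case: (ord2P i) => ->; case: (ord2P j) => ->.
have [A [_ zA]] := gdual_supp gw.
have wE z' : wbar (EV (pair2 v1 v2) z') by exact: (@EV_wbar R V 2 _ (fun _ _ => N) vN).
rewrite (pairing_gdual zA); last by move=> r; rewrite /wt fw wE.
have lw : linear (w' : W -> C^o) by move=> c x y; rewrite linearP.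
have h r := @weight_sum R V W (w' : W -> C^o) zeta (EV (pair2 v1 v2) (fun i => z i - zeta)) r f mf lw (wE _).
refine (abs_cvg_to_ext _ _); last first.
  have := abs_cvg_to_sum A h.
  have -> : \sum_(r <- A) (w' : W -> C^o) (f (expD (W := adjoint V) zeta
      (EV (pair2 v1 v2) (fun i => z i - zeta)) r)) = \sum_(r <- A) w' (f (EV (pair2 v1 v2) z r)).
    by apply: eq_bigr => r _; rewrite -(@EV_translation R V 2 _ (fun _ _ => N) vN).
  exact.
move=> k; rewrite /exp_cochain (pairing_gdual zA) //.
by apply: expD_wbar; exact: wbar_wpr.
Qed.

Variables (f : V -> W) (df : derivation f).

Lemma exp_cochain_cocycle m : delta1 m (exp_cochain f) 0.
Proof.
have [lf _ pf _] := df.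
split; [exact: exp_cochain_C1|exact: C2_0|] => a b v1 v2 p1 p2.
have [N0 hN0] := pole_orders f; have [_ nY n1 n2] := hN0 v1 v2.
set N := N0 v1 v2 in nY n1 n2.
pose cN (i j : 'I_2) := N.
have vN (i j : 'I_2) : (i < j)%N -> trunc Y (pair2 v1 v2 i) (pair2 v1 v2 j) (cN i j)%:Z.
  by case: (ord2P i) => ->; case: (ord2P j) => ->.
have vN1 (i j : 'I_2) : (i < j)%N -> trunc YW (pair2 v1 v2 i) (f (pair2 v1 v2 j)) (cN i j)%:Z.
  by case: (ord2P i) => ->; case: (ord2P j) => ->.
have vN2 (i j : 'I_2) : (i < j)%N -> trunc YW (pair2 v1 v2 j) (f (pair2 v1 v2 i)) (cN i j)%:Z.
  by case: (ord2P i) => ->; case: (ord2P j) => ->.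
pose e : C := (-1) ^+ (a && b).
pose G1 := rat_fun cN (@conf R 2) (two_arr v1 (f v2)).
pose G0 := rat_fun cN (@conf R 2) (two_swapped v2 (f v1)).
have r1 := two_regular n1; have r0 := two_swapped_regular n2.
have fE z r : f (EV (pair2 v1 v2) z r) = G0 z r + G1 z r.
  have l1 : lift ord0 ord0 = 1 :> 'I_2 by exact: val_inj.
  have a0 : (fun k => (fprod (der_at f (pair2 v1 v2) ord0) k (vac V, 0)).2) = two_swapped v2 (f v1).
    apply/funext => k; rewrite /fprod enum_ord2 /= /field_at /der_at /=.
    by rewrite -(modesDl fY) -ppr_sum.
  have a1 : (fun k => (fprod (der_at f (pair2 v1 v2) 1) k (vac V, 0)).2) = two_arr v1 (f v2).
    apply/funext => k; rewrite two_arrE /fprod enum_ord2 /= /field_at /der_at /=.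
    by rewrite -(modesDl fW) -ppr_sum.
  by rewrite (der_EV df vN vN1 vN2) big_ord_recl big_ord1 l1 a0 a1.
have w1 z : wbar (G1 z) by apply: rat_fun_wbar; case: r1.
have w0 z : wbar (G0 z) by apply: rat_fun_wbar; case: r0.
have q1 w' : gdual w' -> diag_rat (fun z => pairing w' (G1 z)).
  by move=> gw; exists cN; exact: rat_fun_diag_rat.
have q0 w' : gdual w' -> diag_rat (fun z => pairing w' (G0 z)).
  by move=> gw; exists cN; exact: rat_fun_diag_rat.
exists G1, (fun z r => f (EV (pair2 v1 v2) z r)), (fun z r => e *: G0 z r); split.
- split=> // w' gw; split; first exact: q1.
  by move=> z z10; exact: (two_point n1 gw z10).
- move=> zeta; split=> [z r|w' gw]; first by rewrite /wt fE (linD _ _ (@wpr_linear _ W r)) w0 w1.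
  split=> [|z _]; last by apply: middle_sum => //; exact: der_D_map.
  rewrite (_ : (fun z => _) = fun z => 1 * pairing w' (G0 z) + pairing w' (G1 z)).
    by apply: diag_rat_lin; [exact: q0|exact: q1].
  apply/funext => z; rewrite -pairing_lin //; congr (pairing w').
  by apply/funext => r; rewrite fE -[G0 z r in LHS]scale1r.
- have es z r : e *: G0 z r = rat_fun cN (@conf R 2) (two_arr v2 (f v1)) (pair2 (z 1) (z 0)) r.
    by rewrite (two_exchange n2 (pf _ _ p1) p2).
  split=> [z r|w' gw]; first by rewrite /wt (linZ _ _ (@wpr_linear _ W r)) w0.
  have ep z : pairing w' (fun r => e *: G0 z r) = e * pairing w' (G0 z).
    by have := pairing_lin e gw (w0 z) (@wbar0 R V W); rewrite pairing0 !addr0 => <-.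
  split=> [|z z01].
    rewrite (_ : (fun z => _) = fun z => e * pairing w' (G0 z) + 0).
      by apply: diag_rat_lin; [exact: q0|exact: diag_rat0].
    by apply/funext => z; rewrite addr0.
  have -> : (fun r => e *: G0 z r) = rat_fun cN (@conf R 2) (two_arr v2 (f v1)) (pair2 (z 1) (z 0)).
    by apply/funext => r; exact: es.
  exact: (two_point n2 gw (z := pair2 (z 1) (z 0)) z01).
move=> z cz; apply/funext => r.
have ee : e * e = 1 by rewrite /e -expr2 sqrr_sign.
rewrite -[LHS]/(0 : W) -[RHS]/(G1 z r - f (EV (pair2 v1 v2) z r) + e *: (e *: G0 z r)).
by rewrite fE scalerA ee scale1r opprD addrCA subrr addr0 addNr.
Qed.
End CocycleOfDerivation.

Section DerivationOfCocycle.
Variable R : realType.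
Local Notation C := (Cx R).
Variables (V : vertexSuperalgebra R) (W : supermodule V).
Local Notation YW := (@YW R V W).
Local Notation Y := (@vY R V).
Local Notation DW := (@DW R V W).
Let fY := @vY_field R V.
Let fW := @YW_field R V W.

Lemma wpr_ext (U : gradedSpace R) (x y : U) : (forall r, wpr r x = wpr r y) -> x = y.
Proof.
move=> e; apply/eqP; rewrite -subr_eq0; have [A ->] := wpr_decomp (x - y).
rewrite big1 // => r _; rewrite (linB (@wpr_linear _ U r)) e; exact: subrr.
Qed.

Lemma pairing_wproj (w' : {scalar W}) r (x : C -> W) : wbar x ->
  pairing (comp_scalar w' (@wpr_linear _ W r)) x = w' (x r).
Proof.
move=> wx; rewrite (@pairing_gdual _ _ _ [fset r]%fset) // => [|s].
  by rewrite big_seq_fset1 -[in RHS](wx r).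
rewrite in_fset1 => sr w; rewrite /comp_scalar /= /scalar_fun wprM eq_sym (negPf sr).
exact: raddf0.
Qed.

Lemma cexp1_neq1 : cexp 1 != 1 :> C.
Proof.
apply/eqP => /(congr1 (@complex.Re R)); rewrite /cexp /= cos0 mulr1 => e.
by have := @expR_gt1 R 1; rewrite ltr01 e ltxx.
Qed.

Lemma poly_ext (P Q : {poly C}) : (forall z, P.[z] = Q.[z]) -> P = Q.
Proof.
move=> e; apply/eqP; rewrite -subr_eq0; apply/eqP.
by apply: (@poly_infinite_roots R _ 0) => t _; rewrite hornerD hornerN e subrr.
Qed.

Section OneCochain.
Variable Phi : cochain W 1.
Hypotheses (mP : multilinear Phi) (rP : rational_valued Phi) (DP : D_derivative_property Phi)
  (dP : d_conjugation_property Phi).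

Let P v z := Phi (fun=> v) (fun=> z).
Let wP v z : wbar (P v z). Proof. exact: (rP _).1. Qed.

Lemma cochain_lin a x y z : P (a *: x + y) z = a *: P x z + P y z.
Proof.
have e (u : V) : ([eta (fun=> 0 : V) with (0 : 'I_1) |-> u] : 'I_1 -> V) = (fun=> u).
  by apply/funext => i /=; rewrite (ord1 i).
by have := mP 0 (fun=> 0) (fun=> z) a x y; rewrite !e.
Qed.

Lemma cochain_weight s v r : wt s v -> r != s -> P v 0 r = 0.
Proof.
move=> sv rs; apply: (@gdual_separates R W) => w' gw.
pose lam := (r - s)^-1.
have rs0 : r - s != 0 by rewrite subr_eq0.
have zv : zpow_d lam v = cexp (lam * s) *: v.
  apply: wpr_ext => t; rewrite wpr_zpow (linZ _ _ (@wpr_linear _ V t)) -sv wprM.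
  by case: eqP => [->//|_]; rewrite !scaler0.
have gr := @gdual_wpr R W w' r.
have := dP lam (fun=> v) gr (@conf1 R (fun=> 0)).
have -> : (fun i : 'I_1 => cexp lam * 0) = (fun=> 0) by apply/funext => i; rewrite mulr0.
rewrite zv -[Phi _ _ in RHS]/(P (cexp (lam * s) *: v) 0).
rewrite !pairing_wproj; [|exact: wP|by move=> t; rewrite /wt (linZ _ _ (@wpr_linear _ W t)) wP].
have -> : P (cexp (lam * s) *: v) 0 = cexp (lam * s) *: P v 0.
  have := cochain_lin (cexp (lam * s)) v 0 0.
  have -> : P 0 0 = 0 by have := cochain_lin (-1) 0 0 0; rewrite scaler0 addr0 scaleN1r addNr.
  by rewrite !addr0.
rewrite -[(cexp (lam * s) *: P v 0) r]/(cexp (lam * s) *: P v 0 r) !linearZ /=.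
have -> : lam * r = lam * s + 1 by rewrite -[1](mulVf rs0) -/lam -mulrDr addrC subrK.
rewrite cexpD => /eqP; rewrite -subr_eq0 -mulrA -mulrBr mulf_eq0 => /orP[e0|].
  have := cexpD (lam * s) (- (lam * s)); rewrite (eqP e0) mul0r subrr cexp0 => /eqP.
  by rewrite oner_eq0.
rewrite -[X in _ - X]mul1r -mulrBl mulf_eq0 subr_eq0 (negPf cexp1_neq1) /= => /eqP.
exact.
Qed.

Lemma cochain_wpr v r : P v 0 r = P (wpr r v) 0 r.
Proof.
have [A [hA zA]] := wpr_decomp0 v.
have P0 : P 0 0 = 0 by have := cochain_lin (-1) 0 0 0; rewrite scaler0 addr0 scaleN1r addNr.
have -> : P v 0 r = \sum_(s <- A) P (wpr s v) 0 r.
  rewrite {1}hA; elim: (A : seq C) => [|s t IH]; first by rewrite !big_nil P0.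
  by have := cochain_lin 1 (wpr s v) (\sum_(j <- t) wpr j v) 0; rewrite !scale1r !big_cons -IH => ->.
have z s : s != r -> P (wpr s v) 0 r = 0.
  by move=> sr; apply: cochain_weight (wt_wpr s v) _; rewrite eq_sym.
have [rA|rA] := boolP (r \in A).
  rewrite (big_fsetD1 _ rA) /= big_seq big1 ?addr0 // => s.
  by rewrite in_fsetD1 => /andP[/z].
rewrite zA // P0 big_seq big1 // => s sA; apply: z.
by apply: contraTneq sA => ->.
Qed.

(* The restriction of a 1-cochain to z = 0 *)
Lemma cochain_at0 : exists f : V -> W, forall v r, wpr r (f v) = P v 0 r.
Proof.
have h v : exists x : W, forall r, wpr r x = P v 0 r.
  have [A [hA zA]] := wpr_decomp0 v; exists (\sum_(s <- A) P v 0 s) => r.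
  rewrite (lin_sum _ _ (@wpr_linear _ W r)).
  have e s : wpr r (P v 0 s) = if r == s then P v 0 r else 0.
    by rewrite -(wP v 0 s) wprM; case: eqP => [->|//]; exact: wP.
  have [rA|rA] := boolP (r \in A).
    rewrite (big_fsetD1 _ rA) /= e eqxx big_seq big1 ?addr0 // => s.
    by rewrite in_fsetD1 e eq_sym => /andP[/negPf ->].
  rewrite big_seq big1 => [|s sA]; last by rewrite e; case: eqP sA => // <-; rewrite (negPf rA).
  rewrite cochain_wpr zA //.
  by have := cochain_lin (-1) 0 0 0; rewrite scaler0 addr0 scaleN1r addNr => ->.
by have [f hf] := choice h; exists f.
Qed.

Lemma cochain_poly v r (w' : {scalar W}) : exists Q : {poly C}, forall z,
  Q.[z] = w' (P v z r) /\ Q^`().[z] = w' (DW (P v z (r - 1))).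
Proof.
pose wr := comp_scalar w' (@wpr_linear _ W r).
have gr : gdual wr by exact: gdual_wpr.
have [_ [_ /(_ wr gr)[N [[p hp] _]]]] := rP (fun=> v).
have [Q hQ] := meval_line p (fun=> 0) (fun=> 1).
have QE t : Q.[t] = pairing wr (P v t).
  rewrite hQ (hp (fun=> t) (@conf1 R _)) diag_den1 divr1; congr (meval _ p).
  by apply/funext => i; rewrite add0r mulr1.
exists Q => z; split; first by rewrite QE pairing_wproj.
have [_ ] := DP (fun=> v) gr (@conf1 R (fun=> z)).
rewrite big_ord1 pairing_wproj; last by apply: DWbar_wbar; exact: wP.
rewrite /DWbar => <-.
have -> : (fun t : C => pairing wr (Phi (fun=> v) [eta (fun=> z) with (ord0 : 'I_1) |-> t])) = fun t => Q.[t].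
  apply/funext => t; rewrite QE; congr (pairing wr (Phi _ _)).
  by apply/funext => i /=; rewrite (ord1 i).
by rewrite (is_derive_val (is_derive_horner Q z)).
Qed.

Lemma cochain_poly_derivn v j r (w' : {scalar W}) (Q : {poly C}) :
  (forall z, Q.[z] = w' (P v z r)) -> Q^`(j).[0] = w' (iter j DW (P v 0 (r - j%:R))).
Proof.
elim: j r w' Q => [|j IH] r w' Q hQ; first by rewrite subr0 hQ.
have [Q1 h1] := cochain_poly v r w'.
have e1 : Q = Q1 by apply: poly_ext => z; rewrite hQ (h1 z).1.
rewrite derivSn (IH (r - 1) (comp_scalar w' (@DW_linear _ _ W))).
  by rewrite /comp_scalar /= /scalar_fun -natr1 opprD [in RHS]addrCA [in RHS]addrC.
by move=> z; rewrite e1 (h1 z).2.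
Qed.

Variable f : V -> W.
Hypothesis fP : forall v r, wpr r (f v) = P v 0 r.

Lemma cochain_exp v z : P v z = expD z (fun r => wpr r (f v)).
Proof.
apply/funext => r; apply: (@gdual_separates_eq R W) => w' _.
have [Q hQ] := cochain_poly v r w'.
have [J0 hJ] := expD_wbarE r (@wbar_wpr R V W (f v)).
rewrite (hJ _ (leq_maxl J0 (size Q))) raddf_sum -(hQ z).1 -[z in LHS]add0r.
rewrite (nderiv_taylor_wide (n := maxn J0 (size Q))) ?leq_maxr //; last exact: mulrC.
have lw : linear (w' : W -> C^o) by move=> c x y; rewrite linearP.
apply: eq_bigr => j _; rewrite mulrC.
transitivity (z ^+ j * w' (divD j (wpr (r - j%:R) (f v)))); last exact: esym (linZ _ _ lw).
congr (_ * _); rewrite /divD (linZ (f := w' : W -> C^o) _ _ lw) fP -(cochain_poly_derivn _ (fun z => (hQ z).1)) nderivn_def hornerMn.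
by rewrite /GRing.scale /= -(mulr_natl Q^`N(j).[0]) mulrA mulVf ?mul1r // pnatr_eq0 -lt0n fact_gt0.
Qed.

Lemma cochain_D_map : D_map f.
Proof.
split.
- move=> a x y; apply: wpr_ext => r.
  by rewrite (@wpr_linear _ W r) !fP cochain_lin.
- move=> r v; apply: wpr_ext => s; rewrite wprM !fP [in RHS]cochain_wpr wprM.
  case: eqP => [->|_]; first by rewrite -cochain_wpr.
  by have := cochain_lin (-1) 0 0 0; rewrite scaler0 addr0 scaleN1r addNr => ->.
move=> v; apply: wpr_ext => r; rewrite wpr_DW !fP.
apply: (@gdual_separates_eq R W) => w' _; have [Q hQ] := cochain_poly v r w'.
rewrite -(hQ 0).2.
pose wr := comp_scalar w' (@wpr_linear _ W r).
have gr : gdual wr by exact: gdual_wpr.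
have [/(_ 0) h _] := DP (fun=> v) gr (@conf1 R (fun=> 0)).
have e (u : V) : ([eta (fun=> v) with (0 : 'I_1) |-> u] : 'I_1 -> V) = (fun=> u).
  by apply/funext => i /=; rewrite (ord1 i).
have e' (u : C) : ([eta (fun=> (0 : C)) with (0 : 'I_1) |-> u] : 'I_1 -> C) = (fun=> u).
  by apply/funext => i /=; rewrite (ord1 i).
rewrite e pairing_wproj in h; last exact: wP.
have eQ : (fun t : C => pairing wr (Phi (fun=> v) [eta (fun=> 0) with (0 : 'I_1) |-> t])) =
    fun t => Q.[t].
  by apply/funext => t; rewrite e' pairing_wproj; [rewrite (hQ t).1|exact: wP].
rewrite eQ in h.
exact: etrans (esym (is_derive_val h)) (is_derive_val (is_derive_horner Q 0)).
Qed.

Lemma cochain_par : parity_preserving Phi -> forall a v, par a v -> par a (f v).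
Proof.
move=> pP a v av; apply: wpr_ext => r; rewrite wpr_ppr fP.
by have := pP (fun=> a) (fun=> v) (fun _ => av) (fun=> 0) r; rewrite big_ord1.
Qed.
End OneCochain.
End DerivationOfCocycle.

Section LeibnizFromCocycle.
Variable R : realType.
Local Notation C := (Cx R).
Variables (V : vertexSuperalgebra R) (W : supermodule V).
Local Notation YW := (@YW R V W).
Local Notation Y := (@vY R V).
Let fY := @vY_field R V.
Let fW := @YW_field R V W.

Lemma real_norm_lt (t : C) (s : R) : complex.Re `|t| < s -> `|t| < `|s%:C%C : C|.
Proof.
move=> h; have e : (complex.Re `|t|)%:C%C = `|t| :> C by apply: RRe_real; exact: normr_real.
have t0 : 0 <= complex.Re `|t| by rewrite -(@lecR R) e normr_ge0.
have s0 : 0 <= (s%:C%C : C) by rewrite (@lecR R 0) (ltW (le_lt_trans t0 h)).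
by rewrite -e (ger0_norm s0) ltcR.
Qed.

(* Analytic continuation from |z_1| < |z_2| to (t, 0), along the line z_1 = t. *)
Lemma diag_rat_eq_line (F G : ('I_2 -> C) -> C) : diag_rat F -> diag_rat G ->
  (forall z, `|z 0| < `|z 1| -> F z = G z) ->
  forall t, t != 0 -> F (pair2 t 0) = G (pair2 t 0).
Proof.
move=> [N [[p hp] _]] [M [[q hq] _]] FG t t0.
have [P hP] := meval_line p (pair2 t 0) (pair2 0 1).
have [Q hQ] := meval_line q (pair2 t 0) (pair2 0 1).
have ez (s : C) : (fun i => pair2 t 0 i + s * pair2 0 1 i) = pair2 t s.
  by apply/funext => i; case: (ord2P i) => ->; rewrite /pair2 /= ?mulr0 ?addr0 ?add0r ?mulr1.
have Fz s : s != t -> F (pair2 t s) = P.[s] / (t - s) ^+ N 0 1.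
  move=> st; rewrite hp; last by apply: conf_neq; rewrite /= eq_sym.
  by rewrite hP ez diag_den2.
have Gz s : s != t -> G (pair2 t s) = Q.[s] / (t - s) ^+ M 0 1.
  move=> st; rewrite hq; last by apply: conf_neq; rewrite /= eq_sym.
  by rewrite hQ ez diag_den2.
pose d := t%:P - 'X.
have dE s : d.[s] = t - s by rewrite hornerD hornerN hornerC hornerX.
have E : P * d ^+ M 0 1 - Q * d ^+ N 0 1 = 0.
  apply: (@poly_infinite_roots R _ (complex.Re `|t|)) => s /real_norm_lt st.
  have sn : s%:C%C != t by apply: contraTneq st => ->; rewrite ltxx.
  have := FG (pair2 t s%:C%C) st; rewrite Fz // Gz //.
  have d0 : t - s%:C%C != 0 by rewrite subr_eq0 eq_sym.
  move/eqP; rewrite eqr_div ?expf_neq0 // => /eqP e.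
  by rewrite hornerD hornerN !hornerM !horner_exp !dE e subrr.
have := congr1 (horner^~ 0) E; rewrite hornerD hornerN !hornerM !horner_exp !dE horner0 => /eqP.
rewrite subr_eq0 Fz 1?eq_sym // Gz 1?eq_sym // => /eqP e.
by apply/eqP; rewrite eqr_div ?expf_neq0 ?subr0 //; apply/eqP; rewrite subr0 in e.
Qed.

Lemma leibniz_of_cocycle m (f : V -> W) : D_map f ->
  (forall a v, par a v -> par a (f v)) -> delta1 m (exp_cochain f) 0 -> derivation f.
Proof.
move=> mf pf [_ _ hd]; have [lf fw _] := mf.
split=> // [r v rv|a b u v ua vb k]; first by rewrite /wt fw rv.
have [g1 [g2 [g3 [E1 E2 E3 E]]]] := hd a b u v ua vb.
have [N0 hN0] := pole_orders f; have [_ nY n1 n2] := hN0 u v.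
set N := N0 u v in nY n1 n2.
pose cN (i j : 'I_2) := N.
have vN (i j : 'I_2) : (i < j)%N -> trunc Y (pair2 u v i) (pair2 u v j) (cN i j)%:Z.
  by case: (ord2P i) => ->; case: (ord2P j) => ->.
pose e : C := (-1) ^+ (a && b).
have ee : e * e = 1 by rewrite /e -expr2 sqrr_sign.
have r1 := two_regular n1; have r0 := two_swapped_regular n2; have r2 := EVarr_regular vN.
pose S1 := rat_fun cN (@conf R 2) (two_arr u (f v)).
pose S0 := rat_fun cN (@conf R 2) (two_swapped v (f u)).
have sv (w : W) : skew_full w (-1) (vac V) = w by rewrite -[-1]/(- 0%:Z - 1) /skew_full skew_super_vac divD0.
have key l : f (Y u l v) = YW u l (f v) + skew_full (f u) l v.
  apply: (@gdual_separates_eq R W) => w' gw.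
  pose wf := comp_scalar w' lf.
  have gf : gdual wf.
    apply: sub_finite_set gw => r [x]; rewrite /comp_scalar /= /scalar_fun -fw => nz.
    by exists (f x).
  pose A (l : int) := w' (f (Y u l v)) - w' (YW u l (f v)) - w' (skew_full (f u) l v).
  suff A0 : forall l, A l = 0.
    by have /eqP := A0 l; rewrite /A -addrA -opprD subr_eq0 -raddfD => /eqP.
  apply: (@lsum_uniq0 R A N%:Z) => [l' Nl|t /andP[t0 _]].
    have s0 p : skew_super p (f u) l' v = 0.
      rewrite /skew_super big1 // => q _.
      by rewrite (skew_op_trunc (trunc_ppr q p fW n2) Nl) scaler0.
    have e0 : skew_full (f u) l' v = 0 by rewrite /skew_full !s0 addr0.
    by rewrite /A (trunc_full fY nY Nl) (trunc_full fW n1 Nl) (lin0 lf) e0 (raddf0 w') !subr0.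
  have {}t0 : t != 0 by rewrite -normr_gt0.
  pose z := pair2 t (0 : C).
  have cz : conf z by exact: conf_neq.
  have z10 : `|z 1| < `|z 0| by rewrite /z /= normr0 normr_gt0.
  have s1 : pairing w' (g1 z) = pairing w' (S1 z).
    exact: abs_cvg_to_uniq ((E1.2 w' gw).2 z z10) (two_point n1 gw z10).
  have s2 : pairing w' (g2 z) = pairing wf (EV (pair2 u v) z).
    exact: abs_cvg_to_uniq (((E2 0).2 w' gw).2 z cz) (middle_sum u v z 0 mf gw).
  have s3 : pairing w' (g3 z) = e * pairing w' (S0 z).
    have w0 z' : wbar (S0 z') by apply: rat_fun_wbar; case: r0.
    have q0 : diag_rat (fun z => e * pairing w' (S0 z)).
      rewrite (_ : (fun z => _) = fun z => e * pairing w' (S0 z) + 0).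
        by apply: diag_rat_lin; [exists cN; exact: rat_fun_diag_rat|exact: diag_rat0].
      by apply/funext => z'; rewrite addr0.
    apply: (diag_rat_eq_line (E3.2 w' gw).1 q0) => // z' z01.
    have := abs_cvg_to_uniq ((E3.2 w' gw).2 z' z01)
      (two_point n2 gw (z := pair2 (z' 1) (z' 0)) z01).
    move=> ->.
    have -> : rat_fun (fun _ _ => N) (@conf R 2) (two_arr v (f u)) (pair2 (z' 1) (z' 0)) =
        fun r => e *: S0 z' r.
      by apply/funext => r; exact: (two_exchange n2 (pf _ _ ua) vb).
    have := pairing_lin e gw (w0 z') (@wbar0 R V W); rewrite pairing0 !addr0 => <-.
    by [].
  have c1 (q : {ffun 'I_2 -> int}) : 0 <= q 1 -> two_arr u (f v) q = 0.
    move=> k1; rewrite two_arrE.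
    have s0 p : skew_super p (f v) (q 1) (vac V) = 0.
      by have := @fld_creation R V W (inr (f v)) p (q 1) k1; case.
    by rewrite /skew_full !s0 addr0 (modes0r fW).
  have c0 (q : {ffun 'I_2 -> int}) : 0 <= q 1 -> two_swapped v (f u) q = 0.
    move=> k1; rewrite /two_swapped (vY_creation v).2 // /skew_full.
    by rewrite !(lin0 (@skew_super_linear R V W _ _ _)) addr0.
  have EVE (q : {ffun 'I_2 -> int}) : EVarr (pair2 u v) q = Y u (q 0) (Y v (q 1) (vac V)).
    by rewrite /EVarr /modes_prod enum_ord2.
  have c2 (q : {ffun 'I_2 -> int}) : 0 <= q 1 -> EVarr (pair2 u v) q = 0.
    by move=> k1; rewrite EVE (vY_creation v).2 // (modes0r fY).
  have := abs_cvg_toB (abs_cvg_toB (eval_line gf r2 c2 t0) (eval_line gw r1 c1 t0))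
    (eval_line gw r0 c0 t0).
  have -> : pairing wf (rat_fun cN (@conf R 2) (EVarr (pair2 u v)) z)
     - pairing w' (S1 z) - pairing w' (S0 z) = 0.
    rewrite -(EV_rat_fun vN) -s2 -s1.
    have w1 := E1.1 z; have w2 := (E2 0).1 z; have w3 := E3.1 z.
    have := congr1 (pairing w') (E z cz); rewrite pairing0.
    have -> : g1 z - g2 z + (-1) ^+ (a && b) *: g3 z = e *: g3 z + (-1 *: g2 z + g1 z).
      by rewrite addrC scaleN1r [- _ + _]addrC.
    rewrite pairing_lin // ?pairing_lin // ?s3 ?mulrA ?ee ?mul1r ?mulN1r; last exact: wbar_lin.
    move=> h; transitivity (- (pairing w' (S0 z) + (- pairing w' (g2 z) + pairing w' (g1 z)))).
      by ring.
    by rewrite -h oppr0.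
  rewrite /lsum; apply: abs_cvg_to_ext => l'.
  rewrite two_arrE EVE /two_swapped !ffunE /= sv (vY_creation v).1 /A -!mulrBl.
  by [].
rewrite key addrC; congr (_ + _).
rewrite (skew_full_par _ _ (pf _ _ ua)) /skew_super big_bool /= (pf _ _ ua).
have z q : q != b -> ppr q v = 0 by move=> qb; rewrite -vb pprM (negPf qb).
have s0 : skew_op (f u) k (0 : V) = 0 :> W by rewrite (lin0 (@skew_op_linear_r R V W _ _)).
by case: b vb z {E3 E1 E2 E e ee hd} => vb z;
  [rewrite (z false isT)|rewrite (z true isT)]; rewrite vb s0 scaler0 ?addr0 ?add0r.
Qed.
End LeibnizFromCocycle.

Section Isomorphism.
Variable R : realType.
Local Notation C := (Cx R).

Lemma linear_isoI (K : pzRingType) (U U' : lmodType K) (F : U -> U') (G : U' -> U) :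
  linear G -> cancel F G -> cancel G F -> linear_iso U' U.
Proof.
move=> lG FG GF.
pose GL : {linear U' -> U} := HB.pack G (GRing.isLinear.Build K U' U *:%R G lG).
by exists GL; exists F.
Qed.

Variables (V : vertexSuperalgebra R) (W : supermodule V).

Lemma exp_cochain_lin a (f g : V -> W) : exp_cochain (a *: f + g) = a *: exp_cochain f + exp_cochain g.
Proof.
apply/funext => v; apply/funext => z; rewrite /exp_cochain.
have -> : (fun r => wpr r ((a *: f + g) (v 0))) = fun r => a *: wpr r (f (v 0)) + wpr r (g (v 0)).
  by apply/funext => r; exact: (@wpr_linear _ W r).
exact: expD_lin (@wbar_wpr _ _ _ _) (@wbar_wpr _ _ _ _).
Qed.

Lemma exp_cochain_at0 (f : V -> W) v r : exp_cochain f (fun=> v) (fun=> 0) r = wpr r (f v).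
Proof.
rewrite /exp_cochain; have [J h] := expD_wbarE r (@wbar_wpr R V W (f v)).
rewrite (h J.+1) // big_ord_recl expr0 scale1r subr0 divD0 big1 ?addr0 // => j _.
by rewrite expr0n /= scale0r.
Qed.

Lemma exp_cochain_inj (f g : V -> W) : exp_cochain f = exp_cochain g -> f = g.
Proof.
move=> e; apply/funext => v; apply: wpr_ext => r.
by rewrite -!exp_cochain_at0 e.
Qed.

Lemma cocycle_is_exp m (Phi : cochain W 1) : delta1 m Phi 0 ->
  exists2 f : V -> W, derivation f & Phi = exp_cochain f.
Proof.
move=> dPhi; have [[[mP rP DP dP _] pP] _ _] := dPhi.
have [f fP] := cochain_at0 mP rP dP.
have eP : Phi = exp_cochain f.
  apply/funext => v; apply/funext => z; have := cochain_exp rP DP fP (v 0) (z 0).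
  have -> : (fun _ : 'I_1 => v 0) = v by apply/funext => i; rewrite (ord1 i).
  by have -> : (fun _ : 'I_1 => z 0) = z by apply/funext => i; rewrite (ord1 i).
exists f => //; apply: (@leibniz_of_cocycle R V W m); last by rewrite -eP.
  exact: (cochain_D_map mP rP DP dP fP).
exact: (cochain_par fP pP).
Qed.

Lemma der_of (d : Der W) : derivation (sub_val d).
Proof. by have := valP d => /asboolP. Qed.

Lemma cocycle_in m (f : V -> W) : derivation f -> exp_cochain f \in sub_pred (cocycles1 W m).
Proof. by move=> df; apply/asboolP; exact: exp_cochain_cocycle. Qed.

Definition exp_cocycle m (d : Der W) : Defs.sub_type (cocycles1 W m) :=
  @Defs.SubType _ _ (cocycles1 W m) (exp_cochain (sub_val d)) (cocycle_in m (der_of d)).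

Definition der_class m (d : Der W) : H1 W m := @quot_pi _ _ (coboundaries1 W m) (exp_cocycle m d).

Lemma der_class_linear m : linear (der_class m).
Proof.
move=> a d d'.
have -> : a *: der_class m d = @quot_pi _ _ (coboundaries1 W m) (a *: exp_cocycle m d).
  exact: quot_scale_pi.
rewrite /der_class -quot_piD; congr quot_pi; apply: val_inj.
have e1 : exp_cochain (sub_val (a *: d + d')) =
    a *: exp_cochain (sub_val d) + exp_cochain (sub_val d').
  by rewrite -exp_cochain_lin; congr exp_cochain; exact: sub_val_lin.
exact: etrans e1 (esym (sub_val_lin a (exp_cocycle m d) (exp_cocycle m d'))).
Qed.

Lemma der_class_inj m : injective (der_class m).
Proof.
move=> d d' /(quot_pi_eq (coboundaries1 W m))[w ew].
have h : sub_val (exp_cocycle m d - exp_cocycle m d') =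
    sub_val (exp_cocycle m d) - sub_val (exp_cocycle m d').
  have := sub_val_lin (-1) (exp_cocycle m d') (exp_cocycle m d).
  by rewrite !scaleN1r ![- _ + _]addrC.
have /eqP := etrans (esym h) ew; rewrite subr_eq0 => /eqP e.
by apply: val_inj; exact: exp_cochain_inj e.
Qed.

Lemma der_class_surj m q : exists d, der_class m d = q.
Proof.
have [Phi ->] := quot_piP q.
have /asboolP /cocycle_is_exp[f df eP] := valP Phi.
have fin : f \in sub_pred (Subspace (sub_set := @derivation R V W) (derivation0 W)
              (@derivation_lin R V W)) by exact/asboolP.
exists (Defs.SubType fin); congr quot_pi; apply: val_inj.
by rewrite /= -eP.
Qed.

Lemma der_class_inverse m : exists G : H1 W m -> Der W,
  [/\ linear G, cancel G (der_class m) & cancel (der_class m) G].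
Proof.
have [G hG] := choice (@der_class_surj m).
have GF : cancel (der_class m) G by move=> d; apply: (@der_class_inj m); rewrite hG.
exists G; split=> // a x y; apply: (@der_class_inj m).
by rewrite der_class_linear !hG.
Qed.
End Isomorphism.

Theorem theorem4p2 (R : realType) (V : vertexSuperalgebra R)
    (W : supermodule V) :
  (forall m : nat, (0 < m)%N -> linear_iso (H1 W m) (Der W)) /\
  (forall m m' : nat, (0 < m)%N -> (0 < m')%N ->
     linear_iso (H1 W m) (H1 W m')).
Proof.
split=> [m _|m m' _ _]; have [G [lG GF FG]] := @der_class_inverse R V W m.
  exact: linear_isoI lG FG GF.
have [G' [lG' GF' FG']] := @der_class_inverse R V W m'.
apply: (@linear_isoI _ _ _ (der_class m \o G') (der_class m' \o G)).
- move=> a x y; rewrite -[LHS]/(der_class m' (G (a *: x + y))) lG.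
  exact: der_class_linear.
- by move=> x; rewrite /= FG GF'.
by move=> x; rewrite /= FG' GF.
Qed.
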